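(* For any fixed continuous $F_{X,Y}$, as $n\to\infty$, $$\hat{\sigma}^2-n\operatorname{Var}[\xi_n]\longrightarrow 0\quad\text{in probability},$$ and, when $d=1$, $$\hat{\overline{\sigma}}^2-n\operatorname{Var}[\overline{\xi}_n]\longrightarrow 0\quad\text{in probability}.$$
   Context: $Y$ is a real random variable and $X$ is a random vector in $\mathbb{R}^d$, defined on the same probability space, with joint distribution function $F_{X,Y}$, which is fixed (not depending on $n$) and continuous. $(X_1,Y_1),\ldots,(X_n,Y_n)$ are $n$ independent copies of $(X,Y)$. For $i\in\{1,\ldots,n\}$, $R_i:=\sum_{j=1}^n\mathbf{1}(Y_j\le Y_i)$ is the rank of $Y_i$. $N_k(i)$ is the index of the $k$-th nearest neighbor of $X_i$ among $\{X_j\}_{j=1}^n$ in the Euclidean metric ($X_i$ itself is not counted as its own neighbor). When $d=1$, $\overline{N}_k(i)$ is the index of the right $k$-th nearest neighbor of $X_i$ among $\{X_j\}_{j=1}^n$ (the $k$-th closest among sample points larger than $X_i$), with $\overline{N}_k(i):=i$ if $X_i$ is among the $k$ largest. Write $a\wedge b=\min\{a,b\}$ and $|S|$ for the cardinality of a finite set $S$. Define $$\xi_n:=\frac{6}{n^2-1}\sum_{i=1}^n\min\{R_i,R_{N_1(i)}\}-\frac{2n+1}{n-1}\ (d\ge 1),\qquad \overline{\xi}_n:=1-\frac{3}{n^2-1}\sum_{i=1}^n\big|R_{\overline{N}_1(i)}-R_i\big|\ (d=1),$$ $$\begin{aligned}\hat\sigma^2:=36\Big\{&\frac1{n^3}\sum_{i=1}^n(R_i\wedge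 R_{N_1(i)})^2\big(1+\mathbf 1(i=N_1(N_1(i)))\big)\\ &+\frac1{n^3}\sum_{i=1}^n(R_i\wedge R_{N_1(i)})(R_i\wedge R_{N_2(i)})\big(2\cdot\mathbf 1(i\ne N_1(N_1(i)))+|\{j:j\ne i,N_1(j)=N_1(i)\}|\big)\\ &-\frac1{n^3}\sum_{i=1}^n(R_i\wedge R_{N_1(i)})(R_{N_2(i)}\wedge R_{N_3(i)})\big(1+\mathbf 1(i\ne N_1(N_1(i)))+|\{j:j\ne i,N_1(j)=N_1(i)\}|\big)\\ &+\frac4{n^2(n-1)}\sum_{i\ne j}\mathbf 1(R_i\le R_j\wedge R_{N_1(j)})(R_i\wedge R_{N_1(i)})\\ &-\frac2{n^2(n-1)}\sum_{i\ne j}\mathbf 1(R_i\le R_j\wedge R_{N_1(j)})(R_{N_1(i)}\wedge R_{N_2(i)})\\ &+\frac1{n^2(n-1)}\sum_{i\ne j}(R_i\wedge R_{N_1(i)}\wedge R_j\wedge R_{N_1(j)})-4\Big[\frac1{n^2}\sum_{i=1}^n(R_i\wedge R_{N_1(i)})\Big]^2\Big\},\end{aligned}$$ and, for $d=1$, $$\begin{aligned}\hat{\overline\sigma}^2:=36\Big\{&\frac1{n^3}\sum_{i=1}^n(R_i\wedge R_{\overline N_1(i)})^2+\frac2{n^3}\sum_{i=1}^n(R_i\wedge R_{\overline N_1(i)})(R_i\wedge R_{\overline N_2(i)})\\ &-\frac2{n^3}\sum_{i=1}^n(R_i\wedge R_{\overline N_1(i)})(R_{\overline N_2(i)}\wedge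 R_{\overline N_3(i)})\\ &+\frac4{n^2(n-1)}\sum_{i\ne j}\mathbf 1(R_i\le R_j\wedge R_{\overline N_1(j)})(R_i\wedge R_{\overline N_1(i)})\\ &-\frac2{n^2(n-1)}\sum_{i\ne j}\mathbf 1(R_i\le R_j\wedge R_{\overline N_1(j)})(R_{\overline N_1(i)}\wedge R_{\overline N_2(i)})\\ &+\frac1{n^2(n-1)}\sum_{i\ne j}(R_i\wedge R_{\overline N_1(i)}\wedge R_j\wedge R_{\overline N_1(j)})-4\Big[\frac1{n^2}\sum_{i=1}^n(R_i\wedge R_{\overline N_1(i)})\Big]^2\Big\}.\end{aligned}$$ Double sums over $i\ne j$ run over all ordered pairs $i,j\in\{1,\ldots,n\}$ with $i\neq j$. *)

(* Defs.v *)
From HB Require Import structures.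
From mathcomp Require Import all_boot all_order all_algebra.
From mathcomp Require Import all_classical all_reals all_analysis.
Set Implicit Arguments.
Unset Strict Implicit.
Unset Printing Implicit Defensive.
Import Order.TTheory GRing.Theory Num.Theory.
Import numFieldNormedType.Exports.
Local Open Scope classical_set_scope.
Local Open Scope ring_scope.

Definition joint_cdf (R : realType) (d : nat) (disp : measure_display)
    (T : measurableType disp) (P : probability T R)
    (X : {RV P >-> d.-tuple R}) (Y : {RV P >-> R}) (z : 'rV[R]_d * R) : R :=
  fine (P [set w | (forall k : 'I_d, tnth (X w) k <= z.1 ord0 k) /\
                   Y w <= z.2]).

Definition mutually_independent (R : realType) (disp disp' : measure_display)
    (T : measurableType disp) (E : measurableType disp')
    (P : probability T R) (Z : nat -> T -> E) : Prop :=
  forall (s : seq nat) (B : nat -> set E), uniq s ->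
    (forall i, measurable (B i)) ->
    P (\bigcap_(i in [set` s]) (Z i @^-1` B i)) =
    (\prod_(i <- s) P (Z i @^-1` B i))%E.

Definition same_law (R : realType) (disp0 disp disp' : measure_display)
    (T0 : measurableType disp0) (T : measurableType disp)
    (E : measurableType disp') (P0 : probability T0 R) (P : probability T R)
    (Z0 : T0 -> E) (Z : T -> E) : Prop :=
  forall B : set E, measurable B -> P (Z @^-1` B) = P0 (Z0 @^-1` B).

Definition iid_copies (R : realType) (disp0 disp disp' : measure_display)
    (T0 : measurableType disp0) (T : measurableType disp)
    (E : measurableType disp') (P0 : probability T0 R) (P : probability T R)
    (Z0 : T0 -> E) (Z : nat -> T -> E) : Prop :=
  mutually_independent P Z /\ forall i, same_law P0 P Z0 (Z i).

Definition cvg_in_probability (R : realType) (disp : measure_display)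
    (T : measurableType disp) (P : probability T R)
    (W : nat -> T -> R) (c : R) : Prop :=
  forall eps : R, 0 < eps ->
    (fun n => P [set w | eps < `|W n w - c|]) @ \oo --> 0%E.

(* The library norm on row vectors is the sup norm, hence an explicit l2 one. *)
Definition euclidean_dist (R : realType) (d : nat) (u v : d.-tuple R) : R :=
  Num.sqrt (\sum_(k < d) (tnth u k - tnth v k) ^+ 2).

Definition rank (R : realType) (n : nat) (y : 'I_n -> R) (i : 'I_n) : nat :=
  (\sum_(j < n) (y j <= y i)%R)%N.

(* k starts at 1.  [sort] is stable and [enum 'I_n] is increasing, so that
   equidistant points are ordered by index; the value is i when k >= n. *)
Definition nearest_neighbor (R : realType) (d n : nat) (x : 'I_n -> d.-tuple R)
    (k : nat) (i : 'I_n) : 'I_n :=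
  nth i (sort (fun j l => euclidean_dist (x i) (x j)
                          <= euclidean_dist (x i) (x l))
              [seq j <- enum 'I_n | j != i]) k.-1.

(* The value is i when fewer than k points lie strictly to the right of u i,
   that is, when u i is among the k largest. *)
Definition right_neighbor (R : realType) (n : nat) (u : 'I_n -> R)
    (k : nat) (i : 'I_n) : 'I_n :=
  nth i (sort (fun j l => u j <= u l) [seq j <- enum 'I_n | u i < u j]) k.-1.

Section statistics.
Variables (R : realType) (d n : nat) (x : 'I_n -> d.-tuple R) (y : 'I_n -> R).

Local Notation N := (nearest_neighbor x).
Local Notation r := (rank y).
Local Notation n1 := (n%:R : R).

Definition xi : R :=
  6 / (n1 ^+ 2 - 1) * \sum_(i < n) (minn (r i) (r (N 1 i)))%:R
  - (2 * n1 + 1) / (n1 - 1).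

(* number of j <> i having the same nearest neighbor as i *)
Definition shared (i : 'I_n) : nat :=
  #|[pred j : 'I_n | (j != i) && (N 1 j == N 1 i)]|.

Definition sigma2_hat : R :=
  36 * (
    1 / n1 ^+ 3 *
      (\sum_(i < n) (minn (r i) (r (N 1 i)))%:R ^+ 2
         * (1 + (i == N 1 (N 1 i))%:R))
  + 1 / n1 ^+ 3 *
      (\sum_(i < n) (minn (r i) (r (N 1 i)))%:R * (minn (r i) (r (N 2 i)))%:R
         * (2 * (i != N 1 (N 1 i))%:R + (shared i)%:R))
  - 1 / n1 ^+ 3 *
      (\sum_(i < n) (minn (r i) (r (N 1 i)))%:R
         * (minn (r (N 2 i)) (r (N 3 i)))%:R
         * (1 + (i != N 1 (N 1 i))%:R + (shared i)%:R))
  + 4 / (n1 ^+ 2 * (n1 - 1)) *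
      (\sum_(i < n) \sum_(j < n | i != j)
         (r i <= minn (r j) (r (N 1 j)))%N%:R * (minn (r i) (r (N 1 i)))%:R)
  - 2 / (n1 ^+ 2 * (n1 - 1)) *
      (\sum_(i < n) \sum_(j < n | i != j)
         (r i <= minn (r j) (r (N 1 j)))%N%:R
         * (minn (r (N 1 i)) (r (N 2 i)))%:R)
  + 1 / (n1 ^+ 2 * (n1 - 1)) *
      (\sum_(i < n) \sum_(j < n | i != j)
         (minn (minn (r i) (r (N 1 i))) (minn (r j) (r (N 1 j))))%:R)
  - 4 * (1 / n1 ^+ 2 * \sum_(i < n) (minn (r i) (r (N 1 i)))%:R) ^+ 2).

End statistics.

Section right_statistics.
Variables (R : realType) (n : nat) (u : 'I_n -> R) (y : 'I_n -> R).

Local Notation N := (right_neighbor u).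
Local Notation r := (rank y).
Local Notation n1 := (n%:R : R).

Definition xi_bar : R :=
  1 - 3 / (n1 ^+ 2 - 1) * \sum_(i < n) `|(r (N 1 i))%:R - (r i)%:R|.

Definition sigma2_hat_bar : R :=
  36 * (
    1 / n1 ^+ 3 *
      (\sum_(i < n) (minn (r i) (r (N 1 i)))%:R ^+ 2)
  + 2 / n1 ^+ 3 *
      (\sum_(i < n) (minn (r i) (r (N 1 i)))%:R * (minn (r i) (r (N 2 i)))%:R)
  - 2 / n1 ^+ 3 *
      (\sum_(i < n) (minn (r i) (r (N 1 i)))%:R
         * (minn (r (N 2 i)) (r (N 3 i)))%:R)
  + 4 / (n1 ^+ 2 * (n1 - 1)) *
      (\sum_(i < n) \sum_(j < n | i != j)
         (r i <= minn (r j) (r (N 1 j)))%N%:R * (minn (r i) (r (N 1 i)))%:R)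
  - 2 / (n1 ^+ 2 * (n1 - 1)) *
      (\sum_(i < n) \sum_(j < n | i != j)
         (r i <= minn (r j) (r (N 1 j)))%N%:R
         * (minn (r (N 1 i)) (r (N 2 i)))%:R)
  + 1 / (n1 ^+ 2 * (n1 - 1)) *
      (\sum_(i < n) \sum_(j < n | i != j)
         (minn (minn (r i) (r (N 1 i))) (minn (r j) (r (N 1 j))))%:R)
  - 4 * (1 / n1 ^+ 2 * \sum_(i < n) (minn (r i) (r (N 1 i)))%:R) ^+ 2).

End right_statistics.

(* Main.v *)
Require Import Defs.
From HB Require Import structures.
From mathcomp Require Import all_boot all_order all_algebra.
From mathcomp Require Import all_classical all_reals all_analysis.
From mathcomp Require Import measurable_realfun ring lra zify.

(** Write m_i for the minimum of the ranks of Y_i and of the response of the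
    nearest neighbour of X_i, divided by n. Up to a deterministic factor, xi is
    the sum of the m_i, so the claim is about the variance of a sum over the
    edges of the nearest neighbour graph; the right neighbour statistic is the
    same sum for the cyclic right neighbour graph, up to boundedly many terms.
    Both graphs come from a proximity relation: a total preorder around each
    point, with bounded in-degrees and few long edges. The argument uses only
    these properties.

    The responses are replaced by labels. Since Y has no atoms, it can be cut
    into finitely many bins of equal small mass, monotonically in Y. A
    minimum of two ranks is then close to a function K of the two labels, and
    the proportion of edges lying above a given response is close to a function
    h of its label. All these approximations hold uniformly over the sample, up
    to one random error whose mean is of the order of the mass of a bin
    (min_rank_close, Hr_close, small_rank_error). Removing one observation from
    the sum of the m_i changes boundedly many minima and decreases every rank
    above it; to first order this is what removing it does to
    the sum of K(label_i, label of the neighbour) + h(label_i). The Efron-Stein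
    inequality, in the form where the k-th comparison statistic is any function
    not depending on the k-th observation, turns this into a bound for the
    variance of the difference of the two sums (Var_rank_label).

    For labels the variance can be computed. Given the positions, the labels
    are independent, with conditional law p(x). Bounded measurable functions of
    the position are almost equal at a point and at its neighbours, on average
    over the sample (local_bmf). Replacing the law at a neighbour by the law at
    the point itself turns the centred label sum into a sum of
    orthogonal vertex and edge terms plus a sum of functions of single positions.
    Its variance is read off and coincides, by a pointwise identity, with the
    mean of Gam, minus a square; Gam is the summand of the estimator written
    with labels (conditional_variance_estimator, core_variance).

    It remains to see that the averages entering the estimator concentrate:
    each is a sum of local terms, so its variance is of order n by Efron-Stein
    (Efron_Stein_local_bounded, Var_Gam). Combining these bounds gives
    convergence in mean (rank_variance_estimator, variance_consistency), hence
    in probability. *)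
Set Implicit Arguments.
Unset Strict Implicit.
Unset Printing Implicit Defensive.
Import Order.TTheory GRing.Theory Num.Theory.
Import numFieldNormedType.Exports.
Local Open Scope classical_set_scope.
Local Open Scope ring_scope.

(** * Expectations of bounded measurable functions *)

Section expectation_of_bounded.
Context {R : realType} {disp : measure_display} {W : measurableType disp}.
Implicit Types f g : W -> R.

Definition bmf f := measurable_fun setT f /\ exists M : R, forall w, `|f w| <= M.

Lemma bmf_cst (c : R) : bmf (fun _ => c).
Proof. by split; [exact: measurable_cst|exists `|c|]. Qed.

Lemma bmfD f g : bmf f -> bmf g -> bmf (fun w => f w + g w).
Proof.
move=> [mf [M fM]] [mg [N gN]]; split; first exact: measurable_funD.
by exists (M + N) => w; rewrite (le_trans (ler_normD _ _))// lerD.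
Qed.

Lemma bmfM f g : bmf f -> bmf g -> bmf (fun w => f w * g w).
Proof.
move=> [mf [M fM]] [mg [N gN]]; split; first exact: measurable_funM.
by exists (M * N) => w; rewrite normrM ler_pM.
Qed.

Lemma bmfZ (c : R) f : bmf f -> bmf (fun w => c * f w).
Proof. by move=> bf; apply: bmfM => //; exact: bmf_cst. Qed.

Lemma bmfN f : bmf f -> bmf (fun w => - f w).
Proof.
move=> [mf [M fM]]; split; first exact: measurableT_comp.
by exists M => w; rewrite normrN.
Qed.

Lemma bmfB f g : bmf f -> bmf g -> bmf (fun w => f w - g w).
Proof. by move=> bf bg; apply: bmfD => //; exact: bmfN. Qed.

Lemma bmf_ext f g : f =1 g -> bmf g -> bmf f.
Proof. by move=> /funext ->. Qed.

Lemma bmfX f n : bmf f -> bmf (fun w => f w ^+ n).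
Proof.
move=> bf; elim: n => [|n ih].
  by apply: bmf_ext (bmf_cst 1) => w; rewrite expr0.
by apply: bmf_ext (bmfM bf ih) => w; rewrite exprS.
Qed.

Lemma bmf_norm f : bmf f -> bmf (fun w => `|f w|).
Proof.
move=> [mf [M fM]]; split; first exact: measurableT_comp.
by exists M => w; rewrite normr_id.
Qed.

Lemma bmf_sum (I : Type) (s : seq I) (Q : pred I) (F : I -> W -> R) :
  (forall i, Q i -> bmf (F i)) -> bmf (fun w => \sum_(i <- s | Q i) F i w).
Proof.
move=> bF; elim: s => [|i s ih].
  by apply: bmf_ext (bmf_cst 0) => w; rewrite big_nil.
have [Qi|Qi] := boolP (Q i).
  by apply: bmf_ext (bmfD (bF i Qi) ih) => w; rewrite big_cons Qi.
by apply: bmf_ext ih => w; rewrite big_cons (negPf Qi).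
Qed.

Lemma bmf_prod (I : Type) (s : seq I) (Q : pred I) (F : I -> W -> R) :
  (forall i, Q i -> bmf (F i)) -> bmf (fun w => \prod_(i <- s | Q i) F i w).
Proof.
move=> bF; elim: s => [|i s ih].
  by apply: bmf_ext (bmf_cst 1) => w; rewrite big_nil.
have [Qi|Qi] := boolP (Q i).
  by apply: bmf_ext (bmfM (bF i Qi) ih) => w; rewrite big_cons Qi.
by apply: bmf_ext ih => w; rewrite big_cons (negPf Qi).
Qed.

Lemma bmf_indic (A : set W) : measurable A -> bmf (\1_A : W -> R).
Proof.
move=> mA; split; first exact: measurable_indic.
by exists 1 => w; rewrite indicE; case: (_ \in _); rewrite ?normr1 ?normr0.
Qed.

(** Finitely valued observables; all order patterns of a sample are of this
    kind, so their functions are bounded and measurable for free. *)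
Definition finobs (F : finType) (b : W -> F) :=
  forall v, measurable (b @^-1` [set v]).

Lemma bmf_fin (F : finType) (b : W -> F) (G : F -> W -> R) :
  finobs b -> (forall v, bmf (G v)) -> bmf (fun w => G (b w) w).
Proof.
move=> mb bG.
have -> : (fun w => G (b w) w) =
    (fun w => \sum_(v : F) \1_(b @^-1` [set v]) w * G v w).
  apply: funext => w; rewrite (bigD1 (b w))//= indicE mem_set// mul1r big1 ?addr0//.
  by move=> v vb; rewrite indicE memNset ?mul0r// => /= e; rewrite e eqxx in vb.
by apply: bmf_sum => v _; apply: bmfM => //; exact: bmf_indic.
Qed.

Lemma bmf_obs (F : finType) (b : W -> F) (G : F -> R) :
  finobs b -> bmf (fun w => G (b w)).
Proof. by move=> mb; apply: (@bmf_fin _ b (fun v _ => G v)) => // v; exact: bmf_cst. Qed.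

Lemma finobs_comp (F G : finType) (b : W -> F) (h : F -> G) :
  finobs b -> finobs (fun w => h (b w)).
Proof.
move=> mb v.
have -> : (fun w => h (b w)) @^-1` [set v] =
    \big[setU/set0]_(u : F | h u == v) (b @^-1` [set u]).
  apply/seteqP; split => w /=.
    by move=> hv; rewrite -bigcup_seq_cond/=; exists (b w) => //=; rewrite mem_index_enum/= hv.
  by rewrite -bigcup_seq_cond/= => -[u /= /andP[_ /eqP hu] ->].
by apply: bigsetU_measurable => u _; exact: mb.
Qed.

Lemma finobs_pair (F G : finType) (b : W -> F) (c : W -> G) :
  finobs b -> finobs c -> finobs (fun w => (b w, c w)).
Proof.
move=> mb mc [u v].
have -> : (fun w => (b w, c w)) @^-1` [set (u, v)] =
    (b @^-1` [set u]) `&` (c @^-1` [set v]).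
  by apply/seteqP; split => w /= [-> ->].
by apply: measurableI; [exact: mb|exact: mc].
Qed.

Lemma finobs_ffun (I F : finType) (b : I -> W -> F) :
  (forall i, finobs (b i)) -> finobs (fun w => [ffun i => b i w]).
Proof.
move=> mb v.
have -> : (fun w => [ffun i => b i w]) @^-1` [set v] =
    \big[setI/setT]_(i : I) (b i @^-1` [set v i]).
  apply/seteqP; split => w /=.
    by move=> <-; rewrite -bigcap_seq/= => i _ /=; rewrite ffunE.
  rewrite -bigcap_seq/= => h; apply/ffunP => i; rewrite ffunE.
  by apply: h; rewrite /= mem_index_enum.
by apply: bigsetI_measurable => i _; exact: mb.
Qed.

Lemma finobs_bool (b : W -> bool) : measurable_fun setT b -> finobs b.
Proof. by move=> mb v; rewrite -[X in measurable X]setTI; exact: mb. Qed.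

End expectation_of_bounded.

Arguments bmf_cst {R disp W}.

Ltac bm := repeat first
  [ exact: bmf_cst | assumption | by apply: bmf_cst
  | apply: bmfX | apply: bmf_norm | apply: bmf_sum => ? ?
  | apply: bmfB | apply: bmfD | apply: bmfN | apply: bmfM ].

Section expectation.
Context {R : realType} {disp : measure_display} {W : measurableType disp}.
Variable P : probability W R.
Implicit Types f g : W -> R.

Definition Ex f : R := (\int[P]_w f w)%R.

Lemma bmf_integrable f : bmf f -> P.-integrable setT (EFin \o f).
Proof.
move=> [mf [M fM]]; apply: measurable_bounded_integrable => //.
- by rewrite /= (le_lt_trans (probability_le1 P measurableT))// ltry.
- exists (Num.max M 0); split; first by rewrite num_real.
  move=> x Mx w _ /=; rewrite (le_trans (fM w))// ltW// (le_lt_trans _ Mx)//.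
  by rewrite le_max lexx.
Qed.
#[local] Hint Resolve bmf_integrable : core.

Lemma Ex_fin f : bmf f -> (\int[P]_w (f w)%:E)%E = (Ex f)%:E.
Proof.
move=> bf; rewrite /Ex /Rintegral fineK//.
exact: (integrable_fin_num _ (bmf_integrable bf)).
Qed.

Lemma eq_Ex f g : f =1 g -> Ex f = Ex g.
Proof. by move=> fg; congr Ex; apply: funext. Qed.

Lemma Ex_cst c : Ex (fun _ => c) = c.
Proof.
rewrite /Ex Rintegral_cst//.
have -> : fine (P setT) = 1 by rewrite (_ : P setT = 1%E)//; exact: probability_setT.
by rewrite mulr1.
Qed.

Lemma ExD f g : bmf f -> bmf g -> Ex (fun w => f w + g w) = Ex f + Ex g.
Proof. by move=> bf bg; rewrite /Ex RintegralD//; exact: bmf_integrable. Qed.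

Lemma ExB f g : bmf f -> bmf g -> Ex (fun w => f w - g w) = Ex f - Ex g.
Proof. by move=> bf bg; rewrite /Ex RintegralB//; exact: bmf_integrable. Qed.

Lemma ExZ c f : bmf f -> Ex (fun w => c * f w) = c * Ex f.
Proof. by move=> bf; rewrite /Ex RintegralZl//; exact: bmf_integrable. Qed.

Lemma Ex_sum (I : Type) (s : seq I) (Q : pred I) (F : I -> W -> R) :
  (forall i, bmf (F i)) ->
  Ex (fun w => \sum_(i <- s | Q i) F i w) = \sum_(i <- s | Q i) Ex (F i).
Proof.
move=> bF; elim: s => [|i s ih].
  by rewrite big_nil -[RHS](Ex_cst 0); apply: eq_Ex => w; rewrite big_nil.
rewrite big_cons; have [Qi|Qi] := boolP (Q i).
  rewrite -ih -ExD//; last exact: bmf_sum.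
  by apply: eq_Ex => w; rewrite big_cons Qi.
by rewrite -ih; apply: eq_Ex => w; rewrite big_cons (negPf Qi).
Qed.

Lemma Ex_le f g : bmf f -> bmf g -> (forall w, f w <= g w) -> Ex f <= Ex g.
Proof. by move=> bf bg fg; apply: le_Rintegral => //; exact: bmf_integrable. Qed.

Lemma Ex_ge0 f : (forall w, 0 <= f w) -> 0 <= Ex f.
Proof. by move=> f0; exact: Rintegral_ge0. Qed.

Lemma Ex_norm f : bmf f -> `|Ex f| <= Ex (fun w => `|f w|).
Proof. by move=> bf; apply: le_normr_Rintegral => //; exact: bmf_integrable. Qed.

Lemma Ex_indic (A : set W) : measurable A -> Ex \1_A = fine (P A).
Proof. by move=> mA; rewrite /Ex /Rintegral integral_indic// setIT. Qed.

Lemma Ex_indicE (A : set W) : measurable A -> (Ex \1_A)%:E = P A.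
Proof. by move=> mA; rewrite Ex_indic// fineK// fin_num_measure. Qed.

Definition full (D : set W) := measurable D /\ P D = 1%E.

Lemma Ex_le_full D f g : full D -> bmf f -> bmf g ->
  (forall w, D w -> f w <= g w) -> Ex f <= Ex g.
Proof.
move=> [mD PD] bf bg fg.
have [_ [M fM]] := bf; have [_ [N gN]] := bg.
have bC : bmf (\1_(~` D) : W -> R) by apply: bmf_indic; exact: measurableC.
have -> : Ex g = Ex (fun w => g w + (M + N) * \1_(~` D) w).
  rewrite ExD// ?ExZ//; last exact: bmfZ.
  by rewrite Ex_indic ?probability_setC// ?PD ?subee// ?mulr0 ?addr0//; exact: measurableC.
apply: Ex_le => //; first by apply: bmfD => //; exact: bmfZ.
move=> w; rewrite indicE; case: (pselect (D w)) => Dw.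
  by rewrite memNset ?mulr0 ?addr0 ?fg// => /(_ Dw).
rewrite mem_set// mulr1.
by have := fM w; have := gN w; rewrite !ler_norml => /andP[? ?] /andP[? ?]; lra.
Qed.

Lemma Ex_eq_full D f g : full D -> bmf f -> bmf g ->
  (forall w, D w -> f w = g w) -> Ex f = Ex g.
Proof.
move=> fD bf bg fg; apply/eqP; rewrite eq_le.
by apply/andP; split; apply: (Ex_le_full fD) => // w Dw; rewrite fg.
Qed.

Definition Var f : R := Ex (fun w => (f w - Ex f) ^+ 2).

Lemma Var_ge0 f : 0 <= Var f.
Proof. by apply: Ex_ge0 => w; exact: sqr_ge0. Qed.

Lemma VarE f : bmf f -> Var f = Ex (fun w => f w ^+ 2) - Ex f ^+ 2.
Proof.
move=> bf; rewrite /Var.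
have -> : Ex (fun w => (f w - Ex f) ^+ 2) =
    Ex (fun w => f w ^+ 2 + (- (2 * Ex f)) * f w + Ex f ^+ 2).
  by apply: eq_Ex => w; ring.
have b1 : bmf (fun w => f w ^+ 2) := bmfX 2 bf.
have b2 : bmf (fun w => - (2 * Ex f) * f w) := bmfZ _ bf.
rewrite ExD ?Ex_cst ?ExD ?ExZ//; first by ring.
- exact: bmfD.
- exact: bmf_cst.
Qed.

Lemma Var_le f c : bmf f -> Var f <= Ex (fun w => (f w - c) ^+ 2).
Proof.
move=> bf; rewrite VarE//.
have -> : Ex (fun w => (f w - c) ^+ 2) =
    Ex (fun w => f w ^+ 2 + (- (2 * c)) * f w + c ^+ 2).
  by apply: eq_Ex => w; ring.
rewrite ExD ?Ex_cst ?ExD ?ExZ//.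
- by have := sqr_ge0 (Ex f - c); lra.
- exact: bmfX.
- exact: bmfZ.
- by apply: bmfD; [exact: bmfX|exact: bmfZ].
- exact: bmf_cst.
Qed.

Lemma Ex_sqr_le f : bmf f -> Ex f ^+ 2 <= Ex (fun w => f w ^+ 2).
Proof. by move=> bf; have := Var_ge0 f; rewrite VarE// subr_ge0. Qed.

(** A first moment controlled by a second one, with a free parameter in place
    of a square root. *)
Lemma Ex_abs_le f (e : R) : bmf f -> 0 < e ->
  Ex (fun w => `|f w|) <= e + Ex (fun w => f w ^+ 2) / e.
Proof.
move=> bf e0.
have -> : e + Ex (fun w => f w ^+ 2) / e = Ex (fun w => e + e^-1 * f w ^+ 2).
  rewrite ExD ?Ex_cst ?ExZ//; first by rewrite mulrC.
  - exact: bmfX.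
  - exact: bmf_cst.
  - by apply: bmfZ; exact: bmfX.
apply: Ex_le; first exact: bmf_norm.
- by apply: bmfD; [exact: bmf_cst|apply: bmfZ; exact: bmfX].
- move=> w; rewrite -[f w ^+ 2]real_normK ?num_real//.
  set a := `|f w|; rewrite -subr_ge0.
  have -> : e + e^-1 * a ^+ 2 - a = ((e - a) ^+ 2 + e * a) / e.
    by field; rewrite gt_eqF.
  apply: divr_ge0; last exact: ltW.
  by rewrite addr_ge0 ?sqr_ge0// mulr_ge0 ?normr_ge0// ltW.
Qed.

(** Stability of the variance under an L2-small perturbation. *)
Lemma Var_perturb f g (e : R) : bmf f -> bmf g -> 0 < e <= 1 ->
  Var f <= Var g + e * Var g + 2 / e * Var (fun w => f w - g w).
Proof.
move=> bf bg /andP[e0 e1].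
pose h w := f w - g w.
have bh : bmf h by exact: bmfB.
have Eh : Ex h = Ex f - Ex g by rewrite ExB.
have -> : Var g + e * Var g + 2 / e * Var h =
    Ex (fun w => (1 + e) * (g w - Ex g) ^+ 2 + 2 / e * (h w - Ex h) ^+ 2).
  rewrite ExD; [|by bm|by bm]; rewrite !ExZ; [|by bm|by bm].
  by rewrite -/(Var g) -/(Var h); ring.
apply: Ex_le.
- by bm.
- by bm.
move=> w.
have -> : f w - Ex f = (g w - Ex g) + (h w - Ex h) by rewrite Eh /h; ring.
set a := _ - Ex g; set b := _ - Ex h.
rewrite -subr_ge0.
have -> : (1 + e) * a ^+ 2 + 2 / e * b ^+ 2 - (a + b) ^+ 2 =
  ((e * a - b) ^+ 2 + (1 - e) * b ^+ 2) / e by field; rewrite gt_eqF.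
apply: divr_ge0; last exact: ltW.
by rewrite addr_ge0 ?sqr_ge0// mulr_ge0 ?sqr_ge0// subr_ge0.
Qed.

End expectation.

(** * Product laws and the Efron-Stein inequality *)

Section transport.
Context {R : realType} {d1 d2 : measure_display}.
Context {T1 : measurableType d1} {T2 : measurableType d2}.

Definition mk_mfun (phi : T1 -> T2) (mphi : measurable_fun setT phi) :
  {mfun T1 >-> T2} := HB.pack phi (isMeasurableFun.Build _ _ _ _ phi mphi).

Lemma bmf_comp (phi : T1 -> T2) (f : T2 -> R) :
  measurable_fun setT phi -> bmf f -> bmf (fun w => f (phi w)).
Proof.
move=> mphi [mf [M fM]]; split; first exact: (measurableT_comp mf mphi).
by exists M => w.
Qed.

Lemma Ex_distribution (P : probability T1 R) (X : {mfun T1 >-> T2}) (f : T2 -> R) :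
  bmf f -> Ex (distribution P X) f = Ex P (fun w => f (X w)).
Proof.
move=> bf; rewrite /Ex /Rintegral; congr fine.
rewrite -[in LHS]/(EFin \o f) integral_distribution//.
- by apply/measurable_EFinP; case: bf.
- have bfX : bmf (fun w => f (X w)) by apply: bmf_comp.
  exact: (bmf_integrable P bfX).
Qed.

Lemma Ex_eq_measure (P Q : probability T1 R) (f : T1 -> R) :
  (forall A, measurable A -> P A = Q A) -> Ex P f = Ex Q f.
Proof.
move=> PQ; rewrite /Ex /Rintegral; congr fine.
by apply: eq_measure_integral => A mA _; exact: PQ.
Qed.

End transport.

Section fubini_bounded.
Context {R : realType} {d1 d2 : measure_display}.
Context {T1 : measurableType d1} {T2 : measurableType d2}.

Lemma Ex_Fubini (P : probability T1 R) (Q : probability T2 R)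
    (f : T1 * T2 -> R) : bmf f ->
  bmf (fun x => Ex Q (fun y => f (x, y))) /\
  Ex (P \x Q)%E f = Ex P (fun x => Ex Q (fun y => f (x, y))).
Proof.
move=> bf.
have bfx x : bmf (fun y => f (x, y)).
  apply: (bmf_comp (phi := fun y => (x, y)) _ bf).
  apply: measurable_fun_pair => //; exact: measurable_cst.
have inf := bmf_integrable (P \x Q)%E bf.
have FE : fubini_F Q (EFin \o f) = EFin \o (fun x => Ex Q (fun y => f (x, y))).
  by apply: funext => x /=; rewrite /fubini_F /= Ex_fin.
have mF := measurable_fubini_F inf.
have bF : bmf (fun x => Ex Q (fun y => f (x, y))).
  split; first by apply/measurable_EFinP; rewrite -FE.
  have [_ [M fM]] := bf; exists M => x.
  rewrite (le_trans (Ex_norm _ (bfx x)))// -[leRHS](Ex_cst Q).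
  by apply: Ex_le => //; [exact: bmf_norm|exact: bmf_cst].
split=> //; have := integral12_prod_meas1 inf; rewrite FE => e.
by rewrite /Ex /Rintegral -[in LHS]/(EFin \o f) -e.
Qed.

End fubini_bounded.

Section product_law.
Context {R : realType} {dE : measure_display} {E : measurableType dE}.
Context {n : nat}.
Local Notation Om := (n.-tuple E).

Definition rect (B : 'I_n -> set E) : set Om :=
  [set z | forall i, B i (tnth z i)].

Lemma measurable_rect B : (forall i, measurable (B i)) -> measurable (rect B).
Proof.
move=> mB.
have -> : rect B = \big[setI/setT]_(i < n) ((fun z : Om => tnth z i) @^-1` B i).
  apply/seteqP; split => z /=; rewrite -bigcap_seq/=.
    by move=> h i _; exact: h.
  by move=> h i; apply: h; rewrite /= mem_index_enum.
apply: bigsetI_measurable => i _.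
by rewrite -[X in measurable X]setTI; apply: measurable_tnth => //.
Qed.

(** Rectangles form a generating pi-system of the sample space. *)
Lemma rect_measure_unique (m1 m2 : {measure set Om -> \bar R}) :
  (m1 setT < +oo)%E ->
  (forall B, (forall i, measurable (B i)) -> m1 (rect B) = m2 (rect B)) ->
  forall A, measurable A -> m1 A = m2 A.
Proof.
move=> m1oo m12.
pose G : set (set Om) := [set rect B | B in [set B | forall i, measurable (B i)]].
have rT : rect (fun=> setT) = setT by apply/seteqP; split.
apply: (measure_unique G (fun=> setT)) => //.
- apply/seteqP; split; last first.
    apply: smallest_sub; first exact: sigma_algebra_measurable.
    by move=> _ [B mB <-]; exact: measurable_rect.
  apply: smallest_sub; first exact: smallest_sigma_algebra.
  move=> A; rewrite -bigcup_seq/= => -[i /= _ [C mC <-]].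
  apply: sub_sigma_algebra => /=.
  exists (fun j => if j == i then C else setT).
    by move=> j /=; case: ifP.
  apply/seteqP; split => z /=.
    by move=> /(_ i); rewrite eqxx.
  by move=> [_ Cz] j; case: eqP => [->|].
- move=> _ _ [B mB <-] [C mC <-].
  exists (fun i => B i `&` C i); first by move=> i /=; exact: measurableI.
  apply/seteqP; split => z /=; first by move=> h; split => i; case: (h i).
  by move=> [hB hC] i; split.
- by move=> _; exists (fun=> setT).
- by rewrite bigcup_const.
- by move=> _ [B mB <-]; exact: m12.
Qed.

Variables (mu : probability E R) (la : probability Om R).

Definition iid_law := forall B, (forall i, measurable (B i)) ->
  la (rect B) = (\prod_(i < n) mu (B i))%E.

Definition upd (z : Om) (k : 'I_n) (e : E) : Om :=
  [tuple if i == k then e else tnth z i | i < n].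

Lemma tnth_upd z k e i : tnth (upd z k e) i = if i == k then e else tnth z i.
Proof. by rewrite tnth_mktuple. Qed.

Lemma upd_upd z k e e' : upd (upd z k e) k e' = upd z k e'.
Proof. by apply: eq_from_tnth => i; rewrite !tnth_upd; case: eqP. Qed.

Lemma updC z j k e e' : j != k ->
  upd (upd z j e) k e' = upd (upd z k e') j e.
Proof.
move=> jk; apply: eq_from_tnth => i; rewrite !tnth_upd.
by case: (eqVneq i k) => // ->; rewrite eq_sym (negPf jk).
Qed.

Definition free (k : 'I_n) (T : Type) (f : Om -> T) :=
  forall z e, f (upd z k e) = f z.

Lemma measurable_upd k :
  measurable_fun setT (fun ze : Om * E => upd ze.1 k ze.2).
Proof.
apply/measurable_fun_tnthP => i.
have -> : (tnth (T:=E))^~ i \o (fun ze : Om * E => upd ze.1 k ze.2) =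
    (fun ze : Om * E => if i == k then ze.2 else tnth ze.1 i).
  by apply: funext => ze /=; rewrite tnth_upd.
case: eqP => _; first exact: measurable_snd.
by apply: (measurableT_comp (measurable_tnth i)) => //; exact: measurable_fst.
Qed.

Lemma measurable_updE (z : Om) k : measurable_fun setT (fun e => upd z k e).
Proof.
apply/measurable_fun_tnthP => i.
have -> : (tnth (T:=E))^~ i \o (fun e => upd z k e) =
    (fun e => if i == k then e else tnth z i).
  by apply: funext => e /=; rewrite tnth_upd.
by case: eqP => _; [exact: measurable_id|exact: measurable_cst].
Qed.

Lemma bmf_upd (F : Om -> R) z k : bmf F -> bmf (fun e => F (upd z k e)).
Proof. by apply: bmf_comp; exact: measurable_updE. Qed.

(** Integrating out the k-th observation. *)
Definition Mk (k : 'I_n) (F : Om -> R) : Om -> R :=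
  fun z => Ex mu (fun e => F (upd z k e)).

Hypothesis iid : iid_law.

Lemma Mk_resample k F : bmf F -> bmf (Mk k F) /\ Ex la F = Ex la (Mk k F).
Proof.
move=> bF.
have bF2 : bmf (fun ze : Om * E => F (upd ze.1 k ze.2)).
  by apply: bmf_comp bF; exact: measurable_upd.
have [b1 e1] := Ex_Fubini la mu bF2; split; first exact: b1.
rewrite /Mk -e1.
have -> : Ex (la \x mu)%E (fun ze : Om * E => F (upd ze.1 k ze.2)) =
    Ex (distribution (la \x mu)%E (mk_mfun (measurable_upd k))) F.
  by rewrite Ex_distribution.
apply: Ex_eq_measure; apply: rect_measure_unique.
  by rewrite (le_lt_trans (probability_le1 la measurableT))// ltry.
move=> B mB; rewrite -[RHS]/((la \x mu)%E ((fun ze : Om * E => upd ze.1 k ze.2) @^-1` rect B)).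
have -> : (fun ze : Om * E => upd ze.1 k ze.2) @^-1` rect B =
    rect (fun i => if i == k then setT else B i) `*` B k.
  apply/seteqP; split => -[z e] /=.
    move=> h; split=> /=; last by have := h k; rewrite tnth_upd eqxx.
    by move=> i; have := h i; rewrite tnth_upd; case: eqP.
  by move=> [h Be] i; rewrite tnth_upd; have := h i; case: eqP => [->|].
have mB' i : measurable (if i == k then setT else B i) by case: ifP.
rewrite product_measure1E//; last exact: measurable_rect.
apply: (etrans (iid mB)).
transitivity (la (rect (fun i => if i == k then setT else B i)) * mu (B k))%E; last by [].
rewrite (iid mB').
rewrite (bigD1 k)//= [in RHS](bigD1 k)//= eqxx.
rewrite (_ : mu setT = 1%E); last exact: probability_setT.
rewrite mul1e muleC; congr (_ * _)%E.
by apply: eq_bigr => i /negPf ->.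
Qed.

Lemma bmf_Mk k F : bmf F -> bmf (Mk k F).
Proof. by move=> /(Mk_resample k)[]. Qed.

Lemma Ex_Mk k F : bmf F -> Ex la (Mk k F) = Ex la F.
Proof. by move=> /(Mk_resample k)[_ <-]. Qed.

Lemma free_Mk k F : free k (Mk k F).
Proof. by move=> z e; apply: eq_Ex => e'; rewrite upd_upd. Qed.

Lemma free_Mk_other j k F : free j F -> free j (Mk k F).
Proof.
move=> fF z e; apply: eq_Ex => e'.
have [->|jk] := eqVneq j k; first by rewrite upd_upd.
by rewrite updC// fF.
Qed.

Lemma Mk_free k F : free k F -> Mk k F =1 F.
Proof. by move=> fF z; rewrite /Mk -[RHS](Ex_cst mu); apply: eq_Ex => e; rewrite fF. Qed.

Lemma Mk_free_mul k F G z : bmf F -> free k G ->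
  Mk k (fun z => G z * F z) z = G z * Mk k F z.
Proof.
move=> bF fG; rewrite /Mk -ExZ; last exact: bmf_upd.
by apply: eq_Ex => e; rewrite fG.
Qed.

(** A mean-zero observation, given the others, is uncorrelated with every
    function of the others. *)
Lemma Ex_centered k F : bmf F -> (forall z, Mk k F z = 0) -> Ex la F = 0.
Proof. by move=> bF F0; rewrite -(Ex_Mk k bF) -[RHS](Ex_cst la); exact: eq_Ex. Qed.

Definition Ms (s : seq 'I_n) (F : Om -> R) : Om -> R :=
  foldr Mk F s.

Lemma bmf_Ms s F : bmf F -> bmf (Ms s F).
Proof. by move=> bF; elim: s => //= k s; exact: bmf_Mk. Qed.

Lemma Ex_Ms s F : bmf F -> Ex la (Ms s F) = Ex la F.
Proof. by move=> bF; elim: s => //= k s <-; apply: Ex_Mk; exact: bmf_Ms. Qed.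

Lemma free_Ms s k F : k \in s -> free k (Ms s F).
Proof.
elim: s => //= j s ih; rewrite inE => /predU1P[->|ks]; first exact: free_Mk.
by apply: free_Mk_other; exact: ih.
Qed.

Lemma free_Ms_other s k F : free k F -> free k (Ms s F).
Proof. by move=> fF; elim: s => //= j s; exact: free_Mk_other. Qed.

Lemma MsB s F G z : bmf F -> bmf G ->
  Ms s (fun z => F z - G z) z = Ms s F z - Ms s G z.
Proof.
move=> bF bG; elim: s z => //= k s ih z.
rewrite /Mk -ExB; try by apply: bmf_upd; exact: bmf_Ms.
by apply: eq_Ex => e; rewrite ih.
Qed.

Lemma Ex_Mk_sqr k F : bmf F ->
  Ex la (fun z => Mk k F z ^+ 2) <= Ex la (fun z => F z ^+ 2).
Proof.
move=> bF; have bF2 : bmf (fun z => F z ^+ 2) by bm.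
rewrite -(Ex_Mk k bF2); apply: Ex_le.
- by apply: bmfX; exact: bmf_Mk.
- exact: bmf_Mk.
- by move=> z; apply: Ex_sqr_le; exact: bmf_upd.
Qed.

Lemma Ex_Ms_sqr s F : bmf F ->
  Ex la (fun z => Ms s F z ^+ 2) <= Ex la (fun z => F z ^+ 2).
Proof.
move=> bF; elim: s => //= k s ih; apply: le_trans ih.
by apply: Ex_Mk_sqr; exact: bmf_Ms.
Qed.

Lemma Ex_Mk_orth k F : bmf F ->
  Ex la (fun z => F z ^+ 2) - Ex la (fun z => Mk k F z ^+ 2) =
  Ex la (fun z => (F z - Mk k F z) ^+ 2).
Proof.
move=> bF; have bM := bmf_Mk k bF.
have e : Ex la (fun z => Mk k F z * F z) = Ex la (fun z => Mk k F z ^+ 2).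
  rewrite -(Ex_Mk k); last by bm.
  by apply: eq_Ex => z; rewrite Mk_free_mul//; exact: free_Mk.
have -> : Ex la (fun z => (F z - Mk k F z) ^+ 2) =
   Ex la (fun z => F z ^+ 2 + Mk k F z ^+ 2 - 2 * (Mk k F z * F z)).
  by apply: eq_Ex => z; ring.
rewrite ExB; [|by bm|by apply: bmfZ; bm]; rewrite ExD; [|by bm|by bm].
rewrite ExZ; last by bm.
by rewrite e; ring.
Qed.

Lemma Ex_Mk_dist k F G : bmf F -> bmf G -> free k G ->
  Ex la (fun z => (F z - Mk k F z) ^+ 2) <= Ex la (fun z => (F z - G z) ^+ 2).
Proof.
move=> bF bG fG.
pose U z := F z - G z.
have bU : bmf U by exact: bmfB.
have -> : Ex la (fun z => (F z - Mk k F z) ^+ 2) =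
          Ex la (fun z => (U z - Mk k U z) ^+ 2).
  apply: eq_Ex => z; rewrite /U.
  have -> : Mk k (fun z => F z - G z) z = Mk k F z - Mk k G z.
    by have := @MsB [:: k] F G z bF bG.
  by rewrite (Mk_free fG); congr (_ ^+ 2); ring.
by rewrite -Ex_Mk_orth// gerBl; apply: Ex_ge0 => z; exact: sqr_ge0.
Qed.

(** Efron-Stein inequality: the k-th increment of the Doob martingale obtained
    by integrating out the observations one by one is, after removing any
    approximation G k that ignores the k-th observation, at most the L2 distance
    between F and G k. *)
Theorem Efron_Stein (F : Om -> R) (G : 'I_n -> Om -> R) :
  bmf F -> (forall k, bmf (G k)) -> (forall k, free k (G k)) ->
  Var la F <= \sum_(k < n) Ex la (fun z => (F z - G k z) ^+ 2).
Proof.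
move=> bF bG fG.
suff H s : uniq s ->
    Ex la (fun z => F z ^+ 2) - Ex la (fun z => Ms s F z ^+ 2) <=
    \sum_(k <- s) Ex la (fun z => (F z - G k z) ^+ 2).
  have := H (index_enum 'I_n) (index_enum_uniq _).
  apply: le_trans; rewrite VarE// lerD2l lerN2.
  set s := index_enum _.
  have fs k : free k (Ms s F) by apply: free_Ms; rewrite mem_index_enum.
  have Hc z z' : Ms s F z = Ms s F z'.
    pose h (t : seq 'I_n) := foldr (fun k (w : Om) => upd w k (tnth z' k)) z t.
    have hE t : Ms s F (h t) = Ms s F z by elim: t => //= k t <-; rewrite fs.
    rewrite -(hE s); congr (Ms s F _); apply: eq_from_tnth => i.
    have : i \in s by rewrite mem_index_enum.
    elim: (s) => //= k t ih; rewrite inE tnth_upd.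
    by case: eqVneq => [->|_ /ih].
  have [[z1 _]|noz] := pselect (exists z : Om, True); last first.
    have e f : Ex la f = Ex la (fun=> 0) by apply: eq_Ex => z; exfalso; apply: noz; exists z.
    by rewrite (e (fun z => Ms s F z ^+ 2)) (e F) !Ex_cst expr0n.
  have -> : Ex la (fun z => Ms s F z ^+ 2) = Ms s F z1 ^+ 2.
    by rewrite -[RHS](Ex_cst la); apply: eq_Ex => z; rewrite (Hc z z1).
  rewrite -(Ex_Ms s bF).
  have -> : Ex la (Ms s F) = Ms s F z1; last by [].
  by rewrite -[RHS](Ex_cst la); apply: eq_Ex => z; rewrite (Hc z z1).
elim: s => [_|k s ih]; first by rewrite big_nil/= subrr.
move=> /=/andP[ks us]; rewrite big_cons.
have bs := bmf_Ms s bF.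
have := ih us; rewrite -subr_ge0 => h1.
have h2 := Ex_Mk_orth k bs.
have h3 : Ex la (fun z => (Ms s F z - Mk k (Ms s F) z) ^+ 2) <=
          Ex la (fun z => (F z - G k z) ^+ 2).
  apply: (le_trans (Ex_Mk_dist bs (bmf_Ms s (bG k)) _)).
    by apply: free_Ms_other.
  have bFG : bmf (fun z => F z - G k z) by exact: bmfB.
  apply: le_trans (Ex_Ms_sqr s bFG); rewrite le_eqVlt; apply/orP; left; apply/eqP.
  by apply: eq_Ex => z; rewrite MsB.
by lra.
Qed.

End product_law.

(** * Neighbour lists *)

Section sort_facts.

Lemma eq_in_sort_rel (T : eqType) (r r' : rel T) (s : seq T) :
  {in s &, r =2 r'} -> sort r s = sort r' s.
Proof.
move=> rr'.
have [t ->] : exists t : seq {x | x \in s}, s = map val t.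
  by have /all_sigP[t ts] : all [in s] s by [apply/allP]; exists t.
rewrite !sort_map; congr (map _ (sort _ _)).
by apply/funext => -[x xs]; apply/funext => -[y ys]; exact: rr'.
Qed.

(** Only fewer than m items can precede strictly one of the first m items. *)
Lemma card_before_take (T : finType) (r : rel T) (s : seq T) (m : nat) (a : T)
    (A : {pred T}) : total r -> transitive r ->
  a \in take m (sort r s) -> {subset A <= s} ->
  (forall l, l \in A -> ~~ r a l) -> (#|A| < m)%N.
Proof.
move=> tot tra am As Ab.
have rr : reflexive r by move=> x; have := tot x x; rewrite orbb.
have so := sort_sorted tot s.
have q := index_ltn am.
apply: leq_ltn_trans q.
have asx : a \in sort r s := mem_take am.
have sub : {subset A <= take (index a (sort r s)) (sort r s)}.
  move=> l lA; have ls : l \in sort r s by rewrite mem_sort As.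
  rewrite in_take// ltnNge; apply/negP => h.
  by move/negP: (Ab l lA); apply; exact: (sorted_leq_index tra rr so).
apply: leq_trans (_ : size (take (index a (sort r s)) (sort r s)) <= _)%N.
  apply: leq_trans (card_size _); apply: subset_leq_card.
  by apply/fintype.subsetP => l; exact: sub.
by rewrite size_take; case: ltnP.
Qed.

Lemma card_classes (T C : finType) (A : {pred T}) (f : T -> C) (m : nat) :
  (forall c, #|[pred i | (i \in A) && (f i == c)]| <= m)%N ->
  (#|A| <= m * #|C|)%N.
Proof.
move=> h; rewrite -sum1_card (partition_big f predT)//=.
rewrite mulnC -sum_nat_const; apply: leq_sum => c _.
by rewrite sum1_card; exact: h.
Qed.

End sort_facts.

Section near.
Context {R : realType} {d : nat}.
Local Notation X := (d.-tuple R).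

Definition inbox (M : R) (a : X) := [forall k, `|tnth a k| <= M].

(** rho a b c means that c does not precede b in the order of
    proximity to a.  The two remaining fields are what makes neighbour graphs
    sparse and local.  Within one of finitely many classes of positions
    relative to a, the point b farthest from a sees all the others before a.
    Within one of finitely many cells of a box, the point of largest key sees
    all the others before any point at distance at least delta. *)
Record proximity (rho : X -> X -> X -> bool) : Prop := {
  prox_total : forall a, total (rho a);
  prox_trans : forall a, transitive (rho a);
  prox_meas : measurable [set abc : X * X * X | rho abc.1.1 abc.1.2 abc.2];
  prox_cone : exists (C : finType) (cls : X -> X -> C) (key : X -> X -> R),
    forall a b c, b <> a -> c <> a -> b <> c -> cls a b = cls a c ->
      key a c <= key a b -> ~~ rho b a c;
  prox_cell : forall M delta : R, 0 < delta ->
    exists (C : finType) (cell : X -> C) (key : X -> R), forall a b w k,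
      inbox M a -> inbox M b -> cell a = cell b -> a <> b ->
      key b <= key a -> delta < `|tnth a k - tnth w k| -> ~~ rho a w b }.

Variable rho : X -> X -> X -> bool.

Definition nbs n (x : 'I_n -> X) (i : 'I_n) : seq 'I_n :=
  sort (fun j l => rho (x i) (x j) (x l)) [seq j <- enum 'I_n | j != i].

(** The fourth neighbour is the one that replaces the third when a
    neighbour is deleted. *)
Definition nb4 n (x : 'I_n -> X) i := take 4 (nbs x i).

Hypothesis prox : proximity rho.

Lemma nbs_uniq n (x : 'I_n -> X) i : uniq (nbs x i).
Proof. by rewrite sort_uniq filter_uniq// enum_uniq. Qed.

Lemma mem_nbs n (x : 'I_n -> X) i j : (j \in nbs x i) = (j != i).
Proof. by rewrite mem_sort mem_filter mem_enum andbT. Qed.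

Lemma size_nbs n (x : 'I_n -> X) i : size (nbs x i) = n.-1.
Proof.
rewrite size_sort size_filter -(@eq_count _ (predC (pred1 i)))//.
have := count_predC (pred1 i) (enum 'I_n).
rewrite size_enum_ord count_uniq_mem ?enum_uniq// mem_enum /= add1n.
by set c := count _ _; lia.
Qed.

Definition nb_minus n (x : 'I_n -> X) (k i : 'I_n) : seq 'I_n :=
  [seq j <- nbs x i | j != k].

Lemma nb_minus_free n (x x' : 'I_n -> X) k i : i != k ->
  (forall j, j != k -> x j = x' j) -> nb_minus x k i = nb_minus x' k i.
Proof.
move=> ik xx'; have [tot tra _ _ _] := prox.
rewrite /nb_minus /nbs !filter_sort//; last 4 first.
- by move=> j l; exact: tot.
- by move=> j l m; exact: tra.
- by move=> j l; exact: tot.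
- by move=> j l m; exact: tra.
apply: eq_in_sort_rel => j l; rewrite !mem_filter => /andP[jk _] /andP[lk _].
by rewrite !xx'.
Qed.

Definition degree_bound (D : nat) := forall n (x : 'I_n -> X) j, injective x ->
  (#|[pred i | j \in nb4 x i]| <= D)%N.

Lemma nb4_before n (x : 'I_n -> X) i j (A : {pred 'I_n}) :
  j \in nb4 x i -> (forall l, l \in A -> l != i) ->
  (forall l, l \in A -> ~~ rho (x i) (x j) (x l)) -> (#|A| < 4)%N.
Proof.
move=> ji Ai Ab; have [tot tra _ _ _] := prox.
apply: (card_before_take _ _ ji) => //.
- by move=> u v; exact: tot.
- by move=> u v w; exact: tra.
- by move=> l lA; rewrite mem_filter Ai// mem_enum.
Qed.

(** The classes around a point play the role of cones: within one class, all
    but boundedly many points meet four points of the class before x_j. *)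
Lemma prox_degree : exists D, degree_bound D.
Proof.
have [C [cls [key H]]] := prox_cone prox.
exists (4 * #|C|)%N => n x j xi.
apply: (card_classes (f := fun i => cls (x j) (x i))) => c.
set J := [pred i | _].
have [[i0 Ji0]|noJ] := pselect (exists i, i \in J); last first.
  by rewrite eq_card0// => i; apply/negbTE/negP => iJ; apply: noJ; exists i.
case: (@Order.TotalTheory.arg_maxP _ _ _ i0 (mem J) (fun i => key (x j) (x i)) Ji0).
move=> i iJ imax.
have /andP[ji /eqP ci] : (j \in nb4 x i) && (cls (x j) (x i) == c) by exact: iJ.
rewrite (cardD1 i) (_ : (i \in J) = true) ?add1n; last exact: iJ.
apply: (nb4_before ji).
  by move=> l /andP[].
move=> l /andP[li /andP[]]; rewrite inE => jl /eqP cl.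
have neq u : j \in nb4 x u -> x u <> x j.
  move=> ju /xi uj; move: ju => /mem_take; rewrite mem_nbs.
  by rewrite uj eqxx.
apply: H; [exact: neq|exact: neq| |by rewrite ci cl| ].
  by move=> /xi e; rewrite e eqxx in li.
by apply: imax; change ((j \in nb4 x l) && (cls (x j) (x l) == c)); rewrite jl cl eqxx.
Qed.

Definition far (delta : R) (k : 'I_d) n (x : 'I_n -> X) (i : 'I_n) : bool :=
  has (fun j => delta < `|tnth (x i) k - tnth (x j) k|) (nb4 x i).

(** Points of a common cell are close to each other, so only boundedly many
    points of each cell can have a far point among their first neighbours. *)
Lemma prox_local (M delta : R) : 0 < delta -> exists B : nat,
  forall k n (x : 'I_n -> X), injective x ->
  (#|[pred i | inbox M (x i) && far delta k x i]| <= B)%N.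
Proof.
move=> d0; have [C [cell [key H]]] := prox_cell prox M d0.
exists (4 * #|C|)%N => k n x xi.
apply: (card_classes (f := fun i => cell (x i))) => c.
set J := [pred i | _].
have [[i0 Ji0]|noJ] := pselect (exists i, i \in J); last first.
  by rewrite eq_card0// => i; apply/negbTE/negP => iJ; apply: noJ; exists i.
case: (@Order.TotalTheory.arg_maxP _ _ _ i0 (mem J) (fun i => key (x i)) Ji0).
move=> i iJ imax.
have /andP[/andP[bi /hasP[w wi fw]] /eqP ci] :
  (inbox M (x i) && far delta k x i) && (cell (x i) == c) by exact: iJ.
rewrite (cardD1 i) (_ : (i \in J) = true) ?add1n; last exact: iJ.
apply: (nb4_before wi) => l /andP[li]; first by [].
move=> /andP[/andP[bl fl] /eqP cl].
apply: (H _ _ _ k) => //; first by rewrite ci cl.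
  by move=> /xi e; rewrite e eqxx in li.
apply: imax; change (inbox M (x l) && far delta k x l && (cell (x l) == c)).
by rewrite bl fl cl eqxx.
Qed.

End near.

(** * The two proximity orders *)

Section grid.
Context {R : realType}.

(** Points of a bounded interval cut into N.+1 unit cells. *)
Definition gcode (N : nat) (s : R) : 'I_N.+1 := inord (Num.trunc s).

Lemma gcode_close (N : nat) (s t : R) : 0 <= s <= N%:R -> 0 <= t <= N%:R ->
  gcode N s = gcode N t -> `|s - t| < 1.
Proof.
move=> /andP[s0 sN] /andP[t0 tN] /(congr1 val).
have tr y : 0 <= y -> y <= N%:R -> (Num.trunc y < N.+1)%N.
  move=> y0 yN; rewrite truncn_lt_nat//.
  by rewrite (le_lt_trans yN)// ltr_nat.
rewrite /= !inordK ?tr// => e.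
have := truncn_itv s0; have := truncn_itv t0; rewrite e -!natr1.
move=> /andP[? ?] /andP[? ?]; rewrite ltr_norml; apply/andP; split; lra.
Qed.

End grid.

Section euclidean_proximity.
Context {R : realType} {d : nat}.
Hypothesis hd : (0 < d)%N.
Local Notation X := (d.-tuple R).
Implicit Types a b c w : X.

Definition rho_nn a b c : bool := euclidean_dist a b <= euclidean_dist a c.

Lemma euclidean_distC a b : euclidean_dist a b = euclidean_dist b a.
Proof. by congr Num.sqrt; apply: eq_bigr => k _; rewrite -sqrrN opprB. Qed.

Lemma euclidean_dist_sqr a b :
  euclidean_dist a b ^+ 2 = \sum_(k < d) (tnth a k - tnth b k) ^+ 2.
Proof. by rewrite sqr_sqrtr// sumr_ge0// => k _; exact: sqr_ge0. Qed.

Lemma euclidean_dist_ge0 a b : 0 <= euclidean_dist a b.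
Proof. exact: sqrtr_ge0. Qed.

Lemma coord_le_dist a b k : `|tnth a k - tnth b k| <= euclidean_dist a b.
Proof.
rewrite -(@ler_pXn2r _ 2) ?nnegrE ?euclidean_dist_ge0// real_normK ?num_real//.
rewrite euclidean_dist_sqr (bigD1 k)//= lerDl sumr_ge0// => j _; exact: sqr_ge0.
Qed.

Lemma euclidean_dist_gt0 a b : a <> b -> 0 < euclidean_dist a b.
Proof.
move=> ab; rewrite lt_neqAle euclidean_dist_ge0 andbT eq_sym; apply/eqP => e.
apply: ab; apply: eq_from_tnth => k.
by have := coord_le_dist a b k; rewrite e normr_le0 subr_eq0 => /eqP.
Qed.

Let d0 : (0 : R) < d%:R. Proof. by rewrite ltr0n. Qed.

Lemma sum_sqr_small (v : 'I_d -> R) (eta : R) : 0 < eta ->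
  (forall k, `|v k| < eta / d%:R) -> \sum_(k < d) v k ^+ 2 < eta ^+ 2.
Proof.
move=> e0 h.
have h2 k : v k ^+ 2 < (eta / d%:R) ^+ 2.
  rewrite -[X in X < _]real_normK ?num_real// ltr_pXn2r ?nnegrE//.
  by rewrite ltW// divr_gt0.
apply: (@lt_le_trans _ _ (\sum_(k < d) (eta / d%:R) ^+ 2)).
  apply: ltr_sum => [|k _]; last exact: h2.
  by apply/hasP; exists (Ordinal hd); rewrite ?mem_index_enum.
rewrite sumr_const card_ord -[X in X <= _]mulr_natr.
have -> : (eta / d%:R) ^+ 2 * d%:R = eta ^+ 2 * (d%:R)^-1 by field; rewrite gt_eqF.
by apply: ler_piMr; [exact: sqr_ge0|rewrite invf_le1// ler1n].
Qed.

Definition direction a b : {ffun 'I_d -> 'I_(2 * d).+1} :=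
  [ffun k => gcode (2 * d)
     (d%:R * ((tnth b k - tnth a k) / euclidean_dist a b) + d%:R)].

(** Two vectors in a common cone of opening less than sixty degrees are closer
    to each other than the longer one is to the apex. *)
Lemma cone_closer a b c : b <> a -> c <> a -> direction a b = direction a c ->
  euclidean_dist a c <= euclidean_dist a b ->
  euclidean_dist b c < euclidean_dist b a.
Proof.
move=> ba ca dir BA.
set A := euclidean_dist a b in BA *; set B := euclidean_dist a c in BA *.
have A0 : 0 < A by apply: euclidean_dist_gt0 => /esym.
have B0 : 0 < B by apply: euclidean_dist_gt0 => /esym.
pose p k := tnth b k - tnth a k; pose q k := tnth c k - tnth a k.
have unit_code (r s : R) k (V : X) : 0 < r -> `|tnth V k - tnth a k| <= r ->
    s = (tnth V k - tnth a k) / r -> 0 <= d%:R * s + d%:R <= (2 * d)%:R.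
  move=> r0 h ->.
  have : `|(tnth V k - tnth a k) / r| <= 1.
    by rewrite normrM normfV [`|r|]gtr0_norm// ler_pdivrMr// mul1r.
  rewrite ler_norml natrM => /andP[h1 h2].
  set y := _ / r in h1 h2 *.
  have := ler_wpM2l (ltW d0) h1; have := ler_wpM2l (ltW d0) h2.
  by rewrite mulr1 mulrN1 => ? ?; apply/andP; split; lra.
have close k : `|p k / A - q k / B| < 1 / d%:R.
  have /ffunP/(_ k) := dir; rewrite !ffunE.
  have hb : `|tnth b k - tnth a k| <= A by rewrite distrC; exact: coord_le_dist.
  have hc : `|tnth c k - tnth a k| <= B by rewrite distrC; exact: coord_le_dist.
  move=> /(gcode_close (unit_code A _ k b A0 hb erefl) (unit_code B _ k c B0 hc erefl)).
  rewrite -/A -/B -/(p k) -/(q k) => h.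
  rewrite ltr_pdivlMr// -[d%:R]gtr0_norm// -normrM.
  by move: h; congr (`|_| < 1); ring.
have := sum_sqr_small ltr01 close; rewrite expr1n.
pose S := \sum_k p k * q k.
have sA : A ^+ 2 = \sum_k p k ^+ 2.
  by rewrite euclidean_dist_sqr; apply: eq_bigr => k _; rewrite /p; ring.
have sB : B ^+ 2 = \sum_k q k ^+ 2.
  by rewrite euclidean_dist_sqr; apply: eq_bigr => k _; rewrite /q; ring.
have -> : \sum_k (p k / A - q k / B) ^+ 2 = 2 - 2 * S / (A * B).
  transitivity (A ^+ 2 / A ^+ 2 + B ^+ 2 / B ^+ 2 - 2 * S / (A * B)).
    rewrite {1}sA {1}sB /S mulr_sumr !mulr_suml -big_split -sumrB/=.
    by apply: eq_bigr => k _; field; rewrite ?gt_eqF.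
  by rewrite !divff ?expf_neq0 ?gt_eqF.
move=> h.
have h2 : A * B < 2 * S.
  rewrite -[X in X < _]mul1r -ltr_pdivlMr ?mulr_gt0//; lra.
rewrite -(@ltr_pXn2r _ 2) ?nnegrE ?euclidean_dist_ge0// euclidean_dist_sqr.
rewrite [euclidean_dist b a]euclidean_distC -/A.
have -> : \sum_(k < d) (tnth b k - tnth c k) ^+ 2 = A ^+ 2 + B ^+ 2 - 2 * S.
  rewrite sA sB /S mulr_sumr -big_split -sumrB/=.
  by apply: eq_bigr => k _; rewrite /p /q; ring.
have : B * B <= A * B by rewrite ler_pM2r.
by rewrite !expr2; lra.
Qed.

Definition cell (M eta : R) a : {ffun 'I_d -> 'I_(Num.trunc (2 * M / eta)).+2} :=
  [ffun k => gcode (Num.trunc (2 * M / eta)).+1 ((tnth a k + M) / eta)].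

Lemma cell_close M eta a b : 0 < eta -> inbox M a -> inbox M b ->
  cell M eta a = cell M eta b -> forall k, `|tnth a k - tnth b k| < eta.
Proof.
move=> e0 /forallP aM /forallP bM /ffunP ab k.
have h (V : X) : `|tnth V k| <= M ->
    0 <= (tnth V k + M) / eta <= (Num.trunc (2 * M / eta)).+1%:R.
  rewrite ler_norml => /andP[h1 h2].
  have M0 : 0 <= 2 * M by lra.
  apply/andP; split; first by rewrite divr_ge0 ?(ltW e0)//; lra.
  apply: (@le_trans _ _ (2 * M / eta)).
    by rewrite ler_pM2r ?invr_gt0//; lra.
  by rewrite ltW// truncnS_gt.
have := ab k; rewrite !ffunE => /(gcode_close (h a (aM k)) (h b (bM k))).
rewrite -mulrBl normrM normfV [`|eta|]gtr0_norm// ltr_pdivrMr// mul1r.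
by congr (`|_| < _); ring.
Qed.

(** The classes are cones of small opening, the cells cubes of small side. *)
Lemma proximity_nn : proximity rho_nn.
Proof.
split.
- by move=> a b c; exact: le_total.
- by move=> a b c e; exact: le_trans.
- have mc (f : X * X * X -> X) k : measurable_fun setT f ->
      measurable_fun setT (fun abc => tnth (f abc) k).
    by move=> mf; exact: (measurableT_comp (measurable_tnth k)).
  have m1 : measurable_fun setT (fun abc : X * X * X => abc.1.1).
    by apply: (measurableT_comp measurable_fst) => //; exact: measurable_fst.
  have m2 : measurable_fun setT (fun abc : X * X * X => abc.1.2).
    by apply: (measurableT_comp measurable_snd) => //; exact: measurable_fst.
  have m3 : measurable_fun setT (fun abc : X * X * X => abc.2) := measurable_snd.
  have md (f g : X * X * X -> X) : measurable_fun setT f -> measurable_fun setT g ->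
      measurable_fun setT (fun abc => \sum_(k < d) (tnth (f abc) k - tnth (g abc) k) ^+ 2).
    move=> mf mg; apply: measurable_sum => k; apply: measurable_funX.
    by apply: measurable_funB; exact: mc.
  have mb := measurable_fun_ler (md _ _ m1 m2) (md _ _ m1 m3).
  have := mb measurableT [set true]; rewrite setTI => /(_ _).
  suff -> : [set abc : X * X * X | rho_nn abc.1.1 abc.1.2 abc.2] =
    (fun x : X * X * X =>
         \sum_(k < d) (tnth x.1.1 k - tnth x.1.2 k) ^+ 2 <=
         \sum_(k < d) (tnth x.1.1 k - tnth x.2 k) ^+ 2) @^-1` [set true].
    by apply.
  apply/seteqP; split => -[[a b] c] /=; rewrite /rho_nn ler_sqrt//;
    by rewrite sumr_ge0// => k _; exact: sqr_ge0.
- exists _, direction, (@euclidean_dist R d) => a b c ba ca bc dir key.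
  by rewrite /rho_nn -ltNge; exact: cone_closer.
- move=> M delta dl0.
  have e0 : 0 < delta / d%:R by rewrite divr_gt0.
  exists _, (cell M (delta / d%:R)), (fun=> 0) => a b w k aM bM ab _ _ dw.
  rewrite /rho_nn -ltNge (lt_le_trans _ (coord_le_dist a w k))// (le_lt_trans _ dw)//.
  rewrite -(@ler_pXn2r _ 2) ?nnegrE ?euclidean_dist_ge0 ?(ltW dl0)//.
  rewrite euclidean_dist_sqr ltW// sum_sqr_small// => j.
  exact: (cell_close e0 aM bM ab).
Qed.

End euclidean_proximity.

Section cyclic_proximity.
Context {R : realType}.
Local Notation X := (1.-tuple R).
Implicit Types a b c w : X.

Local Notation "a `t" := (tnth a ord0) (at level 2).

(** The order in which the points of a circle are met when leaving a to the
    right: first the points on the right of a, then those on its left. *)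
Definition rho_cyc a b c : bool :=
  if a`t < b`t then (a`t < c`t) ==> (b`t <= c`t)
  else ~~ (a`t < c`t) && (b`t <= c`t).

Lemma neq_coord a b : a <> b -> a`t != b`t.
Proof.
move=> ab; apply/eqP => e; apply: ab; apply: eq_from_tnth => k.
by rewrite ord1.
Qed.

Lemma proximity_cyc : proximity rho_cyc.
Proof.
split.
- move=> a b c; rewrite /rho_cyc.
  by case: (ltP a`t b`t) => h1; case: (ltP a`t c`t) => h2 //=; exact: le_total.
- move=> a b c e; rewrite /rho_cyc.
  case: (ltP a`t c`t) => h1; case: (ltP a`t b`t) => h2; case: (ltP a`t e`t) => h3 //=;
    exact: le_trans.
- have m1 : measurable_fun setT (fun abc : X * X * X => abc.1.1`t).
    apply: (measurableT_comp (measurable_tnth ord0)) => //.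
    by apply: (measurableT_comp measurable_fst) => //; exact: measurable_fst.
  have m2 : measurable_fun setT (fun abc : X * X * X => abc.1.2`t).
    apply: (measurableT_comp (measurable_tnth ord0)) => //.
    by apply: (measurableT_comp measurable_snd) => //; exact: measurable_fst.
  have m3 : measurable_fun setT (fun abc : X * X * X => abc.2`t).
    by apply: (measurableT_comp (measurable_tnth ord0)) => //; exact: measurable_snd.
  pose b1 (z : X * X * X) := z.1.1`t < z.1.2`t.
  pose b2 (z : X * X * X) := z.1.1`t < z.2`t.
  pose b3 (z : X * X * X) := z.1.2`t <= z.2`t.
  have o1 : finobs b1 by apply: finobs_bool; exact: measurable_fun_ltr.
  have o2 : finobs b2 by apply: finobs_bool; exact: measurable_fun_ltr.
  have o3 : finobs b3 by apply: finobs_bool; exact: measurable_fun_ler.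
  have := finobs_comp (fun v : bool * bool * bool =>
     if v.1.1 then v.1.2 ==> v.2 else ~~ v.1.2 && v.2)
     (finobs_pair (finobs_pair o1 o2) o3) true.
  exact.
- exists bool, (fun a b => a`t < b`t), (fun a b => - b`t) => a b c ba ca bc e.
  rewrite lerN2 => bc'.
  have {}bc : b`t < c`t by rewrite lt_neqAle bc' neq_coord.
  rewrite /rho_cyc; move: e; case: (ltP a`t b`t) => ab.
    by move=> _; rewrite ltNge (ltW ab)/= bc.
  move=> ac; have {}ac : c`t < a`t.
    rewrite lt_neqAle neq_coord//=; rewrite leNgt -ac//.
  by rewrite (lt_trans bc ac) bc/= -ltNge.
- move=> M delta dl0.
  exists _, (cell M delta), (fun a => - a`t) => a b w k aM bM ab nab.
  rewrite lerN2 => ab'; have {}nab : a`t < b`t by rewrite lt_neqAle ab' neq_coord.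
  have := cell_close dl0 aM bM ab ord0; rewrite !ord1 => h1 h2.
  rewrite /rho_cyc nab/=; case: ltP => aw //=.
  rewrite -ltNge; move: h1 h2; rewrite [`|a`t - b`t|]distrC gtr0_norm ?subr_gt0//.
  rewrite [`|a`t - w`t|]distrC [`|w`t - a`t|]gtr0_norm ?subr_gt0// => ? ?; lra.
Qed.

Section neighbours_of_a_sample.
Variables (n : nat) (x : 'I_n -> X).
Hypothesis xi : injective x.
Let u i := (x i)`t.

Let ui : injective u.
Proof.
move=> i j e; apply: contrapT => ij.
by have := @neq_coord (x i) (x j) (fun h => ij (xi h)); rewrite /u in e; rewrite e eqxx.
Qed.

Lemma nbs_cyc i : nbs rho_cyc x i =
  sort (fun j l => u j <= u l) [seq j <- enum 'I_n | u i < u j] ++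
  sort (fun j l => u j <= u l) [seq j <- enum 'I_n | (j != i) && ~~ (u i < u j)].
Proof.
set s1 := sort _ [seq j <- enum 'I_n | u i < u j]; set s2 := sort _ _.
have [tot tra _ _ _] := proximity_cyc.
pose r := fun j l => rho_cyc (x i) (x j) (x l).
have rtot : total r by move=> j l; exact: tot.
have rtra : transitive r by move=> j l m; exact: tra.
have ltot : total (fun j l => u j <= u l) by move=> j l; exact: le_total.
have ltra : transitive (fun j l => u j <= u l) by move=> j l m; exact: le_trans.
have m1 : all (fun j => u i < u j) s1.
  by apply/allP => j; rewrite mem_sort mem_filter => /andP[].
have m2 : all (fun j => ~~ (u i < u j)) s2.
  by apply/allP => j; rewrite mem_sort mem_filter => /andP[/andP[]].
apply: (@sorted_eq _ r rtra).
- move=> j l /andP[]; rewrite /r /rho_cyc -/(u i) -/(u j) -/(u l) => h1 h2.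
  apply: ui; apply/eqP; rewrite eq_le; move: h1 h2.
  by case: (ltP (u i) (u j)); case: (ltP (u i) (u l)) => //= _ _ -> ->.
- exact: sort_sorted.
- rewrite sorted_pairwise// pairwise_cat -!sorted_pairwise//.
  apply/and3P; split.
  + apply/allrelP => j l /(allP m1) h1 /(allP m2) h2.
    by rewrite /r /rho_cyc -/(u i) -/(u j) -/(u l) h1 (negPf h2).
  + apply: (@sub_in_sorted _ (fun j => u i < u j) (fun j l => u j <= u l)) m1 _.
      move=> j l; rewrite !unfold_in => h1 h2.
      by rewrite /r /rho_cyc -/(u i) -/(u j) -/(u l) h1 h2.
    exact: sort_sorted.
  + apply: (@sub_in_sorted _ (fun j => ~~ (u i < u j)) (fun j l => u j <= u l)) m2 _.
      move=> j l; rewrite !unfold_in => h1 h2.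
      by rewrite /r /rho_cyc -/(u i) -/(u j) -/(u l) (negPf h1) (negPf h2).
    exact: sort_sorted.
- rewrite perm_sort; apply: uniq_perm.
  + by rewrite filter_uniq// enum_uniq.
  + have us1 : uniq s1 by rewrite sort_uniq filter_uniq// enum_uniq.
    have us2 : uniq s2 by rewrite sort_uniq filter_uniq// enum_uniq.
    rewrite cat_uniq us1 us2 andbT andTb.
    apply/hasPn => j /(allP m2) h; apply/negP => /(allP m1) h1.
    by rewrite h1 in h.
  + move=> j; rewrite mem_cat /s1 /s2 !mem_sort !mem_filter.
    have e1 : j \in Finite.enum 'I_n by rewrite -enumT mem_enum.
    rewrite e1 !andbT.
    have [h|h] := ltP (u i) (u j); rewrite /= ?andbT ?andbF ?orbF//.
    by apply/eqP => e; rewrite e ltxx in h.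
Qed.

Definition nright i := #|[pred j | u i < u j]|.

Lemma right_neighbor_cyc k i : (k.-1 < nright i)%N ->
  right_neighbor u k i = nth i (nbs rho_cyc x i) k.-1.
Proof.
move=> h; rewrite nbs_cyc nth_cat size_sort size_filter.
have -> : count (fun j => u i < u j) (enum 'I_n) = nright i.
  by rewrite -sum1_count big_enum_cond /nright -sum1_card.
by rewrite h.
Qed.

(** Only the k largest points lack a k-th right neighbour. *)
Lemma card_few_right k : (#|[pred i | (nright i < k)%N]| <= k)%N.
Proof.
have inj : {in [pred i | (nright i < k)%N] &, injective (fun i => inord (nright i) : 'I_k.+1)}.
  move=> i j; rewrite !inE => hi hj /(congr1 val) /=.
  rewrite !inordK ?ltnS ?(ltnW hi) ?(ltnW hj)// => e.
  apply: ui; apply/eqP; rewrite eq_le !leNgt.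
  have mono (v w : 'I_n) : u v < u w -> (nright w < nright v)%N.
    move=> vw; apply: proper_card; apply/properP; split.
      by apply/fintype.subsetP => l; rewrite !inE; exact: lt_trans.
    by exists w; rewrite !inE ?ltxx.
  by apply/andP; split; apply/negP => /mono; rewrite e ltnn.
rewrite -(card_in_image inj) -[leqRHS]card_ord.
have -> : #|'I_k| = #|[pred i : 'I_k.+1 | (i < k)%N]|.
  have winj : injective (widen_ord (leqnSn k)) by move=> v w /(congr1 val)/= /val_inj.
  rewrite -(card_codom winj).
  apply: eq_card => i; rewrite inE; apply/codomP/idP => [[j ->]|ik]; first exact: (ltn_ord j).
  by exists (Ordinal ik); exact: val_inj.
apply: subset_leq_card; apply/fintype.subsetP => v /fintype.imageP[i hi ve].
have hi' : (nright i < k)%N by exact: hi.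
by rewrite ve inE inordK// ltnS ltnW.
Qed.

Local Notation N1 i := (nth i (nbs rho_cyc x i) 0).

Hypothesis n3 : (2 < n)%N.

Lemma N1_neq i : N1 i != i.
Proof. by rewrite -(mem_nbs rho_cyc x) mem_nth// size_nbs; lia. Qed.

Lemma N1_first i l : l != i -> rho_cyc (x i) (x (N1 i)) (x l).
Proof.
have [tot tra _ _ _] := proximity_cyc.
rewrite -(mem_nbs rho_cyc x) => li.
have so : sorted (fun j l => rho_cyc (x i) (x j) (x l)) (nbs rho_cyc x i).
  by apply: sort_sorted => j m; exact: tot.
rewrite -[in X in rho_cyc _ _ X](nth_index i li).
apply: (sorted_leq_nth (leT := fun j l => rho_cyc (x i) (x j) (x l))) => //.
- by move=> j m k; exact: tra.
- by move=> j; have := tot (x i) (x j) (x j); rewrite orbb.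
- by rewrite inE size_nbs; lia.
- by rewrite inE index_mem.
Qed.

(** Of two points with the same successor, one would meet the other before
    that successor. *)
Lemma N1_cyc_inj : injective (fun i => N1 i).
Proof.
suff H i j : N1 i = N1 j -> ~~ (u i < u j).
  move=> i j e; apply: ui; apply/eqP; rewrite eq_le !leNgt.
  by apply/andP; split; apply: H.
move=> e; apply/negP => ij.
have ne : i != j by apply/eqP => h; rewrite h ltxx in ij.
have h1 := N1_first (i := i) (l := j); have h2 := N1_first (i := j) (l := i).
have := h2 ne; have := h1 (_ : j != i); rewrite eq_sym => /(_ ne).
have := N1_neq j; rewrite -e; set v := N1 i => vj.
rewrite /rho_cyc -/(u i) -/(u j) -/(u v) ij /= => h3.
have := h3; case: ltP => // iv /= vj' h4.
by move: h4; rewrite (ltNge (u j) (u v)) vj' /= andbF.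
Qed.

Lemma N1_cyc_not_mutual i : N1 (N1 i) != i.
Proof.
apply/eqP => e; set j := N1 i in e.
have ij : i != j by rewrite eq_sym; exact: N1_neq.
have [l /andP[li lj]] : exists l : 'I_n, (l != i) && (l != j).
  have : (0 < #|~: [set i; j]|)%N.
    by rewrite cardsCs finset.setCK cards2 ij card_ord; lia.
  by move=> /card_gt0P[l]; rewrite !inE negb_or; exists l.
have ri := N1_first li; have rj := N1_first (i := j) (l := l) lj.
rewrite e in rj; rewrite -/j in ri.
have ne : u i != u j by apply/eqP => /ui h; rewrite h eqxx in ij.
have nl : u l != u i by apply/eqP => /ui h; rewrite h eqxx in li.
have nl' : u l != u j by apply/eqP => /ui h; rewrite h eqxx in lj.
move: ri rj; rewrite /rho_cyc -/(u i) -/(u j) -/(u l).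
by case: (ltgtP (u i) (u j)) ne => // h1 _;
   case: (ltgtP (u l) (u i)) nl => // h2 _;
   case: (ltgtP (u l) (u j)) nl' => // h3 _ //=; lra.
Qed.

End neighbours_of_a_sample.

End cyclic_proximity.

(** * Neighbour statistics of an independent sample *)

Section real_facts.
Context {R : realType}.

Lemma sqr_sum_le (I : finType) (Q : pred I) (a : I -> R) :
  (\sum_(i | Q i) a i) ^+ 2 <= #|Q|%:R * \sum_(i | Q i) a i ^+ 2.
Proof.
have : 0 <= \sum_(i | Q i) \sum_(j | Q j) (a i - a j) ^+ 2.
  by apply: sumr_ge0 => i _; apply: sumr_ge0 => j _; exact: sqr_ge0.
have -> : \sum_(i | Q i) \sum_(j | Q j) (a i - a j) ^+ 2 =
    2 * (#|Q|%:R * \sum_(i | Q i) a i ^+ 2) - 2 * (\sum_(i | Q i) a i) ^+ 2.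
  transitivity (\sum_(i | Q i) (#|Q|%:R * a i ^+ 2 + \sum_(j | Q j) a j ^+ 2
                 - 2 * a i * \sum_(j | Q j) a j)).
    apply: eq_bigr => i _; rewrite mulr_sumr mulr_natl -sumr_const -big_split -sumrB/=.
    by apply: eq_bigr => j _; ring.
  rewrite sumrB big_split/= -mulr_sumr sumr_const -mulr_suml -mulr_sumr.
  by rewrite -[X in _ + X - _]mulr_natl; ring.
lra.
Qed.

Lemma sum_bool_card (I : finType) (Q : pred I) :
  \sum_(i : I) (Q i)%:R = #|Q|%:R :> R.
Proof.
rewrite -sum1_card natr_sum [RHS]big_mkcond/=.
by apply: eq_bigr => i _; rewrite unfold_in; case: (Q i).
Qed.

End real_facts.

Section distinct_values.
Context {R : realType} {dE : measure_display} {E : measurableType dE}.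
Variables (mu : probability E R) (n : nat) (la : probability (n.-tuple E) R).
Hypothesis iid : iid_law mu la.
Variable f : E -> R.
Hypothesis mf : measurable_fun setT f.
Hypothesis atomless : forall t, mu [set e | f e = t] = 0%E.
Local Notation Om := (n.-tuple E).

Lemma measurable_value_eq (i j : 'I_n) :
  measurable [set z : Om | f (tnth z i) = f (tnth z j)].
Proof.
have mc l : measurable_fun setT (fun z : Om => f (tnth z l)).
  by apply: (measurableT_comp mf) => //; exact: measurable_tnth.
have h1 := finobs_bool (measurable_fun_ler (mc i) (mc j)) true.
have h2 := finobs_bool (measurable_fun_ler (mc j) (mc i)) true.
have := measurableI _ _ h1 h2; congr measurable.
apply/seteqP; split => z /=; last by move=> ->; rewrite lexx.
by move=> [h3 h4]; apply/eqP; rewrite eq_le h3 h4.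
Qed.

(** Resampling one of two observations shows that they share a value with
    probability zero. *)
Lemma full_injective :
  full la [set z : Om | forall i j, i != j -> f (tnth z i) != f (tnth z j)].
Proof.
set D := [set z : Om | _].
pose C (ij : 'I_n * 'I_n) := [set z : Om | f (tnth z ij.1) = f (tnth z ij.2)].
have mC ij : measurable (C ij) by exact: measurable_value_eq.
have dE' : D = ~` \big[setU/set0]_(ij : 'I_n * 'I_n | ij.1 != ij.2) C ij.
  apply/seteqP; split => z; rewrite -bigcup_seq_cond /=.
    by move=> h [[i j] /= /andP[_ ij]] e; have := h _ _ ij; rewrite e eqxx.
  move=> h i j ij; apply/eqP => e; apply: h; exists (i, j) => //=.
  by rewrite mem_index_enum.
have mB : measurable (\big[setU/set0]_(ij : 'I_n * 'I_n | ij.1 != ij.2) C ij).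
  by apply: bigsetU_measurable => ij _; exact: mC.
split; first by rewrite dE'; exact: measurableC.
rewrite dE' probability_setC// (_ : la _ = 0%E) ?sube0//.
rewrite -Ex_indicE//; congr EFin.
apply/eqP; rewrite eq_le; apply/andP; split; last first.
  by apply: Ex_ge0 => z; rewrite indicE ler0n.
apply: (@le_trans _ _ (\sum_(ij : 'I_n * 'I_n | ij.1 != ij.2) Ex la \1_(C ij))).
  rewrite -Ex_sum => [|ij]; last exact: bmf_indic.
  apply: Ex_le => [||z]; first exact: bmf_indic.
    by apply: bmf_sum => ij _; exact: bmf_indic.
  rewrite indicE; have [|_] := boolP (z \in _); last first.
    by apply: sumr_ge0 => ij _; rewrite indicE ler0n.
  rewrite inE -bigcup_seq_cond => -[ij /= /andP[_ ijn] zij].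
  rewrite (bigD1 ij)//= indicE mem_set// lerDl.
  by apply: sumr_ge0 => ? _; rewrite indicE ler0n.
apply: sumr_le0 => -[i j] /= ij.
rewrite -(Ex_Mk iid i); last exact: bmf_indic.
rewrite le_eqVlt; apply/orP; left; apply/eqP; rewrite -[RHS](Ex_cst la).
apply: eq_Ex => z; rewrite /Mk.
set t := f (tnth z j).
have mt : measurable [set e : E | f e = t].
  have := mf measurableT (measurable_set1 t); rewrite setTI.
  by congr measurable.
transitivity (Ex mu \1_[set e : E | f e = t]).
  apply: eq_Ex => e; rewrite !indicE; congr (_%:R); congr nat_of_bool.
  have ji : (j == i) = false by rewrite eq_sym (negPf ij).
  by apply/idP/idP; rewrite !inE /C /= !tnth_upd eqxx ji.
by have := Ex_indicE mu mt; rewrite atomless => -[].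
Qed.

End distinct_values.

Section sample.
Context {R : realType} {d : nat}.
Local Notation X := (d.-tuple R).
Local Notation E := (X * R)%type.
Variable rho : X -> X -> X -> bool.
Hypothesis prox : proximity rho.

Definition xs n (z : n.-tuple E) (i : 'I_n) : X := (tnth z i).1.
Definition ys n (z : n.-tuple E) (i : 'I_n) : R := (tnth z i).2.

Definition Nb n (k : nat) (z : n.-tuple E) (i : 'I_n) : 'I_n :=
  nth i (nbs rho (xs z) i) k.

(** The neighbours after deletion of the m-th observation. *)
Definition Nbm n (m : 'I_n) (k : nat) (z : n.-tuple E) (i : 'I_n) : 'I_n :=
  nth i (nb_minus rho (xs z) m i) k.

Definition close_to n (z : n.-tuple E) (i j : 'I_n) : bool :=
  j \in nb4 rho (xs z) i.

Lemma measurable_xs n i : measurable_fun setT (fun z : n.-tuple E => xs z i).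
Proof.
apply: (measurableT_comp measurable_fst) => //; exact: measurable_tnth.
Qed.

Lemma measurable_ys n i : measurable_fun setT (fun z : n.-tuple E => ys z i).
Proof.
apply: (measurableT_comp measurable_snd) => //; exact: measurable_tnth.
Qed.

Definition order_pattern n (z : n.-tuple E) : {ffun 'I_n * 'I_n * 'I_n -> bool} :=
  [ffun t => rho (xs z t.1.1) (xs z t.1.2) (xs z t.2)].

Lemma finobs_pattern n : finobs (@order_pattern n).
Proof.
apply: finobs_ffun => -[[i j] l] /=; apply: finobs_bool => _ B mB.
rewrite setTI.
have mt : measurable_fun setT (fun z : n.-tuple E => (xs z i, xs z j, xs z l)).
  apply: measurable_fun_pair; last exact: measurable_xs.
  by apply: measurable_fun_pair; exact: measurable_xs.
have mr : measurable_fun setT (fun abc : X * X * X => rho abc.1.1 abc.1.2 abc.2).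
  apply: (measurable_fun_bool true); rewrite setTI.
  rewrite (_ : _ @^-1` _ = [set abc : X * X * X | rho abc.1.1 abc.1.2 abc.2]).
    exact: prox_meas prox.
  by apply/seteqP; split => abc /=.
have := measurableT_comp mr mt measurableT mB.
by rewrite setTI.
Qed.

Definition pattern_nbs n (pat : {ffun 'I_n * 'I_n * 'I_n -> bool}) i :=
  sort (fun j l => pat (i, j, l)) [seq j <- enum 'I_n | j != i].

Lemma nbs_pattern n (z : n.-tuple E) i :
  nbs rho (xs z) i = pattern_nbs (order_pattern z) i.
Proof.
rewrite /nbs /pattern_nbs; congr sort.
by apply/funext => j; apply/funext => l; rewrite ffunE.
Qed.

Lemma finobs_Nb n k i : finobs (fun z : n.-tuple E => Nb k z i).
Proof.
have := finobs_comp (fun p => nth i (pattern_nbs p i) k) (@finobs_pattern n).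
by congr finobs; apply/funext => z; rewrite /Nb nbs_pattern.
Qed.

Lemma finobs_Nbm n m k i : finobs (fun z : n.-tuple E => Nbm m k z i).
Proof.
have := finobs_comp (fun p => nth i [seq j <- pattern_nbs p i | j != m] k)
  (@finobs_pattern n).
by congr finobs; apply/funext => z; rewrite /Nbm /nb_minus nbs_pattern.
Qed.

Lemma finobs_close n i j : finobs (fun z : n.-tuple E => close_to z i j).
Proof.
have := finobs_comp (fun p => j \in take 4 (pattern_nbs p i)) (@finobs_pattern n).
by congr finobs; apply/funext => z; rewrite /close_to /nb4 nbs_pattern.
Qed.

Lemma xs_upd n (z : n.-tuple E) m e i : i != m -> xs (upd z m e) i = xs z i.
Proof. by move=> im; rewrite /xs tnth_upd (negPf im). Qed.

Lemma ys_upd n (z : n.-tuple E) m e i : i != m -> ys (upd z m e) i = ys z i.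
Proof. by move=> im; rewrite /ys tnth_upd (negPf im). Qed.

Lemma free_Nbm n m k i : i != m -> free m (fun z : n.-tuple E => Nbm m k z i).
Proof.
move=> im z e; rewrite /Nbm (nb_minus_free (x' := xs z) prox im)//.
by move=> j jm; rewrite xs_upd.
Qed.

Lemma Nbm_far n m k (z : n.-tuple E) i : (k < 4)%N ->
  ~~ close_to z i m -> Nbm m k z i = Nb k z i.
Proof.
rewrite /close_to /nb4 /Nbm /Nb /nb_minus; set s := nbs _ _ _ => k4 mz.
rewrite -{1}(cat_take_drop 4 s) filter_cat.
have -> : [seq j <- take 4 s | j != m] = take 4 s.
  by apply/all_filterP/allP => j js; apply/eqP => e; rewrite -e js in mz.
rewrite nth_cat; case: ltnP => h; first by rewrite nth_take.
move: h; rewrite size_take; case: (ltnP 4 (size s)) => s4; first by lia.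
move=> h; rewrite drop_oversize// nth_nil nth_default//.
Qed.

Lemma Nbm0 n m (z : n.-tuple E) i :
  Nbm m 0 z i = if Nb 0 z i == m then Nb 1 z i else Nb 0 z i.
Proof.
rewrite /Nbm /Nb /nb_minus; have := nbs_uniq rho (xs z) i.
case: (nbs _ _ _) => [|a [|b s]] /=; first by case: eqP.
  by move=> _; case: eqP.
rewrite inE negb_or => /andP[/andP[ab _] _].
by case: eqVneq => [am|am] //=; rewrite -am eq_sym ab.
Qed.

Lemma mem_nth_take (T : eqType) (a : T) (s : seq T) k m : (k < size s)%N ->
  (k < m)%N -> nth a s k \in take m s.
Proof.
move=> ks km; rewrite -(nth_take a km); apply: mem_nth.
by rewrite size_take; case: ifP.
Qed.

Lemma close_Nb n k (z : n.-tuple E) i : (k < 4)%N -> (4 < n)%N ->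
  close_to z i (Nb k z i).
Proof. by move=> k4 n4; apply: mem_nth_take => //; rewrite size_nbs; lia. Qed.

Lemma close_Nbm n m k (z : n.-tuple E) i : (k < 3)%N -> (4 < n)%N -> i != m ->
  close_to z i (Nbm m k z i).
Proof.
move=> k3 n4 im; have [mi|mi] := boolP (close_to z i m); last first.
  by rewrite Nbm_far ?close_Nb//; lia.
move: mi; rewrite /close_to /nb4 /Nbm /nb_minus.
have us := nbs_uniq rho (xs z) i; have ss := size_nbs rho (xs z) i.
set s := nbs _ _ _ in us ss *; move=> mi.
rewrite -{1}(cat_take_drop 4 s) filter_cat.
have ut : uniq (take 4 s) by exact: take_uniq.
have sz : size [seq j <- take 4 s | j != m] = 3.
  have -> : [seq j <- take 4 s | j != m] = rem m (take 4 s) by rewrite rem_filter.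
  by rewrite size_rem// size_take ss; case: ltnP; lia.
rewrite nth_cat sz k3.
by have /(mem_nth i) : (k < size [seq j <- take 4 s | j != m])%N;
  rewrite ?sz// mem_filter => /andP[].
Qed.

Lemma Nb_neq n k (z : n.-tuple E) i : (k < 4)%N -> (4 < n)%N -> Nb k z i != i.
Proof.
by move=> k4 n4; rewrite -(mem_nbs rho (xs z)) mem_nth// size_nbs; lia.
Qed.

Lemma Nb_inj n k l (z : n.-tuple E) i : (k < 4)%N -> (l < 4)%N -> (4 < n)%N ->
  (Nb k z i == Nb l z i) = (k == l).
Proof.
by move=> k4 l4 n4; rewrite nth_uniq ?nbs_uniq// size_nbs; lia.
Qed.

Lemma card_close_le n (z : n.-tuple E) i : (#|[pred m | close_to z i m]| <= 4)%N.
Proof.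
apply: leq_trans (card_size (nb4 rho (xs z) i)) _.
by rewrite size_take; case: ltnP => //; lia.
Qed.

Variable D : nat.
Hypothesis hD : degree_bound rho D.

Hypothesis hd : (0 < d)%N.
Variable mu : probability E R.

Hypothesis atomless : forall k t, mu [set e : E | tnth e.1 k = t] = 0%E.

Local Notation k0 := (Ordinal hd).

Definition distinct n : set (n.-tuple E) :=
  [set z | forall i j : 'I_n, i != j -> tnth (xs z i) k0 != tnth (xs z j) k0].

Lemma distinct_inj n (z : n.-tuple E) : distinct z -> injective (xs z).
Proof.
move=> dz i j e; apply: contrapT => /eqP ij.
by have := dz _ _ ij; rewrite e eqxx.
Qed.

Section fixed_size.
Variables (n : nat) (la : probability (n.-tuple E) R).
Hypothesis iid : iid_law mu la.
Local Notation Om := (n.-tuple E).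

Lemma full_distinct : full la (@distinct n).
Proof.
have mf : measurable_fun setT (fun e : E => tnth e.1 k0).
  by apply: (measurableT_comp (measurable_tnth k0)); exact: measurable_fst.
exact: (full_injective iid mf (atomless k0)).
Qed.

(** Every vertex has bounded in-degree, so sums over neighbours are controlled
    by sums over the sample. *)
Lemma sum_Nb_le (z : Om) k (a : 'I_n -> R) : (k < 4)%N -> (4 < n)%N ->
  distinct z -> (forall i, 0 <= a i) ->
  \sum_i a (Nb k z i) <= D%:R * \sum_i a i.
Proof.
move=> k4 n4 dz a0.
rewrite (partition_big (fun i => Nb k z i) predT)//= mulr_sumr.
apply: ler_sum => j _.
apply: (@le_trans _ _ (\sum_(i | Nb k z i == j) a j)).
  by apply: ler_sum => i /eqP ->.
rewrite sumr_const -[X in X <= _]mulr_natl; apply: ler_wpM2r => //.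
rewrite ler_nat; apply: leq_trans (hD j (distinct_inj dz)).
apply: subset_leq_card; apply/fintype.subsetP => i hi.
have /eqP <- : Nb k z i == j by exact: hi.
exact: close_Nb.
Qed.

(** Efron-Stein for sums of local terms: deleting the m-th observation
    only affects the m-th term and the boundedly many terms having m among
    their first neighbours. *)
Lemma Efron_Stein_local (phi : 'I_n -> Om -> R) (phim : 'I_n -> 'I_n -> Om -> R) :
  (forall i, bmf (phi i)) -> (forall m i, bmf (phim m i)) ->
  (forall m i, i != m -> free m (phim m i)) ->
  (forall m i z, distinct z -> i != m -> ~~ close_to z i m -> phi i z = phim m i z) ->
  Var la (fun z => \sum_i phi i z) <=
  D.+1%:R * (\sum_i Ex la (fun z => phi i z ^+ 2) +
     \sum_m \sum_(i | i != m) Ex la (fun z =>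
        (close_to z i m)%:R * (phi i z - phim m i z) ^+ 2)).
Proof.
move=> b1 b2 fr loc.
have bS : bmf (fun z => \sum_i phi i z) by apply: bmf_sum => i _; exact: b1.
have bG m : bmf (fun z => \sum_(i | i != m) phim m i z) by apply: bmf_sum => i _; exact: b2.
have bc i m : bmf (fun z : Om => (close_to z i m)%:R : R).
  exact: (bmf_obs (fun b : bool => b%:R) (finobs_close i m)).
have bt i m : bmf (fun z => (close_to z i m)%:R * (phi i z - phim m i z) ^+ 2).
  by apply: bmfM => //; apply: bmfX; exact: bmfB.
have fG m : free m (fun z => \sum_(i | i != m) phim m i z).
  by move=> z e; apply: eq_bigr => i im; exact: (fr m i im).
apply: (le_trans (Efron_Stein iid bS bG fG)).
rewrite mulrDr !mulr_sumr -big_split/=; apply: ler_sum => m _.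
rewrite -Ex_sum//.
rewrite -ExZ; last by apply: bmfX; exact: b1.
rewrite -ExZ; last by apply: bmf_sum.
rewrite -ExD; [|by apply: bmfZ; apply: bmfX; exact: b1|by apply: bmfZ; apply: bmf_sum].
apply: (Ex_le_full full_distinct).
- by apply: bmfX; exact: bmfB.
- by apply: bmfD; apply: bmfZ; [apply: bmfX; exact: b1|apply: bmf_sum].
move=> z dz.
rewrite (bigD1 m)//= -addrA -sumrB.
pose q i := (i == m) || close_to z i m.
pose a i := if i == m then phi m z else phi i z - phim m i z.
have -> : phi m z + \sum_(i | i != m) (phi i z - phim m i z) = \sum_(i | q i) a i.
  rewrite [RHS](bigD1 m) /q ?eqxx//= {1}/a eqxx; congr (_ + _).
  rewrite (bigID (fun i => close_to z i m))/= [X in _ + X]big1 ?addr0; last first.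
    by move=> i /andP[im ic]; rewrite (loc m i z)// subrr.
  rewrite /a; apply: eq_big => i; first by case: eqP => _; rewrite ?andbT ?andbF.
  by move=> /andP[/negPf ->].
apply: (le_trans (sqr_sum_le _ _)).
have -> : \sum_(i | q i) a i ^+ 2 = phi m z ^+ 2 +
    \sum_(i | i != m) (close_to z i m)%:R * (phi i z - phim m i z) ^+ 2.
  rewrite (bigD1 m) /q ?eqxx//= {1}/a eqxx; congr (_ + _).
  rewrite [RHS](bigID (fun i => close_to z i m))/= [X in _ = _ + X]big1 ?addr0; last first.
    by move=> i /andP[_ /negPf ->]; rewrite mul0r.
  rewrite /a; apply: eq_big => i; first by case: eqP => _; rewrite ?andbT ?andbF.
  by case: eqP => //= _ /andP[]// -> _; rewrite mul1r.
rewrite -mulrDr; apply: ler_wpM2r.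
  apply: addr_ge0; first exact: sqr_ge0.
  by apply: sumr_ge0 => i _; rewrite mulr_ge0 ?sqr_ge0.
rewrite ler_nat.
apply: leq_trans (_ : #|[pred i | i == m]| + #|[pred i | close_to z i m]| <= _)%N.
  by rewrite -cardUI; apply: leq_trans (leq_addr _ _); apply: subset_leq_card;
     apply/fintype.subsetP => i; rewrite !inE.
by rewrite card1 add1n ltnS; exact: (hD m (distinct_inj dz)).
Qed.

Lemma Efron_Stein_local_bounded (phi : 'I_n -> Om -> R)
    (phim : 'I_n -> 'I_n -> Om -> R) (B : R) : 0 <= B ->
  (forall i, bmf (phi i)) -> (forall m i, bmf (phim m i)) ->
  (forall m i, i != m -> free m (phim m i)) ->
  (forall m i z, distinct z -> i != m -> ~~ close_to z i m -> phi i z = phim m i z) ->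
  (forall i z, distinct z -> `|phi i z| <= B) ->
  (forall i m z, distinct z -> `|phim m i z| <= B) ->
  Var la (fun z => \sum_i phi i z) <= 17%:R * D.+1%:R * B ^+ 2 * n%:R.
Proof.
move=> B0 b1 b2 fr loc h1 h2.
have bc i m : bmf (fun z : Om => (close_to z i m)%:R : R).
  exact: (bmf_obs (fun b : bool => b%:R) (finobs_close i m)).
apply: (le_trans (Efron_Stein_local b1 b2 fr loc)).
rewrite -!mulrA mulrCA; apply: ler_wpM2l => //.
have hb (a c : R) : `|a| <= B -> `|c| <= B -> (a - c) ^+ 2 <= 4 * B ^+ 2.
  move=> ha hc; have : `|a - c| <= 2 * B.
    by apply: (le_trans (ler_normB _ _)); rewrite mulr_natl mulr2n lerD.
  move=> h; rewrite -[X in X <= _]real_normK ?num_real//.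
  rewrite (_ : 4 * B ^+ 2 = (2 * B) ^+ 2); last by ring.
  by rewrite lerXn2r ?nnegrE// mulr_ge0.
have t1 : \sum_i Ex la (fun z => phi i z ^+ 2) <= n%:R * B ^+ 2.
  rewrite -[n in n%:R * _]card_ord mulr_natl -sumr_const.
  apply: ler_sum => i _; rewrite -[leRHS](Ex_cst la).
  apply: (Ex_le_full full_distinct); [by apply: bmfX|exact: bmf_cst|].
  move=> z dz; rewrite -[X in X <= _]real_normK ?num_real//.
  by rewrite lerXn2r ?nnegrE// h1.
have t2 : \sum_m \sum_(i | i != m) Ex la (fun z =>
        (close_to z i m)%:R * (phi i z - phim m i z) ^+ 2) <= n%:R * (16%:R * B ^+ 2).
  have bt i m : bmf (fun z => (close_to z i m)%:R * (phi i z - phim m i z) ^+ 2).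
    by apply: bmfM => //; apply: bmfX; exact: bmfB.
  rewrite (exchange_big_dep predT)//=.
  rewrite -[n in n%:R * _]card_ord mulr_natl -sumr_const.
  apply: ler_sum => i _; rewrite -Ex_sum// -[leRHS](Ex_cst la).
  apply: (Ex_le_full full_distinct); [by apply: bmf_sum|exact: bmf_cst|].
  move=> z dz.
  apply: (@le_trans _ _ (\sum_m (close_to z i m)%:R * (4 * B ^+ 2))).
    rewrite big_mkcond/=; apply: ler_sum => m _; case: ifP => im.
      by apply: ler_wpM2l => //; apply: hb; [exact: h1|exact: h2].
    by rewrite mulr_ge0// mulr_ge0// sqr_ge0.
  rewrite -mulr_suml sum_bool_card (_ : 16%:R * B ^+ 2 = 4%:R * (4 * B ^+ 2)); last by ring.
  apply: ler_wpM2r; first by rewrite mulr_ge0// sqr_ge0.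
  by rewrite ler_nat; exact: card_close_le.
apply: (le_trans (lerD t1 t2)); rewrite le_eqVlt; apply/orP; left; apply/eqP; ring.
Qed.

End fixed_size.
End sample.

(** * Conditional label probabilities *)

Section level_sets.
Context {R : realType} {dX : measure_display} {X : measurableType dX}.

(** Bounded measurable functions are uniform limits of step functions. *)
Lemma bmf_step (g : X -> R) (eps : R) : bmf g -> 0 < eps ->
  exists (N : nat) (A : 'I_N -> set X) (v : 'I_N -> R),
    (forall j, measurable (A j)) /\
    (forall x, `|g x - \sum_j v j * \1_(A j) x| <= eps).
Proof.
move=> [mg [M gM]] e0.
pose code x : 'I_(Num.trunc (2 * M / eps)).+2 :=
  gcode (Num.trunc (2 * M / eps)).+1 ((g x + M) / eps).
pose v (j : 'I_(Num.trunc (2 * M / eps)).+2) := (j%:R : R) * eps - M.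
exists _, (fun j => code @^-1` [set j]), v; split.
  move=> j.
  have -> : code @^-1` [set j] =
    \big[setU/set0]_(m < (Num.trunc (2 * M / eps)).+2 | m == j)
      [set x | (m%:R <= (g x + M) / eps) && ((g x + M) / eps < m.+1%:R)].
    apply/seteqP; split=> x /=; rewrite -bigcup_seq_cond/=.
      move=> <-; exists (code x); rewrite /= ?mem_index_enum ?eqxx//.
      have := gM x; rewrite ler_norml => /andP[g1 g2].
      have h0 : 0 <= (g x + M) / eps by rewrite divr_ge0 ?(ltW e0)//; lra.
      rewrite /code /gcode inordK; first by have := truncn_itv h0.
      rewrite ltnS; apply: leqW; apply: le_truncn.
      by rewrite ler_pM2r ?invr_gt0//; lra.
    move=> [m /= /andP[_ /eqP <-] /andP[h1 h2]]; apply: val_inj; rewrite /code /gcode /=.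
    have -> : Num.trunc ((g x + M) / eps) = m by apply: truncn_def; rewrite h1.
    by rewrite inordK.
  apply: bigsetU_measurable => m _.
  have ma : measurable_fun setT (fun x => (g x + M) / eps).
    by apply: measurable_funM => //; apply: measurable_funD.
  have h1 := finobs_bool (measurable_fun_ler (measurable_cst (m%:R : R)) ma) true.
  have h2 := finobs_bool (measurable_fun_ltr ma (measurable_cst (m.+1%:R : R))) true.
  have := measurableI _ _ h1 h2; congr measurable.
  by apply/seteqP; split => x /= => [[-> ->]|/andP[-> ->]].
move=> x; rewrite (bigD1 (code x))//= indicE mem_set// mulr1 big1 ?addr0.
  have := gM x; rewrite ler_norml => /andP[g1 g2].
  have h0 : 0 <= (g x + M) / eps by rewrite divr_ge0 ?(ltW e0)//; lra.
  have h1 : (nat_of_ord (code x)) = Num.trunc ((g x + M) / eps).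
    rewrite /code /gcode inordK// ltnS; apply: leqW; apply: le_truncn.
    by rewrite ler_pM2r ?invr_gt0//; lra.
  rewrite /v h1; have /andP[h2 h3] := truncn_itv h0.
  set t := (Num.trunc _)%:R in h2 *; rewrite -natr1 -/t in h3.
  move: h2 h3; rewrite ler_pdivlMr// ltr_pdivrMr// mulrDl mul1r => h2 h3.
  by rewrite ler_norml; apply/andP; split; lra.
by move=> j jx; rewrite indicE memNset ?mulr0// => /= e; rewrite e eqxx in jx.
Qed.

End level_sets.

Section conditional_probability.
Context {R : realType} {dX : measure_display} {X : measurableType dX}.
Local Notation E := (X * R)%type.
Variables (mu : probability E R) (F : finType) (c : R -> F).
Hypothesis mc : finobs c.

Let mlab : finobs (fun e : E => c e.2).
Proof.
move=> b; have := @measurable_snd _ _ X R measurableT _ (mc b).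
by rewrite setTI.
Qed.

Let muX : probability X R := distribution mu (mk_mfun (@measurable_fst _ _ X R)).

Let Lb b : set E := (fun e : E => c e.2) @^-1` [set b].

Let nu0 (b : F) : {measure set X -> \bar R}.
Proof.
unshelve refine [the measure X R of pushforward (mrestr mu (mlab b)) fst].
exact: measurable_fst.
Defined.

Let nu0E b A : nu0 b A = mu ((fst @^-1` A) `&` Lb b).
Proof. by []. Qed.

Let nu0_fin b : fin_num_fun (nu0 b).
Proof.
move=> A mA; rewrite nu0E; apply: fin_num_measure; apply: measurableI; last exact: mlab.
by have := @measurable_fst _ _ X R measurableT _ mA; rewrite setTI.
Qed.

Let nu b : {finite_measure set X -> \bar R} :=
  HB.pack_for {finite_measure set X -> \bar R} (Measure.sort (nu0 b)) (Measure_isFinite.Build _ _ _ _ (nu0_fin b)).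

Let nu_dom b : nu b `<< muX.
Proof.
apply/null_content_dominatesP => A mA muA0.
apply/eqP; rewrite eq_le measure_ge0 andbT.
have mfA : measurable (fst @^-1` A : set E).
  by have := @measurable_fst _ _ X R measurableT _ mA; rewrite setTI.
have <- : mu (fst @^-1` A) = 0%E by [].
rewrite [X in (X <= _)%E](nu0E b A); apply: le_measure; rewrite ?inE//.
by apply: measurableI => //; exact: mlab.
Qed.

Let h b x : R := fine (Radon_Nikodym_SigmaFinite.f (nu b) muX x).

Let hE b x : (h b x)%:E = Radon_Nikodym_SigmaFinite.f (nu b) muX x.
Proof. by rewrite /h fineK// Radon_Nikodym_SigmaFinite.f_fin_num. Qed.

Let h_ge0 b x : 0 <= h b x.
Proof. by rewrite fine_ge0// Radon_Nikodym_SigmaFinite.f_ge0. Qed.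

Let h_int b : muX.-integrable setT (EFin \o h b).
Proof.
have := Radon_Nikodym_SigmaFinite.f_integrable (@nu_dom b).
by congr (integrable _ _ _); apply/funext => x /=; rewrite hE.
Qed.

Let mh b : measurable_fun setT (h b).
Proof. by apply/measurable_EFinP; have /integrableP[] := h_int b. Qed.

Let h_integral b A : measurable A ->
  (\int[muX]_(x in A) (h b x)%:E)%E = mu ((fst @^-1` A) `&` Lb b).
Proof.
move=> mA; rewrite -nu0E -[RHS]/(nu b A) (Radon_Nikodym_SigmaFinite.f_integral (@nu_dom b) mA).
by apply: eq_integral => x _; rewrite hE.
Qed.

Let good : set X := [set x | \sum_b h b x = 1].

Let msum : measurable_fun setT (fun x => \sum_b h b x).
Proof. by apply: measurable_sum => b; exact: mh. Qed.

Let mgood : measurable good.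
Proof.
have := msum measurableT (measurable_set1 (1 : R)); rewrite setTI; congr measurable.
Qed.

Let sum_Lb A : measurable A ->
  (\sum_(b : F) mu ((fst @^-1` A) `&` Lb b))%E = mu (fst @^-1` A).
Proof.
move=> mA.
have mfA : measurable (fst @^-1` A : set E).
  by have := @measurable_fst _ _ X R measurableT _ mA; rewrite setTI.
have mb b : measurable ((fst @^-1` A) `&` Lb b) by apply: measurableI => //; exact: mlab.
transitivity ((\sum_b Ex mu \1_((fst @^-1` A) `&` Lb b))%:E).
  by rewrite -sumEFin; apply: eq_bigr => b _; rewrite Ex_indicE.
rewrite -Ex_indicE// -Ex_sum; last by move=> b; exact: bmf_indic.
congr EFin; apply: eq_Ex => e.
rewrite (bigD1 (c e.2))//= big1 ?addr0.
  rewrite !indicE; congr (nat_of_bool _)%:R.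
  by apply/idP/idP; rewrite !inE; [case|split].
move=> b bc; rewrite indicE memNset// => -[_] /= e2.
by rewrite -e2 eqxx in bc.
Qed.

Let good_full : muX good = 1%E.
Proof.
have ii : muX.-integrable setT (fun x => (\sum_b h b x)%:E).
  rewrite (_ : (fun x => _) = (fun x => (\sum_(b : F) (h b x)%:E)%E)).
    by apply: integrable_sum => // b _; exact: h_int.
  by apply/funext => x; rewrite sumEFin.
have : ae_eq muX setT (fun x => (\sum_b h b x)%:E) (cst 1%:E).
  apply: integral_ae_eq => // A _ mA.
  rewrite integral_cst// mul1e.
  under eq_integral do rewrite -sumEFin.
  rewrite ge0_integral_sum//; last 2 first.
  - move=> b; apply/measurable_EFinP; exact: (measurable_funS measurableT).
  - by move=> b x _; rewrite lee_fin.
  by under eq_bigr do rewrite h_integral//; rewrite sum_Lb.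
move=> [N [mN N0 sN]].
have : muX (~` good) = 0%E.
  apply/eqP; rewrite eq_le measure_ge0 andbT -N0; apply: le_measure; rewrite ?inE//.
    exact: measurableC.
  move=> x gx; apply: sN => /= h1; apply: gx.
  by have := h1 I => -[].
move=> g0; rewrite -[good]setCK probability_setC; last exact: measurableC.
by rewrite g0 sube0.
Qed.

Let b0 : F := c point.

(** A version of the conditional law of the label given the position which is
    a probability vector at every position. *)
Lemma conditional_label_law : exists p : F -> X -> R,
  [/\ forall b, bmf (p b), forall b x, 0 <= p b x, forall x, \sum_b p b x = 1 &
   forall b (g : X -> R), bmf g ->
     Ex mu (fun e => (c e.2 == b)%:R * g e.1) = Ex mu (fun e => p b e.1 * g e.1)].
Proof.
pose p b x := \1_good x * h b x + \1_(~` good) x * (b == b0)%:R.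
have pg b x : good x -> p b x = h b x.
  by move=> gx; rewrite /p !indicE mem_set// memNset ?mul1r ?mul0r ?addr0// => /(_ gx).
have png b x : ~ good x -> p b x = (b == b0)%:R.
  by move=> gx; rewrite /p !indicE memNset// mem_set// mul1r mul0r add0r.
have p0 b x : 0 <= p b x.
  by have [gx|gx] := pselect (good x); [rewrite pg// h_ge0|rewrite png].
have p1 x : \sum_b p b x = 1.
  have [gx|gx] := pselect (good x).
    by rewrite -[RHS]gx; apply: eq_bigr => b _; rewrite pg.
  rewrite (bigD1 b0)//= big1 ?addr0 ?png ?eqxx// => b /negPf bb.
  by rewrite png// bb.
have bp b : bmf (p b).
  split.
    apply: measurable_funD; apply: measurable_funM.
    - have [mi _] : bmf (\1_good : X -> R) := bmf_indic mgood; exact: mi.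
    - exact: mh.
    - have [mi _] : bmf (\1_(~` good) : X -> R) := bmf_indic (measurableC mgood); exact: mi.
    - exact: measurable_cst.
  exists 1 => x; rewrite ger0_norm// -(p1 x) (bigD1 b)//= lerDl.
  by apply: sumr_ge0 => b' _; exact: p0.
exists p; split => //.
have bl b : bmf (fun e : E => (c e.2 == b)%:R : R).
  exact: (bmf_obs (fun v => (v == b)%:R) mlab).
have bfst (g : X -> R) : bmf g -> bmf (fun e : E => g e.1).
  by apply: bmf_comp; exact: measurable_fst.
have ind b (A : set X) : measurable A ->
    Ex mu (fun e => (c e.2 == b)%:R * \1_A e.1) = Ex mu (fun e => p b e.1 * \1_A e.1).
  move=> mA.
  have mfA : measurable (fst @^-1` A : set E).
    by have := @measurable_fst _ _ X R measurableT _ mA; rewrite setTI.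
  have mAb : measurable ((fst @^-1` A) `&` Lb b) by apply: measurableI => //; exact: mlab.
  transitivity (Ex mu \1_((fst @^-1` A) `&` Lb b)).
    apply: eq_Ex => e; rewrite !indicE -natrM mulnb; congr (nat_of_bool _)%:R.
    apply/idP/idP; first by move=> /andP[/eqP eb]; rewrite !inE.
    by rewrite !inE => -[eA eb]; apply/andP; split; [exact/eqP|rewrite inE].
  apply: EFin_inj; rewrite Ex_indicE// -(h_integral _ mA).
  have bpA : bmf (fun x => p b x * \1_A x) by apply: bmfM => //; exact: bmf_indic.
  transitivity ((Ex muX (fun x => p b x * \1_A x))%:E); last first.
    by rewrite Ex_distribution.
  rewrite -Ex_fin// integral_mkcond.
  apply: ae_eq_integral => //.
  - have := integrableS measurableT mA (@subsetT _ A) (h_int b).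
    move=> /integrableP[mm _].
    apply/measurable_restrict => //; by rewrite setTI.
  - by apply/measurable_EFinP; case: bpA.
  - exists (~` good); split; first exact: measurableC.
      by apply: (etrans (probability_setC _ mgood)); rewrite good_full subee.
    move=> x /= hx gx; apply: hx => _; rewrite /patch pg//.
    case: ifPn => xA; first by rewrite indicE xA mulr1.
    by rewrite indicE (negPf xA) mulr0.
move=> b g bg; apply/eqP; rewrite -subr_eq0 -normr_le0.
apply/ler_addgt0Pr => e e0; rewrite add0r.
have [N [A [v [mA Av]]]] := bmf_step bg (divr_gt0 e0 (@ltr0n R 2)).
pose s x := \sum_j v j * \1_(A j) x.
have bs : bmf s by apply: bmf_sum => j _; apply: bmfZ; exact: bmf_indic.
have Es : Ex mu (fun e => (c e.2 == b)%:R * s e.1) = Ex mu (fun e => p b e.1 * s e.1).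
  have dist (u : E -> R) : bmf u ->
     Ex mu (fun e => u e * s e.1) = \sum_j v j * Ex mu (fun e => u e * \1_(A j) e.1).
    move=> bu.
    have bj j : bmf (fun e => u e * \1_(A j) e.1).
      by apply: bmfM => //; apply: bfst; exact: bmf_indic.
    transitivity (Ex mu (fun e => \sum_j v j * (u e * \1_(A j) e.1))).
      by apply: eq_Ex => w; rewrite mulr_sumr; apply: eq_bigr => j _; ring.
    rewrite Ex_sum => [|j]; last exact: bmfZ.
    by apply: eq_bigr => j _; rewrite ExZ.
  rewrite !dist//; last exact: bfst.
  by apply: eq_bigr => j _; rewrite ind.
have bgs : bmf (fun x => g x - s x) by exact: bmfB.
have small (u : E -> R) : bmf u -> (forall w, 0 <= u w <= 1) ->
    `|Ex mu (fun e => u e * g e.1) - Ex mu (fun e => u e * s e.1)| <= e / 2.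
  move=> bu u01.
  have b1 : bmf (fun e => u e * g e.1) by apply: bmfM => //; exact: bfst.
  have b2 : bmf (fun e => u e * s e.1) by apply: bmfM => //; exact: bfst.
  rewrite -ExB//; apply: (le_trans (Ex_norm _ (bmfB b1 b2))).
  rewrite -[leRHS](Ex_cst mu); apply: Ex_le; [by apply: bmf_norm; exact: bmfB|exact: bmf_cst|].
  move=> w; rewrite -mulrBr normrM; have /andP[u0 u1] := u01 w.
  by rewrite (ger0_norm u0) -[leRHS]mul1r; apply: ler_pM => //; exact: (Av w.1).
have s1 : `|Ex mu (fun e => (c e.2 == b)%:R * g e.1) - Ex mu (fun e => (c e.2 == b)%:R * s e.1)| <= e / 2.
  by apply: (small _ (bl b)) => w; case: eqP; rewrite ?lexx ?ler01.
have s2 : `|Ex mu (fun e => p b e.1 * g e.1) - Ex mu (fun e => p b e.1 * s e.1)| <= e / 2.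
  apply: (small _ (bfst _ (bp b))) => w; rewrite p0 -(p1 w.1) (bigD1 b)//= lerDl.
  by apply: sumr_ge0 => b' _; exact: p0.
rewrite Es in s1; move: s1 s2; rewrite !ler_norml => /andP[? ?] /andP[? ?].
by apply/andP; split; lra.
Qed.

End conditional_probability.

(** * Integrating out the labels *)

Section finite_product.
Context {R : realType} {n : nat} {F : finType}.
Variable P : 'I_n -> F -> R.
Hypothesis P1 : forall i, \sum_b P i b = 1.
Local Notation V := {ffun 'I_n -> F}.

Definition setv (v : V) (i : 'I_n) (b : F) : V := [ffun j => if j == i then b else v j].

Lemma setvE v i b j : setv v i b j = if j == i then b else v j.
Proof. by rewrite ffunE. Qed.

Lemma setv_neq v i b j : j != i -> setv v i b j = v j.
Proof. by move=> /negPf ji; rewrite setvE ji. Qed.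

Lemma setv_eq v i b : setv v i b i = b.
Proof. by rewrite setvE eqxx. Qed.

(** Expectation of a function of independent labels. *)
Definition q (H : V -> R) : R := \sum_(v : V) (\prod_i P i (v i)) * H v.

Lemma eq_q H H' : H =1 H' -> q H = q H'.
Proof. by move=> h; apply: eq_bigr => v _; rewrite h. Qed.

Lemma q_cst a : q (fun=> a) = a.
Proof.
rewrite /q -mulr_suml -(bigA_distr_bigA (fun i b => P i b)).
by rewrite big1 ?mul1r.
Qed.

Lemma qD H H' : q (fun v => H v + H' v) = q H + q H'.
Proof. by rewrite /q -big_split; apply: eq_bigr => v _; rewrite mulrDr. Qed.

Lemma qZ a H : q (fun v => a * H v) = a * q H.
Proof. by rewrite /q mulr_sumr; apply: eq_bigr => v _; ring. Qed.

Lemma qN H : q (fun v => - H v) = - q H.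
Proof. by rewrite -mulN1r -qZ; apply: eq_q => v; rewrite mulN1r. Qed.

Lemma qB H H' : q (fun v => H v - H' v) = q H - q H'.
Proof. by rewrite qD qN. Qed.

Lemma q_sum (I : Type) (s : seq I) (Q : pred I) (H : I -> V -> R) :
  q (fun v => \sum_(i <- s | Q i) H i v) = \sum_(i <- s | Q i) q (H i).
Proof.
rewrite /q exchange_big/=; apply: eq_bigr => v _; exact: mulr_sumr.
Qed.

Lemma q_int i H : q H = q (fun v => \sum_b P i b * H (setv v i b)).
Proof.
rewrite /q.
under [RHS]eq_bigr do rewrite mulr_sumr.
rewrite pair_bigA/=.
pose sw (vb : V * F) := (setv vb.1 i vb.2, vb.1 i).
have swK : involutive sw.
  move=> [v b]; rewrite /sw/= setv_eq; congr pair; apply/ffunP => j.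
  by rewrite !setvE; case: eqP => [->|].
rewrite (reindex_inj (inv_inj swK))/=.
transitivity (\sum_(vb : V * F) (\prod_j P j (vb.1 j)) * P i vb.2 * H vb.1).
  rewrite -(pair_bigA _ (fun (v : V) (b : F) => (\prod_j P j (v j)) * P i b * H v))/=.
  apply: eq_bigr => v _.
  by rewrite -mulr_suml -mulr_sumr P1 mulr1.
apply: eq_bigr => -[v b] _ /=.
have -> : setv (setv v i b) i (v i) = v.
  by apply/ffunP => j; rewrite !setvE; case: eqP => [->|].
rewrite mulrA; congr (_ * _).
rewrite (bigD1 i)//= [in RHS](bigD1 i)//= setv_eq.
rewrite [X in _ = _ * X * _](eq_bigr (fun j => P j (v j))); last first.
  by move=> j ji; rewrite setv_neq.
ring.
Qed.

Lemma q_centered i H : (forall v, \sum_b P i b * H (setv v i b) = 0) -> q H = 0.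
Proof. by move=> h; rewrite (q_int i) -[RHS](q_cst 0); apply: eq_q. Qed.

Lemma q1 i (f : F -> R) : q (fun v => f (v i)) = \sum_b P i b * f b.
Proof.
rewrite (q_int i) -[RHS]q_cst; apply: eq_q => v.
by apply: eq_bigr => b _; rewrite setv_eq.
Qed.

Lemma q2 i j (f : F -> F -> R) : i != j ->
  q (fun v => f (v i) (v j)) = \sum_b \sum_b' P i b * P j b' * f b b'.
Proof.
move=> ij; rewrite (q_int i).
transitivity (q (fun v => \sum_b P i b * f b (v j))).
  by apply: eq_q => v; apply: eq_bigr => b _; rewrite setv_eq setv_neq// eq_sym.
rewrite q_sum; apply: eq_bigr => b _; rewrite qZ (q1 j (f b)) mulr_sumr.
by apply: eq_bigr => b' _; rewrite mulrA.
Qed.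

Hypothesis P0 : forall i b, 0 <= P i b.

End finite_product.

Section labels.
Context {R : realType} {d : nat}.
Local Notation X := (d.-tuple R).
Local Notation E := (X * R)%type.
Variables (mu : probability E R) (F : finType) (c : R -> F).
Hypothesis mc : finobs c.
Variable p : F -> X -> R.
Hypothesis bp : forall b, bmf (p b).
Hypothesis p0 : forall b x, 0 <= p b x.
Hypothesis p1 : forall x, \sum_b p b x = 1.
Hypothesis pc : forall b (g : X -> R), bmf g ->
  Ex mu (fun e => (c e.2 == b)%:R * g e.1) = Ex mu (fun e => p b e.1 * g e.1).

Definition lab n (z : n.-tuple E) (i : 'I_n) : F := c (ys z i).

Definition labs n (z : n.-tuple E) : {ffun 'I_n -> F} := [ffun i => lab z i].

Lemma finobs_lab n i : finobs (fun z : n.-tuple E => lab z i).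
Proof.
move=> b; have h := @measurable_ys R d n i measurableT _ (mc b).
by rewrite -[X in measurable X]setTI; exact: h.
Qed.

Lemma finobs_labs n : finobs (@labs n).
Proof. by apply: finobs_ffun => i; exact: finobs_lab. Qed.

Lemma bmf_px n i b : bmf (fun z : n.-tuple E => p b (xs z i)).
Proof. by apply: bmf_comp (bp b); exact: measurable_xs. Qed.

Definition xfun n (T : Type) (G : n.-tuple E -> T) :=
  forall z z', xs z =1 xs z' -> G z = G z'.

Variables (n : nat) (la : probability (n.-tuple E) R).
Hypothesis iid : iid_law mu la.
Local Notation Om := (n.-tuple E).

Lemma Ex_label_step i b (G : Om -> R) : bmf G ->
  (forall z y, G (upd z i (xs z i, y)) = G z) ->
  Ex la (fun z => (lab z i == b)%:R * G z) = Ex la (fun z => p b (xs z i) * G z).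
Proof.
move=> bG fG.
have bl : bmf (fun z : Om => (lab z i == b)%:R : R).
  exact: (bmf_obs (fun v => (v == b)%:R) (finobs_lab i)).
rewrite -(Ex_Mk iid i); last exact: bmfM.
rewrite -[RHS](Ex_Mk iid i); last by apply: bmfM => //; exact: bmf_px.
apply: eq_Ex => z; rewrite /Mk.
pose g x := G (upd z i (x, point)).
have gE e : G (upd z i e) = g e.1.
  rewrite /g -(fG (upd z i e) point) upd_upd; congr (G (upd _ _ (_, _))).
  by rewrite /xs tnth_upd eqxx.
have bg : bmf g.
  apply: (bmf_comp (phi := fun x => upd z i (x, point)) _ bG).
  have m1 : measurable_fun setT (fun x : X => (x, point : R)).
    by apply: measurable_fun_pair; [exact: measurable_id|exact: measurable_cst].
  exact: (measurableT_comp (measurable_updE z i) m1).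
transitivity (Ex mu (fun e => (c e.2 == b)%:R * g e.1)).
  by apply: eq_Ex => e; rewrite gE /lab /ys tnth_upd eqxx.
rewrite pc//; apply: eq_Ex => e.
by rewrite gE /xs tnth_upd eqxx.
Qed.

(** Conditionally on the positions the labels are independent, with laws
    given by the vectors p. *)
Lemma Ex_labels (H : {ffun 'I_n -> F} -> Om -> R) :
  (forall v, bmf (H v)) -> (forall v, xfun (H v)) ->
  Ex la (fun z => H (labs z) z) =
  Ex la (fun z => q (fun i b => p b (xs z i)) (fun v => H v z)).
Proof.
move=> bH xH.
have bl i b : bmf (fun z : Om => (lab z i == b)%:R : R).
  exact: (bmf_obs (fun v => (v == b)%:R) (finobs_lab i)).
pose W (v : {ffun 'I_n -> F}) (s : {set 'I_n}) z :=
  \prod_i (if i \in s then p (v i) (xs z i) else (lab z i == v i)%:R) * H v z.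
have bt (v : {ffun 'I_n -> F}) (s : {set 'I_n}) i :
    bmf (fun z : Om => if i \in s then p (v i) (xs z i) else (lab z i == v i)%:R).
  by case: (i \in s); [exact: bmf_px|exact: bl].
have bW v s : bmf (W v s).
  by apply: bmfM (bH v); apply: bmf_prod => i _; exact: bt.
have stepW v (s : {set 'I_n}) j : j \notin s -> Ex la (W v s) = Ex la (W v (j |: s)).
  move=> js.
  pose G z := (\prod_(i | i != j)
    (if i \in s then p (v i) (xs z i) else (lab z i == v i)%:R)) * H v z.
  have bG : bmf G.
    by apply: bmfM (bH v); apply: bmf_prod => i _; exact: bt.
  have fG z y : G (upd z j (xs z j, y)) = G z.
    rewrite /G; congr (_ * _).
      apply: eq_bigr => i ij; rewrite xs_upd// /lab ys_upd//.
    apply: xH => i; have [->|ij] := eqVneq i j; last by rewrite xs_upd.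
    by rewrite {1}/xs tnth_upd eqxx.
  transitivity (Ex la (fun z => (lab z j == v j)%:R * G z)).
    by apply: eq_Ex => z; rewrite /W (bigD1 j)//= (negPf js) mulrA.
  rewrite Ex_label_step//; apply: eq_Ex => z.
  rewrite /W [in RHS](bigD1 j)//= setU11 mulrA; congr (_ * _ * _).
  by apply: eq_bigr => i ij; rewrite in_setU1 (negPf ij).
have allW v : Ex la (W v finset.set0) = Ex la (W v finset.setT).
  have gen m : (m <= n)%N -> exists s : {set 'I_n}, #|s| = m /\
      Ex la (W v finset.set0) = Ex la (W v s).
    elim: m => [_|m ih mn]; first by exists finset.set0; rewrite cards0.
    have [s [sm es]] := ih (ltnW mn).
    have : (0 < #|~: s|)%N by rewrite cardsCs finset.setCK sm card_ord subn_gt0.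
    move=> /card_gt0P[j]; rewrite inE => js.
    by exists (j |: s); rewrite cardsU1 js sm add1n -stepW.
  have [s [sn ->]] := gen n (leqnn n).
  suff -> : s = finset.setT :> {set 'I_n} by [].
  by apply/eqP; rewrite eqEcard finset.subsetT cardsT card_ord sn leqnn.
transitivity (Ex la (fun z => \sum_v W v finset.set0 z)).
  apply: eq_Ex => z; rewrite (bigD1 (labs z))//= big1 ?addr0.
    rewrite /W big1 ?mul1r// => i _; by rewrite inE ffunE eqxx.
  move=> v vz; rewrite /W.
  have [i vi] : exists i, v i != lab z i.
    apply: contrapT => h; move/eqP: vz; apply; apply/ffunP => i; rewrite ffunE.
    by apply/eqP/negPn/negP => vi; apply: h; exists i.
  by rewrite (bigD1 i)//= inE eq_sym (negPf vi) !mul0r.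
rewrite Ex_sum//; under eq_bigr do rewrite allW.
rewrite -Ex_sum//; apply: eq_Ex => z; apply: eq_bigr => v _.
by rewrite /W; congr (_ * _); apply: eq_bigr => i _; rewrite inE.
Qed.

End labels.

(** * Neighbours share the same local law *)

Section small_sequences.
Context {R : realType}.

(** For nonnegative sequences this is convergence to zero; the one-sided form
    allows the subtraction of a fixed error. *)
Definition small (a : nat -> R) :=
  forall e, 0 < e -> exists n0, forall n, (n0 <= n)%N -> a n <= e.

Lemma small_le (a b : nat -> R) (m : nat) :
  (forall n, (m <= n)%N -> a n <= b n) -> small b -> small a.
Proof.
move=> ab sb e e0; have [n0 h] := sb e e0; exists (maxn m n0) => n.
by rewrite geq_max => /andP[mn nn]; exact: le_trans (ab n mn) (h n nn).
Qed.

Lemma smallD (a b : nat -> R) : small a -> small b -> small (fun n => a n + b n).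
Proof.
move=> sa sb e e0; have e2 : 0 < e / 2 by exact: divr_gt0.
have [n1 h1] := sa _ e2; have [n2 h2] := sb _ e2; exists (maxn n1 n2) => n.
rewrite geq_max => /andP[/h1 ? /h2 ?]; lra.
Qed.

Lemma smallZ (C : R) (a : nat -> R) : 0 <= C -> small a -> small (fun n => C * a n).
Proof.
move=> C0 sa e e0; have C1 : 0 < C + 1 by lra.
have [n0 h] := sa _ (divr_gt0 e0 C1); exists n0 => n /h hn.
apply: (le_trans (ler_wpM2l C0 hn)).
rewrite mulrCA ger_pMr// ler_pdivrMr//; lra.
Qed.

Lemma small_sum (I : Type) (s : seq I) (a : I -> nat -> R) :
  (forall i, small (a i)) -> small (fun n => \sum_(i <- s) a i n).
Proof.
move=> sa; elim: s => [|i s ih].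
  by move=> e e0; exists 0%N => n _; rewrite big_nil ltW.
by apply: (small_le (m := 0%N)) (smallD (sa i) ih) => n _; rewrite big_cons.
Qed.

Lemma small_inv (C : R) : small (fun n => C / n%:R).
Proof.
move=> e e0; exists (Num.trunc (`|C| / e)).+1 => n hn.
have n0 : 0 < n%:R :> R by rewrite ltr0n; lia.
rewrite ler_pdivrMr//; apply: (le_trans (ler_norm C)).
by rewrite mulrC -ler_pdivrMr// ltW// (lt_le_trans (truncnS_gt _))// ler_nat.
Qed.

Lemma small_approx (a : nat -> R) :
  (forall e, 0 < e -> exists2 b, small b & exists m, forall n, (m <= n)%N -> a n <= e + b n) ->
  small a.
Proof.
move=> h e e0; have e2 : 0 < e / 2 by exact: divr_gt0.
have [b sb [m hm]] := h _ e2; have [n0 hn] := sb _ e2.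
exists (maxn m n0) => n; rewrite geq_max => /andP[/hm ? /hn ?]; lra.
Qed.

End small_sequences.

Lemma shrinking_sets (R : realType) (dE : measure_display) (E : measurableType dE)
    (P : probability E R) (A : nat -> set E) (e : R) :
  (forall m, measurable (A m)) -> (forall m, A m.+1 `<=` A m) ->
  P (\bigcap_m A m) = 0%E -> 0 < e -> exists m, Ex P \1_(A m) <= e.
Proof.
move=> mA dA A0 e0.
have nA : nonincreasing_seq A.
  by apply/nonincreasing_seqP => m; apply/subsetPset; exact: dA.
have Aoo : (P (A 0%N) < +oo)%E by rewrite (le_lt_trans (probability_le1 P (mA 0%N)))// ltry.
have cv : P \o A @ \oo --> P (\bigcap_m A m) :=
  nonincreasing_cvg_mu Aoo mA (bigcapT_measurable mA) nA.
move: cv; rewrite A0 => /fine_cvgP[].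
move=> _ /cvgrPdist_le/(_ e e0)[N _ /(_ N (leqnn N))] /=.
rewrite sub0r normrN ger0_norm ?fine_ge0// => h.
by exists N; rewrite Ex_indic.
Qed.

Section locality.
Context {R : realType} {d : nat}.
Hypothesis hd : (0 < d)%N.
Local Notation X := (d.-tuple R).
Local Notation E := (X * R)%type.
Variable rho : X -> X -> X -> bool.
Hypothesis prox : proximity rho.
Variable D : nat.
Hypothesis hD : degree_bound rho D.
Variable mu : probability E R.
Hypothesis atomless : forall k t, mu [set e : E | tnth e.1 k = t] = 0%E.
Variable la : forall n, probability (n.-tuple E) R.
Hypothesis iid : forall n, iid_law mu (la n).

Local Notation Nb := (Nb rho).

Lemma Ex_single n (i : 'I_n) (f : E -> R) : bmf f ->
  Ex (la n) (fun z => f (tnth z i)) = Ex mu f.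
Proof.
move=> bf; rewrite -(Ex_Mk (iid (n := n)) i); last first.
  by apply: bmf_comp bf; exact: measurable_tnth.
rewrite -[RHS](Ex_cst (la n)); apply: eq_Ex => z.
by apply: eq_Ex => e; rewrite tnth_upd eqxx.
Qed.

Lemma bmf_fst (g : X -> R) : bmf g -> bmf (fun e : E => g e.1).
Proof. by apply: bmf_comp; exact: measurable_fst. Qed.

Lemma bmf_xs n (g : X -> R) (i : 'I_n) : bmf g -> bmf (fun z : n.-tuple E => g (xs z i)).
Proof. by apply: bmf_comp; exact: measurable_xs. Qed.

Lemma bmf_xNb n (g : X -> R) k (i : 'I_n) : bmf g ->
  bmf (fun z : n.-tuple E => g (xs z (Nb k z i))).
Proof.
move=> bg.
apply: (bmf_fin (G := fun j (z : n.-tuple E) => g (xs z j)) (finobs_Nb prox k i)) => j.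
exact: bmf_xs.
Qed.

Definition avg n (f : 'I_n -> n.-tuple E -> R) : R :=
  n%:R^-1 * \sum_i Ex (la n) (f i).

Lemma avg_le n (f g : 'I_n -> n.-tuple E -> R) :
  (forall i, Ex (la n) (f i) <= Ex (la n) (g i)) -> avg f <= avg g.
Proof. by move=> h; apply: ler_wpM2l; [rewrite invr_ge0|apply: ler_sum]. Qed.

Lemma avg_single n (f : E -> R) : bmf f -> (0 < n)%N ->
  avg (fun (i : 'I_n) z => f (tnth z i)) = Ex mu f.
Proof.
move=> bf n0; rewrite /avg; under eq_bigr do rewrite Ex_single//.
by rewrite sumr_const card_ord -[X in _ * X]mulr_natl mulrA mulVf ?mul1r// pnatr_eq0 -lt0n.
Qed.

Lemma avg_Nb_le n k (a : 'I_n -> n.-tuple E -> R) : (k < 4)%N -> (4 < n)%N ->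
  (forall i, bmf (a i)) -> (forall i z, 0 <= a i z) ->
  avg (fun i z => a (Nb k z i) z) <= D%:R * avg a.
Proof.
move=> k4 n4 ba a0.
have bN i : bmf (fun z => a (Nb k z i) z).
  by apply: (bmf_fin (G := fun j z => a j z) (finobs_Nb prox k i)).
rewrite /avg mulrCA; apply: ler_wpM2l; first by rewrite invr_ge0.
rewrite -!Ex_sum// -ExZ; last by apply: bmf_sum.
apply: (Ex_le_full (full_distinct hd atomless (iid (n := n)))).
- by apply: bmf_sum.
- by apply: bmfZ; apply: bmf_sum.
move=> z dz.
exact: (sum_Nb_le hD (a := fun i => a i z) k4 n4 dz (fun i => a0 i z)).
Qed.

Lemma measurable_inbox M : measurable [set e : E | inbox M e.1].
Proof.
have o : finobs (fun e : E => [ffun k : 'I_d => `|tnth e.1 k| <= M]).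
  apply: finobs_ffun => k; apply: finobs_bool; apply: measurable_fun_ler => //.
  apply: measurableT_comp => //.
  apply: (measurableT_comp (measurable_tnth k)) => //; exact: measurable_fst.
have := finobs_comp (fun v : {ffun 'I_d -> bool} => [forall k, v k]) o true.
congr measurable; apply/seteqP; split => e /= /forallP h; apply/forallP => k;
  by have := h k; rewrite ffunE.
Qed.

Lemma bmf_outbox M : bmf (fun e : E => (~~ inbox M e.1)%:R : R).
Proof.
apply: bmf_ext (bmf_indic (measurableC (measurable_inbox M))) => e.
rewrite indicE; congr (nat_of_bool _)%:R.
by apply/idP/idP; [move=> h; rewrite inE => /= h'; rewrite h' in h|
  rewrite inE => /= h; apply/negP].
Qed.

Lemma bmf_far n delta k (i : 'I_n) :
  bmf (fun z : n.-tuple E => (far rho delta k (xs z) i)%:R : R).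
Proof.
have of_ j : finobs (fun z : n.-tuple E => delta < `|tnth (xs z i) k - tnth (xs z j) k|).
  apply: finobs_bool; apply: measurable_fun_ltr => //.
  apply: measurableT_comp => //; apply: measurable_funB;
  by apply: (measurableT_comp (measurable_tnth k)) => //; exact: measurable_xs.
have := finobs_comp (fun v : {ffun 'I_n -> bool} * {ffun 'I_n -> bool} =>
    [exists j, v.1 j && v.2 j])
  (finobs_pair (finobs_ffun of_) (finobs_ffun (finobs_close prox i))).
move=> o; apply: bmf_ext (bmf_obs (fun b : bool => b%:R) o) => z.
congr (nat_of_bool _)%:R; apply/hasP/existsP => /= [[j js fj]|[j]].
  by exists j; rewrite !ffunE fj.
by rewrite !ffunE => /andP[fj js]; exists j.
Qed.

Lemma small_far delta k : 0 < delta ->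
  small (fun n => avg (fun (i : 'I_n) z => (far rho delta k (xs z) i)%:R)).
Proof.
move=> dl0; apply: small_approx => e e0.
have [m hm] : exists m : nat, Ex mu \1_[set e : E | ~~ inbox m%:R e.1] <= e.
  apply: shrinking_sets e0.
  - move=> m; have := measurableC (measurable_inbox m%:R); congr measurable.
    by apply/seteqP; split => w /= /negP.
  - move=> m w /=; apply: contra => /forallP h; apply/forallP => j.
    by rewrite (le_trans (h j))// ler_nat.
  - rewrite (_ : bigcap _ _ = set0) ?measure0// -subset0 => w /=.
    pose B := \sum_k `|tnth w.1 k|.
    move=> /(_ (Num.trunc B).+1 I)/= /negP; apply; apply/forallP => j.
    rewrite (@le_trans _ _ B)//; last by rewrite ltW// truncnS_gt.
    by rewrite /B (bigD1 j)//= lerDl sumr_ge0.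
have [B hB] := prox_local prox m%:R dl0.
exists (fun n => B%:R / n%:R); first exact: small_inv.
exists 1%N => n n1.
have n0 : (0 : R) < n%:R by rewrite ltr0n.
have bo := bmf_outbox m%:R.
have -> : e + B%:R / n%:R = n%:R^-1 * (n%:R * e + B%:R).
  by field; rewrite gt_eqF.
rewrite /avg; apply: ler_wpM2l; first by rewrite invr_ge0 ltW.
have bf i := @bmf_far n delta k i.
have bos (i : 'I_n) : bmf (fun z : n.-tuple E => (~~ inbox m%:R (xs z i))%:R : R).
  by apply: (bmf_comp (phi := fun z : n.-tuple E => tnth z i) _ bo); exact: measurable_tnth.
apply: (@le_trans _ _ (\sum_(i < n) Ex (la n) (fun z => (~~ inbox m%:R (xs z i))%:R) + B%:R)).
  rewrite -!Ex_sum// -[B%:R](Ex_cst (la n)) -ExD; [|by apply: bmf_sum|exact: bmf_cst].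
  apply: (Ex_le_full (full_distinct hd atomless (iid (n := n)))).
  - by apply: bmf_sum.
  - by apply: bmfD; [apply: bmf_sum|exact: bmf_cst].
  move=> z dz.
  apply: (@le_trans _ _ (\sum_(i < n) ((~~ inbox m%:R (xs z i))%:R +
      (inbox m%:R (xs z i) && far rho delta k (xs z) i)%:R))).
    by apply: ler_sum => i _; case: (inbox _ _); case: (far _ _ _ _ _);
      rewrite /= ?addr0 ?add0r ?lexx ?ler01.
  rewrite big_split/= lerD2l sum_bool_card ler_nat.
  exact: (hB k n (xs z) (distinct_inj dz)).
rewrite lerD2r.
rewrite (eq_bigr (fun=> Ex mu (fun e : E => (~~ inbox m%:R e.1)%:R))); last first.
  by move=> i _; rewrite -(Ex_single i bo).
rewrite sumr_const card_ord -[X in X <= _]mulr_natl ler_pM2l//.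
apply: le_trans hm; rewrite le_eqVlt; apply/orP; left; apply/eqP; apply: eq_Ex => w.
by rewrite indicE; congr (nat_of_bool _)%:R; apply/idP/idP; rewrite inE.
Qed.

Definition local_fun (g : X -> R) := forall k, (k < 4)%N ->
  small (fun n => avg (fun (i : 'I_n) z => `|g (xs z (Nb k z i)) - g (xs z i)|)).

Let lset (A : set X) := measurable A /\ local_fun \1_A.

Lemma bmf_diff n (g : X -> R) k (i : 'I_n) : bmf g ->
  bmf (fun z : n.-tuple E => `|g (xs z (Nb k z i)) - g (xs z i)|).
Proof.
by move=> bg; apply: bmf_norm; apply: bmfB; [exact: bmf_xNb|exact: bmf_xs].
Qed.

(** If g is L1-close to local functions then g is local: the error at a
    neighbour is controlled by the bounded in-degree. *)
Lemma local_approx (g : X -> R) : bmf g ->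
  (forall e, 0 < e -> exists h, [/\ bmf h, local_fun h &
     Ex mu (fun w => `|g w.1 - h w.1|) <= e]) -> local_fun g.
Proof.
move=> bg H k k4; apply: small_approx => e e0.
have D1 : (0 : R) < D.+1%:R by rewrite ltr0n.
have [h [bh lh gh]] := H _ (divr_gt0 e0 D1).
exists (fun n => avg (fun (i : 'I_n) z => `|h (xs z (Nb k z i)) - h (xs z i)|)).
  exact: lh.
exists 5%N => n n5.
pose r (x : X) := `|g x - h x|.
have br : bmf r by apply: bmf_norm; exact: bmfB.
have b1 (i : 'I_n) := bmf_diff k i bg.
have b2 (i : 'I_n) := bmf_diff k i bh.
have b3 (i : 'I_n) : bmf (fun z : n.-tuple E => r (xs z (Nb k z i))) by exact: bmf_xNb.
have b4 (i : 'I_n) : bmf (fun z : n.-tuple E => r (xs z i)) by exact: bmf_xs.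
apply: (@le_trans _ _ (avg (fun (i : 'I_n) z => r (xs z (Nb k z i))) +
   avg (fun (i : 'I_n) z => r (xs z i)) +
   avg (fun (i : 'I_n) z => `|h (xs z (Nb k z i)) - h (xs z i)|))).
  rewrite /avg -!mulrDr -!big_split/=; apply: ler_wpM2l; first by rewrite invr_ge0.
  apply: ler_sum => i _; rewrite -ExD// -ExD//; last exact: bmfD.
  apply: Ex_le => //; first by apply: bmfD => //; exact: bmfD.
  move=> z; rewrite /r; set a := g _; set b := g _; set a' := h _; set b' := h _.
  have -> : a - b = (a - a') - (b - b') + (a' - b') by ring.
  by rewrite (le_trans (ler_normD _ _))// lerD2r (le_trans (ler_normB _ _)).
rewrite lerD2r.
have h1 := @avg_Nb_le n k (fun i z => r (xs z i)) k4 n5 b4 (fun i z => normr_ge0 _).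
have h2 : avg (fun (i : 'I_n) z => r (xs z i)) <= e / D.+1%:R.
  by rewrite (avg_single (bmf_fst br)) ?(leq_trans _ n5).
apply: (@le_trans _ _ (D.+1%:R * avg (fun (i : 'I_n) z => r (xs z i)))).
  by rewrite -natr1 mulrDl mul1r lerD2r.
by rewrite mulrC -ler_pdivlMr.
Qed.

Lemma local_indicC A : lset A -> lset (~` A).
Proof.
move=> [mA lA]; split; first exact: measurableC.
move=> k k4; apply: (small_le (m := 0%N)) (lA k k4) => n _.
apply: avg_le => i; rewrite le_eqVlt; apply/orP; left; apply/eqP; apply: eq_Ex => z.
rewrite !indicE !in_setC; case: (_ \in A); case: (_ \in A);
  by rewrite /= ?subrr ?subr0 ?sub0r ?normrN.
Qed.

Lemma local_indicU A B : lset A -> lset B -> lset (A `|` B).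
Proof.
move=> [mA lA] [mB lB]; split; first exact: measurableU.
move=> k k4; apply: (small_le (m := 0%N)) (smallD (lA k k4) (lB k k4)) => n _.
rewrite /avg -mulrDr -big_split/=; apply: ler_wpM2l; first by rewrite invr_ge0.
have b1 (i : 'I_n) := bmf_diff k i (bmf_indic mA).
have b2 (i : 'I_n) := bmf_diff k i (bmf_indic mB).
have b3 (i : 'I_n) := bmf_diff k i (bmf_indic (measurableU _ _ mA mB)).
apply: ler_sum => i _; rewrite -ExD//; apply: Ex_le => //; first exact: bmfD.
move=> z; rewrite !indicE !in_setU.
by case: (_ \in A); case: (_ \in A); case: (_ \in B); case: (_ \in B);
  rewrite /= ?subrr ?subr0 ?sub0r ?normrN ?normr0 ?normr1 ?addr0 ?add0r ?lexx ?ler01// -?mulr2n ?ler0n ?ler1n.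
Qed.

Lemma local_indic0 : lset set0.
Proof.
split; first exact: measurable0.
move=> k k4 e e0; exists 0%N => n _; rewrite /avg big1 ?mulr0 ?ltW// => i _.
rewrite -[RHS](Ex_cst (la n)); apply: eq_Ex => z.
by rewrite !indicE !in_set0 subrr normr0.
Qed.

Lemma local_sigma : sigma_algebra setT lset.
Proof.
split; first exact: local_indic0.
  by move=> A hA; rewrite setTD; exact: local_indicC.
move=> A hA; have mA m : measurable (A m) by case: (hA m).
have mU : measurable (\bigcup_m A m) by exact: bigcupT_measurable.
split=> //; apply: local_approx; first exact: bmf_indic.
move=> e e0.
pose B m := \big[setU/set0]_(i < m) A i.
have lB m : lset (B m).
  rewrite /B; elim: m => [|m ih]; first by rewrite big_ord0; exact: local_indic0.
  by rewrite big_ord_recr; exact: local_indicU.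
pose C m := [set w : E | (\bigcup_m A m `\` B m) w.1].
have mC m : measurable (C m).
  have := @measurable_fst _ _ X R measurableT _ (measurableD mU (lB m).1).
  by rewrite setTI.
have [m hm] : exists m, Ex mu \1_(C m) <= e.
  apply: shrinking_sets e0 => //.
  - move=> m w [wA wB]; split => // h; apply: wB.
    by rewrite /B big_ord_recr; left.
  - rewrite (_ : bigcap _ _ = set0) ?measure0// -subset0 => w /= h.
    have [[m _ Am] _] := h 0%N I.
    have [_] := h m.+1 I; apply.
    by rewrite /B big_ord_recr; right.
exists \1_(B m); split; [exact: bmf_indic (lB m).1|exact: (lB m).2|].
apply: le_trans hm; rewrite le_eqVlt; apply/orP; left; apply/eqP; apply: eq_Ex => w.
rewrite !indicE.
have sub : B m w.1 -> (\bigcup_m A m) w.1.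
  by rewrite /B -bigcup_mkord => -[j /= _ ?]; exists j.
have [wB|wB] := pselect (B m w.1).
  rewrite (mem_set wB) (mem_set (sub wB)) subrr normr0 memNset// => -[_]; exact.
rewrite (memNset wB) subr0 ger0_norm//; congr (nat_of_bool _)%:R.
by apply/idP/idP; rewrite !inE; [split|case].
Qed.

(** A half-space separates a point from a neighbour only if the point is near
    the boundary hyperplane or the neighbour is far. *)
Lemma local_ray k t : lset [set x : X | t < tnth x k].
Proof.
have mr : measurable [set x : X | t < tnth x k].
  have := finobs_bool (measurable_fun_ltr (measurable_cst t) (@measurable_tnth _ R d k)) true.
  by [].
split=> // l l4; apply: small_approx => e e0.
have mc (u v : R) : measurable [set w : E | `|tnth w.1 k - u| <= v].
  have m1 : measurable_fun setT (fun w : E => `|tnth w.1 k - u|).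
    apply: measurableT_comp => //; apply: measurable_funB => //.
    by apply: (measurableT_comp (measurable_tnth k)) => //; exact: measurable_fst.
  have := finobs_bool (measurable_fun_ler m1 (measurable_cst v)) true.
  by [].
have [m hm] : exists m : nat, Ex mu \1_[set w : E | `|tnth w.1 k - t| <= m.+1%:R^-1] <= e.
  apply: shrinking_sets e0 => //.
  - move=> m w /= h; rewrite (le_trans h)// lef_pV2 ?posrE ?ltr0n// ler_nat; exact: leqnSn.
  - rewrite -[RHS](atomless k t); congr (mu _); apply/seteqP; split => w /=.
      move=> h; apply/eqP; rewrite -subr_eq0 -normr_le0; apply/ler_addgt0Pr => u u0.
      rewrite add0r (le_trans (h (Num.trunc u^-1) I))//.
      rewrite invf_ple ?posrE ?ltr0n//; exact: ltW (truncnS_gt _).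
    by move=> wt i _; rewrite /= wt subrr normr0.
pose delta : R := m.+1%:R^-1.
have dl0 : 0 < delta by rewrite invr_gt0 ltr0n.
exists (fun n => avg (fun (i : 'I_n) z => (far rho delta k (xs z) i)%:R)).
  exact: small_far.
exists 5%N => n n5.
have bI := bmf_indic (mc t delta) : bmf (\1_[set w : E | `|tnth w.1 k - t| <= delta] : E -> R).
apply: (@le_trans _ _ (avg (fun (i : 'I_n) z =>
    \1_[set w : E | `|tnth w.1 k - t| <= delta] (tnth z i)) +
    avg (fun (i : 'I_n) z => (far rho delta k (xs z) i)%:R))); last first.
  by rewrite lerD2r avg_single//; lia.
rewrite /avg -mulrDr -big_split/=; apply: ler_wpM2l; first by rewrite invr_ge0.
have b1 (i : 'I_n) := bmf_diff l i (bmf_indic mr).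
have b2 (i : 'I_n) : bmf (fun z : n.-tuple E =>
    \1_[set w : E | `|tnth w.1 k - t| <= delta] (tnth z i) : R).
  by apply: (bmf_comp (phi := fun z : n.-tuple E => tnth z i) _ bI); exact: measurable_tnth.
have b3 (i : 'I_n) := @bmf_far n delta k i.
apply: ler_sum => i _; rewrite -ExD//; apply: Ex_le => //; first exact: bmfD.
move=> z.
have [fi|fi] := boolP (far rho delta k (xs z) i).
  rewrite (@le_trans _ _ 1)// ?lerDr ?indicE ?ler0n//.
  by case: (_ \in _); case: (_ \in _); rewrite /= ?subrr ?subr0 ?sub0r ?normrN ?normr0 ?normr1 ?ler01.
rewrite addr0 [leRHS]indicE.
have := fi; rewrite /far => /hasPn/(_ (Nb l z i) (close_Nb rho z i l4 n5)).
rewrite -leNgt; set x := xs z i; set y := xs z _ => xy.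
have [xt|xt] := boolP (`|tnth x k - t| <= delta).
  rewrite (mem_set (xt : [set w : E | `|tnth w.1 k - t| <= delta] (tnth z i))).
  by rewrite !indicE; case: (_ \in _); case: (_ \in _); rewrite /= ?subrr ?subr0 ?sub0r ?normrN ?normr0 ?normr1 ?ler01.
suff -> : \1_[set x : X | t < tnth x k] y = \1_[set x : X | t < tnth x k] x :> R.
  by rewrite subrr normr0.
rewrite !indicE; congr (nat_of_bool _)%:R.
apply/idP/idP; rewrite !inE /=; move: xt xy; rewrite -ltNge ler_norml;
  move: (tnth x k) (tnth y k) => a b h1 /andP[h2 h3] h4; rewrite ltNge; apply/negP => h5.
  by move: h1; rewrite ler0_norm => [h1|]; lra.
by move: h1; rewrite ger0_norm => [h1|]; lra.
Qed.

Lemma local_measurable A : measurable A -> lset A.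
Proof.
apply: smallest_sub; first exact: local_sigma.
move=> B; rewrite -bigcup_seq => -[k _ [C mC <-]]; rewrite setTI.
have {}mC : <<s (@RGenOInfty.G R) >> C.
  exact: (eq_ind _ (fun S : set (set R) => S C) mC _ (RGenOInfty.measurableE R)).
move: C mC; apply: smallest_sub.
  split.
  - by rewrite preimage_set0; exact: local_indic0.
  - by move=> C; rewrite setTD preimage_setC; exact: local_indicC.
  - move=> C hC; rewrite preimage_bigcup; have [_ _] := local_sigma; exact.
move=> _ [t ->]; have := local_ray k t; congr lset.
by apply/seteqP; split => x /=; rewrite in_itv/= andbT.
Qed.

(** Bounded measurable functions take nearly the same value at a point and at
    its neighbours: the sets with this property form a sigma-algebra, and it
    contains the half-spaces because their boundaries are null. *)
Theorem local_bmf (g : X -> R) : bmf g -> local_fun g.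
Proof.
move=> bg; apply: local_approx => // e e0.
have [N [A [v [mA Av]]]] := bmf_step bg e0.
have bA j : bmf (\1_(A j) : X -> R) := bmf_indic (mA j).
have bs : bmf (fun x => \sum_j v j * \1_(A j) x).
  by apply: bmf_sum => j _; apply: bmfZ.
exists (fun x => \sum_j v j * \1_(A j) x); split=> //; last first.
  rewrite -[leRHS](Ex_cst mu); apply: Ex_le; [|exact: bmf_cst|by move=> w; exact: Av].
  by apply: (bmf_fst (g := fun x => `|g x - \sum_j v j * \1_(A j) x|)); apply: bmf_norm; exact: bmfB.
move=> k k4.
apply: (small_le (m := 0%N) (b := fun n => \sum_j `|v j| *
   avg (fun (i : 'I_n) z => `|\1_(A j) (xs z (Nb k z i)) - \1_(A j) (xs z i)|))).
  move=> n _; rewrite /avg.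
  under [leRHS]eq_bigr do rewrite mulrCA.
  rewrite -mulr_sumr; apply: ler_wpM2l; first by rewrite invr_ge0.
  under [leRHS]eq_bigr do rewrite mulr_sumr.
  rewrite exchange_big/=; apply: ler_sum => i _.
  have b1 j := bmf_diff k i (bA j).
  have b2 j : bmf (fun z : n.-tuple E => `|v j| * `|\1_(A j) (xs z (Nb k z i)) - \1_(A j) (xs z i)|).
    exact: bmfZ.
  under [leRHS]eq_bigr do rewrite -ExZ//.
  rewrite -Ex_sum//; apply: Ex_le; [|by apply: bmf_sum|].
    exact: (bmf_diff k i bs).
  move=> z; rewrite -sumrB; apply: (le_trans (ler_norm_sum _ _ _)).
  by apply: ler_sum => j _; rewrite -mulrBr normrM.
apply: small_sum => j.
exact: (smallZ (normr_ge0 (v j)) ((local_measurable (mA j)).2 k k4)).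
Qed.

End locality.

(** * Averages over label distributions *)

Section averages.
Context {R : realType} {F : finType}.
Implicit Types u w : F -> R.

Definition av u (f : F -> R) : R := \sum_b u b * f b.

Definition pvec u := (forall b, 0 <= u b) /\ \sum_b u b = 1.

Definition tv u w : R := \sum_b `|u b - w b|.

Lemma eq_av u f g : f =1 g -> av u f = av u g.
Proof. by move=> fg; apply: eq_bigr => b _; rewrite fg. Qed.

Lemma avD u f g : av u (fun b => f b + g b) = av u f + av u g.
Proof. by rewrite /av -big_split; apply: eq_bigr => b _; rewrite mulrDr. Qed.

Lemma avZ u a f : av u (fun b => a * f b) = a * av u f.
Proof. by rewrite /av mulr_sumr; apply: eq_bigr => b _; ring. Qed.

Lemma avN u f : av u (fun b => - f b) = - av u f.
Proof. by rewrite -mulN1r -avZ; apply: eq_av => b; ring. Qed.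

Lemma avB u f g : av u (fun b => f b - g b) = av u f - av u g.
Proof. by rewrite avD avN. Qed.

Lemma av_cst u a : pvec u -> av u (fun=> a) = a.
Proof. by move=> [_ u1]; rewrite /av -mulr_suml u1 mul1r. Qed.

Lemma av_exchange u w (f : F -> F -> R) :
  av u (fun b => av w (f b)) = av w (fun b' => av u (f^~ b')).
Proof.
rewrite /av; under eq_bigr do rewrite mulr_sumr.
rewrite exchange_big/=; apply: eq_bigr => b' _.
by rewrite mulr_sumr; apply: eq_bigr => b _; ring.
Qed.

Lemma av_norm u f B : pvec u -> (forall b, `|f b| <= B) -> `|av u f| <= B.
Proof.
move=> [u0 u1] fB; apply: (le_trans (ler_norm_sum _ _ _)).
rewrite -[leRHS]mul1r -u1 mulr_suml; apply: ler_sum => b _.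
by rewrite normrM ger0_norm//; exact: ler_wpM2l.
Qed.

Lemma av_diff u f g B : pvec u -> (forall b, `|f b - g b| <= B) ->
  `|av u f - av u g| <= B.
Proof. by move=> pu h; rewrite -avB; exact: av_norm. Qed.

Lemma av_tv u w f B : 0 <= B -> (forall b, `|f b| <= B) ->
  `|av u f - av w f| <= B * tv u w.
Proof.
move=> B0 fB; rewrite /av -sumrB /tv mulr_sumr.
apply: (le_trans (ler_norm_sum _ _ _)); apply: ler_sum => b _.
by rewrite -mulrBl normrM mulrC; apply: ler_wpM2r.
Qed.

Lemma tv_ge0 u w : 0 <= tv u w.
Proof. by apply: sumr_ge0. Qed.

Lemma tvC u w : tv u w = tv w u.
Proof. by apply: eq_bigr => b _; rewrite distrC. Qed.

Lemma tv_le2 u w : pvec u -> pvec w -> tv u w <= 2.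
Proof.
move=> [u0 u1] [w0 w1]; rewrite (_ : 2 = \sum_b (u b + w b)); last first.
  by rewrite big_split/= u1 w1; ring.
apply: ler_sum => b _; rewrite ler_norml; have := u0 b; have := w0 b => ? ?.
by apply/andP; split; lra.
Qed.

(** Replacing three of four independent label laws by the first one. *)
Lemma av4_replace u u1 u2 u3 (G : F -> F -> F -> F -> R) B :
  pvec u -> pvec u1 -> pvec u2 -> pvec u3 ->
  0 <= B -> (forall b0 b1 b2 b3, `|G b0 b1 b2 b3| <= B) ->
  `|av u (fun b0 => av u1 (fun b1 => av u2 (fun b2 => av u3 (G b0 b1 b2)))) -
    av u (fun b0 => av u (fun b1 => av u (fun b2 => av u (G b0 b1 b2))))|
  <= B * (tv u u1 + tv u u2 + tv u u3).
Proof.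
move=> pu pu1 pu2 pu3 B0 GB; apply: av_diff => // b0.
have n3 w b1 b2 : pvec w -> `|av w (G b0 b1 b2)| <= B by move=> pw; exact: av_norm.
have n2 w w' b1 : pvec w -> pvec w' -> `|av w (fun b2 => av w' (G b0 b1 b2))| <= B.
  by move=> pw pw'; apply: av_norm => // b2; exact: n3.
set a1 := av u1 _; set a2 := av u _.
pose a3 := av u (fun b1 => av u2 (fun b2 => av u3 (G b0 b1 b2))).
pose a4 := av u (fun b1 => av u (fun b2 => av u3 (G b0 b1 b2))).
have h1 : `|a1 - a3| <= B * tv u u1.
  by rewrite tvC; apply: av_tv => // b1; exact: n2.
have h2 : `|a3 - a4| <= B * tv u u2.
  by apply: av_diff => // b1; rewrite tvC; apply: av_tv => // b2; exact: n3.
have h3 : `|a4 - a2| <= B * tv u u3.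
  by apply: av_diff => // b1; apply: av_diff => // b2; rewrite tvC; exact: av_tv.
rewrite !mulrDr (_ : a1 - a2 = (a1 - a3) + (a3 - a4) + (a4 - a2)); last by ring.
apply: (le_trans (ler_normD _ _)); apply: lerD => //.
by apply: (le_trans (ler_normD _ _)); exact: lerD.
Qed.

Section kernel.
Variable K : F -> F -> R.

(** The part of K orthogonal to the functions of a single end point. *)
Definition resid u w b b' : R :=
  K b b' - av w (K b) - av u (K^~ b') + av u (fun b => av w (K b)).

Lemma resid_centered1 u w b' : pvec u -> pvec w -> av u (resid u w ^~ b') = 0.
Proof.
move=> pu pw; rewrite /resid.
by rewrite avD avB avB !av_cst//; ring.
Qed.

Lemma resid_centered2 u w b : pvec u -> pvec w -> av w (resid u w b) = 0.
Proof.
move=> pu pw; rewrite /resid.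
by rewrite avD avB avB !av_cst// (av_exchange u w); ring.
Qed.

Lemma resid_sqr u w : pvec u -> pvec w ->
  av u (fun b => av w (fun b' => resid u w b b' ^+ 2)) =
  av u (fun b => av w (fun b' => K b b' ^+ 2)) - av u (fun b => av w (K b) ^+ 2)
  - av w (fun b' => av u (K^~ b') ^+ 2) + av u (fun b => av w (K b)) ^+ 2.
Proof.
move=> pu pw.
pose f b := av w (K b); pose g b' := av u (K^~ b').
set k := av u (fun b => av w (K b)).
have kg : av w g = k by rewrite /k av_exchange.
have step b : av w (fun b' => resid u w b b' ^+ 2) =
   av w (fun b' => K b b' ^+ 2) - f b ^+ 2 + av w (fun b' => g b' ^+ 2)
   - 2 * av w (fun b' => g b' * K b b') + 2 * k * f b - k ^+ 2.
  transitivity (av w (fun b' => K b b' ^+ 2 + (- (2 * f b) + 2 * k) * K b b' +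
     (g b' ^+ 2 + - 2 * (g b' * K b b')) + ((2 * f b - 2 * k) * g b' +
      (f b - k) ^+ 2))).
    by apply: eq_av => b'; rewrite /resid -/(f b) -/(g b') -/k; ring.
  by rewrite !avD !avZ av_cst// kg -/(f b); ring.
under eq_av do rewrite step.
rewrite avB avD avB avD avB !avZ !av_cst//.
have -> : av u (fun b => av w (fun b' => g b' * K b b')) = av w (fun b' => g b' ^+ 2).
  by rewrite av_exchange; apply: eq_av => b'; rewrite avZ expr2.
by rewrite -/f -/k; ring.
Qed.

Hypothesis Ksym : forall b b', K b b' = K b' b.

Lemma resid_sym u w b b' : resid w u b' b = resid u w b b'.
Proof.
rewrite /resid Ksym (av_exchange w u).
have -> : av w (K^~ b) = av w (K b) by apply: eq_av => c; rewrite Ksym.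
have -> : av u (K b') = av u (K^~ b') by apply: eq_av => c; rewrite Ksym.
have -> : av u (fun b'0 => av w (K^~ b'0)) = av u (fun b => av w (K b)).
  by apply: eq_av => c; apply: eq_av => c'; rewrite Ksym.
ring.
Qed.

End kernel.

End averages.

Section orthogonality.
Context {R : realType} {n : nat} {F : finType}.
Variable P : 'I_n -> F -> R.
Hypothesis Pv : forall i, pvec (P i).
Local Notation V := {ffun 'I_n -> F}.
Local Notation qP := (q P).

Let P1 i : \sum_b P i b = 1. Proof. by case: (Pv i). Qed.

Lemma q_av i H : qP H = qP (fun v => av (P i) (fun b => H (setv v i b))).
Proof. exact: q_int. Qed.

Lemma q_av1 i (f : F -> R) : qP (fun v => f (v i)) = av (P i) f.
Proof. exact: q1. Qed.

Lemma q_av2 i j (f : F -> F -> R) : i != j ->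
  qP (fun v => f (v i) (v j)) = av (P i) (fun b => av (P j) (f b)).
Proof.
move=> ij; rewrite (q_av i).
transitivity (qP (fun v => av (P i) (fun b => f b (v j)))).
  by apply: eq_q => v; apply: eq_av => b; rewrite setv_eq setv_neq// eq_sym.
rewrite (q_av j) -[RHS](q_cst P1); apply: eq_q => v.
rewrite av_exchange; apply: eq_av => b'; apply: eq_av => b; by rewrite setv_eq.
Qed.

Lemma q_av4 i0 i1 i2 i3 (G : F -> F -> F -> F -> R) :
  uniq [:: i0; i1; i2; i3] ->
  qP (fun v => G (v i0) (v i1) (v i2) (v i3)) =
  av (P i0) (fun b0 => av (P i1) (fun b1 => av (P i2) (fun b2 => av (P i3) (G b0 b1 b2)))).
Proof.
rewrite /= !inE !negb_or andbT => /and3P[/and3P[n01 n02 n03] /andP[n12 n13] n23].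
have s j i b (v : V) : j != i -> setv v i b j = v j by move=> ji; rewrite setv_neq.
rewrite (q_av i3).
transitivity (qP (fun v => av (P i3) (G (v i0) (v i1) (v i2)))).
  by apply: eq_q => v; apply: eq_av => b; rewrite setv_eq !s.
rewrite (q_av i2).
transitivity (qP (fun v => av (P i2) (fun b2 => av (P i3) (G (v i0) (v i1) b2)))).
  by apply: eq_q => v; apply: eq_av => b; rewrite setv_eq !s.
exact: (q_av2 (fun b0 b1 => av (P i2) (fun b2 => av (P i3) (G b0 b1 b2)))).
Qed.

Variable N : 'I_n -> 'I_n.
Hypothesis Nn : forall i, N i != i.
Variable f : 'I_n -> F -> F -> R.
Hypothesis f1 : forall i b', av (P i) ((f i)^~ b') = 0.
Hypothesis f2 : forall i b, av (P (N i)) (f i b) = 0.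
Hypothesis fsym : forall i, N (N i) = i -> forall b b', f (N i) b' b = f i b b'.
Variable g : 'I_n -> F -> R.
Hypothesis g1 : forall i, av (P i) (g i) = 0.

Definition mutual (i : 'I_n) : bool := i == N (N i).

Let a i (v : V) := f i (v i) (v (N i)).

(** The edge terms are centred given either end point and the vertex terms are
    centred, so all products of distinct terms average to zero, except for the
    two orientations of a mutual edge. *)
Lemma q_orthogonal :
  qP (fun v => (\sum_i a i v + \sum_i g i (v i)) ^+ 2) =
  \sum_i (1 + (mutual i)%:R) * qP (fun v => a i v ^+ 2) +
  \sum_i qP (fun v => g i (v i) ^+ 2).
Proof.
have aa i j : i != j -> qP (fun v => a i v * a j v) =
    ((j == N i) && mutual i)%:R * qP (fun v => a i v ^+ 2).
  move=> ij; have [jN|jN] := eqVneq j (N i).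
    have [m|m] := boolP (mutual i); rewrite ?mul1r ?mul0r.
      apply: eq_q => v; rewrite expr2; congr (_ * _).
      by rewrite /a jN -(eqP m) fsym// -(eqP m).
    apply: (q_centered P1 (i := i)) => v.
    transitivity (a j v * av (P i) ((f i)^~ (v (N i)))); last by rewrite f1 mulr0.
    rewrite -avZ; apply: eq_bigr => b _; congr (_ * _).
    rewrite /a setv_eq !setv_neq//; first by rewrite mulrC.
    by rewrite jN eq_sym; move: m; rewrite /mutual.
    by rewrite eq_sym.
  rewrite mul0r; apply: (q_centered P1 (i := j)) => v.
  transitivity (a i v * av (P j) ((f j)^~ (v (N j)))); last by rewrite f1 mulr0.
  rewrite -avZ; apply: eq_bigr => b _; congr (_ * _).
  by rewrite /a setv_eq !setv_neq// eq_sym.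
have ag i j : qP (fun v => a i v * g j (v j)) = 0.
  have [<-|ij] := eqVneq i j.
    apply: (q_centered P1 (i := N i)) => v.
    transitivity (g i (v i) * av (P (N i)) (f i (v i))); last by rewrite f2 mulr0.
    rewrite -avZ; apply: eq_bigr => b _; congr (_ * _).
    rewrite /a setv_eq (setv_neq _ _ (_ : i != N i)); last by rewrite eq_sym.
    by rewrite mulrC.
  apply: (q_centered P1 (i := i)) => v.
  transitivity (g j (v j) * av (P i) ((f i)^~ (v (N i)))); last by rewrite f1 mulr0.
  rewrite -avZ; apply: eq_bigr => b _; congr (_ * _).
  rewrite /a setv_eq (setv_neq _ _ (Nn i)) (setv_neq _ _ (_ : j != i)); last by rewrite eq_sym.
  by rewrite mulrC.
have gg i j : i != j -> qP (fun v => g i (v i) * g j (v j)) = 0.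
  move=> ij; apply: (q_centered P1 (i := i)) => v.
  transitivity (g j (v j) * av (P i) (g i)); last by rewrite g1 mulr0.
  rewrite -avZ; apply: eq_bigr => b _; congr (_ * _).
  rewrite setv_eq (setv_neq _ _ (_ : j != i)); last by rewrite eq_sym.
  by rewrite mulrC.
have exp (s t : 'I_n -> V -> R) :
    qP (fun v => (\sum_i s i v) * (\sum_i t i v)) =
    \sum_i \sum_j qP (fun v => s i v * t j v).
  transitivity (qP (fun v => \sum_i \sum_j s i v * t j v)).
    by apply: eq_q => v; rewrite mulr_suml; apply: eq_bigr => i _; rewrite mulr_sumr.
  by rewrite q_sum; apply: eq_bigr => i _; rewrite q_sum.
transitivity (qP (fun v => (\sum_i a i v) * (\sum_i a i v)) +
   2 * qP (fun v => (\sum_i a i v) * (\sum_i g i (v i))) +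
   qP (fun v => (\sum_i g i (v i)) * (\sum_i g i (v i)))).
  by rewrite -qZ -!qD; apply: eq_q => v; ring.
rewrite (exp a a) (exp a (fun i v => g i (v i))) (exp (fun i v => g i (v i)) (fun i v => g i (v i))).
rewrite [X in 2 * X]big1 ?mulr0 ?addr0; last first.
  by move=> i _; rewrite big1// => j _; exact: ag.
congr (_ + _); apply: eq_bigr => i _; rewrite (bigD1 i)//=; last first.
  rewrite big1; last by move=> j ji; rewrite gg// eq_sym.
  by rewrite addr0; apply: eq_q => v; rewrite expr2.
rewrite mulrDl mul1r; congr (_ + _).
rewrite (bigD1 (N i))//= aa; last by rewrite eq_sym.
rewrite eqxx/= big1 ?addr0// => j /andP[ji jN].
by rewrite aa; [rewrite (negPf jN) mul0r|rewrite eq_sym].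
Qed.

End orthogonality.

(** * The variance of a sum over nearest neighbour edges *)

Section graph_weights.
Context {n : nat}.
Variable nl : 'I_n -> seq 'I_n.

Definition Nl (k : nat) (i : 'I_n) : 'I_n := nth i (nl i) k.
Definition mut (i : 'I_n) : bool := i == Nl 0 (Nl 0 i).
Definition shr (i : 'I_n) : nat := #|[pred j | (j != i) && (Nl 0 j == Nl 0 i)]|.
Definition indeg (i : 'I_n) : nat := #|[pred j | Nl 0 j == i]|.

Lemma indeg_shr i : indeg (Nl 0 i) = (shr i).+1.
Proof.
rewrite /indeg /shr (cardD1 i) inE eqxx add1n; congr S.
Qed.

Lemma sum_indeg (R : realType) (f : 'I_n -> R) :
  \sum_i (indeg i)%:R * f i = \sum_i f (Nl 0 i).
Proof.
rewrite [RHS](partition_big (Nl 0) predT)//=; apply: eq_bigr => i _.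
rewrite (eq_bigr (fun=> f i)); last by move=> j /eqP ->.
by rewrite sumr_const mulr_natl.
Qed.

End graph_weights.

Section edge_statistics.
Context {R : realType} {F : finType}.
Variables (K : F -> F -> R) (h : F -> R).

(** The summand of the variance estimator, for a label configuration v and the
    neighbour lists nl. *)
Definition Gam4 (m s : R) (b0 b1 b2 b3 : F) : R :=
  K b0 b1 ^+ 2 * (1 + m) + K b0 b1 * K b0 b2 * (2 * (1 - m) + s)
  - K b0 b1 * K b2 b3 * (1 + (1 - m) + s)
  + 4 * (h b0 * K b0 b1) - 2 * (h b0 * K b1 b2) + h b0 ^+ 2.

Definition Gam n (v : {ffun 'I_n -> F}) (nl : 'I_n -> seq 'I_n) (i : 'I_n) : R :=
  Gam4 (mut nl i)%:R (shr nl i)%:R (v i) (v (Nl nl 0 i)) (v (Nl nl 1 i)) (v (Nl nl 2 i)).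

Definition edge n (v : {ffun 'I_n -> F}) (nl : 'I_n -> seq 'I_n) (i : 'I_n) : R :=
  K (v i) (v (Nl nl 0 i)).

Hypothesis K1 : forall b b', `|K b b'| <= 1.
Hypothesis h1 : forall b, `|h b| <= 1.

Lemma normM1 (x y : R) : `|x| <= 1 -> `|y| <= 1 -> `|x * y| <= 1.
Proof. by move=> ? ?; rewrite normrM -[leRHS]mulr1; apply: ler_pM. Qed.

Lemma Gam4_bound (m : bool) s (B : R) b0 b1 b2 b3 : 0 <= s <= B ->
  `|Gam4 m%:R s b0 b1 b2 b3| <= 13 + 2 * B.
Proof.
move=> /andP[s0 sB]; rewrite /Gam4.
have := normM1 (K1 b0 b1) (K1 b0 b1); have := normM1 (K1 b0 b1) (K1 b0 b2).
have := normM1 (K1 b0 b1) (K1 b2 b3); have := normM1 (h1 b0) (K1 b0 b1).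
have := normM1 (h1 b0) (K1 b1 b2); have := normM1 (h1 b0) (h1 b0).
rewrite !expr2; move: (h b0 * h b0) (h b0 * K b1 b2) (h b0 * K b0 b1)
  (K b0 b1 * K b2 b3) (K b0 b1 * K b0 b2) (K b0 b1 * K b0 b1) => a1 a2 a3 a4 a5 a6.
have ub (x w W : R) : `|x| <= 1 -> 0 <= w -> w <= W -> `|x * w| <= W.
  move=> hx w0 wW; rewrite normrM (ger0_norm w0) -[leRHS]mul1r.
  by apply: ler_pM.
move=> l1 l2 l3 l4 l5 l6.
have mm : 0 <= (m%:R : R) <= 1 by case: (m); rewrite ?lexx ?ler01.
case/andP: mm => m0 m1.
have e6 := ub a6 (1 + m%:R) 2 l6 ltac:(lra) ltac:(lra).
have e5 := ub a5 (2 * (1 - m%:R) + s) (2 + B) l5 ltac:(lra) ltac:(lra).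
have e4 := ub a4 (1 + (1 - m%:R) + s) (2 + B) l4 ltac:(lra) ltac:(lra).
move: l1 l2 l3 e6 e5 e4; rewrite !ler_norml.
move=> /andP[? ?] /andP[? ?] /andP[? ?] /andP[? ?] /andP[? ?] /andP[? ?].
by apply/andP; split; lra.
Qed.

Hypothesis Ksym : forall b b', K b b' = K b' b.

Section at_a_point.
Implicit Types u w : F -> R.

Definition kap u b := av u (K b).
Definition k0 u := av u (kap u).
Definition h0 u := av u h.
Definition Phi1 u := av u (fun b => av u (fun b' => K b b' ^+ 2)).
Definition Phi2 u := av u (fun b => kap u b ^+ 2).
Definition Th1 u := av u (fun b => h b * kap u b).
Definition h2 u := av u (fun b => h b ^+ 2).
Definition psi u := k0 u + h0 u.

Lemma av4_Gam u (m s : R) : pvec u ->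
  av u (fun b0 => av u (fun b1 => av u (fun b2 => av u (Gam4 m s b0 b1 b2)))) =
  (1 + m) * Phi1 u + (2 * (1 - m) + s) * Phi2 u - (1 + (1 - m) + s) * k0 u ^+ 2
  + 4 * Th1 u - 2 * (h0 u * k0 u) + h2 u.
Proof.
move=> pu.
transitivity (av u (fun b0 => av u (fun b1 => av u (fun b2 =>
   K b0 b1 ^+ 2 * (1 + m) + K b0 b1 * K b0 b2 * (2 * (1 - m) + s)
  - K b0 b1 * kap u b2 * (1 + (1 - m) + s)
  + 4 * (h b0 * K b0 b1) - 2 * (h b0 * K b1 b2) + h b0 ^+ 2)))).
  apply: eq_av => b0; apply: eq_av => b1; apply: eq_av => b2.
  transitivity (av u (fun b3 => (K b0 b1 ^+ 2 * (1 + m) + K b0 b1 * K b0 b2 * (2 * (1 - m) + s)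
     + 4 * (h b0 * K b0 b1) - 2 * (h b0 * K b1 b2) + h b0 ^+ 2) +
     (- (K b0 b1 * (1 + (1 - m) + s))) * K b2 b3)).
    by apply: eq_av => b3; rewrite /Gam4; ring.
  by rewrite avD avZ av_cst// -/(kap u b2); ring.
transitivity (av u (fun b0 => av u (fun b1 =>
   K b0 b1 ^+ 2 * (1 + m) + K b0 b1 * kap u b0 * (2 * (1 - m) + s)
  - K b0 b1 * k0 u * (1 + (1 - m) + s)
  + 4 * (h b0 * K b0 b1) - 2 * (h b0 * kap u b1) + h b0 ^+ 2))).
  apply: eq_av => b0; apply: eq_av => b1.
  transitivity (av u (fun b2 => (K b0 b1 ^+ 2 * (1 + m)
     + 4 * (h b0 * K b0 b1) + h b0 ^+ 2) + (K b0 b1 * (2 * (1 - m) + s)) * K b0 b2 +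
     (- (K b0 b1 * (1 + (1 - m) + s))) * kap u b2 + (- (2 * h b0)) * K b1 b2)).
    by apply: eq_av => b2; ring.
  by rewrite !avD !avZ !av_cst// -/(kap u b1) -/(kap u b0) -/(k0 u); ring.
transitivity (av u (fun b0 =>
   (1 + m) * av u (fun b1 => K b0 b1 ^+ 2) + (2 * (1 - m) + s) * (kap u b0 ^+ 2)
  + (- (k0 u * (1 + (1 - m) + s))) * kap u b0
  + 4 * (h b0 * kap u b0) + (- (2 * k0 u)) * h b0 + h b0 ^+ 2)).
  apply: eq_av => b0.
  transitivity (av u (fun b1 => (1 + m) * K b0 b1 ^+ 2 + (kap u b0 * (2 * (1 - m) + s)
     - k0 u * (1 + (1 - m) + s) + 4 * h b0) * K b0 b1 + (- (2 * h b0)) * kap u b1 + h b0 ^+ 2)).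
    by apply: eq_av => b1; ring.
  by rewrite !avD !avZ !av_cst// -/(kap u b0) -/(k0 u); ring.
rewrite !avD !avZ -/(Phi1 u) -/(Phi2 u) -/(k0 u) -/(Th1 u) -/(h0 u) -/(h2 u).
ring.
Qed.

(** Conditional variance contributed by a vertex of in-degree e. *)
Definition vertex_var u (e : R) :=
  (1 + e) ^+ 2 * (Phi2 u - k0 u ^+ 2) + 2 * (1 + e) * (Th1 u - h0 u * k0 u)
  + (h2 u - h0 u ^+ 2).

Definition vertex_term u (e : R) b := (1 + e) * (kap u b - k0 u) + (h b - h0 u).

Lemma vertex_term_centered u e : pvec u -> av u (vertex_term u e) = 0.
Proof.
by move=> pu; rewrite /vertex_term avD avZ !avB !av_cst// -/(k0 u) -/(h0 u); ring.
Qed.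

Lemma vertex_term_sqr u e : pvec u ->
  av u (fun b => vertex_term u e b ^+ 2) = vertex_var u e.
Proof.
move=> pu; rewrite /vertex_term /vertex_var.
transitivity (av u (fun b => (1 + e) ^+ 2 * kap u b ^+ 2 +
   (2 * (1 + e)) * (h b * kap u b) + h b ^+ 2 +
   (- (2 * (1 + e) * ((1 + e) * k0 u + h0 u))) * kap u b +
   (- (2 * ((1 + e) * k0 u + h0 u))) * h b + ((1 + e) * k0 u + h0 u) ^+ 2)).
  by apply: eq_av => b; ring.
rewrite !avD !avZ !av_cst// -/(Phi2 u) -/(k0 u) -/(Th1 u) -/(h0 u) -/(h2 u).
ring.
Qed.

Lemma kap_bound u b : pvec u -> `|kap u b| <= 1.
Proof. by move=> pu; apply: av_norm. Qed.

Lemma k0_bound u : pvec u -> `|k0 u| <= 1.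
Proof. by move=> pu; apply: av_norm => // b; exact: kap_bound. Qed.

Lemma h0_bound u : pvec u -> `|h0 u| <= 1.
Proof. by move=> pu; apply: av_norm. Qed.

Lemma kap_tv u w b : `|kap u b - kap w b| <= tv u w.
Proof. by rewrite -[leRHS]mul1r; exact: av_tv. Qed.

Lemma h0_tv u w : `|h0 u - h0 w| <= tv u w.
Proof. by rewrite -[leRHS]mul1r; exact: av_tv. Qed.

Lemma av_fun_tv u w f g (C : R) : pvec u -> pvec w -> (forall b, `|f b| <= 1) ->
  (forall b, `|f b - g b| <= C * tv u w) -> `|av u f - av w g| <= (1 + C) * tv u w.
Proof.
move=> pu pw f1 fg; rewrite mulrDl.
rewrite (_ : av u f - av w g = (av u f - av w f) + (av w f - av w g)); last by ring.
apply: (le_trans (ler_normD _ _)); apply: lerD; first exact: av_tv.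
exact: av_diff.
Qed.

Lemma k0_tv u w : pvec u -> pvec w -> `|k0 u - k0 w| <= 2 * tv u w.
Proof.
move=> pu pw; rewrite (_ : 2 = 1 + 1 :> R); last by ring.
apply: av_fun_tv => // b; first exact: kap_bound.
by rewrite mul1r; exact: kap_tv.
Qed.

Lemma prod_tv (a b a' b' A B : R) : `|a| <= 1 -> `|b'| <= 1 ->
  `|a - a'| <= A -> `|b - b'| <= B -> `|a * b - a' * b'| <= B + A.
Proof.
move=> a1 b1 aA bB.
rewrite (_ : a * b - a' * b' = a * (b - b') + (a - a') * b'); last by ring.
apply: (le_trans (ler_normD _ _)); rewrite !normrM; apply: lerD.
  by rewrite -[leRHS]mul1r; apply: ler_pM.
by rewrite -[leRHS]mulr1; apply: ler_pM.
Qed.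

Lemma Phi2_tv u w : pvec u -> pvec w -> `|Phi2 u - Phi2 w| <= 3 * tv u w.
Proof.
move=> pu pw; rewrite (_ : 3 = 1 + 2 :> R); last by ring.
apply: av_fun_tv => // b; rewrite expr2; first by apply: normM1; exact: kap_bound.
rewrite expr2 (_ : 2 * _ = tv u w + tv u w); last by ring.
by apply: prod_tv; rewrite ?kap_bound ?kap_tv.
Qed.

Lemma Th1_tv u w : pvec u -> pvec w -> `|Th1 u - Th1 w| <= 2 * tv u w.
Proof.
move=> pu pw; rewrite (_ : 2 = 1 + 1 :> R); last by ring.
apply: av_fun_tv => // b; first by apply: normM1 => //; exact: kap_bound.
rewrite -mulrBr normrM; apply: ler_pM => //; exact: kap_tv.
Qed.

Definition Bv u := Phi2 u - k0 u ^+ 2.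
Definition Cv u := Th1 u - h0 u * k0 u.

Lemma Bv_tv u w : pvec u -> pvec w -> `|Bv u - Bv w| <= 7 * tv u w.
Proof.
move=> pu pw.
have e1 := Phi2_tv pu pw.
have e2 : `|k0 u * k0 u - k0 w * k0 w| <= 2 * tv u w + 2 * tv u w.
  by apply: prod_tv; rewrite ?k0_bound ?k0_tv.
move: e1 e2; rewrite /Bv !expr2 !ler_norml => /andP[? ?] /andP[? ?].
by apply/andP; split; lra.
Qed.

Lemma Cv_tv u w : pvec u -> pvec w -> `|Cv u - Cv w| <= 5 * tv u w.
Proof.
move=> pu pw.
have e1 := Th1_tv pu pw.
have e2 : `|h0 u * k0 u - h0 w * k0 w| <= 2 * tv u w + tv u w.
  by apply: prod_tv; rewrite ?k0_bound ?h0_bound ?k0_tv ?h0_tv.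
move: e1 e2; rewrite /Cv !ler_norml => /andP[? ?] /andP[? ?].
by apply/andP; split; lra.
Qed.

Lemma kk_tv u w : pvec u -> pvec w ->
  `|av u (kap w) - k0 u| <= tv u w.
Proof. by move=> pu pw; apply: av_diff => // b; rewrite tvC; exact: kap_tv. Qed.

Lemma resid_sqr_tv u w : pvec u -> pvec w ->
  `|av u (fun b => av w (fun b' => resid K u w b b' ^+ 2)) -
    (Phi1 u - 2 * Phi2 u + k0 u ^+ 2)| <= 6 * tv u w.
Proof.
move=> pu pw; rewrite resid_sqr//.
have e1 : `|av u (fun b => av w (fun b' => K b b' ^+ 2)) - Phi1 u| <= tv u w.
  apply: av_diff => // b; rewrite tvC -[leRHS]mul1r; apply: av_tv => // b'.
  by rewrite expr2; exact: normM1.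
have e2 : `|av u (fun b => av w (K b) ^+ 2) - Phi2 u| <= tv u w + tv u w.
  apply: av_diff => // b; rewrite !expr2.
  by apply: prod_tv; rewrite ?kap_bound// tvC; exact: kap_tv.
have e3 : `|av w (fun b' => av u (K^~ b') ^+ 2) - Phi2 u| <= tv u w.
  have -> : av w (fun b' => av u (K^~ b') ^+ 2) = av w (fun b' => kap u b' ^+ 2).
    by apply: eq_av => b'; congr (_ ^+ 2); apply: eq_av => b; rewrite Ksym.
  rewrite tvC -[leRHS]mul1r; apply: av_tv => // b.
  by rewrite expr2; apply: normM1; exact: kap_bound.
have e4 : `|av u (fun b => av w (K b)) ^+ 2 - k0 u ^+ 2| <= tv u w + tv u w.
  rewrite !expr2; apply: prod_tv; rewrite ?k0_bound//; last 2 first.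
  - exact: kk_tv.
  - exact: kk_tv.
  by apply: av_norm => // b; exact: kap_bound.
move: e1 e2 e3 e4; set a1 := av u _; set a2 := av u _; set a3 := av w _; set a4 := av u _ ^+ 2.
rewrite !ler_norml => /andP[? ?] /andP[? ?] /andP[? ?] /andP[? ?].
by apply/andP; split; lra.
Qed.

(** The error made by pretending that the neighbour has the same label law. *)
Definition err u w b b' : R :=
  (kap w b - kap u b) + (kap u b' - kap w b') + (k0 w - av u (kap w)).

Lemma err_decomp u w b b' :
  K b b' + h b - (resid K u w b b' + (kap u b - k0 u) + (kap w b' - k0 w)
    + (h b - h0 u) + psi u) = err u w b b'.
Proof.
rewrite /resid /err /psi.
have -> : av u (K^~ b') = kap u b' by apply: eq_av => c; rewrite Ksym.
rewrite -/(kap w b) (_ : av u (fun b0 => av w (K b0)) = av u (kap w)); last by [].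
ring.
Qed.

Lemma err_sqr u w b b' : pvec u -> pvec w -> err u w b b' ^+ 2 <= 18%:R * tv u w.
Proof.
move=> pu pw.
have e : `|err u w b b'| <= 3 * tv u w.
  have e1 := kap_tv u w b; have e2 := kap_tv u w b'.
  have e3 : `|k0 w - av u (kap w)| <= tv u w.
    by rewrite -[leRHS]mul1r tvC; apply: av_tv => // c; exact: kap_bound.
  move: e1 e2 e3; rewrite /err !ler_norml => /andP[? ?] /andP[? ?] /andP[? ?].
  by apply/andP; split; lra.
have t2 := tv_le2 pu pw; have t0 := tv_ge0 u w.
rewrite -[X in X <= _]real_normK ?num_real//.
apply: (@le_trans _ _ ((3 * tv u w) ^+ 2)).
  by rewrite lerXn2r ?nnegrE// mulr_ge0.
rewrite (_ : (3 * tv u w) ^+ 2 = 9%:R * tv u w * tv u w); last by ring.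
rewrite (_ : 18%:R * tv u w = 9%:R * tv u w * 2); last by ring.
by apply: ler_wpM2l => //; rewrite mulr_ge0.
Qed.

End at_a_point.

(** Conditional variance of the linearized sum against the conditional mean
    of the estimator, for label laws U that vary slowly along the graph. *)
Lemma conditional_variance_estimator n (U : 'I_n -> F -> R) (nl : 'I_n -> seq 'I_n)
    (D : nat) : (forall i, pvec (U i)) ->
  (forall i, uniq [:: i; Nl nl 0 i; Nl nl 1 i; Nl nl 2 i]) ->
  (forall i, (shr nl i <= D)%N) ->
  `| q U (fun v => (\sum_i resid K (U i) (U (Nl nl 0 i)) (v i) (v (Nl nl 0 i)) +
                    \sum_i vertex_term (U i) (indeg nl i)%:R (v i)) ^+ 2)
    - (\sum_i q U (fun v => Gam v nl i) - \sum_i psi (U i) ^+ 2) |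
  <= (60%:R + 9%:R * D%:R) * \sum_i (tv (U i) (U (Nl nl 0 i)) +
     tv (U i) (U (Nl nl 1 i)) + tv (U i) (U (Nl nl 2 i))).
Proof.
move=> pU un sD.
have Nn i : Nl nl 0 i != i.
  by have := un i; rewrite /= !inE !negb_or eq_sym => /andP[/and3P[]].
have P1 i : \sum_b U i b = 1 by case: (pU i).
have fs i : Nl nl 0 (Nl nl 0 i) = i -> forall b b',
    resid K (U (Nl nl 0 i)) (U (Nl nl 0 (Nl nl 0 i))) b' b =
    resid K (U i) (U (Nl nl 0 i)) b b'.
  by move=> -> b b'; exact: resid_sym.
pose t i := tv (U i) (U (Nl nl 0 i)).
pose m i : R := (mut nl i)%:R; pose s i : R := (shr nl i)%:R.
have qa i : q U (fun v => resid K (U i) (U (Nl nl 0 i)) (v i) (v (Nl nl 0 i)) ^+ 2) =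
    av (U i) (fun b => av (U (Nl nl 0 i)) (fun b' => resid K (U i) (U (Nl nl 0 i)) b b' ^+ 2)).
  by rewrite -q_av2// eq_sym.
have qg i : q U (fun v => vertex_term (U i) (indeg nl i)%:R (v i) ^+ 2) =
    vertex_var (U i) (indeg nl i)%:R.
  by rewrite -vertex_term_sqr//; exact: (q_av1 pU i (fun b => vertex_term (U i) (indeg nl i)%:R b ^+ 2)).
have orth := @q_orthogonal R n F U pU (Nl nl 0) Nn
   (fun i => resid K (U i) (U (Nl nl 0 i)))
   (fun i b => resid_centered1 K b (pU i) (pU (Nl nl 0 i)))
   (fun i b => resid_centered2 K b (pU i) (pU (Nl nl 0 i)))
   fs
   (fun i => vertex_term (U i) (indeg nl i)%:R)
   (fun i => vertex_term_centered _ (pU i)).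
pose A i := av (U i) (fun b => av (U (Nl nl 0 i)) (fun b' =>
     resid K (U i) (U (Nl nl 0 i)) b b' ^+ 2)).
have {orth}-> : q U (fun v => (\sum_i resid K (U i) (U (Nl nl 0 i)) (v i) (v (Nl nl 0 i)) +
                    \sum_i vertex_term (U i) (indeg nl i)%:R (v i)) ^+ 2) =
    \sum_i (1 + m i) * A i + \sum_i vertex_var (U i) (indeg nl i)%:R.
  apply: (etrans orth); congr (_ + _); apply: eq_bigr => i _; last exact: qg.
  by congr (_ * _); exact: qa.
pose Gq i := q U (fun v => Gam v nl i).
pose G1 i := (1 + m i) * Phi1 (U i) + (2 * (1 - m i) + s i) * Phi2 (U i)
  - (1 + (1 - m i) + s i) * k0 (U i) ^+ 2 + 4 * Th1 (U i)
  - 2 * (h0 (U i) * k0 (U i)) + h2 (U i).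
pose tau i := tv (U i) (U (Nl nl 0 i)) + tv (U i) (U (Nl nl 1 i)) + tv (U i) (U (Nl nl 2 i)).
have tle i : t i <= tau i.
  by rewrite /tau -addrA lerDl addr_ge0// tv_ge0.
have t0 i : 0 <= t i by exact: tv_ge0.
have s0 i : 0 <= s i by exact: ler0n.
have sDR i : s i <= D%:R by rewrite ler_nat.
have m01 i : 0 <= m i <= 1 by rewrite /m; case: (mut _ _); rewrite ?lexx ?ler01.
have dG i : `|Gq i - G1 i| <= (13%:R + 2 * D%:R) * tau i.
  have B0 : 0 <= 13%:R + 2 * D%:R :> R by have : 0 <= D%:R :> R by []; lra.
  have Gb b0 b1 b2 b3 : `|Gam4 (m i) (s i) b0 b1 b2 b3| <= 13%:R + 2 * D%:R.
    by apply: Gam4_bound; rewrite s0 sDR.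
  have := av4_replace (pU i) (pU (Nl nl 0 i)) (pU (Nl nl 1 i)) (pU (Nl nl 2 i)) B0 Gb.
  by rewrite av4_Gam// -(q_av4 pU _ (un i)).
pose V1 i := (1 + m i) * (Phi1 (U i) - 2 * Phi2 (U i) + k0 (U i) ^+ 2).
have dV i : `|(1 + m i) * A i - V1 i| <= 12%:R * t i.
  rewrite /V1 -mulrBr normrM; have /andP[ma mb] := m01 i.
  rewrite ger0_norm ?addr_ge0// (_ : 12%:R * t i = 2 * (6 * t i)); last by ring.
  by apply: ler_pM => //; [rewrite addr_ge0|lra|exact: resid_sqr_tv].
pose W1 i := (4 + s i) * Bv (U i) + 4 * Cv (U i) + (h2 (U i) - h0 (U i) ^+ 2).
have dW : `|\sum_i vertex_var (U i) (indeg nl i)%:R - \sum_i W1 i| <=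
    \sum_i (31%:R + 7%:R * D%:R) * t i.
  have -> : \sum_i vertex_var (U i) (indeg nl i)%:R =
     \sum_i (Bv (U i) + 2 * Bv (U (Nl nl 0 i)) + (1 + s i) * Bv (U (Nl nl 0 i)) +
       2 * Cv (U i) + 2 * Cv (U (Nl nl 0 i)) + (h2 (U i) - h0 (U i) ^+ 2)).
    rewrite !big_split/=.
    have -> : \sum_i 2 * Bv (U (Nl nl 0 i)) = \sum_i (indeg nl i)%:R * (2 * Bv (U i)).
      by rewrite sum_indeg.
    have -> : \sum_i 2 * Cv (U (Nl nl 0 i)) = \sum_i (indeg nl i)%:R * (2 * Cv (U i)).
      by rewrite sum_indeg.
    have -> : \sum_i (1 + s i) * Bv (U (Nl nl 0 i)) =
       \sum_i (indeg nl i)%:R * ((indeg nl i)%:R * Bv (U i)).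
      rewrite sum_indeg; apply: eq_bigr => i _.
      by rewrite indeg_shr /s -natr1 addrC.
    by rewrite -!big_split/=; apply: eq_bigr => i _; rewrite /vertex_var -/(Bv _) -/(Cv _); ring.
  rewrite -sumrB; apply: (le_trans (ler_norm_sum _ _ _)); apply: ler_sum => i _.
  have eB := Bv_tv (pU i) (pU (Nl nl 0 i)); have eC := Cv_tv (pU i) (pU (Nl nl 0 i)).
  rewrite -/(t i) in eB eC.
  rewrite (_ : _ - W1 i = - ((3 + s i) * (Bv (U i) - Bv (U (Nl nl 0 i))) +
      2 * (Cv (U i) - Cv (U (Nl nl 0 i))))); last by rewrite /W1; ring.
  rewrite normrN; apply: (le_trans (ler_normD _ _)).
  rewrite (_ : (31%:R + 7%:R * D%:R) * t i = (3 + D%:R) * (7 * t i) + 2 * (5 * t i)); last by ring.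
  rewrite !normrM; apply: lerD.
    by apply: ler_pM => //; rewrite ger0_norm ?addr_ge0// lerD2l.
  by apply: ler_pM => //; rewrite ger0_norm.
have id i : V1 i + W1 i = G1 i - psi (U i) ^+ 2.
  by rewrite /V1 /W1 /G1 /psi /Bv /Cv; ring.
set S1 := \sum_i (1 + m i) * A i.
have e1 : `|S1 - \sum_i V1 i| <= \sum_i 12%:R * t i.
  rewrite -sumrB; apply: (le_trans (ler_norm_sum _ _ _)); apply: ler_sum => i _; exact: dV.
have e3 : `|\sum_i Gq i - \sum_i G1 i| <= \sum_i (13%:R + 2 * D%:R) * tau i.
  rewrite -sumrB; apply: (le_trans (ler_norm_sum _ _ _)); apply: ler_sum => i _; exact: dG.
have e4 : \sum_i V1 i + \sum_i W1 i = \sum_i G1 i - \sum_i psi (U i) ^+ 2.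
  by rewrite -big_split -sumrB; apply: eq_bigr => i _; exact: id.
have e5 : \sum_i t i <= \sum_i tau i by apply: ler_sum.
have T0 : 0 <= \sum_i t i by apply: sumr_ge0.
have D0 : 0 <= D%:R :> R by [].
move: e1 dW e3; rewrite -!mulr_sumr -/(Gq _); set S2 := \sum_i vertex_var _ _.
rewrite -/(\sum_i tau i).
move: (\sum_i t i) (\sum_i tau i) e5 T0 => T TA e5 T0.
have e6 : D%:R * T <= D%:R * TA by apply: ler_wpM2l.
have e7 : 0 <= D%:R * T by rewrite mulr_ge0.
rewrite !ler_norml => /andP[? ?] /andP[? ?] /andP[? ?].
rewrite (_ : \sum_i q U (fun v => Gam v nl i) = \sum_i Gq i); last by [].
by apply/andP; split; lra.
Qed.

End edge_statistics.

(** * The linearized statistic *)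

Lemma close_of_perturb (R : realType) (a b V e : R) : 0 < e <= 1 ->
  0 <= a -> 0 <= b -> 0 <= V ->
  a <= b + e * b + 2 / e * V -> b <= a + e * a + 2 / e * V ->
  a <= 2 * b + 2 * V -> `|a - b| <= 3 * e * b + 4 / e * V.
Proof.
move=> /andP[e0 e1] a0 b0 V0.
rewrite (_ : 2 / e * V = 2 * (V / e)); last by ring.
rewrite (_ : 4 / e * V = 4 * (V / e)); last by ring.
have Ve : 0 <= V / e by apply: divr_ge0 => //; exact: ltW.
have eV : e * V <= V / e.
  apply: (@le_trans _ _ V); first by rewrite ler_piMl.
  by rewrite ler_pdivlMr// ler_piMr.
have eb : 0 <= e * b by apply: mulr_ge0 => //; exact: ltW.
move=> h1 h2 h3.
have ea : e * a <= e * (2 * b + 2 * V) by apply: ler_wpM2l => //; exact: ltW.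
rewrite ler_norml (_ : 3 * e * b = 3 * (e * b)); last by ring.
rewrite mulrDr mulrCA (mulrCA e) in ea.
move: (V / e) (e * V) (e * b) (e * a) eV Ve eb ea h1 h2 h3 => *.
by apply/andP; split; lra.
Qed.

Lemma Var_close (R : realType) (disp : measure_display) (W : measurableType disp)
    (P : probability W R) (f g : W -> R) (e : R) : bmf f -> bmf g -> 0 < e <= 1 ->
  `|Var P f - Var P g| <= 3 * e * Var P g + 4 / e * Var P (fun w => f w - g w).
Proof.
move=> bf bg e01.
have sw : Var P (fun w => g w - f w) = Var P (fun w => f w - g w).
  by rewrite /Var; apply: eq_Ex => w; rewrite !ExB//; ring.
have one : ((0 : R) < 1) && ((1 : R) <= 1) by rewrite ltr01 lexx.
have v1 := Var_perturb P bf bg e01.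
have v2 := Var_perturb P bg bf e01; rewrite sw in v2.
have v3 := Var_perturb P bf bg one; rewrite mul1r divr1 -mulr2n -(mulr_natl (Var P g)) in v3.
exact: (close_of_perturb e01 (Var_ge0 P f) (Var_ge0 P g) (Var_ge0 P (fun w => f w - g w)) v1 v2 v3).
Qed.

Lemma rescaled_estimate (R : realType) (n t e C A B G T VL VS VD m g u : R) :
  0 < n -> 0 < t -> `|VL - VS| <= 3 * t * VS + 4 / t * VD -> VD <= A * T ->
  VS <= C * n -> 3 * t * C <= e -> `|VL - (G - n * m)| <= B * T ->
  n^-1 * G = g -> `|m - u| <= 4 * (n^-1 * T) ->
  `|n^-1 * VS - (g - u)| <= e + (4 / t * A + B + 4) * (n^-1 * T).
Proof.
move=> n0 t0 h1 h2 h3 h4 h5 <- h6.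
have i0 : 0 <= n^-1 by rewrite invr_ge0 ltW.
have nn : n^-1 * n = 1 by rewrite mulVf ?gt_eqF.
have w1 : `|n^-1 * VL - n^-1 * VS| <= e + 4 / t * A * (n^-1 * T).
  rewrite -mulrBr normrM ger0_norm//; apply: (le_trans (ler_wpM2l i0 h1)).
  rewrite mulrDr; apply: lerD.
    have k3 : n^-1 * VS <= C by rewrite ler_pdivrMl// mulrC.
    apply: le_trans h4; rewrite mulrCA; apply: ler_wpM2l => //.
    by apply: mulr_ge0 => //; exact: ltW.
  rewrite mulrCA -mulrA; apply: ler_wpM2l; first by rewrite divr_ge0// ltW.
  by rewrite mulrCA; exact: ler_wpM2l.
have w2 : `|n^-1 * VL - (n^-1 * G - m)| <= B * (n^-1 * T).
  have -> : n^-1 * VL - (n^-1 * G - m) = n^-1 * (VL - (G - n * m)).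
    by rewrite !mulrBr mulrA nn mul1r.
  by rewrite normrM ger0_norm// mulrCA; exact: ler_wpM2l.
rewrite !mulrDl.
move: (4 / t * A * (n^-1 * T)) (B * (n^-1 * T)) (n^-1 * T) (n^-1 * VL) (n^-1 * VS) (n^-1 * G) w1 w2 h6.
clear=> a1 a2 a3 g1 g2 g3; rewrite !ler_norml => /andP[? ?] /andP[? ?] /andP[? ?].
by apply/andP; split; lra.
Qed.

Section linearized_statistic.
Context {R : realType} {d : nat}.
Hypothesis hd : (0 < d)%N.
Local Notation X := (d.-tuple R).
Local Notation E := (X * R)%type.
Variable rho : X -> X -> X -> bool.
Hypothesis prox : proximity rho.
Variable D : nat.
Hypothesis hD : degree_bound rho D.
Variable mu : probability E R.
Hypothesis atomless : forall k t, mu [set e : E | tnth e.1 k = t] = 0%E.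
Variable la : forall n, probability (n.-tuple E) R.
Hypothesis iid : forall n, iid_law mu (la n).
Variables (F : finType) (c : R -> F).
Hypothesis mc : finobs c.
Variable p : F -> X -> R.
Hypothesis bp : forall b, bmf (p b).
Hypothesis p0 : forall b x, 0 <= p b x.
Hypothesis p1 : forall x, \sum_b p b x = 1.
Hypothesis pc : forall b (g : X -> R), bmf g ->
  Ex mu (fun e => (c e.2 == b)%:R * g e.1) = Ex mu (fun e => p b e.1 * g e.1).
Variable K : F -> F -> R.
Hypothesis K1 : forall b b', `|K b b'| <= 1.
Hypothesis Ksym : forall b b', K b b' = K b' b.
Variable h : nat -> F -> R.
Hypothesis h1 : forall n b, `|h n b| <= 1.

Local Notation Nb := (Nb rho).
Local Notation Nbm := (Nbm rho).
Local Notation avg := (avg la).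
Local Notation labs := (labs c).

Definition pv (x : X) : F -> R := fun b => p b x.

Lemma pv_pvec x : pvec (pv x). Proof. by split=> [b|]; [exact: p0|exact: p1]. Qed.

Lemma bmf_av dW (W : measurableType dW) (u f : F -> W -> R) :
  (forall b, bmf (u b)) -> (forall b, bmf (f b)) ->
  bmf (fun w => av (fun b => u b w) (fun b => f b w)).
Proof. by move=> bu bf; apply: bmf_sum => b _; exact: bmfM. Qed.

Lemma bmf_kap b : bmf (fun x => kap K (pv x) b).
Proof. by apply: (bmf_av bp) => b'; exact: bmf_cst. Qed.

Lemma bmf_k0 : bmf (fun x => k0 K (pv x)).
Proof. by apply: (bmf_av bp) => b; exact: bmf_kap. Qed.

Lemma bmf_h0 n : bmf (fun x => h0 (h n) (pv x)).
Proof. by apply: (bmf_av bp) => b; exact: bmf_cst. Qed.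

Lemma bmf_psi n : bmf (fun x => psi K (h n) (pv x)).
Proof. by apply: bmfD; [exact: bmf_k0|exact: bmf_h0]. Qed.

Section fixed_sample_size.
Variable n : nat.
Local Notation Om := (n.-tuple E).

Lemma bmf_pattern (Phi : ('I_n -> seq 'I_n) -> Om -> R) :
  (forall nl, bmf (Phi nl)) -> bmf (fun z => Phi (nbs rho (xs z)) z).
Proof.
move=> bPhi.
apply: bmf_ext (bmf_fin (G := fun pat z => Phi (pattern_nbs pat) z)
  (@finobs_pattern _ _ _ prox n) (fun pat => bPhi _)) => z.
by congr (Phi _ z); apply/funext => i; exact: nbs_pattern.
Qed.

Lemma bmf_conf (Phi : {ffun 'I_n -> F} -> ('I_n -> seq 'I_n) -> R) :
  bmf (fun z : Om => Phi (labs z) (nbs rho (xs z))).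
Proof.
apply: (bmf_pattern (Phi := fun nl z => Phi (labs z) nl)) => nl.
exact: (bmf_obs (fun v => Phi v nl) (finobs_labs mc (n := n))).
Qed.

Lemma bmf_q (H : {ffun 'I_n -> F} -> Om -> R) : (forall v, bmf (H v)) ->
  bmf (fun z => q (fun i b => p b (xs z i)) (fun v => H v z)).
Proof.
move=> bH; apply: bmf_sum => v _; apply: bmfM => //.
by apply: bmf_prod => i _; exact: bmf_px.
Qed.

Lemma xfun_xs (T : Type) (G : ('I_n -> X) -> T) : xfun (fun z : Om => G (xs z)).
Proof. by move=> z z' /funext ->. Qed.

Definition tvz k (z : Om) i := tv (pv (xs z i)) (pv (xs z (Nb k z i))).

Definition tvsum (z : Om) := \sum_i (tvz 0 z i + tvz 1 z i + tvz 2 z i).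

Lemma bmf_tvz k i : bmf (fun z => tvz k z i).
Proof.
apply: bmf_sum => b _; apply: bmf_norm; apply: bmfB; first exact: bmf_px.
exact: (bmf_xNb prox k i (bp b)).
Qed.

Lemma bmf_tvsum : bmf tvsum.
Proof.
by apply: bmf_sum => i _; do ?apply: bmfD; exact: bmf_tvz.
Qed.

Lemma tvz_ge0 k z i : 0 <= tvz k z i. Proof. exact: tv_ge0. Qed.

Lemma tvz_le_sum z : \sum_i tvz 0 z i <= tvsum z.
Proof.
by apply: ler_sum => i _; rewrite -addrA lerDl addr_ge0// tvz_ge0.
Qed.

Hypothesis n5 : (4 < n)%N.

Lemma Nb_uniq4 (z : Om) i : uniq [:: i; Nb 0 z i; Nb 1 z i; Nb 2 z i].
Proof.
have e k : (k < 4)%N -> (i == Nb k z i) = false.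
  by move=> k4; rewrite eq_sym; apply/negbTE; exact: Nb_neq.
by rewrite /= !inE !negb_or !e// !Nb_inj.
Qed.

Lemma shr_le (z : Om) i : distinct hd z -> (shr (nbs rho (xs z)) i <= D)%N.
Proof.
move=> dz; apply: leq_trans (hD (Nb 0 z i) (distinct_inj dz)).
apply: subset_leq_card; apply/fintype.subsetP => j /andP[_ /eqP e].
have e' : Nb 0 z j = Nb 0 z i by exact: e.
by rewrite inE -e'; exact: close_Nb.
Qed.

Definition Ssum (z : Om) : R :=
  \sum_i (edge K (labs z) (nbs rho (xs z)) i + h n (labs z i)).

Definition lin (v : {ffun 'I_n -> F}) (x : 'I_n -> X) : R :=
  \sum_i resid K (pv (x i)) (pv (x (Nl (nbs rho x) 0 i))) (v i) (v (Nl (nbs rho x) 0 i)) +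
  \sum_i vertex_term K (h n) (pv (x i)) (indeg (nbs rho x) i)%:R (v i).

Definition Psi (x : 'I_n -> X) : R := \sum_i psi K (h n) (pv (x i)).

Definition mpsi : R := Ex mu (fun e => psi K (h n) (pv e.1)).

Lemma bmf_lin v : bmf (fun z : Om => lin v (xs z)).
Proof.
apply: (bmf_pattern (Phi := fun nl z =>
  \sum_i resid K (pv (xs z i)) (pv (xs z (Nl nl 0 i))) (v i) (v (Nl nl 0 i)) +
  \sum_i vertex_term K (h n) (pv (xs z i)) (indeg nl i)%:R (v i))) => nl.
have bk i b : bmf (fun z : Om => kap K (pv (xs z i)) b) by exact: bmf_xs (bmf_kap b).
have bP i b : bmf (fun z : Om => p b (xs z i)) by exact: bmf_px.
apply: bmfD; apply: bmf_sum => i _.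
  apply: bmfD; last by apply: (bmf_av (bP i)) => b; exact: bk.
  apply: bmfB; last by apply: (bmf_av (bP i)) => b; exact: bmf_cst.
  by apply: bmfB; [exact: bmf_cst|exact: bk].
apply: bmfD.
  apply: bmfM; first exact: bmf_cst.
  by apply: bmfB; [exact: bk|exact: bmf_xs bmf_k0].
by apply: bmfB; [exact: bmf_cst|exact: bmf_xs (bmf_h0 n)].
Qed.

Lemma bmf_Psi : bmf (fun z : Om => Psi (xs z)).
Proof. by apply: bmf_sum => i _; exact: bmf_xs (bmf_psi n). Qed.

Lemma q_lin (z : Om) : q (fun i b => p b (xs z i)) (fun v => lin v (xs z)) = 0.
Proof.
have pU i : pvec (fun b => p b (xs z i)) := pv_pvec (xs z i).
rewrite /lin qD !q_sum !big1 ?addr0// => i _.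
  rewrite (q_av1 pU i (vertex_term K (h n) (pv (xs z i)) (indeg (nbs rho (xs z)) i)%:R)).
  exact: vertex_term_centered.
have ij : i != Nb 0 z i by rewrite eq_sym Nb_neq.
rewrite (q_av2 pU (resid K (pv (xs z i)) (pv (xs z (Nb 0 z i)))) ij).
rewrite -[RHS](av_cst 0 (pU i)); apply: eq_av => b.
by apply: resid_centered2; exact: pv_pvec.
Qed.

Lemma Ex_Psi : Ex (la n) (fun z => Psi (xs z)) = n%:R * mpsi.
Proof.
rewrite Ex_sum; last by move=> i; exact: bmf_xs (bmf_psi n).
rewrite (eq_bigr (fun=> mpsi)) ?sumr_const ?card_ord ?mulr_natl// => i _.
exact: (Ex_single iid i (bmf_fst (bmf_psi n))).
Qed.

Lemma Ex_lin : Ex (la n) (fun z => lin (labs z) (xs z)) = 0.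
Proof.
rewrite (Ex_labels mc bp pc (iid (n := n)) bmf_lin (fun v => xfun_xs _)).
by rewrite -[RHS](Ex_cst (la n)); apply: eq_Ex => z; exact: q_lin.
Qed.

Lemma bmf_lin_labs : bmf (fun z : Om => lin (labs z) (xs z)).
Proof.
exact: (bmf_fin (G := fun v z => lin v (xs z)) (finobs_labs mc (n := n)) bmf_lin).
Qed.

Lemma Ex_Psi_sqr : Ex (la n) (fun z => (Psi (xs z) - n%:R * mpsi) ^+ 2) =
  n%:R * (Ex mu (fun e => psi K (h n) (pv e.1) ^+ 2) - mpsi ^+ 2).
Proof.
pose r (e : E) := psi K (h n) (pv e.1) - mpsi.
have br : bmf r by apply: bmfB; [exact: bmf_fst (bmf_psi n)|exact: bmf_cst].
have bri i : bmf (fun z : Om => r (tnth z i)).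
  by apply: (bmf_comp (phi := fun z : Om => tnth z i) _ br); exact: measurable_tnth.
transitivity (Ex (la n) (fun z => \sum_i \sum_j r (tnth z i) * r (tnth z j))).
  apply: eq_Ex => z.
  have -> : Psi (xs z) - n%:R * mpsi = \sum_i r (tnth z i).
    by rewrite sumrB sumr_const card_ord mulr_natl.
  by rewrite expr2 mulr_suml; apply: eq_bigr => i _; rewrite mulr_sumr.
have bij i j : bmf (fun z : Om => r (tnth z i) * r (tnth z j)) by exact: bmfM.
rewrite Ex_sum; last by move=> i; apply: bmf_sum => j _; exact: bij.
transitivity (\sum_(i < n) Ex mu (fun e => r e ^+ 2)).
  apply: eq_bigr => i _; rewrite Ex_sum; last by move=> j; exact: bij.
  rewrite (bigD1 i)//= big1 ?addr0.
    rewrite -(Ex_single iid i (bmfX 2 br)); apply: eq_Ex => z; by rewrite expr2.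
  move=> j ji; apply: (Ex_centered (iid (n := n)) (k := j)) => // z.
  rewrite /Mk; transitivity (r (tnth z i) * Ex mu r).
    by rewrite -ExZ//; apply: eq_Ex => e; rewrite !tnth_upd eqxx eq_sym (negPf ji).
  rewrite [X in _ * X]ExB ?Ex_cst; [|exact: bmf_fst (bmf_psi n)|exact: bmf_cst].
  by rewrite subrr mulr0.
rewrite sumr_const card_ord mulr_natl; congr (_ *+ n).
exact: (VarE mu (bmf_fst (bmf_psi n))).
Qed.

Lemma bmf_Gam_sum v : bmf (fun z : Om => \sum_i Gam K (h n) v (nbs rho (xs z)) i).
Proof.
by apply: (bmf_pattern (Phi := fun nl z => \sum_i Gam K (h n) v nl i)) => nl; exact: bmf_cst.
Qed.

(** Given the positions, lin is centred: the variance is the mean of the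
    conditional variance plus the variance of Psi. *)
Lemma Var_linearized :
  `|Var (la n) (fun z => lin (labs z) (xs z) + Psi (xs z)) -
    (Ex (la n) (fun z => \sum_i Gam K (h n) (labs z) (nbs rho (xs z)) i) - n%:R * mpsi ^+ 2)|
  <= (60%:R + 9%:R * D%:R) * Ex (la n) tvsum.
Proof.
have bL := bmf_lin_labs; have bPs := bmf_Psi.
have bPm : bmf (fun z : Om => Psi (xs z) - n%:R * mpsi).
  by apply: bmfB => //; exact: bmf_cst.
have bLq v : bmf (fun z : Om => lin v (xs z) ^+ 2) by apply: bmfX; exact: bmf_lin.
have bLP v : bmf (fun z : Om => (lin v (xs z) + (Psi (xs z) - n%:R * mpsi)) ^+ 2).
  by apply: bmfX; apply: bmfD => //; exact: bmf_lin.
have bqL := bmf_q bLq.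
have bqG := bmf_q bmf_Gam_sum.
have eV : Var (la n) (fun z => lin (labs z) (xs z) + Psi (xs z)) =
   Ex (la n) (fun z => q (fun i b => p b (xs z i)) (fun v => lin v (xs z) ^+ 2)) +
   n%:R * (Ex mu (fun e => psi K (h n) (pv e.1) ^+ 2) - mpsi ^+ 2).
  rewrite /Var ExD// Ex_lin Ex_Psi add0r.
  transitivity (Ex (la n) (fun z => (lin (labs z) (xs z) + (Psi (xs z) - n%:R * mpsi)) ^+ 2)).
    by apply: eq_Ex => z; rewrite addrA.
  rewrite (Ex_labels mc bp pc (iid (n := n)) bLP
    (fun v => xfun_xs (fun x => (lin v x + (Psi x - n%:R * mpsi)) ^+ 2))).
  rewrite -Ex_Psi_sqr -ExD//; last exact: bmfX.
  apply: eq_Ex => z.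
  have P1' i : \sum_b p b (xs z i) = 1 by exact: p1.
  rewrite -[X in _ = _ + X](q_cst P1').
  rewrite -qD -[LHS]subr0 -(mulr0 (2 * (Psi (xs z) - n%:R * mpsi))) -(q_lin z) -qZ -qB.
  by apply: eq_q => v; ring.
have eG : Ex (la n) (fun z => \sum_i Gam K (h n) (labs z) (nbs rho (xs z)) i) =
   Ex (la n) (fun z => q (fun i b => p b (xs z i))
        (fun v => \sum_i Gam K (h n) v (nbs rho (xs z)) i)).
  exact: (Ex_labels mc bp pc (iid (n := n)) bmf_Gam_sum
     (fun v => xfun_xs (fun x => \sum_i Gam K (h n) v (nbs rho x) i))).
have bpsq i : bmf (fun z : Om => psi K (h n) (pv (xs z i)) ^+ 2).
  by apply: bmfX; exact: bmf_xs (bmf_psi n).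
have eP : n%:R * Ex mu (fun e => psi K (h n) (pv e.1) ^+ 2) =
    Ex (la n) (fun z => \sum_i psi K (h n) (pv (xs z i)) ^+ 2).
  rewrite Ex_sum// (eq_bigr (fun=> Ex mu (fun e => psi K (h n) (pv e.1) ^+ 2))).
    by rewrite sumr_const card_ord mulr_natl.
  by move=> i _; rewrite -(Ex_single iid i (bmfX 2 (bmf_fst (bmf_psi n)))).
have bpsum : bmf (fun z : Om => \sum_i psi K (h n) (pv (xs z i)) ^+ 2) by apply: bmf_sum.
rewrite eV eG mulrBr eP.
set A := Ex _ _; set B := Ex _ (fun z => \sum_i _ ^+ 2); set C := Ex _ _.
have -> : A + (B - n%:R * mpsi ^+ 2) - (C - n%:R * mpsi ^+ 2) = A - (C - B) by ring.
rewrite /A /B /C -ExB// -ExB//; last exact: bmfB.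
rewrite -ExZ; last exact: bmf_tvsum.
have bdiff : bmf (fun w : Om =>
   q (fun i b => p b (xs w i)) (fun v => lin v (xs w) ^+ 2) -
   (q (fun i b => p b (xs w i)) (fun v => \sum_i Gam K (h n) v (nbs rho (xs w)) i) -
      \sum_i psi K (h n) (pv (xs w i)) ^+ 2)).
  by apply: bmfB => //; exact: bmfB.
apply: (le_trans (Ex_norm _ bdiff)).
apply: (Ex_le_full (full_distinct hd atomless (iid (n := n)))).
- exact: bmf_norm.
- by apply: bmfZ; exact: bmf_tvsum.
move=> z dz; rewrite q_sum.
exact: (conditional_variance_estimator K1 (h1 n) Ksym (U := fun i => pv (xs z i))
   (nl := nbs rho (xs z)) (D := D) (fun i => pv_pvec _) (Nb_uniq4 z) (fun i => shr_le i dz)).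
Qed.

Lemma Ssum_decomp (z : Om) : Ssum z - (lin (labs z) (xs z) + Psi (xs z)) =
  \sum_i err K (pv (xs z i)) (pv (xs z (Nb 0 z i))) (labs z i) (labs z (Nb 0 z i)).
Proof.
pose kb i := kap K (pv (xs z i)) (labs z i) - k0 K (pv (xs z i)).
have -> : lin (labs z) (xs z) = \sum_i (resid K (pv (xs z i)) (pv (xs z (Nb 0 z i)))
    (labs z i) (labs z (Nb 0 z i)) + kb i + kb (Nb 0 z i) +
    (h n (labs z i) - h0 (h n) (pv (xs z i)))).
  have -> : \sum_i (resid K (pv (xs z i)) (pv (xs z (Nb 0 z i)))
    (labs z i) (labs z (Nb 0 z i)) + kb i + kb (Nb 0 z i) +
    (h n (labs z i) - h0 (h n) (pv (xs z i)))) =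
    \sum_i resid K (pv (xs z i)) (pv (xs z (Nb 0 z i))) (labs z i) (labs z (Nb 0 z i)) +
    (\sum_i kb i + \sum_i kb (Nb 0 z i) + \sum_i (h n (labs z i) - h0 (h n) (pv (xs z i)))).
    by rewrite !big_split/= !addrA.
  rewrite /lin; congr (_ + _).
  have -> : \sum_i kb (Nb 0 z i) = \sum_i (indeg (nbs rho (xs z)) i)%:R * kb i.
    by rewrite sum_indeg.
  rewrite -!big_split/=; apply: eq_bigr => i _.
  by rewrite /vertex_term /kb; ring.
rewrite /Ssum /Psi -big_split -sumrB/=; apply: eq_bigr => i _.
by rewrite -(err_decomp (h n) Ksym) /kb /edge -/(Nb 0 z i); ring.
Qed.

Lemma Nbm_neq m k (z : Om) i : i != m -> Nbm m k z i != m.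
Proof.
move=> im; rewrite /Nbm /nb_minus; set s := [seq j <- _ | _].
have [ks|ks] := ltnP k (size s); last by rewrite nth_default.
by have := mem_nth i ks; rewrite mem_filter => /andP[].
Qed.

Lemma free_Nbm_fun m k i (T : Type) (G : 'I_n -> Om -> T) : i != m ->
  (forall j, j != m -> free m (G j)) -> free m (fun z => G (Nbm m k z i) z).
Proof.
by move=> im fG z e; rewrite (free_Nbm prox k im z e) fG// Nbm_neq.
Qed.

Lemma free_xs m i : i != m -> free m (fun z : Om => xs z i).
Proof. by move=> im z e; rewrite xs_upd. Qed.

Lemma free_labs m i : i != m -> free m (fun z : Om => labs z i).
Proof. by move=> im z e; rewrite !ffunE /lab ys_upd. Qed.

(** Each error term depends locally on the sample, and its square is at most a
    multiple of the distance between the label laws of neighbours. *)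
Lemma Var_Ssum_lin :
  Var (la n) (fun z => Ssum z - (lin (labs z) (xs z) + Psi (xs z))) <=
  D.+1%:R * 54%:R * Ex (la n) tvsum.
Proof.
pose phik k i (z : Om) := err K (pv (xs z i)) (pv (xs z (Nb k z i))) (labs z i) (labs z (Nb k z i)).
pose ph j i (z : Om) := err K (pv (xs z i)) (pv (xs z j)) (labs z i) (labs z j).
pose phim m i (z : Om) := ph (Nbm m 0 z i) i z.
have berr j i : bmf (ph j i).
  have bk l b : bmf (fun z : Om => kap K (pv (xs z l)) b) by exact: bmf_xs (bmf_kap b).
  suff bv (v : {ffun 'I_n -> F}) : bmf (fun z : Om =>
      err K (pv (xs z i)) (pv (xs z j)) (v i) (v j)).
    exact: (bmf_fin (finobs_labs mc (n := n)) bv).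
  have bP l b : bmf (fun z : Om => p b (xs z l)) by exact: bmf_px.
  apply: bmfD; last first.
    by apply: bmfB; [exact: bmf_xs bmf_k0|apply: (bmf_av (bP i)) => b; exact: bk].
  by apply: bmfD; apply: bmfB; exact: bk.
have bphi k i : bmf (phik k i).
  exact: (bmf_fin (G := fun j z => ph j i z) (finobs_Nb prox k i) (fun j => berr j i)).
have bphim m i : bmf (phim m i).
  exact: (bmf_fin (G := fun j z => ph j i z) (finobs_Nbm prox m 0 i) (fun j => berr j i)).
have fr m i : i != m -> free m (phim m i).
  move=> im; apply: (free_Nbm_fun 0 (G := fun j z => ph j i z) im) => j jm z e.
  by rewrite /ph !(free_xs im z e) !(free_xs jm z e) !(free_labs im z e) !(free_labs jm z e).
have loc m i z : distinct hd z -> i != m -> ~~ close_to rho z i m -> phik 0 i z = phim m i z.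
  by move=> _ im nc; rewrite /phim /phik /ph Nbm_far.
have -> : (fun z => Ssum z - (lin (labs z) (xs z) + Psi (xs z))) =
   (fun z => \sum_i phik 0 i z) by apply/funext => z; exact: Ssum_decomp.
apply: (le_trans (Efron_Stein_local prox hD atomless (iid (n := n)) (bphi 0) bphim fr loc)).
rewrite -mulrA; apply: ler_wpM2l => //.
have sq k i z : phik k i z ^+ 2 <= 18%:R * tvz k z i.
  by apply: err_sqr => //; exact: pv_pvec.
have bc i m : bmf (fun z : Om => (close_to rho z i m)%:R : R).
  exact: (bmf_obs (fun b : bool => b%:R) (finobs_close prox i m)).
have bt i m : bmf (fun z => (close_to rho z i m)%:R * (phik 0 i z - phim m i z) ^+ 2).
  by apply: bmfM => //; apply: bmfX; exact: bmfB.
have t2 : \sum_m \sum_(i | i != m) Ex (la n) (fun z =>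
      (close_to rho z i m)%:R * (phik 0 i z - phim m i z) ^+ 2) <=
    \sum_i Ex (la n) (fun z => 36%:R * (tvz 0 z i + tvz 1 z i)).
  rewrite (exchange_big_dep predT)//=; apply: ler_sum => i _.
  rewrite -Ex_sum//; apply: Ex_le.
  - by apply: bmf_sum.
  - by apply: bmfZ; apply: bmfD; exact: bmf_tvz.
  move=> z.
  apply: (@le_trans _ _ (\sum_m (Nb 0 z i == m)%:R * (36%:R * (tvz 0 z i + tvz 1 z i)))).
    rewrite big_mkcond/=; apply: ler_sum => m _.
    have T0 := tvz_ge0 0 z i; have T1 := tvz_ge0 1 z i.
    have R0 : 0 <= (Nb 0 z i == m)%:R * (36%:R * (tvz 0 z i + tvz 1 z i)).
      by rewrite !mulr_ge0// addr_ge0.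
    case: ifPn => // im; rewrite /phim Nbm0.
    have [e|ne] := eqVneq (Nb 0 z i) m; last first.
      by rewrite -/(phik 0 i z) subrr expr0n mulr0 mul0r.
    rewrite mul1r -/(phik 1 i z).
    apply: (@le_trans _ _ ((phik 0 i z - phik 1 i z) ^+ 2)).
      by case: (close_to _ _ _ _); rewrite ?mul1r// mul0r sqr_ge0.
    have := sq 0 i z; have := sq 1 i z.
    have := sqr_ge0 (phik 0 i z + phik 1 i z).
    rewrite sqrrB sqrrD.
    by move: (phik 0 i z) (phik 1 i z) (tvz 0 z i) (tvz 1 z i) T0 T1 => *; lra.
  by rewrite -mulr_suml (bigD1 (Nb 0 z i))//= eqxx big1 ?addr0 ?mul1r// => m /negPf; rewrite eq_sym => ->.
have t1 : \sum_i Ex (la n) (fun z => phik 0 i z ^+ 2) <=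
    \sum_i Ex (la n) (fun z => 18%:R * tvz 0 z i).
  apply: ler_sum => i _; apply: Ex_le; [exact: bmfX|by apply: bmfZ; exact: bmf_tvz|].
  by move=> z; exact: sq.
apply: (le_trans (lerD t1 t2)).
have bz k i := bmf_tvz k i.
rewrite -!Ex_sum; [|by move=> i; apply: bmfZ; apply: bmfD|by move=> i; exact: bmfZ].
rewrite -ExD; [|by apply: bmf_sum => i _; exact: bmfZ|by apply: bmf_sum => i _; apply: bmfZ; exact: bmfD].
rewrite -ExZ; last exact: bmf_tvsum.
apply: Ex_le.
- by apply: bmfD; apply: bmf_sum => i _; apply: bmfZ => //; exact: bmfD.
- by apply: bmfZ; exact: bmf_tvsum.
move=> z; rewrite -big_split/= /tvsum mulr_sumr; apply: ler_sum => i _.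
have := tvz_ge0 0 z i; have := tvz_ge0 1 z i; have := tvz_ge0 2 z i.
by move: (tvz 0 z i) (tvz 1 z i) (tvz 2 z i) => *; lra.
Qed.

Lemma bmf_Ssum : bmf Ssum.
Proof. exact: (bmf_conf (fun v nl => \sum_i (edge K v nl i + h n (v i)))). Qed.

Lemma Var_Ssum_bound : Var (la n) Ssum <= 17%:R * D.+1%:R * 2 ^+ 2 * n%:R.
Proof.
pose ph j i (z : Om) := K (labs z i) (labs z j) + h n (labs z i).
have bph j i : bmf (ph j i).
  exact: (bmf_obs (fun v : {ffun 'I_n -> F} => K (v i) (v j) + h n (v i)) (finobs_labs mc (n := n))).
have hb j i z : `|ph j i z| <= 2.
  apply: (le_trans (ler_normD _ _)); rewrite (_ : 2 = 1 + 1 :> R); last by ring.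
  exact: lerD.
apply: (Efron_Stein_local_bounded prox hD atomless (iid (n := n))
  (phi := fun i z => ph (Nb 0 z i) i z) (phim := fun m i z => ph (Nbm m 0 z i) i z)) => //.
- by move=> i; exact: (bmf_fin (G := fun j z => ph j i z) (finobs_Nb prox 0 i)).
- by move=> m i; exact: (bmf_fin (G := fun j z => ph j i z) (finobs_Nbm prox m 0 i)).
- move=> m i im; apply: (free_Nbm_fun 0 (G := fun j z => ph j i z) im) => j jm z e.
  by rewrite /ph !(free_labs im z e) !(free_labs jm z e).
- by move=> m i z _ im nc; rewrite Nbm_far.
Qed.

End fixed_sample_size.

(** The label probabilities are bounded measurable functions of the position,
    so they are nearly equal at neighbours. *)
Lemma small_tvsum : small (fun n => n%:R^-1 * Ex (la n) (@tvsum n)).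
Proof.
have sk k : (k < 4)%N -> small (fun n => avg (fun (i : 'I_n) z => tvz k z i)).
  move=> k4.
  apply: (small_le (m := 0%N) (b := fun n => \sum_b avg (fun (i : 'I_n) z =>
     `|p b (xs z (Nb k z i)) - p b (xs z i)|))); last first.
    by apply: small_sum => b; exact: (local_bmf hd prox hD atomless iid (bp b) k4).
  move=> n _; rewrite /avg -mulr_sumr; apply: ler_wpM2l; first by rewrite invr_ge0.
  rewrite exchange_big/=; apply: ler_sum => i _.
  have bb b := bmf_diff prox k i (bp b).
  rewrite -Ex_sum//; apply: Ex_le; [exact: bmf_tvz|by apply: bmf_sum|].
  by move=> z; apply: ler_sum => b _; rewrite distrC.
have k3 := smallD (smallD (sk 0 isT) (sk 1 isT)) (sk 2 isT).
apply: (small_le (m := 0%N)) k3 => n _.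
rewrite /avg -!mulrDr; apply: ler_wpM2l; first by rewrite invr_ge0.
have bz k i := @bmf_tvz n k i.
rewrite /tvsum Ex_sum; last by move=> i; do ?apply: bmfD.
by rewrite -!big_split/=; apply: ler_sum => i _; rewrite !ExD//; exact: bmfD.
Qed.

Lemma mpsi_bound n : `|mpsi n| <= 2.
Proof.
have bm := bmf_fst (bmf_psi n).
rewrite /mpsi; apply: (le_trans (Ex_norm _ bm)); rewrite -[leRHS](Ex_cst mu).
apply: Ex_le; [exact: bmf_norm|exact: bmf_cst|].
move=> e; rewrite /psi; apply: (le_trans (ler_normD _ _)).
rewrite (_ : 2 = 1 + 1 :> R); last by ring.
by apply: lerD; [apply: k0_bound|apply: h0_bound] => //; exact: pv_pvec.
Qed.

Lemma bmf_edge n (i : 'I_n) : bmf (fun z : n.-tuple E => edge K (labs z) (nbs rho (xs z)) i).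
Proof. exact: (bmf_conf (fun v nl => edge K v nl i)). Qed.

Lemma bmf_hlab n (i : 'I_n) : bmf (fun z : n.-tuple E => h n (labs z i)).
Proof. exact: (bmf_obs (fun v : {ffun 'I_n -> F} => h n (v i)) (finobs_labs mc (n := n))). Qed.

Definition mean_edge n := avg (fun (i : 'I_n) z => edge K (labs z) (nbs rho (xs z)) i).
Definition mean_h n := avg (fun (i : 'I_n) z => h n (labs z i)).
Definition mean_Gam n := avg (fun (i : 'I_n) z => Gam K (h n) (labs z) (nbs rho (xs z)) i).

Lemma mpsi_approx n : (4 < n)%N ->
  `|mpsi n - (mean_edge n + mean_h n)| <= n%:R^-1 * Ex (la n) (@tvsum n).
Proof.
move=> n5; have n0 : (0 : R) < n%:R by rewrite ltr0n; lia.
have pU (z : n.-tuple E) i : pvec (fun b => p b (xs z i)) := pv_pvec (xs z i).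
have bk0 i : bmf (fun z : n.-tuple E => k0 K (pv (xs z i))) by exact: bmf_xs bmf_k0.
have bkk i : bmf (fun z : n.-tuple E => av (pv (xs z i)) (kap K (pv (xs z (Nb 0 z i))))).
  apply: (bmf_av (fun b => bmf_px bp i b)) => b.
  exact: (bmf_xNb prox 0 i (bmf_kap b)).
have eh : mean_h n = Ex mu (fun e => h0 (h n) (pv e.1)).
  rewrite -(avg_single iid (n := n) (bmf_fst (bmf_h0 n))); last by lia.
  rewrite /mean_h /avg; congr (_ * _); apply: eq_bigr => i _.
  have bH v : bmf (fun z : n.-tuple E => h n (v i)) by exact: bmf_cst.
  rewrite (Ex_labels mc bp pc (iid (n := n)) (H := fun (v : {ffun 'I_n -> F}) _ => h n (v i)) bH
     (fun v => xfun_xs (fun=> _))).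
  by apply: eq_Ex => z; exact: (q_av1 (pU z) i (h n)).
have ee : mean_edge n = avg (fun (i : 'I_n) z => av (pv (xs z i)) (kap K (pv (xs z (Nb 0 z i))))).
  rewrite /mean_edge /avg; congr (_ * _); apply: eq_bigr => i _.
  have bH v : bmf (fun z : n.-tuple E => edge K v (nbs rho (xs z)) i).
    by apply: (bmf_pattern (Phi := fun nl z => edge K v nl i)) => nl; exact: bmf_cst.
  rewrite (Ex_labels mc bp pc (iid (n := n)) bH (fun v => xfun_xs (fun x => edge K v (nbs rho x) i))).
  apply: eq_Ex => z; have ij : i != Nb 0 z i by rewrite eq_sym Nb_neq.
  exact: (q_av2 (pU z) K ij).
have ek : Ex mu (fun e => k0 K (pv e.1)) = avg (fun (i : 'I_n) z => k0 K (pv (xs z i))).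
  by rewrite -(avg_single iid (n := n) (bmf_fst bmf_k0)) //; lia.
have em : mpsi n = Ex mu (fun e => k0 K (pv e.1)) + mean_h n.
  by rewrite eh /mpsi /psi ExD//; [exact: bmf_fst bmf_k0|exact: bmf_fst (bmf_h0 n)].
rewrite em ek ee opprD addrACA subrr addr0 /avg -mulrBr normrM ger0_norm ?invr_ge0 ?(ltW n0)//.
apply: ler_wpM2l; first by rewrite invr_ge0 ltW.
rewrite -sumrB; apply: (le_trans (ler_norm_sum _ _ _)).
apply: (@le_trans _ _ (\sum_(i < n) Ex (la n) (fun z => tvz 0 z i))).
  apply: ler_sum => i _; rewrite -ExB//; apply: (le_trans (Ex_norm _ (bmfB (bk0 i) (bkk i)))).
  apply: Ex_le; [by apply: bmf_norm; exact: bmfB|exact: bmf_tvz|].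
  by move=> z; rewrite distrC; apply: kk_tv => //; exact: pv_pvec.
rewrite -Ex_sum; last by move=> i; exact: bmf_tvz.
apply: Ex_le; [by apply: bmf_sum => i _; exact: bmf_tvz|exact: bmf_tvsum|].
by move=> z; exact: tvz_le_sum.
Qed.

Lemma mean_edge_bound n : (4 < n)%N -> `|mean_edge n| <= 1 /\ `|mean_h n| <= 1.
Proof.
move=> n5; have n0 : (0 : R) < n%:R by rewrite ltr0n; lia.
have gen (f : 'I_n -> n.-tuple E -> R) : (forall i, bmf (f i)) ->
    (forall i z, `|f i z| <= 1) -> `|avg f| <= 1.
  move=> bf f1; rewrite /avg normrM ger0_norm ?invr_ge0 ?(ltW n0)//.
  rewrite ler_pdivrMl// mulr1; apply: (le_trans (ler_norm_sum _ _ _)).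
  rewrite -[leRHS](_ : \sum_(i < n) 1 = _); last by rewrite sumr_const card_ord.
  apply: ler_sum => i _; apply: (le_trans (Ex_norm _ (bf i))).
  rewrite -[leRHS](Ex_cst (la n)).
  by apply: Ex_le => //; [exact: bmf_norm|exact: bmf_cst].
by split; apply: gen => i; first [exact: bmf_edge|exact: bmf_hlab|move=> z; exact: K1|move=> z; exact: h1].
Qed.

(** The linearization error is a sum of local terms controlled by the change
    of the label law along edges, which is small on average. *)
Theorem core_variance : small (fun n =>
  `|n%:R^-1 * Var (la n) (@Ssum n) - (mean_Gam n - (mean_edge n + mean_h n) ^+ 2)|).
Proof.
apply: small_approx => e e0.
pose CV : R := 17%:R * D.+1%:R * 2 ^+ 2.
have CV0 : 0 < CV by rewrite !mulr_gt0// ?ltr0n// exprn_gt0.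
pose t : R := Num.min 1 (e / (3 * CV)).
have e3 : 0 < e / (3 * CV) by rewrite divr_gt0// mulr_gt0.
have t01 : 0 < t <= 1 by rewrite lt_min ltr01 e3 /= ge_min lexx.
have te : 3 * t * CV <= e.
  have : t <= e / (3 * CV) by rewrite ge_min lexx orbT.
  rewrite ler_pdivlMr ?mulr_gt0//; lra.
have /andP[t0 _] := t01.
pose C2 : R := 4 / t * (D.+1%:R * 54%:R) + (60%:R + 9%:R * D%:R) + 4.
have C20 : 0 <= C2.
  have t0W := ltW t0; apply: addr_ge0; last exact: ler0n.
  by apply: addr_ge0; [rewrite mulr_ge0 ?divr_ge0 ?mulr_ge0 ?ler0n|rewrite addr_ge0 ?mulr_ge0 ?ler0n].
exists (fun n => C2 * (n%:R^-1 * Ex (la n) (@tvsum n))).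
  exact: (smallZ C20 small_tvsum).
exists 5%N => n n5.
have n0 : (0 : R) < n%:R by rewrite ltr0n; lia.
have bS := @bmf_Ssum n.
have bL : bmf (fun z : n.-tuple E => lin (labs z) (xs z) + Psi (xs z)).
  by apply: bmfD; [exact: bmf_lin_labs|exact: bmf_Psi].
have v1 := Var_close (la n) bL bS t01.
have v2 := Var_Ssum_lin n; have v3 := Var_Ssum_bound n.
have sw : Var (la n) (fun w => lin (labs w) (xs w) + Psi (xs w) - Ssum w) =
     Var (la n) (fun z => Ssum z - (lin (labs z) (xs z) + Psi (xs z))).
  by rewrite /Var; apply: eq_Ex => w; rewrite !ExB//; ring.
rewrite sw in v1.
have w2 := Var_linearized n5.
have eG : n%:R^-1 * Ex (la n) (fun z => \sum_i Gam K (h n) (labs z) (nbs rho (xs z)) i) = mean_Gam n.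
  congr (_ * _); rewrite Ex_sum => [//|i]; exact: (bmf_conf (fun v nl => Gam K (h n) v nl i)).
have w4 : `|mpsi n ^+ 2 - (mean_edge n + mean_h n) ^+ 2| <= 4 * (n%:R^-1 * Ex (la n) (@tvsum n)).
  have m2 := mpsi_bound n; have [m3 m4] := mean_edge_bound n5.
  have m1 := mpsi_approx n5; clear -m1 m2 m3 m4.
  move: (mpsi n) (mean_edge n) (mean_h n) (n%:R^-1 * _) m1 m2 m3 m4 => a b c0 t m1 m2 m3 m4.
  rewrite subr_sqr normrM mulrC; apply: ler_pM => //.
  apply: (le_trans (ler_normD _ _)); rewrite (_ : 4 = 2 + (1 + 1) :> R); last by ring.
  by apply: lerD => //; apply: (le_trans (ler_normD _ _)); exact: lerD.
exact: (rescaled_estimate n0 t0 v1 v2 v3 te w2 eG w4).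
Qed.

End linearized_statistic.

(** * Quantile labels *)

Lemma indic_pred (R : realType) (W : Type) (b : W -> bool) w :
  \1_[set w | b w] w = (b w)%:R :> R.
Proof. by rewrite indicE; congr (nat_of_bool _)%:R; apply/idP/idP; rewrite inE. Qed.

Section distribution_function.
Context {R : realType} {disp : measure_display} {W : measurableType disp}.
Variables (P : probability W R) (Y : W -> R).
Hypothesis mY : measurable_fun setT Y.
Hypothesis aY : forall t, P [set w | Y w = t] = 0%E.

Lemma measurable_below t : measurable [set w | Y w <= t].
Proof.
have := mY measurableT (measurable_itv `]-oo, t]); rewrite setTI.
by congr measurable; apply/seteqP; split => w /=; rewrite in_itv.
Qed.

Definition df (t : R) : R := Ex P \1_[set w | Y w <= t].

Lemma df_incr t t' : t <= t' -> df t' - df t = Ex P \1_[set w | t < Y w <= t'].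
Proof.
move=> tt; rewrite -ExB; try by apply: bmf_indic; exact: measurable_below.
apply: eq_Ex => w; rewrite !indic_pred.
have -> : (Y w <= t') = (Y w <= t) || (t < Y w <= t').
  by case: (leP (Y w) t) => //= h; exact: le_trans h tt.
by case: (leP (Y w) t) => //= h; rewrite ?subrr// subr0.
Qed.

Lemma df_le t t' : t <= t' -> df t <= df t'.
Proof.
by move=> tt; rewrite -subr_ge0 df_incr//; apply: Ex_ge0 => w; rewrite indicE.
Qed.

Lemma measurable_near t e : measurable [set w | `|Y w - t| <= e].
Proof.
have -> : [set w | `|Y w - t| <= e] = Y @^-1` `[t - e, t + e]%classic.
  by apply/seteqP; split => w /=; rewrite in_itv /= ler_distl.
by rewrite -[X in measurable X]setTI; exact: mY.
Qed.

(** The increment between t and a close point is at most the mass of a short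
    interval around t, which shrinks to the mass of t. *)
Lemma df_continuous : continuous df.
Proof.
move=> t; apply/cvgrPdist_le => e e0.
pose A k := [set w | `|Y w - t| <= k.+1%:R^-1].
have [m hm] : exists m, Ex P \1_(A m) <= e.
  apply: shrinking_sets => //; first by move=> k; exact: measurable_near.
    move=> k w /= /le_trans; apply; rewrite lef_pV2 ?posrE ?ltr0n// ler_nat//.
  rewrite (_ : \bigcap_m A m = [set w | Y w = t])//; apply/seteqP; split => w /=; last first.
    by move=> e1 k _; rewrite /A /= e1 subrr normr0 invr_ge0.
  move=> h; apply/eqP; rewrite -subr_eq0 -normr_eq0; apply/eqP/le_anti.
  rewrite normr_ge0 andbT; apply/ler_addgt0Pr => d d0; rewrite add0r.
  have := small_inv (1 : R) d0; case=> n0 /(_ n0.+1 (leqnSn _)); rewrite mul1r.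
  by apply: le_trans; exact: (h n0).
near=> s.
have st : `|t - s| <= m.+1%:R^-1.
  near: s; have /cvgrPdist_le : (fun x : R => x) @ t --> t by exact: cvg_id.
  by apply; rewrite invr_gt0 ltr0n.
apply: le_trans hm.
have inc u v : u <= v -> (t = v \/ t = u) -> `|t - s| = v - u -> `|df t - df s| = df v - df u ->
    `|df t - df s| <= Ex P \1_(A m).
  move=> uv tuv d1 ->; rewrite df_incr//; apply: Ex_le.
  - apply: bmf_indic; have -> : [set w | u < Y w <= v] = [set w | Y w <= v] `\` [set w | Y w <= u].
      by apply/seteqP; split => w /=; [move=> /andP[a ->]; split => //; apply/negP; rewrite -ltNge|
         move=> [-> /negP]; rewrite -ltNge => ->].
    by apply: measurableD; exact: measurable_below.
  - by apply: bmf_indic; exact: measurable_near.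
  move=> w; rewrite !indic_pred; case: (boolP (u < Y w <= v)) => // /andP[uY Yv].
  rewrite (le_trans _ st)// d1.
  by rewrite ler_norml; case: tuv => ->; apply/andP; split; lra.
have [ts|st'] := leP t s.
  apply: (inc t s) => //; [by right|by rewrite distrC ger0_norm// subr_ge0|].
  by rewrite distrC ger0_norm// subr_ge0 df_le.
have {}st' := ltW st'.
apply: (inc s t) => //; [by left|by rewrite ger0_norm// subr_ge0|].
by rewrite ger0_norm// subr_ge0 df_le.
Unshelve. all: by end_near.
Qed.

Lemma df_tails e : 0 < e -> exists a b, [/\ a <= b, df a <= e & 1 - e <= df b].
Proof.
move=> e0.
have [m hm] : exists m : nat, Ex P \1_[set w | Y w <= - m%:R] <= e.
  apply: (@shrinking_sets _ _ _ P (fun m : nat => [set w | Y w <= - m%:R])) => //.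
  - by move=> k; exact: measurable_below.
  - by move=> k w /= /le_trans; apply; rewrite lerN2 ler_nat.
  rewrite (_ : \bigcap_m _ = set0) ?measure0//; apply/seteqP; split => w //= h.
  have := h (Num.trunc `|Y w|).+1 I; rewrite /= lerNr => h'.
  have := truncnS_gt `|Y w|; have := ler_norm (- Y w); rewrite normrN; lra.
have [k hk] : exists k : nat, Ex P \1_(~` [set w | Y w <= k%:R]) <= e.
  apply: (@shrinking_sets _ _ _ P (fun m : nat => ~` [set w | Y w <= m%:R])) => //.
  - by move=> k; apply: measurableC; exact: measurable_below.
  - by move=> k w /= h h'; apply: h; apply: (le_trans h'); rewrite ler_nat.
  rewrite (_ : \bigcap_m _ = set0) ?measure0//; apply/seteqP; split => w //= h.
  apply: (h (Num.trunc `|Y w|).+1 I) => /=.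
  by apply: ltW; apply: le_lt_trans (truncnS_gt `|Y w|); exact: ler_norm.
exists (- m%:R), k%:R; split => //.
  by apply: (@le_trans _ _ 0); rewrite ?oppr_le0 ler0n.
have : Ex P \1_(~` [set w | Y w <= k%:R]) = 1 - df k%:R.
  rewrite -[X in X - _](Ex_cst P) -ExB; [|exact: bmf_cst|exact: bmf_indic (measurable_below _)].
  apply: eq_Ex => w; rewrite !indicE in_setC.
  by case: (w \in _); rewrite /= ?subrr ?subr0.
by move=> h; move: hk; rewrite h; lra.
Qed.

(** By the intermediate value theorem the levels l / m.+1 are masses of lower
    rays; the label of y is the number of these rays that y has left. The two
    extreme levels use the empty set and the whole line. *)
Lemma quantile_labels m : exists c : R -> 'I_m.+2,
  [/\ finobs c, forall y y', y <= y' -> (c y <= c y')%N &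
      forall b : 'I_m.+2, Ex P (fun w => (c (Y w) <= b)%N%:R) = b%:R / m.+1%:R].
Proof.
have m0 : (0 : R) < m.+1%:R by rewrite ltr0n.
have qex (l : nat) : exists U : set R, (l <= m.+1)%N ->
    [/\ measurable U, forall y y', y <= y' -> U y' -> U y,
        l = m.+1 -> U = setT & Ex P \1_[set w | U (Y w)] = l%:R / m.+1%:R].
  have [->|l0] := posnP l.
    exists set0 => _; split => //; rewrite mul0r -[RHS](Ex_cst P).
    by apply: eq_Ex => w; rewrite indicE; case: (boolP (w \in _)) => //; rewrite inE.
  have [lm|lm] := leqP m.+1 l.
    exists setT => lm'; split => //; have -> : l = m.+1 by apply/eqP; rewrite eqn_leq lm lm'.
    rewrite divff ?gt_eqF// -[RHS](Ex_cst P).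
    by apply: eq_Ex => w; rewrite indicE mem_set.
  have e0 : 0 < m.+1%:R^-1 :> R by rewrite invr_gt0.
  have [a [b [ab ha hb]]] := df_tails e0.
  have l1 : m.+1%:R^-1 <= l%:R / m.+1%:R :> R.
    by rewrite ler_pdivlMr// mulVf ?gt_eqF// ler1n.
  have l2 : l%:R / m.+1%:R <= 1 - m.+1%:R^-1 :> R.
    rewrite lerBrDr -[X in _ + X]mul1r -mulrDl ler_pdivrMr// mul1r.
    by rewrite natr1 ler_nat.
  have [q _ hq] : exists2 q, q \in `[a, b]%R & df q = l%:R / m.+1%:R.
    apply: IVT => //; first by apply: continuous_subspaceT; exact: df_continuous.
    rewrite ge_min le_max (le_trans ha l1)/=.
    by rewrite (le_trans l2 hb) orbT.
  exists `]-oo, q]%classic => _; split => //.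
  - by move=> y y' yy; rewrite /= !in_itv /=; exact: le_trans.
  - by move=> e; rewrite e ltnn in lm.
have [U hU] := choice qex.
have Umono l l' y : (l <= l' <= m.+1)%N -> U l y -> U l' y.
  rewrite leq_eqVlt => /andP[/predU1P[->//|ll'] lm'] Uy; apply: contrapT => Uy'.
  have [mU' dU' _ eU'] := hU _ lm'; have [mU dU _ eU] := hU _ (leq_trans (ltnW ll') lm').
  have : (l'%:R / m.+1%:R : R) <= l%:R / m.+1%:R.
    rewrite -eU -eU'; apply: Ex_le.
    - by apply: bmf_indic; rewrite -[X in measurable X]setTI; exact: mY.
    - by apply: bmf_indic; rewrite -[X in measurable X]setTI; exact: mY.
    move=> w; rewrite !indicE; case: (boolP (w \in [set w | U l' (Y w)])) => //; rewrite inE /= => h.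
    rewrite mem_set//=; apply: dU Uy; rewrite leNgt; apply/negP => yw; apply: Uy'.
    exact: dU' (ltW yw) h.
  by rewrite ler_pM2r ?invr_gt0// ler_nat leqNgt ll'.
have cl y : (\sum_(l < m.+1) (y \notin U l) < m.+2)%N.
  rewrite ltnS; apply: leq_trans (_ : \sum_(l < m.+1) 1 <= _)%N.
    by apply: leq_sum => l _; case: (_ \notin _).
  by rewrite sum1_card card_ord.
pose c y : 'I_m.+2 := Ordinal (cl y).
have cE y (b : 'I_m.+2) : (c y <= b)%N = (y \in U b).
  have cnt (k : nat) : (\sum_(l < m.+1) (l < k)%N = minn k m.+1)%N.
    elim: (m.+1) => [|j ih]; first by rewrite big_ord0 minn0.
    by rewrite big_ord_recr /= ih; lia.
  have bm : (b <= m.+1)%N by rewrite -ltnS.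
  have [Ub|Ub] := boolP (y \in U b).
    rewrite /c /=; apply: leq_trans (_ : \sum_(l < m.+1) (l < b)%N <= _)%N; last first.
      by rewrite cnt geq_minl.
    apply: leq_sum => l _; have [lb|bl] := ltnP l b; first by case: (_ \notin _).
    rewrite mem_set//; apply: (Umono b); first by rewrite bl ltnW.
    by move: Ub; rewrite inE.
  have bm' : (b < m.+1)%N.
    rewrite ltn_neqAle bm andbT; apply/eqP => e.
    have [_ _ /(_ e) h _] := hU _ bm; by move/negP: Ub; apply; rewrite h inE.
  apply/negbTE; rewrite -ltnNge /c /=.
  apply: leq_trans (_ : (\sum_(l < m.+1) (l < b.+1)%N <= _))%N; first by rewrite cnt; lia.
  apply: leq_sum => l _; have [lb|//] := ltnP l b.+1.
  suff -> : y \notin U l by [].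
  apply/negP; rewrite inE => h; move/negP: Ub; apply; rewrite inE.
  by apply: Umono h; rewrite -ltnS lb.
have mUb (b : 'I_m.+2) : measurable (U b) by have [] := hU b (leq_ord b).
exists c; split.
- move=> b; have -> : c @^-1` [set b] =
      U b `&` \big[setI/setT]_(b' : 'I_m.+2 | (b' < b)%N) ~` U b'.
    apply/seteqP; split => y; rewrite -bigcap_seq_cond /=.
      move=> cb; split; first by have := cE y b; rewrite cb leqnn => /esym/set_mem.
      move=> b' /= /andP[_ b'b] h; have := cE y b'; rewrite cb (mem_set h).
      by rewrite leqNgt b'b.
    move=> [Ub h]; apply/val_inj/eqP; rewrite eqn_leq [X in X && _](cE y b) mem_set//= leqNgt.
    apply/negP => lt; apply: (h (c y)) => /=; first by rewrite mem_index_enum.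
    by have := cE y (c y); rewrite leqnn => /esym/set_mem.
  apply: measurableI => //; apply: bigsetI_measurable => b' _; exact: measurableC.
- move=> y y' yy; have := cE y' (c y'); rewrite leqnn => /esym/set_mem.
  move=> h; rewrite cE mem_set//; have [_ dU _ _] := hU _ (leq_ord (c y')); exact: dU h.
move=> b; have [_ _ _ <-] := hU _ (leq_ord b).
by apply: eq_Ex => w; rewrite cE indicE; congr (nat_of_bool _)%:R; apply/idP/idP; rewrite !inE.
Qed.

End distribution_function.

(** * Null sets of a continuous joint distribution *)

Lemma ball_shift (R : realType) (t r : R) : 0 < r -> ball t r (t - r / 2).
Proof.
move=> r0; rewrite /ball /= (_ : t - (t - r / 2) = r / 2); last by ring.
by rewrite ger0_norm; lra.
Qed.

Section continuous_joint_distribution.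
Context {R : realType} {d : nat} {disp : measure_display} {W : measurableType disp}.
Variables (P : probability W R) (X : {RV P >-> d.-tuple R}) (Y : {RV P >-> R}).
Hypothesis hF : continuous (joint_cdf X Y).

Definition orthant (z : 'rV[R]_d * R) : set W := [set w | (forall k : 'I_d, tnth (X w) k <= z.1 ord0 k) /\ Y w <= z.2].

Lemma measurable_orthant (z : 'rV[R]_d * R) : measurable (orthant z).
Proof.
have -> : orthant z = \big[setI/setT]_(k : 'I_d) [set w | tnth (X w) k <= z.1 ord0 k]
    `&` [set w | Y w <= z.2].
  apply/seteqP; split => w; rewrite -bigcap_seq /=.
    by move=> [h1 h2]; split => // k _; exact: h1.
  by move=> [h1 h2]; split => // k; apply: h1; exact: mem_index_enum.
apply: measurableI; last exact: measurable_below.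
apply: bigsetI_measurable => k _; apply: measurable_below.
by apply: (measurableT_comp (measurable_tnth k)).
Qed.

Lemma orthant_exhaust e : 0 < e -> exists m : nat,
  Ex P \1_(~` orthant (const_mx m%:R : 'rV[R]_d, m%:R : R)) <= e.
Proof.
apply: (@shrinking_sets _ _ _ P
  (fun m : nat => ~` orthant (const_mx m%:R : 'rV[R]_d, m%:R : R))) => //.
- by move=> m; apply: measurableC; exact: measurable_orthant.
- move=> m w /= h [h1 h2]; apply: h; split => [k|].
    by have := h1 k; rewrite !mxE => /le_trans; apply; rewrite ler_nat.
  by apply: (le_trans h2); rewrite ler_nat.
rewrite (_ : \bigcap_m _ = set0) ?measure0//; apply/seteqP; split => w //= h.
apply: (h (\max_(k < d) (Num.trunc `|tnth (X w) k|).+1 + (Num.trunc `|Y w|).+1)%N I) => /=.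
have tr (a : R) (m : nat) : (Num.trunc `|a| < m)%N -> a <= m%:R.
  move=> h'; apply: ltW; apply: le_lt_trans (ler_norm a) _.
  by apply: lt_le_trans (truncnS_gt `|a|) _; rewrite ler_nat.
split => [k|]; last by apply: tr; lia.
rewrite mxE; apply: tr; apply: leq_trans (leq_addr _ _).
exact: (leq_bigmax (F := fun k => (Num.trunc `|tnth (X w) k|).+1) k).
Qed.

(** A set which can be separated from arbitrarily close lower orthants is null:
    its mass inside a large orthant is an increment of the distribution
    function. *)
Lemma null_of_separated (N : set W) : measurable N ->
  (forall m : nat, exists z0 : 'rV[R]_d * R,
     N `&` orthant (const_mx m%:R : 'rV[R]_d, m%:R : R) `<=` orthant z0 /\
     forall r, 0 < r -> exists z, [/\ ball z0 r z, N `&` orthant z = set0 &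
       orthant z `<=` orthant z0]) -> P N = 0%E.
Proof.
move=> mN sep; rewrite -Ex_indicE//; congr EFin; apply/le_anti.
rewrite [X in _ && X]Ex_ge0 => [|w]; last by rewrite indicE.
rewrite andbT; apply/ler_addgt0Pr => e e0; rewrite add0r.
have e2 : 0 < e / 2 by rewrite divr_gt0.
have [m hm] := orthant_exhaust e2.
set B := orthant _ in hm *.
have mB : measurable B by exact: measurable_orthant.
have [z0 [Nz sz]] := sep m.
have /cvgrPdist_le /(_ _ e2) /nbhs_ballP [r /= r0 hr] := hF (x := z0).
have [z [bz Nz' zz]] := sz r r0; have := hr z bz.
have JE y : joint_cdf X Y y = Ex P \1_(orthant y).
  by rewrite Ex_indic//; exact: measurable_orthant.
have bo y : bmf (\1_(orthant y) : W -> R) by apply: bmf_indic; exact: measurable_orthant.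
rewrite !JE -ExB// => /(le_trans (ler_norm _)) h.
apply: (@le_trans _ _ (Ex P (fun w => (\1_(orthant z0) w - \1_(orthant z) w) + \1_(~` B) w))).
  apply: Ex_le => [||w]; first exact: bmf_indic.
    by apply: bmfD; [apply: bmfB|apply: bmf_indic; exact: measurableC].
  have z01 : \1_(orthant z) w <= \1_(orthant z0) w :> R.
    rewrite !indicE; case: (boolP (w \in orthant z)) => // /set_mem /zz /mem_set ->//.
  have [Nw|Nw] := pselect (N w); last first.
    by rewrite [X in X <= _]indicE memNset//= addr_ge0 ?subr_ge0// indicE.
  have zw : \1_(orthant z) w = 0 :> R.
    rewrite indicE memNset// => oz; have : (N `&` orthant z) w by [].
    by rewrite Nz'.
  rewrite zw subr0 [X in X <= _]indicE mem_set//=.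
  have [Bw|Bw] := pselect (B w).
    have zw0 : orthant z0 w by apply: Nz.
    by rewrite [\1_(orthant z0) w]indicE (mem_set zw0) lerDl indicE.
  have Bw' : (~` B) w by [].
  by rewrite [\1_(~` B) w]indicE (mem_set Bw') lerDr indicE.
rewrite ExD; [|by apply: bmfB|by apply: bmf_indic; exact: measurableC]; lra.
Qed.

Lemma atomless_response t : P [set w | Y w = t] = 0%E.
Proof.
apply: null_of_separated => [|m].
  have := measurable_funP Y measurableT [set t] (measurable_set1 t); rewrite setTI.
  by congr measurable.
exists (const_mx m%:R, t); split; first by move=> w /= [e [h _]]; split; rewrite //= e.
move=> r r0; exists (const_mx m%:R, t - r / 2); split.
- split => /=; first exact: ballxx.
  exact: ball_shift.
- apply/seteqP; split => w //= [e [_ /=]]; rewrite e; lra.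
- by move=> w [/= h1 h2]; split => //=; lra.
Qed.

Lemma atomless_position k t : P [set w | tnth (X w) k = t] = 0%E.
Proof.
apply: null_of_separated => [|m].
  have mk : measurable_fun setT (fun w => tnth (X w) k).
    by apply: (measurableT_comp (measurable_tnth k)).
  by have := mk measurableT [set t] (measurable_set1 t); rewrite setTI.
exists (\row_j (if j == k then t else m%:R), m%:R); split.
  move=> w /= [h0 [h1 h2]]; split => //= j; rewrite mxE; case: eqP => [->|_]; first by rewrite h0.
  by have := h1 j; rewrite mxE.
move=> r r0; exists (\row_j (if j == k then t - r / 2 else m%:R), m%:R); split.
- split => /=; last exact: ballxx.
  split => // i j; rewrite !mxE; case: eqP => _; last exact: ballxx.
  exact: ball_shift.
- apply/seteqP; split => w //= [h0 [/(_ k)]]; rewrite mxE eqxx h0; lra.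
- move=> w [/= h1 h2]; split => //= j; have := h1 j; rewrite !mxE; case: eqP => _ //; lra.
Qed.

End continuous_joint_distribution.

(** * Rank statistics of a finite sample *)

Section variance_form.
Context {R : realType}.
Implicit Types a b c e h : R.

Definition gform (m s a b c e h : R) : R :=
  a ^+ 2 * (1 + m) + a * b * (2 * (1 - m) + s) - a * c * (1 + (1 - m) + s)
  + 4 * (h * a) - 2 * (h * e) + h ^+ 2.

Lemma mul_close (x y x' y' t : R) : `|y| <= 1 -> `|x'| <= 1 ->
  `|x - x'| <= t -> `|y - y'| <= t -> `|x * y - x' * y'| <= 2 * t.
Proof.
move=> hy hx dx dy.
have -> : x * y - x' * y' = (x - x') * y + x' * (y - y') by ring.
rewrite mulr_natl mulr2n; apply: (le_trans (ler_normD _ _)); apply: lerD; rewrite normrM.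
  by rewrite -[leRHS]mulr1; apply: ler_pM.
by rewrite -[leRHS]mul1r; apply: ler_pM.
Qed.

Lemma gform_close (m : bool) (s B a b c e h a' b' c' e' h' t : R) : 0 <= s <= B ->
  `|a| <= 1 -> `|b| <= 1 -> `|c| <= 1 -> `|e| <= 1 -> `|h| <= 1 ->
  `|a'| <= 1 -> `|h'| <= 1 ->
  `|a - a'| <= t -> `|b - b'| <= t -> `|c - c'| <= t -> `|e - e'| <= t -> `|h - h'| <= t ->
  `|gform m%:R s a b c e h - gform m%:R s a' b' c' e' h'| <= (26 + 4 * B) * t.
Proof.
move=> /andP[s0 sB] a1 b1 c1 e1 h1 a1' h1' da db dc de dh.
have t0 : 0 <= t := le_trans (normr_ge0 _) da.
have w0 : 0 <= (m%:R : R) <= 1 by case: (m); rewrite ?lexx ?ler01.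
have sc (x w W : R) : `|x| <= 2 * t -> 0 <= w -> w <= W -> `|x * w| <= W * (2 * t).
  by move=> hx w0' wW; rewrite normrM (ger0_norm w0') mulrC; apply: ler_pM.
have p1 := mul_close a1 a1' da da; have p2 := mul_close b1 a1' da db.
have p3 := mul_close c1 a1' da dc; have p4 := mul_close a1 h1' dh da.
have p5 := mul_close e1 h1' dh de; have p6 := mul_close h1 h1' dh dh.
case/andP: w0 => m0 m1.
have [v1 v2] : 0 <= 1 + m%:R :> R /\ 1 + m%:R <= 2 :> R by move: m0 m1; clear; split; lra.
have [v3 v4] : 0 <= 2 * (1 - m%:R) + s /\ 2 * (1 - m%:R) + s <= 2 + B.
  by move: m0 m1 s0 sB; clear; split; lra.
have [v5 v6] : 0 <= 1 + (1 - m%:R) + s /\ 1 + (1 - m%:R) + s <= 2 + B.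
  by move: m0 m1 s0 sB; clear; split; lra.
have q1 := sc _ _ _ p1 v1 v2.
have q2 := sc _ _ _ p2 v3 v4.
have q3 := sc _ _ _ p3 v5 v6.
have -> : gform m%:R s a b c e h - gform m%:R s a' b' c' e' h' =
   (a * a - a' * a') * (1 + m%:R) + (a * b - a' * b') * (2 * (1 - m%:R) + s)
   - (a * c - a' * c') * (1 + (1 - m%:R) + s) + 4 * (h * a - h' * a')
   - 2 * (h * e - h' * e') + (h * h - h' * h') by rewrite /gform; ring.
rewrite (_ : (26 + 4 * B) * t = 2 * (2 * t) + (2 + B) * (2 * t) + (2 + B) * (2 * t)
   + 4 * (2 * t) + 2 * (2 * t) + 2 * t); last by ring.
move: q1 q2 q3 p4 p5 p6.
move: (_ * (1 + m%:R)) (_ * (2 * _ + s)) (_ * (1 + (1 - m%:R) + s)) ((2 + B) * (2 * t))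
  (h * a - h' * a') (h * e - h' * e') (h * h - h' * h') => x1 x2 x3 x5 x6 x7 x8.
clear; rewrite !ler_norml => /andP[? ?] /andP[? ?] /andP[? ?] /andP[? ?] /andP[? ?] /andP[? ?].
by apply/andP; split; lra.
Qed.

End variance_form.

Section ranks.
Context {R : realType} {n : nat}.
Variable y : 'I_n -> R.

Lemma leq_rank i j : (rank y i <= rank y j)%N = (y i <= y j).
Proof.
have mono k l : y k <= y l -> (rank y k <= rank y l)%N.
  move=> kl; apply: leq_sum => j' _; case: (leP (y j') (y k)) => // h.
  by rewrite (le_trans h kl).
have [ij|ji] := leP (y i) (y j); first exact: mono.
apply/negbTE; rewrite -ltnNge /rank (bigD1 i)//= [X in (_ < X)%N](bigD1 i)//=.
rewrite lexx leNgt ji add0n add1n ltnS; apply: leq_sum => k _.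
by case: (leP (y k) (y j)) => // h; rewrite (le_trans h (ltW ji)).
Qed.

Lemma rank_le i : (rank y i <= n)%N.
Proof.
rewrite -[leqRHS]card_ord -sum1_card; apply: leq_sum => j _; exact: leq_b1.
Qed.

Lemma rank_count i : (\sum_(l < n) (rank y l <= rank y i)%N)%N = rank y i.
Proof. by apply: eq_bigr => l _; rewrite leq_rank. Qed.

Lemma minn_rankE i j : minn (rank y i) (rank y j) = (\sum_(l < n) ((y l <= y i)%R && (y l <= y j)%R))%N.
Proof.
wlog ij : i j / y i <= y j.
  move=> H; have [/H//|/ltW /H] := leP (y i) (y j); rewrite minnC => ->.
  by apply: eq_bigr => l _; rewrite andbC.
have := ij; rewrite -leq_rank => /minn_idPl ->; apply: eq_bigr => l _.
by case: leP => // h; rewrite (le_trans h ij).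
Qed.

Lemma sum_rank : injective y -> (2 * \sum_i rank y i = n ^ 2 + n)%N.
Proof.
move=> iy; have ex : (\sum_i rank y i = \sum_(i < n) \sum_(j < n) (y i <= y j)%R)%N.
  by rewrite /rank exchange_big.
rewrite mul2n -addnn {2}ex /rank -big_split/=.
transitivity (\sum_(i < n) \sum_(j < n) (1 + (i == j)))%N.
  apply: eq_bigr => i _; rewrite -big_split/=; apply: eq_bigr => j _.
  have [->|ij] := eqVneq i j; first by rewrite lexx.
  have : y i != y j by apply/eqP => e; move: (ij); rewrite (iy _ _ e) eqxx.
  by case: (ltgtP (y i) (y j)).
have one i : (\sum_(j < n) (1 + (i == j)) = n + 1)%N.
  rewrite big_split/= sum1_card card_ord (bigD1 i)//= eqxx big1 ?addn0// => j.
  by rewrite eq_sym => /negPf ->.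
by rewrite (eq_bigr _ (fun i _ => one i)) sum_nat_const card_ord; lia.
Qed.

End ranks.

Section rank_statistics.
Context {R : realType} {n : nat}.
Variables (r : 'I_n -> nat) (N0 N1 N2 : 'I_n -> 'I_n) (w : 'I_n -> bool) (s : 'I_n -> nat).
Local Notation n1 := (n%:R : R).

Definition mr i j : R := (minn (r i) (r j))%:R / n1.
Definition Hr l : R := (\sum_i (r l <= minn (r i) (r (N0 i)))%N%:R) / n1.

Definition GR : R :=
  n1^-1 * \sum_i gform (w i)%:R (s i)%:R (mr i (N0 i)) (mr i (N1 i)) (mr (N1 i) (N2 i))
    (mr (N0 i) (N1 i)) (Hr i)
  - 4 * (n1^-1 * \sum_i mr i (N0 i)) ^+ 2.

Definition sig : R :=
    1 / n1 ^+ 3 *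
      (\sum_(i < n) (minn (r i) (r (N0 i)))%:R ^+ 2 * (1 + (w i)%:R))
  + 1 / n1 ^+ 3 *
      (\sum_(i < n) (minn (r i) (r (N0 i)))%:R * (minn (r i) (r (N1 i)))%:R
         * (2 * (~~ w i)%:R + (s i)%:R))
  - 1 / n1 ^+ 3 *
      (\sum_(i < n) (minn (r i) (r (N0 i)))%:R
         * (minn (r (N1 i)) (r (N2 i)))%:R
         * (1 + (~~ w i)%:R + (s i)%:R))
  + 4 / (n1 ^+ 2 * (n1 - 1)) *
      (\sum_(i < n) \sum_(j < n | i != j)
         (r i <= minn (r j) (r (N0 j)))%N%:R * (minn (r i) (r (N0 i)))%:R)
  - 2 / (n1 ^+ 2 * (n1 - 1)) *
      (\sum_(i < n) \sum_(j < n | i != j)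
         (r i <= minn (r j) (r (N0 j)))%N%:R
         * (minn (r (N0 i)) (r (N1 i)))%:R)
  + 1 / (n1 ^+ 2 * (n1 - 1)) *
      (\sum_(i < n) \sum_(j < n | i != j)
         (minn (minn (r i) (r (N0 i))) (minn (r j) (r (N0 j))))%:R)
  - 4 * (1 / n1 ^+ 2 * \sum_(i < n) (minn (r i) (r (N0 i)))%:R) ^+ 2.

Hypothesis n2 : (1 < n)%N.
Hypothesis rn : forall i, (r i <= n)%N.
Hypothesis rc : forall i, (\sum_(l < n) (r l <= r i)%N)%N = r i.

Let n0 : n1 != 0. Proof. by rewrite pnatr_eq0; lia. Qed.
Let np : 0 < n1. Proof. by rewrite ltr0n; lia. Qed.

Lemma mr_bound i j : 0 <= mr i j <= 1.
Proof.
rewrite divr_ge0//= ler_pdivrMr// mul1r ler_nat; apply: leq_trans (rn i); exact: geq_minl.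
Qed.

Lemma mr_norm i j : `|mr i j| <= 1.
Proof. by have /andP[a b] := mr_bound i j; rewrite ger0_norm. Qed.

Lemma Hr_bound l : 0 <= Hr l <= 1.
Proof.
rewrite divr_ge0//= ?sumr_ge0// ler_pdivrMr// mul1r -[X in _ <= X%:R]card_ord -sumr_const.
by apply: ler_sum => i _; case: (_ <= _)%N.
Qed.

Lemma Hr_norm l : `|Hr l| <= 1.
Proof. by have /andP[a b] := Hr_bound l; rewrite ger0_norm. Qed.

Let a i := minn (r i) (r (N0 i)).
Let q l i : bool := (r l <= a i)%N.

Lemma count_below (m : nat) i : m = r i -> (\sum_(l < n) (r l <= m)%N%:R) = m%:R :> R.
Proof. by move=> ->; rewrite -[in RHS]rc natr_sum. Qed.

Lemma min_of_ranks i j : exists k, minn (r i) (r j) = r k.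
Proof. by case: (leqP (r i) (r j)) => _; [exists i|exists j]. Qed.

Lemma sum_Hr : \sum_l Hr l = \sum_i mr i (N0 i).
Proof.
rewrite /Hr /mr -!mulr_suml exchange_big/=; congr (_ / _); apply: eq_bigr => i _.
by have [k e] := min_of_ranks i (N0 i); rewrite (count_below e).
Qed.

(** Both sides count the triples (l, i, j) such that the rank of l is below the
    minima at i and at j. *)
Lemma sum_min_min : \sum_i \sum_j (minn (a i) (a j))%:R = n1 ^+ 2 * \sum_l Hr l ^+ 2.
Proof.
have -> : n1 ^+ 2 * \sum_l Hr l ^+ 2 = \sum_l \sum_i \sum_j (q l i)%:R * (q l j)%:R.
  rewrite mulr_sumr; apply: eq_bigr => l _; rewrite -exprMn /Hr mulrC divfK// expr2 mulr_suml.
  by apply: eq_bigr => i _; rewrite mulr_sumr.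
rewrite [RHS]exchange_big/=; apply: eq_bigr => i _; rewrite [RHS]exchange_big/=; apply: eq_bigr => j _.
have [k e] : exists k, minn (a i) (a j) = r k.
  have [k e] := min_of_ranks i (N0 i); have [k' e'] := min_of_ranks j (N0 j).
  by rewrite /a e e'; exact: min_of_ranks.
rewrite -(count_below e); apply: eq_bigr => l _; rewrite -natrM mulnb; congr (nat_of_bool _)%:R.
by rewrite /q leq_min.
Qed.

Lemma sum_off_diagonal i (e : R) :
  \sum_(j < n | i != j) (q i j)%:R * e = (n1 * Hr i - (q i i)%:R) * e.
Proof.
rewrite -mulr_suml; congr (_ * _); rewrite /Hr [n1 * _]mulrC divfK// [in RHS](bigD1 i)//= [RHS]addrC addKr.
by apply: eq_bigl => j; rewrite eq_sym.
Qed.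

Lemma sum_le_n (f : 'I_n -> R) (B : R) : (forall i, `|f i| <= B) -> `|\sum_i f i| <= n1 * B.
Proof.
move=> fB; apply: (le_trans (ler_norm_sum _ _ _)).
by rewrite mulr_natl -[X in _ *+ X]card_ord -sumr_const; apply: ler_sum.
Qed.

(** Replacing the sums over distinct pairs by full double sums. *)
Lemma sig_GR : `|sig - GR| <= 7 / (n1 - 1).
Proof.
have n11 : 0 < n1 - 1 by rewrite subr_gt0 ltr1n.
have n1n : n1 - 1 != 0 by rewrite gt_eqF.
have mE i j : (minn (r i) (r j))%:R = n1 * mr i j by rewrite mulrC divfK.
pose m0 i := mr i (N0 i); pose me i := mr (N0 i) (N1 i).
pose X4 := \sum_i (Hr i * m0 i - (q i i)%:R * m0 i).
pose X5 := \sum_i (Hr i * me i - (q i i)%:R * me i).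
pose X6 := \sum_i (Hr i ^+ 2 - m0 i).
have key : sig - GR = (4 * X4 - 2 * X5 + X6) / (n1 * (n1 - 1)).
  have t4 : \sum_(i < n) \sum_(j < n | i != j)
         (r i <= minn (r j) (r (N0 j)))%N%:R * (minn (r i) (r (N0 i)))%:R =
      n1 ^+ 2 * (\sum_i Hr i * m0 i) - n1 * \sum_i (q i i)%:R * m0 i.
    rewrite !mulr_sumr -sumrB; apply: eq_bigr => i _.
    by rewrite (sum_off_diagonal i) mE -/(m0 i); ring.
  have t5 : \sum_(i < n) \sum_(j < n | i != j)
         (r i <= minn (r j) (r (N0 j)))%N%:R * (minn (r (N0 i)) (r (N1 i)))%:R =
      n1 ^+ 2 * (\sum_i Hr i * me i) - n1 * \sum_i (q i i)%:R * me i.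
    rewrite !mulr_sumr -sumrB; apply: eq_bigr => i _.
    by rewrite (sum_off_diagonal i) mE -/(me i); ring.
  have t6 : \sum_(i < n) \sum_(j < n | i != j)
         (minn (minn (r i) (r (N0 i))) (minn (r j) (r (N0 j))))%:R =
      n1 ^+ 2 * (\sum_i Hr i ^+ 2) - n1 * \sum_i m0 i.
    rewrite -sum_min_min mulr_sumr -sumrB; apply: eq_bigr => i _.
    rewrite [in RHS](bigD1 i)//= minnn -mE [RHS]addrC addKr.
    by apply: eq_bigl => j; rewrite eq_sym.
  have t1 : \sum_(i < n) (minn (r i) (r (N0 i)))%:R ^+ 2 * (1 + (w i)%:R) =
      n1 ^+ 2 * \sum_i m0 i ^+ 2 * (1 + (w i)%:R).
    by rewrite mulr_sumr; apply: eq_bigr => i _; rewrite mE exprMn mulrA.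
  have nw i : (~~ w i)%:R = 1 - (w i)%:R :> R by case: (w i); rewrite ?subrr ?subr0.
  have t2 : \sum_(i < n) (minn (r i) (r (N0 i)))%:R * (minn (r i) (r (N1 i)))%:R
         * (2 * (~~ w i)%:R + (s i)%:R) =
      n1 ^+ 2 * \sum_i m0 i * mr i (N1 i) * (2 * (1 - (w i)%:R) + (s i)%:R).
    by rewrite mulr_sumr; apply: eq_bigr => i _; rewrite !mE nw /m0; ring.
  have t3 : \sum_(i < n) (minn (r i) (r (N0 i)))%:R * (minn (r (N1 i)) (r (N2 i)))%:R
         * (1 + (~~ w i)%:R + (s i)%:R) =
      n1 ^+ 2 * \sum_i m0 i * mr (N1 i) (N2 i) * (1 + (1 - (w i)%:R) + (s i)%:R).
    by rewrite mulr_sumr; apply: eq_bigr => i _; rewrite !mE nw /m0; ring.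
  have t7 : \sum_(i < n) (minn (r i) (r (N0 i)))%:R = n1 * \sum_i m0 i.
    by rewrite mulr_sumr; apply: eq_bigr => i _; rewrite mE.
  rewrite /sig t1 t2 t3 t4 t5 t6 t7 /GR.
  have -> : \sum_i gform (w i)%:R (s i)%:R (mr i (N0 i)) (mr i (N1 i)) (mr (N1 i) (N2 i))
    (mr (N0 i) (N1 i)) (Hr i) =
    \sum_i m0 i ^+ 2 * (1 + (w i)%:R) + \sum_i m0 i * mr i (N1 i) * (2 * (1 - (w i)%:R) + (s i)%:R)
    - \sum_i m0 i * mr (N1 i) (N2 i) * (1 + (1 - (w i)%:R) + (s i)%:R)
    + 4 * \sum_i Hr i * m0 i - 2 * \sum_i Hr i * me i + \sum_i Hr i ^+ 2.
    by rewrite ![_ * \sum_i Hr i * _]mulr_sumr -big_split -sumrB -big_split -sumrB -big_split.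
  rewrite -/(m0 _) /X4 /X5 /X6 !sumrB.
  move: (\sum_i m0 i ^+ 2 * _) (\sum_i m0 i * mr i _ * _) (\sum_i m0 i * mr (N1 i) _ * _).
  move: (\sum_i Hr i * m0 i) (\sum_i Hr i * me i) (\sum_i Hr i ^+ 2) (\sum_i _ * m0 i) (\sum_i _ * me i).
  have -> : \sum_i mr i (N0 i) = \sum_i m0 i by [].
  move: (\sum_i m0 i) => x1 x2 x3 x4 x5 x6 x7 x8 x9; field.
  by rewrite n0 n1n.
have qb (x h : R) (b : bool) : 0 <= x <= 1 -> 0 <= h <= 1 -> `|h * x - b%:R * x| <= 1.
  move=> /andP[x0 x1] /andP[h0 h1]; rewrite -mulrBl normrM (ger0_norm x0) -[leRHS]mulr1.
  apply: ler_pM => //; rewrite ler_norml; case: b => /=; apply/andP; split; lra.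
have b4 : `|X4| <= n1 * 1 by apply: sum_le_n => i; apply: qb; [exact: mr_bound|exact: Hr_bound].
have b5 : `|X5| <= n1 * 1 by apply: sum_le_n => i; apply: qb; [exact: mr_bound|exact: Hr_bound].
have b6 : `|X6| <= n1 * 1.
  apply: sum_le_n => i; have /andP[m1 m2] := mr_bound i (N0 i); have /andP[h1 h2] := Hr_bound i.
  have h3 : Hr i ^+ 2 <= 1 by rewrite exprn_ile1.
  have h4 := sqr_ge0 (Hr i).
  by rewrite ler_norml /m0; apply/andP; split; lra.
rewrite key normrM [`|_^-1|]ger0_norm ?invr_ge0 ?mulr_ge0 ?(ltW n11) ?(ltW np)//.
rewrite invfM mulrA; apply: ler_wpM2r; first by rewrite invr_ge0 ltW.
rewrite ler_pdivrMr//; move: b4 b5 b6; rewrite mulr1; clear.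
move: X4 X5 X6 n1 => x4 x5 x6 x; rewrite !ler_norml => /andP[? ?] /andP[? ?] /andP[? ?]; apply/andP; split; lra.
Qed.

End rank_statistics.

(** * Ranks are close to quantile labels *)

Section concentration.
Context {R : realType} {disp : nat -> measure_display}.
Variables (W : forall n, measurableType (disp n)) (la : forall n, probability (W n) R).

(** Chebyshev, in mean. *)
Lemma small_concentration (f : forall n, W n -> R) (C : R) (m : nat) : 0 <= C ->
  (forall n, bmf (@f n)) -> (forall n, (m <= n)%N -> Var (la n) (@f n) <= C * n%:R) ->
  small (fun n => Ex (la n) (fun z => `|n%:R^-1 * f n z - n%:R^-1 * Ex (la n) (@f n)|)).
Proof.
move=> C0 bf vf; apply: small_approx => e e0.
exists (fun n => (C / e) / n%:R); first exact: small_inv.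
exists m.+1 => n mn; have n0 : (0 : R) < n%:R by rewrite ltr0n; lia.
have bg : bmf (fun z => n%:R^-1 * f n z - n%:R^-1 * Ex (la n) (@f n)).
  by apply: bmfB; [exact: bmfZ|exact: bmf_cst].
apply: (le_trans (Ex_abs_le (la n) bg e0)); rewrite lerD2l.
have -> : Ex (la n) (fun z => (n%:R^-1 * f n z - n%:R^-1 * Ex (la n) (@f n)) ^+ 2) =
    n%:R^-1 ^+ 2 * Var (la n) (@f n).
  have bs : bmf (fun z => (f n z - Ex (la n) (@f n)) ^+ 2).
    by apply: bmfX; apply: bmfB => //; exact: bmf_cst.
  rewrite /Var -(ExZ (la n) _ bs).
  by apply: eq_Ex => z; rewrite -mulrBr exprMn.
have := vf n (ltnW mn); move: (Var _ _) => V hV.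
rewrite [leRHS]mulrAC; apply: ler_wpM2r; first by rewrite invr_ge0 ltW.
apply: (le_trans (ler_wpM2l _ hV)); first by rewrite exprn_ge0// invr_ge0 ltW.
by rewrite le_eqVlt; apply/orP; left; apply/eqP; field; rewrite gt_eqF.
Qed.

End concentration.

Section rank_labels.
Context {R : realType} {d : nat}.
Hypothesis hd : (0 < d)%N.
Local Notation X := (d.-tuple R).
Local Notation E := (X * R)%type.
Variable rho : X -> X -> X -> bool.
Hypothesis prox : proximity rho.
Variable D : nat.
Hypothesis hD : degree_bound rho D.
Variable mu : probability E R.
Hypothesis atomless : forall k t, mu [set e : E | tnth e.1 k = t] = 0%E.
Variable la : forall n, probability (n.-tuple E) R.
Hypothesis iid : forall n, iid_law mu (la n).
Variables (m : nat) (c : R -> 'I_m.+2).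
Hypothesis mc : finobs c.
Hypothesis cmono : forall y y', y <= y' -> (c y <= c y')%N.
Hypothesis cmass : forall b : 'I_m.+2, Ex mu (fun e => (c e.2 <= b)%N%:R) = b%:R / m.+1%:R.

Local Notation labs := (labs c).
Local Notation m1 := (m.+1%:R : R).

Definition comparisons n (z : n.-tuple E) : {ffun 'I_n * 'I_n -> bool} :=
  [ffun t => ys z t.1 <= ys z t.2].

Lemma finobs_comparisons n : finobs (@comparisons n).
Proof.
apply: finobs_ffun => t; apply: finobs_bool.
by apply: measurable_fun_ler; exact: measurable_ys.
Qed.

Definition ranks n (z : n.-tuple E) : 'I_n -> nat := rank (ys z).

Lemma bmf_ranks n (Phi : ('I_n -> nat) -> ('I_n -> seq 'I_n) -> {ffun 'I_n -> 'I_m.+2} -> R) :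
  bmf (fun z : n.-tuple E => Phi (ranks z) (nbs rho (xs z)) (labs z)).
Proof.
apply: (bmf_pattern prox (Phi := fun nl z => Phi (ranks z) nl (labs z))) => nl.
apply: (bmf_fin (G := fun v z => Phi (ranks z) nl v) (finobs_labs mc (n := n))) => v.
apply: bmf_ext (bmf_obs (fun pat : {ffun 'I_n * 'I_n -> bool} =>
  Phi (fun i => (\sum_(j < n) pat (j, i))%N) nl v) (@finobs_comparisons n)) => z.
congr (Phi _ nl v); apply/funext => i; rewrite /ranks /rank.
by apply: eq_bigr => j _; rewrite ffunE.
Qed.

Definition K (b b' : 'I_m.+2) : R := (minn b b')%:R / m1.

Lemma K_bound b b' : 0 <= K b b' <= 1.
Proof.
rewrite divr_ge0//= ler_pdivrMr ?ltr0n// mul1r ler_nat.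
by apply: leq_trans (geq_minl _ _) _; rewrite -ltnS.
Qed.

Lemma K_norm b b' : `|K b b'| <= 1.
Proof. by have /andP[? ?] := K_bound b b'; rewrite ger0_norm. Qed.

Lemma K_sym b b' : K b b' = K b' b.
Proof. by rewrite /K minnC. Qed.

Section sample_of_size_n.
Variable n : nat.
Local Notation Om := (n.-tuple E).
Implicit Types (z : Om) (i j l k : 'I_n) (b : 'I_m.+2).

Definition below b z : R := \sum_k (labs z k <= b)%N%:R.
Definition above b z : R := \sum_j ((b <= labs z j) && (b <= labs z (Nb rho 0 z j)))%N%:R.
Definition hmean b : R := n%:R^-1 * Ex (la n) (above b).

Definition below_error z : R := \sum_b `|n%:R^-1 * below b z - b%:R / m1|.
Definition above_error z : R := \sum_b `|n%:R^-1 * above b z - hmean b|.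
Definition label_error z : R :=
  D.+1%:R * (m1^-1 + 3 * below_error z) + above_error z.
(** The truncation makes the square of the error at most the error itself, with
    constants independent of the number of labels. *)
Definition rank_error z : R := Num.min 1 (label_error z).

Lemma bmf_below b : bmf (below b).
Proof. exact: (bmf_ranks (fun _ _ v => \sum_k (v k <= b)%N%:R)). Qed.

Lemma bmf_above b : bmf (above b).
Proof.
exact: (bmf_ranks (fun _ nl v => \sum_j ((b <= v j) && (b <= v (nth j (nl j) 0)))%N%:R)).
Qed.

Lemma bmf_below_error : bmf below_error.
Proof.
apply: bmf_sum => b _; apply: bmf_norm; apply: bmfB; last exact: bmf_cst.
by apply: bmfZ; exact: bmf_below.
Qed.

Lemma bmf_above_error : bmf above_error.
Proof.
apply: bmf_sum => b _; apply: bmf_norm; apply: bmfB; last exact: bmf_cst.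
by apply: bmfZ; exact: bmf_above.
Qed.

Lemma bmf_label_error : bmf label_error.
Proof.
apply: bmfD; last exact: bmf_above_error.
by apply: bmfZ; apply: bmfD; [exact: bmf_cst|apply: bmfZ; exact: bmf_below_error].
Qed.

Lemma bmf_rank_error : bmf rank_error.
Proof.
have -> : rank_error = (fun z => 2^-1 * (1 + label_error z - `|1 - label_error z|)).
  apply/funext => z; rewrite /rank_error; case: (leP 1 (label_error z)) => h.
    by rewrite ler0_norm ?subr_le0//; field.
  by rewrite ger0_norm ?subr_ge0 ?ltW//; field.
have bL := bmf_label_error.
by apply: bmfZ; apply: bmfB; [apply: bmfD => //; exact: bmf_cst|apply: bmf_norm; apply: bmfB => //; exact: bmf_cst].
Qed.

Lemma below_error_ge0 z : 0 <= below_error z.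
Proof. by apply: sumr_ge0 => b _; exact: normr_ge0. Qed.

Lemma above_error_ge0 z : 0 <= above_error z.
Proof. by apply: sumr_ge0 => b _; exact: normr_ge0. Qed.

Lemma label_error_ge0 z : 0 <= label_error z.
Proof.
have := below_error_ge0 z; have := above_error_ge0 z => ? ?.
by apply: addr_ge0 => //; apply: mulr_ge0 => //; apply: addr_ge0; rewrite ?invr_ge0// mulr_ge0.
Qed.

Lemma rank_error_bound z : 0 <= rank_error z <= 1.
Proof. by rewrite le_min ler01 label_error_ge0 ge_min lexx. Qed.

Lemma le_rank_error z (a : R) : `|a| <= 1 -> `|a| <= label_error z -> `|a| <= rank_error z.
Proof. by move=> h1 h2; rewrite le_min h1 h2. Qed.

Hypothesis n5 : (4 < n)%N.
Let n0 : (0 : R) < n%:R. Proof. by rewrite ltr0n; lia. Qed.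
Let i0 : (0 : R) <= n%:R^-1. Proof. by rewrite invr_ge0 ltW. Qed.

Lemma below_close b z : `|n%:R^-1 * below b z - b%:R / m1| <= below_error z.
Proof. by rewrite /below_error (bigD1 b)//= lerDl; apply: sumr_ge0. Qed.

Lemma above_close b z : `|n%:R^-1 * above b z - hmean b| <= above_error z.
Proof. by rewrite /above_error (bigD1 b)//= lerDl; apply: sumr_ge0. Qed.

Definition bin b z : R := \sum_k (labs z k == b)%:R.

Lemma bin_small b z : n%:R^-1 * bin b z <= m1^-1 + 2 * below_error z.
Proof.
have [b0|b0] := posnP b.
  have -> : bin b z = below b z.
    by apply: eq_bigr => k _; rewrite -val_eqE /= b0 leqn0.
  have := below_close b z; rewrite b0 mul0r subr0 => /(le_trans (ler_norm _)) /le_trans; apply.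
  have := below_error_ge0 z; have : 0 <= m1^-1 by rewrite invr_ge0.
  by move: (m1^-1) => ? ? ?; lra.
have bm : (b.-1 < m.+2)%N by have := ltn_ord b; lia.
have -> : bin b z = below b z - below (Ordinal bm) z.
  rewrite /below -sumrB; apply: eq_bigr => k _ /=.
  have -> : (labs z k == b) = (labs z k <= b)%N && ~~ (labs z k <= b.-1)%N.
    by rewrite -val_eqE /=; apply/idP/idP; lia.
  case: (leqP (labs z k) b.-1) => h /=; last by rewrite andbT subr0.
  by rewrite (leq_trans h (leq_pred _)) /= subrr.
have := below_close b z; have := below_close (Ordinal bm) z; rewrite mulrBr /=.
have -> : b%:R / m1 = b.-1%:R / m1 + m1^-1 by rewrite -[in LHS](prednK b0) -natr1 mulrDl mul1r.
move: (b.-1%:R / m1) (m1^-1) (n%:R^-1 * below b z) (n%:R^-1 * below _ z) (below_error z) => x1 x2 x3 x4 x5.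
rewrite !ler_norml => /andP[? ?] /andP[? ?]; lra.
Qed.

(** The minimum of two ranks counts the responses below both; the labels
    decide which ones these are, except in the bin of the smaller label. *)
Lemma min_rank_close z i j : `|mr (ranks z) i j - K (labs z i) (labs z j)| <= rank_error z.
Proof.
apply: le_rank_error.
  have /andP[? ?] := @mr_bound R n (ranks z) ltac:(lia) (@rank_le _ _ _) i j.
  have /andP[? ?] := K_bound (labs z i) (labs z j).
  by rewrite ler_norml; apply/andP; split; lra.
wlog ij : i j / (labs z i <= labs z j)%N.
  by move=> H; have [/H//|/ltnW /H] := leqP (labs z i) (labs z j); rewrite K_sym /mr minnC.
rewrite /K; have -> : minn (labs z i) (labs z j) = labs z i by apply/minn_idPl.
set b := labs z i.
have lE k : labs z k = c (ys z k) by rewrite ffunE.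
have mE : mr (ranks z) i j = n%:R^-1 * \sum_(k < n) ((ys z k <= ys z i) && (ys z k <= ys z j))%:R :> R.
  by rewrite /mr /ranks minn_rankE natr_sum mulrC.
have up : mr (ranks z) i j <= n%:R^-1 * below b z.
  rewrite mE; apply: ler_wpM2l => //; apply: ler_sum => k _; rewrite ler_nat.
  case: (boolP (_ && _)) => // /andP[h _]; suff -> : (labs z k <= b)%N by [].
  by rewrite /b !lE; exact: cmono.
have low : n%:R^-1 * below b z - n%:R^-1 * bin b z <= mr (ranks z) i j.
  rewrite mE -mulrBr; apply: ler_wpM2l => //; rewrite -sumrB; apply: ler_sum => k _.
  have [kb|kb|kb] := ltngtP (labs z k) b.
  - have lt l : (b <= labs z l)%N -> ys z k <= ys z l.
      move=> bl; rewrite leNgt; apply/negP => /ltW /cmono; rewrite -!lE => h.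
      by move: (leq_trans kb (leq_trans bl h)); rewrite ltnn.
    rewrite !lt// (_ : (_ == _) = false) ?subr0//.
    by apply/negbTE/eqP => e; rewrite e ltnn in kb.
  - rewrite (_ : (_ == _) = false) ?subr0//.
    by apply/negbTE/eqP => e; rewrite e ltnn in kb.
  - by have /val_inj -> := kb; rewrite eqxx subrr.
have h1 := below_close b z; have h2 := bin_small b z.
have h3 := below_error_ge0 z; have h4 := above_error_ge0 z.
have m0 : 0 <= m1^-1 by rewrite invr_ge0.
apply: (@le_trans _ _ (m1^-1 + 3 * below_error z)); last first.
  apply: (@le_trans _ _ (D.+1%:R * (m1^-1 + 3 * below_error z))); last by rewrite /label_error lerDl.
  by apply: ler_peMl; [apply: addr_ge0 => //; apply: mulr_ge0|rewrite ler1n].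
move: up low h1 h2 h3 m0; clear.
move: (mr _ _ _) (b%:R / m1) (n%:R^-1 * below b z) (n%:R^-1 * bin b z) (m1^-1) (below_error z).
move=> x1 x2 x3 x4 x5 x6 u l; rewrite !ler_norml => /andP[? ?] ? ? ?; apply/andP; split; lra.
Qed.

Lemma hmean_bound b : 0 <= hmean b <= 1.
Proof.
have ab z : 0 <= above b z <= n%:R.
  rewrite sumr_ge0//= -[X in _ <= X%:R]card_ord -sumr_const; apply: ler_sum => i _; rewrite lern1; exact: leq_b1.
apply/andP; split; first by apply: mulr_ge0 => //; apply: Ex_ge0 => z; case/andP: (ab z).
rewrite /hmean ler_pdivrMl// mulr1 -[leRHS](Ex_cst (la n)).
by apply: Ex_le; [exact: bmf_above|exact: bmf_cst|move=> z; case/andP: (ab z)].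
Qed.

Lemma hmean_norm b : `|hmean b| <= 1.
Proof. by have /andP[? ?] := hmean_bound b; rewrite ger0_norm. Qed.

Lemma HrE z l : Hr (ranks z) (Nb rho 0 z) l =
  n%:R^-1 * \sum_(i < n) ((ys z l <= ys z i) && (ys z l <= ys z (Nb rho 0 z i)))%:R :> R.
Proof.
rewrite /Hr mulrC; congr (_ * _); apply: eq_bigr => i _.
by rewrite leq_min !leq_rank.
Qed.

(** The labels decide whether an edge lies above y_l unless one of its end
    points is in the bin of y_l. *)
Lemma Hr_close z l : distinct hd z ->
  `|Hr (ranks z) (Nb rho 0 z) l - hmean (labs z l)| <= rank_error z.
Proof.
move=> dz; apply: le_rank_error.
  have /andP[? ?] := @Hr_bound R n (ranks z) (Nb rho 0 z) ltac:(lia) l.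
  by have /andP[? ?] := hmean_bound (labs z l); rewrite ler_norml; apply/andP; split; lra.
set b := labs z l.
have lE k : labs z k = c (ys z k) by rewrite ffunE.
have up : Hr (ranks z) (Nb rho 0 z) l <= n%:R^-1 * above b z.
  rewrite HrE; apply: ler_wpM2l => //; apply: ler_sum => k _; rewrite ler_nat.
  case: (boolP ((ys z l <= _) && _)) => // /andP[h h']; rewrite /b !lE.
  by rewrite !cmono.
have low : n%:R^-1 * above b z - D.+1%:R * (n%:R^-1 * bin b z) <= Hr (ranks z) (Nb rho 0 z) l.
  have bN : \sum_k (labs z (Nb rho 0 z k) == b)%:R <= D%:R * bin b z.
    exact: (sum_Nb_le hD (a := fun k => (labs z k == b)%:R) _ n5 dz).
  rewrite HrE mulrCA -mulrBr; apply: ler_wpM2l => //.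
  apply: (@le_trans _ _ (above b z - (bin b z + \sum_k (labs z (Nb rho 0 z k) == b)%:R))).
    rewrite lerD2l lerN2 -natr1 mulrDl mul1r [leRHS]addrC; exact: lerD.
  rewrite -big_split -sumrB; apply: ler_sum => k _ /=.
  have lt j : (b <= labs z j)%N -> ~~ (ys z l <= ys z j) -> labs z j = b.
    move=> bj; rewrite -ltNge => /ltW /cmono; rewrite -!lE => h.
    by apply/val_inj/eqP; rewrite eqn_leq h bj.
  case: (boolP (b <= labs z k)%N) => [h1|_] /=; last first.
    by apply: (@le_trans _ _ 0); rewrite ?sub0r ?oppr_le0 ?addr_ge0.
  case: (boolP (b <= labs z _)%N) => [h2|_] /=; last first.
    by apply: (@le_trans _ _ 0); rewrite ?sub0r ?oppr_le0 ?addr_ge0.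
  case: (boolP (ys z l <= ys z k)) => [_|/(lt _ h1) ->] /=; last by rewrite eqxx opprD addrA subrr sub0r oppr_le0.
  case: (boolP (ys z l <= _)) => [_|/(lt _ h2) ->] /=; last by rewrite eqxx opprD addrCA subrr addr0 oppr_le0.
  by rewrite lerBlDr lerDl addr_ge0.
have h1 := above_close b z; have h2 := bin_small b z.
have h3 := below_error_ge0 z.
have h5 : D.+1%:R * (n%:R^-1 * bin b z) <= D.+1%:R * (m1^-1 + 3 * below_error z).
  apply: ler_wpM2l => //; apply: (le_trans h2); rewrite lerD2l.
  by apply: ler_wpM2r => //; rewrite ler_nat.
move: up low h1 h5; rewrite /label_error; clear.
move: (Hr _ _ _) (hmean b) (n%:R^-1 * above b z) (D.+1%:R * (n%:R^-1 * _)) (D.+1%:R * (m1^-1 + _)) (above_error z).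
move=> x1 x2 x3 x4 x5 x6 u l'; rewrite !ler_norml => /andP[? ?] ?; apply/andP; split; lra.
Qed.

End sample_of_size_n.

Lemma finobs_response_label : finobs (fun e : E => c e.2).
Proof.
move=> b; have := @measurable_snd _ _ X R measurableT _ (mc b).
by rewrite setTI.
Qed.

Lemma small_below_error : small (fun n => Ex (la n) (@below_error n)).
Proof.
have bB n b : bmf (fun z : n.-tuple E => `|n%:R^-1 * below b z - b%:R / m1|).
  by apply: bmf_norm; apply: bmfB; [apply: bmfZ; exact: bmf_below|exact: bmf_cst].
apply: (small_le (m := 5) (b := fun n => \sum_b Ex (la n) (fun z : n.-tuple E =>
    `|n%:R^-1 * below b z - n%:R^-1 * Ex (la n) (below b)|))); last first.
  apply: small_sum => b.
  apply: (small_concentration (f := fun n => @below n b) (C := 17%:R * D.+1%:R * 1 ^+ 2) (m := 5)).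
  - by rewrite !mulr_ge0.
  - by move=> n; exact: bmf_below.
  move=> n n5; apply: (Efron_Stein_local_bounded prox hD atomless (iid (n := n))
    (phi := fun i z => (labs z i <= b)%N%:R) (phim := fun _ i z => (labs z i <= b)%N%:R)) => //.
  - by move=> i; exact: (bmf_ranks (fun _ _ v => (v i <= b)%N%:R)).
  - by move=> k i; exact: (bmf_ranks (fun _ _ v => (v i <= b)%N%:R)).
  - by move=> k i ik z e; rewrite (free_labs c ik z e).
  - by move=> i z _; rewrite ger0_norm// lern1 leq_b1.
  - by move=> i k z _; rewrite ger0_norm// lern1 leq_b1.
move=> n n5; rewrite /below_error (Ex_sum _ _ _ (bB n)); apply: ler_sum => b _.
rewrite le_eqVlt; apply/orP; left; apply/eqP; apply: eq_Ex => z.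
rewrite -cmass -(avg_single iid (n := n)); last first.
- by lia.
- exact: (bmf_obs (fun v : 'I_m.+2 => (v <= b)%N%:R) finobs_response_label).
rewrite /avg -Ex_sum => [|i]; last first.
  exact: (bmf_comp (phi := fun z : n.-tuple E => tnth z i) (measurable_tnth i)
    (bmf_obs (fun v : 'I_m.+2 => (v <= b)%N%:R) finobs_response_label)).
congr (`|_ - _ * _|); apply: eq_Ex => z'.
by apply: eq_bigr => i _; rewrite ffunE.
Qed.

Lemma small_above_error : small (fun n => Ex (la n) (@above_error n)).
Proof.
have bB n b : bmf (fun z : n.-tuple E => `|n%:R^-1 * above b z - hmean n b|).
  by apply: bmf_norm; apply: bmfB; [apply: bmfZ; exact: bmf_above|exact: bmf_cst].
apply: (small_le (m := 5) (b := fun n => \sum_b Ex (la n) (fun z : n.-tuple E =>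
    `|n%:R^-1 * above b z - n%:R^-1 * Ex (la n) (above b)|))).
  by move=> n n5; rewrite /above_error (Ex_sum _ _ _ (bB n)).
apply: small_sum => b.
apply: (small_concentration (f := fun n => @above n b) (C := 17%:R * D.+1%:R * 1 ^+ 2) (m := 5)).
- by rewrite !mulr_ge0.
- by move=> n; exact: bmf_above.
move=> n n5; pose ph j i (z : n.-tuple E) : R := ((b <= labs z i) && (b <= labs z j))%N%:R.
apply: (Efron_Stein_local_bounded prox hD atomless (iid (n := n))
  (phi := fun i z => ph (Nb rho 0 z i) i z) (phim := fun k i z => ph (Nbm rho k 0 z i) i z)) => //.
- by move=> i; exact: (bmf_ranks (fun _ nl v => ((b <= v i) && (b <= v (nth i (nl i) 0%N)))%N%:R)).
- move=> k i.
  exact: (bmf_ranks (fun _ nl v => ((b <= v i) && (b <= v (nth i [seq j <- nl i | j != k] 0%N)))%N%:R)).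
- move=> k i ik; apply: (free_Nbm_fun prox 0 (G := fun j z => ph j i z) ik) => j jk z e.
  by rewrite /ph (free_labs c ik z e) (free_labs c jk z e).
- by move=> k i z _ ik nc; rewrite Nbm_far.
- by move=> i z _; rewrite ger0_norm// lern1 leq_b1.
- by move=> i k z _; rewrite ger0_norm// lern1 leq_b1.
Qed.

(** The two fluctuation terms vanish by concentration; the mass of a bin
    remains. *)
Lemma small_rank_error : small (fun n => Ex (la n) (@rank_error n) - D.+1%:R / m1).
Proof.
apply: (small_le (m := 0) (b := fun n => (D.+1%:R * 3) * Ex (la n) (@below_error n)
   + Ex (la n) (@above_error n))); last first.
  by apply: smallD small_above_error; apply: smallZ small_below_error; rewrite mulr_ge0.
move=> n _; rewrite lerBlDr.
apply: (@le_trans _ _ (Ex (la n) (@label_error n))).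
  by apply: Ex_le; [exact: bmf_rank_error|exact: bmf_label_error|move=> z; rewrite ge_min lexx orbT].
have b1 := @bmf_below_error n; have b2 := @bmf_above_error n.
have b3 : bmf (fun z : n.-tuple E => 3 * below_error z) by exact: bmfZ.
have b4 : bmf (fun z : n.-tuple E => m1^-1 + 3 * below_error z) by apply: bmfD => //; exact: bmf_cst.
rewrite ExD//; last exact: bmfZ.
rewrite (ExZ (la n) _ b4) (ExD _ (bmf_cst _) b3) Ex_cst (ExZ (la n) _ b1).
by rewrite le_eqVlt; apply/orP; left; apply/eqP; ring.
Qed.

(** Deleting one observation changes the rank statistic and the label
    statistic by almost the same amount. *)
Lemma Var_rank_label n : (4 < n)%N ->
  Var (la n) (fun z => \sum_i mr (ranks z) i (Nb rho 0 z i) -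
      Ssum rho c K (fun n b => hmean n b) z) <=
  n%:R * (8 * D.+1%:R ^+ 2 * (Ex (la n) (@rank_error n) + n%:R^-1)).
Proof.
move=> n5; have n0 : (0 : R) < n%:R by rewrite ltr0n; lia.
have i0 : (0 : R) <= n%:R^-1 by rewrite invr_ge0 ltW.
pose h b := hmean n b.
pose G k z : R := \sum_(i | i != k) (n%:R^-1 * \sum_(l < n | l != k)
    ((ys z l <= ys z i) && (ys z l <= ys z (Nbm rho k 0 z i)))%:R
    - (K (labs z i) (labs z (Nbm rho k 0 z i)) + h (labs z i))).
have bF : bmf (fun z : n.-tuple E => \sum_i mr (ranks z) i (Nb rho 0 z i) -
      Ssum rho c K (fun n b => hmean n b) z).
  exact: (bmf_ranks (fun r nl v => \sum_i mr r i (nth i (nl i) 0%N) -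
    \sum_i (K (v i) (v (nth i (nl i) 0%N)) + h (v i)))).
have bG k : bmf (G k).
  apply: bmf_ext (bmf_ranks (fun r nl v => \sum_(i | i != k) (n%:R^-1 * \sum_(l < n | l != k)
    ((r l <= r i)%N && (r l <= r (nth i [seq j <- nl i | j != k] 0%N))%N)%:R
    - (K (v i) (v (nth i [seq j <- nl i | j != k] 0%N)) + h (v i))))) => z.
  apply: eq_bigr => i _; congr (_ * _ - _); apply: eq_bigr => l _.
  by rewrite !leq_rank.
have fG k : free k (G k).
  move=> z e; apply: eq_bigr => i ik; rewrite (free_Nbm prox 0 ik z e).
  have jk : Nbm rho k 0 z i != k by exact: Nbm_neq.
  rewrite (free_labs c ik z e) (free_labs c jk z e); congr (_ * _ - _).
  by apply: eq_bigr => l lk; rewrite !ys_upd.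
apply: (le_trans (Efron_Stein (iid (n := n)) bF bG fG)).
rewrite mulr_natl -[X in _ *+ X]card_ord -sumr_const; apply: ler_sum => k _.
have bE := @bmf_rank_error n.
have be : bmf (fun z : n.-tuple E => rank_error z + n%:R^-1) by apply: bmfD => //; exact: bmf_cst.
have -> : 8 * D.+1%:R ^+ 2 * (Ex (la n) (@rank_error n) + n%:R^-1) =
    Ex (la n) (fun z => 8 * D.+1%:R ^+ 2 * (rank_error z + n%:R^-1)).
  by rewrite (ExZ _ _ be) (ExD _ bE (bmf_cst _)) Ex_cst.
apply: (Ex_le_full (full_distinct hd atomless (iid (n := n)))).
- by apply: bmfX; apply: bmfB.
- exact: bmfZ.
move=> z dz; set t := rank_error z.
have /andP[t0 t1] := rank_error_bound z.
suff H : `|\sum_i mr (ranks z) i (Nb rho 0 z i) - Ssum rho c K (fun n b => hmean n b) z - G k z|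
    <= 2 * D.+1%:R * t + D.+1%:R * n%:R^-1.
  have inv1 : (n%:R^-1 : R) <= 1 by rewrite invf_le1 ?ler1n//; lia.
  rewrite -real_normK ?num_real//.
  apply: (@le_trans _ _ ((2 * D.+1%:R * t + D.+1%:R * n%:R^-1) ^+ 2)).
    by rewrite lerXn2r ?nnegrE// (le_trans _ H).
  have -> : (2 * D.+1%:R * t + D.+1%:R * n%:R^-1) ^+ 2 = D.+1%:R ^+ 2 * (2 * t + n%:R^-1) ^+ 2 by ring.
  have -> : 8 * D.+1%:R ^+ 2 * (t + n%:R^-1) = D.+1%:R ^+ 2 * (8 * (t + n%:R^-1)) by ring.
  apply: ler_wpM2l; first exact: sqr_ge0.
  move: t0 t1 i0 inv1; rewrite -/t; clear; move: t (n%:R^-1) => t u t0 t1 u0 u1.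
  have tt : t ^+ 2 <= t by rewrite expr2 ler_piMr.
  have uu : u ^+ 2 <= u by rewrite expr2 ler_piMr.
  rewrite -subr_ge0 (_ : _ - _ = (2 * t - u) ^+ 2 + (8 * (t - t ^+ 2) + (8 * u - 2 * u ^+ 2))); last by ring.
  apply: addr_ge0; first exact: sqr_ge0.
  by move: (t ^+ 2) (u ^+ 2) tt uu => a b ? ?; lra.
pose N i := Nb rho 0 z i; pose Nm i := Nbm rho k 0 z i.
pose diff i j := mr (ranks z) i j - K (labs z i) (labs z j).
have dd i j : `|diff i j| <= t by exact: min_rank_close.
pose p i j : R := ((ys z k <= ys z i) && (ys z k <= ys z j))%:R.
have split : \sum_i mr (ranks z) i (Nb rho 0 z i) - Ssum rho c K (fun n b => hmean n b) z - G k z =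
   diff k (N k) + \sum_(i | i != k) (diff i (N i) - diff i (Nm i))
   + (Hr (ranks z) (Nb rho 0 z) k - h (labs z k))
   - n%:R^-1 * (p k (N k) + \sum_(i | i != k) (p i (N i) - p i (Nm i))).
  have GE : G k z = \sum_(i | i != k) (mr (ranks z) i (Nm i)
     - n%:R^-1 * p i (Nm i) - (K (labs z i) (labs z (Nm i)) + h (labs z i))).
    apply: eq_bigr => i _; congr (_ - _).
    by rewrite /mr minn_rankE natr_sum [RHS]addrC [_ / _]mulrC [in RHS](bigD1 k)//= mulrDr -/(p _ _) addKr.
  have SE : Ssum rho c K (fun n b => hmean n b) z = K (labs z k) (labs z (N k)) + h (labs z k) +
      (\sum_(i | i != k) K (labs z i) (labs z (N i)) + \sum_(i | i != k) h (labs z i)).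
    by rewrite -big_split /Ssum (bigD1 k).
  have GE' : G k z = \sum_(i | i != k) mr (ranks z) i (Nm i) - n%:R^-1 * \sum_(i | i != k) p i (Nm i)
      - (\sum_(i | i != k) K (labs z i) (labs z (Nm i)) + \sum_(i | i != k) h (labs z i)).
    by rewrite GE mulr_sumr -big_split -!sumrB.
  have HE : Hr (ranks z) (Nb rho 0 z) k = n%:R^-1 * (p k (N k) + \sum_(i | i != k) p i (N i)).
    by rewrite HrE (bigD1 k).
  rewrite SE GE' HE (bigD1 k)//= /diff !sumrB -/(N k).
  have -> : \sum_(i | i != k) mr (ranks z) i (Nb rho 0 z i) = \sum_(i | i != k) mr (ranks z) i (N i) by [].
  move: (\sum_(i | i != k) h _) (h _) => x y; clear; ring.
have cN i : i != k -> ~~ close_to rho z i k -> Nm i = N i by move=> _ nc; rewrite /Nm Nbm_far.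
have sumclose (f : 'I_n -> R) (B : R) : 0 <= B -> (forall i, `|f i| <= B) ->
    (forall i, i != k -> ~~ close_to rho z i k -> f i = 0) -> `|\sum_(i | i != k) f i| <= D%:R * B.
  move=> B0 fB f0; rewrite (bigID (fun i => close_to rho z i k))/= [X in _ + X]big1 ?addr0; last first.
    by move=> i /andP[]; exact: f0.
  apply: (le_trans (ler_norm_sum _ _ _)); apply: (@le_trans _ _ (\sum_(i | close_to rho z i k) B)).
    rewrite big_mkcondl/=; apply: ler_sum => i _; case: (i != k) => //.
  rewrite sumr_const -[X in X <= _]mulr_natl; apply: ler_wpM2r => //.
  by rewrite ler_nat; exact: (hD k (distinct_inj dz)).
have p01 i j : 0 <= p i j <= 1 by rewrite ler0n lern1 leq_b1.
have s1 : `|\sum_(i | i != k) (diff i (N i) - diff i (Nm i))| <= D%:R * (2 * t).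
  apply: sumclose => [|i|i ik nc]; first exact: mulr_ge0.
    by apply: (le_trans (ler_normB _ _)); rewrite mulr_natl mulr2n; exact: lerD.
  by rewrite cN// subrr.
have s2 : `|\sum_(i | i != k) (p i (N i) - p i (Nm i))| <= D%:R * 1.
  apply: sumclose => // [i|i ik nc]; last by rewrite cN// subrr.
  have /andP[? ?] := p01 i (N i); have /andP[? ?] := p01 i (Nm i).
  by rewrite ler_norml; apply/andP; split; lra.
have s3 : `|p k (N k) + \sum_(i | i != k) (p i (N i) - p i (Nm i))| <= D.+1%:R.
  apply: (le_trans (ler_normD _ _)); rewrite -natr1 addrC; apply: lerD; first by rewrite -[leRHS]mulr1.
  by have /andP[? ?] := p01 k (N k); rewrite ger0_norm.
rewrite split; apply: (le_trans (ler_normB _ _)); apply: lerD; last first.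
  by rewrite normrM ger0_norm// mulrC; apply: ler_wpM2r.
have -> : 2 * D.+1%:R * t = t + D%:R * (2 * t) + t by rewrite -natr1; ring.
apply: (le_trans (ler_normD _ _)); apply: lerD; last exact: Hr_close.
by apply: (le_trans (ler_normD _ _)); apply: lerD.
Qed.

End rank_labels.

(** * Concentration of the variance estimator *)

Section estimator_concentration.
Context {R : realType} {d : nat}.
Hypothesis hd : (0 < d)%N.
Local Notation X := (d.-tuple R).
Local Notation E := (X * R)%type.
Variable rho : X -> X -> X -> bool.
Hypothesis prox : proximity rho.
Variable D : nat.
Hypothesis hD : degree_bound rho D.
Variable mu : probability E R.
Hypothesis atomless : forall k t, mu [set e : E | tnth e.1 k = t] = 0%E.
Variables (F : finType) (c : R -> F).
Hypothesis mc : finobs c.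
Variable K : F -> F -> R.
Hypothesis K1 : forall b b', `|K b b'| <= 1.
Variable h : F -> R.
Hypothesis h1 : forall b, `|h b| <= 1.
Variables (n : nat) (la : probability (n.-tuple E) R).
Hypothesis iid : iid_law mu la.
Hypothesis n5 : (4 < n)%N.
Local Notation Om := (n.-tuple E).
Local Notation labs := (labs c).
Local Notation nbz z := (nbs rho (xs z)).

Definition delete_vertex (nl : 'I_n -> seq 'I_n) (k i : 'I_n) : seq 'I_n :=
  if i == k then [::] else [seq j <- nl i | j != k].

Lemma Nl_delete z k j i : i != k -> Nl (delete_vertex (nbz z) k) j i = Nbm rho k j z i.
Proof. by move=> ik; rewrite /Nl /delete_vertex (negPf ik). Qed.

Lemma Nl_deleted nl k j : Nl (delete_vertex nl k) j k = k.
Proof. by rewrite /Nl /delete_vertex eqxx nth_nil. Qed.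

Lemma delete_vertex_free k (z : Om) e :
  delete_vertex (nbz (upd z k e)) k = delete_vertex (nbz z) k.
Proof.
apply/funext => i; rewrite /delete_vertex; case: eqVneq => // ik.
apply: (nb_minus_free prox ik) => j jk; exact: xs_upd.
Qed.

Lemma card_predecessors (z : Om) w : distinct hd z -> (#|[pred i | Nb rho 0 z i == w]| <= D)%N.
Proof.
move=> dz; apply: leq_trans (hD w (distinct_inj dz)).
apply: subset_leq_card; apply/fintype.subsetP => i; rewrite !inE => /eqP <-; exact: close_Nb.
Qed.

Lemma shr_delete_le (z : Om) k i : distinct hd z -> i != k ->
  (shr (delete_vertex (nbz z) k) i <= D)%N.
Proof.
move=> dz ik; apply: leq_trans (hD (Nbm rho k 0 z i) (distinct_inj dz)).
apply: subset_leq_card; apply/fintype.subsetP => j; rewrite !inE => /andP[_].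
rewrite (Nl_delete z 0 ik); have [->|jk] := eqVneq j k.
  by rewrite Nl_deleted eq_sym (negPf (Nbm_neq _ _ _ ik)).
by rewrite (Nl_delete z 0 jk) => /eqP <-; exact: close_Nbm.
Qed.

(** The vertices whose contribution may change when k is deleted: those close
    to k, and those whose nearest neighbour is in a set of bounded size. *)
Definition touched (z : Om) k : {set 'I_n} :=
  let J := [set j | (j == k) || close_to rho z j k]%SET in
  [set w | close_to rho z w k]%SET :|: (Nb rho 0 z @: J)
    :|: (Nl (delete_vertex (nbz z) k) 0 @: J).

Definition affected (z : Om) k i : bool :=
  [|| i == k, close_to rho z i k | Nb rho 0 z i \in touched z k].

Lemma Gam_unaffected (z : Om) k i : ~~ affected z k i ->
  Gam K h (labs z) (nbz z) i = Gam K h (labs z) (delete_vertex (nbz z) k) i.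
Proof.
rewrite /affected !negb_or => /and3P[ik nc]; rewrite /touched !inE !negb_or => /andP[/andP[nw nJ] nJ'].
have far j l : (j < 4)%N -> l != k -> ~~ close_to rho z l k ->
    Nl (delete_vertex (nbz z) k) j l = Nl (nbz z) j l.
  by move=> j4 lk nl; rewrite Nl_delete// Nbm_far.
have N0k : Nl (nbz z) 0 i != k.
  by apply/eqP => e; move: nc; rewrite -e (close_Nb rho z i (k := 0)).
rewrite /Gam !far//; congr (Gam4 _ _ _%:R _%:R _ _ _ _).
  by rewrite /mut !far.
rewrite /shr; apply: eq_card => j; rewrite !inE (far 0%N i)//; case: (j != i) => //=.
have [jJ|] := boolP ((j == k) || close_to rho z j k); last first.
  by rewrite negb_or => /andP[jk jc]; rewrite (far 0%N j).
have f1 : (Nl (nbz z) 0 j == Nl (nbz z) 0 i) = false.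
  apply/negbTE/eqP => e; move/negP: nJ; apply; apply/imsetP; exists j; first by rewrite inE.
  exact: esym e.
rewrite f1; apply/esym/negbTE/eqP => e; move/negP: nJ'; apply; apply/imsetP; exists j; first by rewrite inE.
exact: esym e.
Qed.

Definition affected_bound := (1 + D + (3 * D + 2) * D)%N.

Lemma card_affected (z : Om) k : distinct hd z ->
  (#|[pred i | affected z k i]| <= affected_bound)%N.
Proof.
move=> dz; have ck : (#|[pred i | close_to rho z i k]| <= D)%N := hD k (distinct_inj dz).
have sub : [pred i | affected z k i] \subset
    [set k]%SET :|: [set i | close_to rho z i k]%SET :|: [set i | Nb rho 0 z i \in touched z k]%SET.
  apply/fintype.subsetP => i; rewrite inE => /or3P[/eqP ->|a|a].
  - by rewrite !finset.in_setU finset.in_set1 eqxx.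
  - by rewrite !finset.in_setU [X in _ || X || _]finset.in_set a orbT.
  - by rewrite !finset.in_setU [X in _ || X]finset.in_set a orbT.
apply: (leq_trans (subset_leq_card sub)); apply: (leq_trans (leq_card_setU _ _)); apply: leq_add.
  apply: (leq_trans (leq_card_setU _ _)); rewrite cards1; apply: leq_add => //.
  by rewrite cardsE.
have ct : (#|touched z k| <= 3 * D + 2)%N.
  have cJ : (#|[set j | (j == k) || close_to rho z j k]%SET| <= D.+1)%N.
    have sub' : [set j | (j == k) || close_to rho z j k]%SET \subset [set k]%SET :|: [set j | close_to rho z j k]%SET.
      by apply/fintype.subsetP => j; rewrite finset.in_setU finset.in_set1 !finset.in_set.
    apply: (leq_trans (subset_leq_card sub')); apply: (leq_trans (leq_card_setU _ _)).
    by rewrite cards1 add1n ltnS cardsE.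
  rewrite /touched; set J := [set j | _]%SET in cJ *; set A := [set w | _]%SET.
  have cA : (#|A| <= D)%N by rewrite cardsE.
  apply: (leq_trans (leq_card_setU _ _)); apply: (leq_trans (leq_add (leq_card_setU _ _) (leqnn _))).
  apply: (leq_trans (leq_add (leq_add cA (leq_trans (leq_imset_card _ _) cJ))
    (leq_trans (leq_imset_card _ _) cJ))); lia.
rewrite -sum1_card (partition_big (Nb rho 0 z) [in touched z k])/=; last by move=> i; rewrite inE.
apply: leq_trans (_ : \sum_(w in touched z k) D <= _)%N; last by rewrite sum_nat_const leq_mul2r ct orbT.
apply: leq_sum => w wt; rewrite sum1_card; apply: leq_trans (card_predecessors w dz).
by apply: subset_leq_card; apply/fintype.subsetP => i; rewrite !inE => /andP[].
Qed.

Definition Gam_lipschitz : R := affected_bound%:R * (2 * (13 + 2 * D%:R)).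

(** mut and shr look at the neighbours of neighbours, so the comparison
    statistic is that of the whole graph after deletion of k. *)
Lemma Var_Gam : Var la (fun z => \sum_i Gam K h (labs z) (nbz z) i) <= Gam_lipschitz ^+ 2 * n%:R.
Proof.
pose G k (z : Om) := \sum_(i | i != k) Gam K h (labs z) (delete_vertex (nbz z) k) i.
have bF : bmf (fun z : Om => \sum_i Gam K h (labs z) (nbz z) i).
  exact: (bmf_conf prox mc (fun v nl => \sum_i Gam K h v nl i)).
have bG k : bmf (G k).
  exact: (bmf_conf prox mc (fun v nl => \sum_(i | i != k) Gam K h v (delete_vertex nl k) i)).
have fG k : free k (G k).
  move=> z e; apply: eq_bigr => i ik; rewrite /Gam delete_vertex_free.
  have lab j : labs (upd z k e) (Nl (delete_vertex (nbz z) k) j i) = labs z (Nl (delete_vertex (nbz z) k) j i).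
    by rewrite Nl_delete//; apply: free_labs; exact: Nbm_neq.
  by rewrite !lab (free_labs c ik z e).
apply: (le_trans (Efron_Stein iid bF bG fG)).
rewrite mulr_natr -[X in _ *+ X]card_ord -sumr_const; apply: ler_sum => k _.
rewrite -[leRHS](Ex_cst la); apply: (Ex_le_full (full_distinct hd atomless iid)).
- by apply: bmfX; exact: bmfB.
- exact: bmf_cst.
move=> z dz; have B0 : 0 <= 13 + 2 * D%:R :> R by rewrite addr_ge0// mulr_ge0.
suff H : `|\sum_i Gam K h (labs z) (nbz z) i - G k z| <= Gam_lipschitz.
  rewrite -real_normK ?num_real// lerXn2r ?nnegrE//.
  by rewrite /Gam_lipschitz mulr_ge0// mulr_ge0.
pose f i := Gam K h (labs z) (nbz z) i - (i != k)%:R * Gam K h (labs z) (delete_vertex (nbz z) k) i.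
have -> : \sum_i Gam K h (labs z) (nbz z) i - G k z = \sum_(i | affected z k i) f i.
  rewrite /G [X in _ - X]big_mkcond/= -sumrB [RHS]big_mkcond/=; apply: eq_bigr => i _.
  rewrite /f; have [ia|ia] := boolP (affected z k i).
    by case: (i != k); rewrite /= ?mul1r ?mul0r ?subr0.
  have ik : i != k by move: ia; rewrite /affected; case: eqP.
  by rewrite ik (Gam_unaffected ia) subrr.
apply: (le_trans (ler_norm_sum _ _ _)).
apply: (@le_trans _ _ (\sum_(i | affected z k i) (2 * (13 + 2 * D%:R)))).
  apply: ler_sum => i _; rewrite /f mulr_natl mulr2n; apply: (le_trans (ler_normB _ _)).
  rewrite [leRHS](_ : _ = 13 + 2 * D%:R + (13 + 2 * D%:R)); last by ring.
  apply: lerD.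
    by apply: (Gam4_bound K1 h1); rewrite ler0n ler_nat; apply: shr_le.
  have [_|ik] := eqVneq i k; first by rewrite /= mulr0n normr0.
  by rewrite /= mulr1n; apply: (Gam4_bound K1 h1); rewrite ler0n ler_nat shr_delete_le.
rewrite sumr_const -[X in X <= _]mulr_natl; apply: ler_wpM2r; first by rewrite mulr_ge0.
by rewrite ler_nat; exact: card_affected.
Qed.

End estimator_concentration.

(** * The rank estimator of the variance of the rank statistic *)

Lemma collect_errors (R : realType) (a b q r i T x1 x2 x3 x4 x5 : R) :
  x1 <= T + b * (r + i) ->
  a * r + x3 + x4 + x5 + (x2 + x1) <=
  T + (a + b) * q + ((a + b) * (r - q) + x3 + x4 + x5 + x2 + b * i).
Proof.
move=> h; have -> : T + (a + b) * q + ((a + b) * (r - q) + x3 + x4 + x5 + x2 + b * i) =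
  a * r + x3 + x4 + x5 + (x2 + (T + b * (r + i))) by ring.
by rewrite !lerD2l.
Qed.

Section rank_variance.
Context {R : realType} {d : nat}.
Hypothesis hd : (0 < d)%N.
Local Notation X := (d.-tuple R).
Local Notation E := (X * R)%type.
Variable rho : X -> X -> X -> bool.
Hypothesis prox : proximity rho.
Variable mu : probability E R.
Hypothesis atomless : forall k t, mu [set e : E | tnth e.1 k = t] = 0%E.
Hypothesis atomless_y : forall t, mu [set e : E | e.2 = t] = 0%E.
Variable la : forall n, probability (n.-tuple E) R.
Hypothesis iid : forall n, iid_law mu (la n).
Local Notation nbz z := (nbs rho (xs z)).

Definition rank_sum n (z : n.-tuple E) : R := \sum_i mr (ranks z) i (Nb rho 0 z i).

Definition rank_form n (z : n.-tuple E) : R :=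
  GR (ranks z) (Nb rho 0 z) (Nb rho 1 z) (Nb rho 2 z) (mut (nbz z)) (shr (nbz z)).

Variable D : nat.
Hypothesis hD : degree_bound rho D.

Section with_labels.
Variables (m : nat) (c : R -> 'I_m.+2).
Hypothesis mc : finobs c.
Hypothesis cmono : forall y y', y <= y' -> (c y <= c y')%N.
Hypothesis cmass : forall b : 'I_m.+2, Ex mu (fun e => (c e.2 <= b)%N%:R) = b%:R / m.+1%:R.

Local Notation Kc := (@K R m).
Local Notation h n b := (hmean rho la c n b).

Lemma bmf_rank_sum n : bmf (@rank_sum n).
Proof. exact: (bmf_ranks prox mc (fun r nl _ => \sum_i mr r i (nth i (nl i) 0%N))). Qed.

Lemma bmf_rank_form n : bmf (@rank_form n).
Proof.
exact: (bmf_ranks prox mc (fun r nl _ => GR r (fun i => nth i (nl i) 0%N)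
  (fun i => nth i (nl i) 1%N) (fun i => nth i (nl i) 2%N) (mut nl) (shr nl))).
Qed.

Definition sum_Gam n (z : n.-tuple E) : R := \sum_i Gam Kc (fun b => h n b) (labs c z) (nbz z) i.
Definition sum_edge n (z : n.-tuple E) : R := \sum_i edge Kc (labs c z) (nbz z) i.
Definition sum_h n (z : n.-tuple E) : R := \sum_i h n (labs c z i).

Definition fluct n (f : n.-tuple E -> R) : R :=
  Ex (la n) (fun z => `|n%:R^-1 * f z - n%:R^-1 * Ex (la n) f|).

Lemma bmf_sum_Gam n : bmf (@sum_Gam n).
Proof. exact: (bmf_conf prox mc (fun v nl => \sum_i Gam Kc (fun b => h n b) v nl i)). Qed.

Lemma bmf_sum_edge n : bmf (@sum_edge n).
Proof. exact: (bmf_conf prox mc (fun v nl => \sum_i edge Kc v nl i)). Qed.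

Lemma bmf_sum_h n : bmf (@sum_h n).
Proof. exact: (bmf_conf prox mc (fun v _ => \sum_i h n (v i))). Qed.

Lemma small_sum_Gam : small (fun n => fluct (@sum_Gam n)).
Proof.
apply: (small_concentration (f := fun n => @sum_Gam n) (C := Gam_lipschitz D ^+ 2) (m := 5)).
- exact: sqr_ge0.
- exact: bmf_sum_Gam.
move=> n n5; have V := Var_Gam hd prox hD atomless mc (@K_norm R m) (hmean_norm hd prox la mc n5) (iid (n := n)) n5.
exact: V.
Qed.

Lemma small_sum_edge : small (fun n => fluct (@sum_edge n)).
Proof.
apply: (small_concentration (f := fun n => @sum_edge n) (C := 17%:R * D.+1%:R * 1 ^+ 2) (m := 5)).
- by rewrite !mulr_ge0.
- exact: bmf_sum_edge.
move=> n n5; pose ph j i (z : n.-tuple E) : R := Kc (labs c z i) (labs c z j).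
apply: (Efron_Stein_local_bounded prox hD atomless (iid (n := n))
  (phi := fun i z => ph (Nb rho 0 z i) i z) (phim := fun k i z => ph (Nbm rho k 0 z i) i z)) => //.
- by move=> i; exact: (bmf_conf prox mc (fun v nl => Kc (v i) (v (nth i (nl i) 0%N)))).
- by move=> k i; exact: (bmf_conf prox mc (fun v nl => Kc (v i) (v (nth i [seq j <- nl i | j != k] 0%N)))).
- move=> k i ik; apply: (free_Nbm_fun prox 0 (G := fun j z => ph j i z) ik) => j jk z e.
  by rewrite /ph (free_labs c ik z e) (free_labs c jk z e).
- by move=> k i z _ ik nc; rewrite Nbm_far.
- by move=> i z _; exact: K_norm.
- by move=> i k z _; exact: K_norm.
Qed.

Lemma small_sum_h : small (fun n => fluct (@sum_h n)).
Proof.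
apply: (small_concentration (f := fun n => @sum_h n) (C := 17%:R * D.+1%:R * 1 ^+ 2) (m := 5)).
- by rewrite !mulr_ge0.
- exact: bmf_sum_h.
move=> n n5; apply: (Efron_Stein_local_bounded prox hD atomless (iid (n := n))
  (phi := fun i z => h n (labs c z i)) (phim := fun _ i z => h n (labs c z i))) => //.
- by move=> i; exact: (bmf_conf prox mc (fun v _ => h n (v i))).
- by move=> k i; exact: (bmf_conf prox mc (fun v _ => h n (v i))).
- by move=> k i ik z e; rewrite (free_labs c ik z e).
- by move=> i z _; exact: hmean_norm.
- by move=> i k z _; exact: hmean_norm.
Qed.

Lemma mean_GamE n : mean_Gam rho la c Kc (fun n b => h n b) n = n%:R^-1 * Ex (la n) (@sum_Gam n).
Proof.
rewrite /mean_Gam /avg Ex_sum// => i.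
exact: (bmf_conf prox mc (fun v nl => Gam Kc (fun b => h n b) v nl i)).
Qed.

Lemma mean_edgeE n : mean_edge rho la c Kc n = n%:R^-1 * Ex (la n) (@sum_edge n).
Proof.
rewrite /mean_edge /avg Ex_sum// => i.
exact: (bmf_conf prox mc (fun v nl => edge Kc v nl i)).
Qed.

Lemma mean_hE n : mean_h la c (fun n b => h n b) n = n%:R^-1 * Ex (la n) (@sum_h n).
Proof.
rewrite /mean_h /avg Ex_sum// => i.
exact: (bmf_conf prox mc (fun v _ => h n (v i))).
Qed.

(** The average of the minima is also the average of Hr, so twice this average
    is close both to the averages of edge and of h added together. *)
Lemma rank_form_close n (z : n.-tuple E) (g e u : R) : (4 < n)%N -> distinct hd z ->
  `|e| <= 1 -> `|u| <= 1 ->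
  `|rank_form z - (g - (e + u) ^+ 2)| <= (34 + 4 * D%:R) * rank_error rho D la c z +
    `|n%:R^-1 * sum_Gam z - g| + 4 * `|n%:R^-1 * sum_edge z - e| + 4 * `|n%:R^-1 * sum_h z - u|.
Proof.
move=> n5 dz e1 u1; set t := rank_error _ _ _ _ z.
have n0 : (0 : R) < n%:R by rewrite ltr0n; lia.
have i0 : (0 : R) <= n%:R^-1 by rewrite invr_ge0 ltW.
have n2 : (1 < n)%N by lia.
have rn : forall i, (ranks z i <= n)%N := @rank_le _ _ (ys z).
have rc : forall i, (\sum_(l < n) (ranks z l <= ranks z i)%N)%N = ranks z i := @rank_count _ _ (ys z).
have avgle (f g' : 'I_n -> R) (B : R) : (forall i, `|f i - g' i| <= B) ->
    `|n%:R^-1 * \sum_i f i - n%:R^-1 * \sum_i g' i| <= B.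
  move=> fB; rewrite -mulrBr normrM ger0_norm// ler_pdivrMl// -sumrB; exact: sum_le_n.
have dm i j : `|mr (ranks z) i j - Kc (labs c z i) (labs c z j)| <= t by exact: (min_rank_close hd rho D la cmono n5 z i j).
have dh l : `|Hr (ranks z) (Nb rho 0 z) l - h n (labs c z l)| <= t.
  exact: (Hr_close prox hD la mc cmono n5 l dz).
have mb i j : `|mr (ranks z) i j| <= 1 by exact: mr_norm.
have hb l : `|Hr (ranks z) (Nb rho 0 z) l| <= 1 by exact: Hr_norm.
pose A : R := n%:R^-1 * \sum_i mr (ranks z) i (Nb rho 0 z i).
have A1 : `|A| <= 1.
  by rewrite normrM ger0_norm// ler_pdivrMl//; apply: sum_le_n => i; exact: mb.
have q1 : `|n%:R^-1 * \sum_i gform (mut (nbz z) i)%:R (shr (nbz z) i)%:R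
    (mr (ranks z) i (Nb rho 0 z i)) (mr (ranks z) i (Nb rho 1 z i))
    (mr (ranks z) (Nb rho 1 z i) (Nb rho 2 z i)) (mr (ranks z) (Nb rho 0 z i) (Nb rho 1 z i))
    (Hr (ranks z) (Nb rho 0 z) i) - n%:R^-1 * sum_Gam z| <= (26 + 4 * D%:R) * t.
  apply: avgle => i; rewrite /Gam.
  apply: (@gform_close R _ _ D%:R) => //.
  - by rewrite ler0n ler_nat; apply: shr_le.
  - exact: K_norm.
  - exact: hmean_norm.
have q2 : `|A - n%:R^-1 * sum_edge z| <= t by apply: avgle => i; exact: dm.
have q3 : `|A - n%:R^-1 * sum_h z| <= t.
  by rewrite /A -(sum_Hr (Nb rho 0 z) rc); apply: avgle.
have q4 : `|4 * A ^+ 2 - (e + u) ^+ 2| <= 8 * t + 4 * `|n%:R^-1 * sum_edge z - e| + 4 * `|n%:R^-1 * sum_h z - u|.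
  have -> : 4 * A ^+ 2 - (e + u) ^+ 2 = ((A - n%:R^-1 * sum_edge z) + (n%:R^-1 * sum_edge z - e)
     + (A - n%:R^-1 * sum_h z) + (n%:R^-1 * sum_h z - u)) * (A + A + e + u) by ring.
  rewrite normrM [leRHS](_ : _ = (t + `|n%:R^-1 * sum_edge z - e| + t + `|n%:R^-1 * sum_h z - u|) * (1 + 1 + 1 + 1)); last by ring.
  apply: ler_pM => //.
    do 2 (apply: (le_trans (ler_normD _ _)); apply: lerD => //).
    by apply: (le_trans (ler_normD _ _)); apply: lerD.
  by do 3 (apply: (le_trans (ler_normD _ _)); apply: lerD => //).
move: q1 q4; rewrite /rank_form /GR -/A.
move: (n%:R^-1 * \sum_i gform _ _ _ _ _ _ _) (4 * A ^+ 2) ((e + u) ^+ 2) (n%:R^-1 * sum_Gam z).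
move: (4 * `|_ * sum_edge z - _|) (4 * `|_ * sum_h z - _|) => y1 y2 x1 x2 x3 x4.
rewrite (_ : (34 + 4 * D%:R) * t = (26 + 4 * D%:R) * t + 8 * t); last by ring.
move: ((26 + _) * t) (8 * t) => t1 t2 h1 h2.
have -> : x1 - x2 - (g - x3) = (x1 - x4) + (x4 - g) - (x2 - x3) by ring.
apply: (le_trans (ler_normB _ _)); apply: (le_trans (lerD (ler_normD _ _) h2)).
by move: (`|x4 - g|) => x5; lra.
Qed.

(** The parameter t balances the relative and the additive error in the
    comparison of the two variances. *)
Lemma estimator_close (t : R) : 0 < t <= 1 -> exists2 b : nat -> R, small b &
  forall n, (4 < n)%N ->
  Ex (la n) (fun z => `|rank_form z - n%:R^-1 * Var (la n) (@rank_sum n)|) <=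
    t * (12 * (17 * D.+1%:R)) +
    (34 + 4 * D%:R + 32 * D.+1%:R ^+ 2 / t) * (D.+1%:R / m.+1%:R) + b n.
Proof.
move=> t01; have /andP[t0 t1] := t01.
have [p [bp p0 p1 pc]] := conditional_label_law mu mc.
have K1 := @K_norm R m; have Ks := @K_sym R m.
(* hmean is bounded by 1 only once n exceeds 4 *)
pose hh n b := if (4 < n)%N then h n b else 0.
have hh1 n b : `|hh n b| <= 1.
  by rewrite /hh; case: ifP => [n5|_]; [exact: hmean_norm|rewrite normr0].
have core := core_variance hd prox hD atomless iid mc bp p0 p1 pc K1 Ks hh1.
pose A : R := 34 + 4 * D%:R + 32 * D.+1%:R ^+ 2 / t.
have A0 : 0 <= A.
  have : 0 <= 32 * D.+1%:R ^+ 2 / t by rewrite divr_ge0 ?mulr_ge0// ltW.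
  have : 0 <= 4 * D%:R :> R by rewrite mulr_ge0.
  by rewrite /A; move: (4 * _) (32 * _ / t) => ? ? ? ?; lra.
exists (fun n => A * (Ex (la n) (@rank_error _ _ rho D la m c n) - D.+1%:R / m.+1%:R)
   + fluct (@sum_Gam n) + 4 * fluct (@sum_edge n) + 4 * fluct (@sum_h n)
   + `|n%:R^-1 * Var (la n) (Ssum rho c Kc hh (n:=n)) - (mean_Gam rho la c Kc hh n -
      (mean_edge rho la c Kc n + mean_h la c hh n) ^+ 2)| + (32 * D.+1%:R ^+ 2 / t) / n%:R).
  apply: smallD (small_inv _); apply: smallD core.
  apply: smallD; last by apply: smallZ small_sum_h.
  apply: smallD; last by apply: smallZ small_sum_edge.
  apply: smallD small_sum_Gam; apply: smallZ => //.
  exact: (small_rank_error hd prox hD atomless iid mc cmass).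
move=> n n5; have n0 : (0 : R) < n%:R by rewrite ltr0n; lia.
have i0 : (0 : R) <= n%:R^-1 by rewrite invr_ge0 ltW.
have hE : hh n = (fun b => h n b) by apply/funext => b; rewrite /hh n5.
have Sh : Ssum rho c Kc hh (n:=n) = Ssum rho c Kc (fun n b => h n b) (n:=n).
  by apply/funext => z; rewrite /Ssum hE.
have GE : mean_Gam rho la c Kc hh n = n%:R^-1 * Ex (la n) (@sum_Gam n).
  by rewrite -mean_GamE /mean_Gam hE.
have HE : mean_h la c hh n = n%:R^-1 * Ex (la n) (@sum_h n).
  by rewrite -mean_hE /mean_h hE.
have [be bh] := mean_edge_bound hd prox la mc K1 hh1 n5.
rewrite Sh GE HE mean_edgeE in be bh *.
have bS : bmf (Ssum rho c Kc (fun n b => h n b) (n:=n)).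
  exact: (bmf_conf prox mc (fun v nl => \sum_i (edge Kc v nl i + h n (v i)))).
have v1 := Var_close (la n) (@bmf_rank_sum n) bS t01.
have v2 := Var_rank_label hd prox hD atomless iid mc cmono n5.
have v3 := Var_Ssum_bound hd prox hD atomless iid mc K1 hh1 n; rewrite Sh in v3.
set VR := Var (la n) (@rank_sum n) in v1 *.
set VS := Var (la n) (Ssum _ _ _ _ (n:=n)) in v1 v3 *.
set VD := Var (la n) (fun z => _ - _) in v1; set re := Ex (la n) (@rank_error _ _ _ _ _ _ _ _) in v2 *.
set eG := n%:R^-1 * Ex (la n) (@sum_Gam n).
set eE := n%:R^-1 * Ex (la n) (@sum_edge n) in be *.
set eH := n%:R^-1 * Ex (la n) (@sum_h n) in bh *.
have w1 : `|n%:R^-1 * VR - n%:R^-1 * VS| <= t * (12 * (17 * D.+1%:R)) + 32 * D.+1%:R ^+ 2 / t * (re + n%:R^-1).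
  rewrite -mulrBr normrM ger0_norm// ler_pdivrMl//; apply: (le_trans v1).
  rewrite mulrDr; apply: lerD.
    rewrite (_ : n%:R * _ = 3 * t * (17 * D.+1%:R * 2 ^+ 2 * n%:R)); last by ring.
    by apply: ler_wpM2l => //; rewrite mulr_ge0// ltW.
  rewrite (_ : n%:R * _ = 4 / t * (n%:R * (8 * D.+1%:R ^+ 2 * (re + n%:R^-1)))); last by ring.
  by apply: ler_wpM2l => //; rewrite divr_ge0// ltW.
pose Q : R := `|n%:R^-1 * VS - (eG - (eE + eH) ^+ 2)| + `|n%:R^-1 * VR - n%:R^-1 * VS|.
pose B (z : n.-tuple E) : R := (34 + 4 * D%:R) * rank_error rho D la c z +
    `|n%:R^-1 * sum_Gam z - eG| + 4 * `|n%:R^-1 * sum_edge z - eE| + 4 * `|n%:R^-1 * sum_h z - eH|.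
have b1 : bmf (fun z : n.-tuple E => `|n%:R^-1 * sum_Gam z - eG|).
  by apply: bmf_norm; apply: bmfB; [apply: bmfZ; exact: bmf_sum_Gam|exact: bmf_cst].
have b2 : bmf (fun z : n.-tuple E => `|n%:R^-1 * sum_edge z - eE|).
  by apply: bmf_norm; apply: bmfB; [apply: bmfZ; exact: bmf_sum_edge|exact: bmf_cst].
have b3 : bmf (fun z : n.-tuple E => `|n%:R^-1 * sum_h z - eH|).
  by apply: bmf_norm; apply: bmfB; [apply: bmfZ; exact: bmf_sum_h|exact: bmf_cst].
have b0 : bmf (@rank_error _ _ rho D la m c n) by exact: bmf_rank_error.
have c0 := bmfZ (34 + 4 * D%:R) b0; have c2 := bmfZ 4 b2; have c3 := bmfZ 4 b3.
have d1 := bmfD c0 b1; have d2 := bmfD d1 c2; have bB : bmf B := bmfD d2 c3.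
have EB : Ex (la n) B = (34 + 4 * D%:R) * re + fluct (@sum_Gam n) + 4 * fluct (@sum_edge n) + 4 * fluct (@sum_h n).
  by rewrite /B (ExD _ d2 c3) (ExD _ d1 c2) (ExD _ c0 b1) (ExZ _ _ b0) (ExZ _ _ b2) (ExZ _ _ b3).
apply: (@le_trans _ _ (Ex (la n) (fun z => B z + Q))).
  apply: (Ex_le_full (full_distinct hd atomless (iid (n := n)))).
  - by apply: bmf_norm; apply: bmfB; [exact: bmf_rank_form|exact: bmf_cst].
  - by apply: bmfD => //; exact: bmf_cst.
  move=> z dz; have := rank_form_close eG n5 dz be bh; rewrite -/(B z) /Q => rf.
  rewrite (_ : rank_form z - n%:R^-1 * VR = (rank_form z - (eG - (eE + eH) ^+ 2))
     - (n%:R^-1 * VS - (eG - (eE + eH) ^+ 2)) - (n%:R^-1 * VR - n%:R^-1 * VS)); last by ring.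
  rewrite addrA; apply: (le_trans (ler_normB _ _)); apply: lerD => //.
  by apply: (le_trans (ler_normB _ _)); apply: lerD.
rewrite (ExD _ bB (bmf_cst _)) Ex_cst EB; exact: collect_errors w1.
Qed.

End with_labels.

(** The form rank_form estimates the normalized variance of rank_sum in mean:
    finer quantile labels make every error as small as desired. *)
Theorem rank_variance_estimator : small (fun n =>
  Ex (la n) (fun z => `|rank_form z - n%:R^-1 * Var (la n) (@rank_sum n)|)).
Proof.
apply: small_approx => e e0.
pose C : R := 12 * (17 * D.+1%:R).
have C0 : 0 < C by rewrite !mulr_gt0 ?ltr0n.
pose t : R := Num.min 1 (e / 2 / C).
have e2 : 0 < e / 2 / C by rewrite !divr_gt0.
have t01 : 0 < t <= 1 by rewrite lt_min ltr01 e2 /= ge_min lexx.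
have te : t * C <= e / 2 by rewrite -ler_pdivlMr// ge_min lexx orbT.
have /andP[t0 _] := t01.
pose A : R := (34 + 4 * D%:R + 32 * D.+1%:R ^+ 2 / t) * D.+1%:R.
have [n0 hn0] := small_inv A (divr_gt0 e0 (ltr0n R 2)).
pose m := n0; have Am : A / m.+1%:R <= e / 2 by exact: hn0.
have msnd : measurable_fun setT (snd : E -> R) by exact: measurable_snd.
have [c [mc cmono cmass]] := quantile_labels msnd atomless_y m.
have [b sb hb] := estimator_close mc cmono cmass t01.
exists b => //; exists 5%N => n n5; apply: (le_trans (hb n n5)).
rewrite -/C mulrA -/A; rewrite lerD2r [leRHS](splitr e).
exact: lerD.
Qed.

End rank_variance.

(** * From the rank form to the estimators *)

Section neighbour_change.
Context {R : realType} {n : nat}.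
Variables (r : 'I_n -> nat) (N0 N1 N2 N0' N1' N2' : 'I_n -> 'I_n).
Hypothesis n2 : (1 < n)%N.
Hypothesis rn : forall i, (r i <= n)%N.
Variable exc : {set 'I_n}.
Hypothesis same : forall i, i \notin exc -> [/\ N0 i = N0' i, N1 i = N1' i & N2 i = N2' i].

(** The minima change at the exceptional vertices only, and each Hr by at most
    their proportion. *)
Lemma GR_change : `|@GR R n r N0 N1 N2 (fun=> false) (fun=> 0%N) -
    GR r N0' N1' N2' (fun=> false) (fun=> 0%N)| <= 86 * #|exc|%:R / n%:R.
Proof.
have n0 : (0 : R) < n%:R by rewrite ltr0n; lia.
have i0 : (0 : R) <= n%:R^-1 by rewrite invr_ge0 ltW.
set b : R := #|exc|%:R; have b0 : 0 <= b by exact: ler0n.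
have mb i j : `|@mr R n r i j| <= 1 by exact: mr_norm.
have hb M l : `|@Hr R n r M l| <= 1 by exact: Hr_norm.
have excE (B : R) : \sum_i (i \in exc)%:R * B = b * B.
  by rewrite -mulr_suml sum_bool_card.
have unit_diff (x y : R) : 0 <= x <= 1 -> 0 <= y <= 1 -> `|x - y| <= 1.
  by move=> /andP[? ?] /andP[? ?]; rewrite ler_norml; apply/andP; split; lra.
have avgb (f : 'I_n -> R) (B : R) : (forall i, `|f i| <= (i \in exc)%:R * B) ->
    `|n%:R^-1 * \sum_i f i| <= b / n%:R * B.
  move=> fB; rewrite normrM ger0_norm// mulrAC mulrC; apply: ler_wpM2r => //.
  by rewrite -excE; apply: (le_trans (ler_norm_sum _ _ _)); exact: ler_sum.
have dH l : `|@Hr R n r N0 l - Hr r N0' l| <= b / n%:R.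
  rewrite /Hr -mulrBl mulrC -sumrB -[leRHS]mulr1; apply: avgb => i; rewrite mulr1.
  have [ie|/same[-> _ _]] := boolP (i \in exc); last by rewrite subrr normr0.
  by apply: unit_diff; rewrite ler0n lern1 leq_b1.
have dA : `|n%:R^-1 * \sum_i @mr R n r i (N0 i) - n%:R^-1 * \sum_i mr r i (N0' i)| <= b / n%:R.
  rewrite -mulrBr -sumrB -[leRHS]mulr1; apply: avgb => i; rewrite mulr1.
  have [ie|/same[-> _ _]] := boolP (i \in exc); last by rewrite subrr normr0.
  by apply: unit_diff; exact: mr_bound.
have A1 M : `|n%:R^-1 * \sum_i @mr R n r i (M i)| <= 1.
  by rewrite normrM ger0_norm// ler_pdivrMl//; apply: sum_le_n => i; exact: mb.
pose gf M0 M1 M2 i : R := gform false%:R 0 (mr r i (M0 i)) (mr r i (M1 i)) (mr r (M1 i) (M2 i))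
    (mr r (M0 i) (M1 i)) (Hr r M0 i).
have dg i : `|gf N0 N1 N2 i - gf N0' N1' N2' i| <= (i \in exc)%:R * 52 + 26 * (b / n%:R).
  have [ie|/same[e0 e1 e2]] := boolP (i \in exc).
    have two (x y : R) : `|x| <= 1 -> `|y| <= 1 -> `|x - y| <= 2.
      by move=> hx hy; apply: (le_trans (ler_normB _ _)); rewrite (_ : 2 = 1 + 1 :> R) ?lerD//; ring.
    rewrite mul1r; apply: (@le_trans _ _ ((26 + 4 * 0) * 2)); last first.
      have : 0 <= b / n%:R by exact: mulr_ge0.
      by move: (b / _) => ? ?; lra.
    by apply: (@gform_close R _ _ 0) => //; rewrite ?lexx//; apply: two.
  rewrite mul0r add0r -[26 in leRHS]addr0 -[X in 26 + X](mulr0 4).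
  rewrite /gf e0 e1 e2; have z0 : 0 <= b / n%:R by exact: mulr_ge0.
  by apply: (@gform_close R _ _ 0) => //; rewrite ?lexx ?subrr ?normr0.
have dS : `|n%:R^-1 * \sum_i gf N0 N1 N2 i - n%:R^-1 * \sum_i gf N0' N1' N2' i| <= 78 * (b / n%:R).
  rewrite -mulrBr -sumrB normrM ger0_norm// ler_pdivrMl//.
  apply: (le_trans (ler_norm_sum _ _ _)); apply: (le_trans (ler_sum _ (fun i _ => dg i))).
  rewrite big_split/= excE sumr_const card_ord -[X in _ + X]mulr_natl.
  by rewrite le_eqVlt; apply/orP; left; apply/eqP; field; rewrite gt_eqF.
rewrite /GR (_ : 86 * b / n%:R = 86 * (b / n%:R)); last by ring.
pose A := n%:R^-1 * \sum_i @mr R n r i (N0 i); pose A' := n%:R^-1 * \sum_i @mr R n r i (N0' i).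
have dA2 : `|A ^+ 2 - A' ^+ 2| <= 2 * (b / n%:R).
  by rewrite !expr2; apply: mul_close; [exact: A1|exact: A1|exact: dA|exact: dA].
move: dS dA2; rewrite /gf.
rewrite -/A -/A'; move: (A ^+ 2) (A' ^+ 2) (n%:R^-1 * _) (n%:R^-1 * _) => x1 x2 x3 x4.
move: (b / n%:R) => t; rewrite !ler_norml => /andP[? ?] /andP[? ?].
by apply/andP; split; lra.
Qed.

Lemma GR_eq_weights (w w' : 'I_n -> bool) (s s' : 'I_n -> nat) : w =1 w' -> s =1 s' ->
  @GR R n r N0 N1 N2 w s = GR r N0 N1 N2 w' s'.
Proof. by move=> /funext -> /funext ->. Qed.

End neighbour_change.

Lemma Var_affine (R : realType) (disp : measure_display) (W : measurableType disp)
    (P : probability W R) (f : W -> R) (k a : R) : bmf f ->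
  Var P (fun w => k + a * f w) = a ^+ 2 * Var P f.
Proof.
move=> bf; have baf : bmf (fun w => a * f w) by exact: bmfZ.
have bs : bmf (fun w => (f w - Ex P f) ^+ 2) by apply: bmfX; apply: bmfB => //; exact: bmf_cst.
rewrite /Var -(ExZ P _ bs) (ExD P (bmf_cst k) baf) Ex_cst (ExZ P _ bf).
by apply: eq_Ex => w; ring.
Qed.

Lemma scaling_bound (R : realType) (x : R) : 3 <= x ->
  36 <= (6 * x / (x ^+ 2 - 1)) ^+ 2 * x ^+ 2 <= 36 + 108 / x.
Proof.
move=> x3; have x0 : 0 < x by lra.
have y0 : 0 < x ^+ 2 - 1 by nra.
pose w := (x ^+ 2 - 1)^-1; have w0 : 0 < w by rewrite invr_gt0.
have -> : (6 * x / (x ^+ 2 - 1)) ^+ 2 * x ^+ 2 = 36 * (1 + w) ^+ 2.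
  by rewrite /w; field; rewrite gt_eqF.
have wx : w <= x^-1 by rewrite lef_pV2 ?posrE//; nra.
have w1 : w <= 1 by apply: (le_trans wx); rewrite invf_le1//; lra.
have ww : w ^+ 2 <= w by rewrite expr2 ler_piMr// ltW.
have w2 := sqr_ge0 w; have -> : 36 * (1 + w) ^+ 2 = 36 + 72 * w + 36 * w ^+ 2 by ring.
move: (x^-1) (w ^+ 2) wx ww w2 => v u ? ? ?.
by apply/andP; split; lra.
Qed.

Section consistency.
Context {R : realType} {d : nat}.
Hypothesis hd : (0 < d)%N.
Local Notation X := (d.-tuple R).
Local Notation E := (X * R)%type.
Variable rho : X -> X -> X -> bool.
Hypothesis prox : proximity rho.
Variable mu : probability E R.
Hypothesis atomless : forall k t, mu [set e : E | tnth e.1 k = t] = 0%E.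
Hypothesis atomless_y : forall t, mu [set e : E | e.2 = t] = 0%E.
Variable la : forall n, probability (n.-tuple E) R.
Hypothesis iid : forall n, iid_law mu (la n).

Lemma bmf_rank_stats n : bmf (@rank_form R d rho n) /\ bmf (@rank_sum R d rho n).
Proof.
have msnd : measurable_fun setT (snd : E -> R) by exact: measurable_snd.
have [c [mc _ _]] := quantile_labels msnd atomless_y 0.
by split; [exact: (bmf_rank_form prox mc)|exact: (bmf_rank_sum prox mc)].
Qed.

(** It is estimated in mean by the rank form, which is bounded. *)
Lemma normalized_variance_bounded : exists2 M : R, 0 <= M & exists n0, forall n, (n0 <= n)%N ->
  n%:R^-1 * Var (la n) (@rank_sum R d rho n) <= M.
Proof.
have [D hD] := prox_degree prox.
have [n0 hn0] := rank_variance_estimator hd prox atomless atomless_y iid hD ltr01.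
exists (1 + (26 + 4 * D%:R + 4)); first by rewrite !addr_ge0// mulr_ge0.
exists (maxn 5 n0) => n; rewrite geq_max => /andP[n5 nn].
have [bf bs] := bmf_rank_stats n; set v := _ * _.
have bv : bmf (fun z : n.-tuple E => `|rank_form rho z - v|) by apply: bmf_norm; apply: bmfB => //; exact: bmf_cst.
apply: (@le_trans _ _ (Ex (la n) (fun z : n.-tuple E => `|rank_form rho z - v| + (26 + 4 * D%:R + 4)))); last first.
  by rewrite (ExD _ bv (bmf_cst _)) Ex_cst lerD2r; exact: hn0.
rewrite -[X in X <= _](Ex_cst (la n)).
apply: (Ex_le_full (full_distinct hd atomless (iid (n := n)))).
- exact: bmf_cst.
- by apply: bmfD => //; exact: bmf_cst.
move=> z dz; have n2 : (1 < n)%N by lia.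
have np : (0 : R) < n%:R by rewrite ltr0n; lia.
have rn : forall i, (ranks z i <= n)%N := @rank_le _ _ (ys z).
have mb i j : `|@mr R n (ranks z) i j| <= 1 by exact: mr_norm.
have hb l : `|@Hr R n (ranks z) (Nb rho 0 z) l| <= 1 by exact: Hr_norm.
have fb : `|rank_form rho z| <= 26 + 4 * D%:R + 4.
  rewrite /rank_form /GR; apply: (le_trans (ler_normB _ _)); apply: lerD.
    rewrite normrM ger0_norm ?invr_ge0 ?(ltW np)// ler_pdivrMl//; apply: sum_le_n => i.
    have g0 (m s : R) : gform m s 0 0 0 0 0 = 0 by rewrite /gform; ring.
    rewrite -[X in `|X|]subr0 -[X in _ - X](g0 (mut (nbs rho (xs z)) i)%:R (shr (nbs rho (xs z)) i)%:R).
    rewrite -[leRHS]mulr1; apply: (@gform_close R _ _ D%:R); rewrite ?subr0 ?normr0//.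
    by rewrite ler0n ler_nat; apply: shr_le.
  rewrite normrM ger0_norm// -[leRHS]mulr1; apply: ler_wpM2l => //.
  rewrite normrX exprn_ile1// normrM ger0_norm ?invr_ge0 ?(ltW np)// ler_pdivrMl//.
  by apply: sum_le_n => i.
rewrite -[X in X <= _](subrK (rank_form rho z)); apply: lerD; first by rewrite distrC ler_norm.
exact: le_trans (ler_norm _) fb.
Qed.

Variables (f g : forall n, n.-tuple E -> R) (Dn : forall n, set (n.-tuple E)).
Hypothesis bf : forall n, bmf (@f n).
Hypothesis bg : forall n, bmf (@g n).
Hypothesis fullD : forall n, full (la n) (@Dn n).
Variables (kk : nat -> R) (C : R).
Hypothesis C0 : 0 <= C.
Hypothesis hf : forall n z, (4 < n)%N -> Dn z -> `|@f n z - 36 * rank_form rho z| <= C / n%:R.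
Hypothesis hg : forall n z, (4 < n)%N -> Dn z ->
  `|@g n z - (kk n + 6 * n%:R / (n%:R ^+ 2 - 1) * rank_sum rho z)| <= C / n%:R.

(** A statistic f close to the rank form estimates n times the variance of any
    statistic g that is asymptotically affine in the rank statistic. *)
Lemma variance_consistency :
  small (fun n => Ex (la n) (fun z => `|@f n z - n%:R * Var (la n) (@g n)|)).
Proof.
have [D hD] := prox_degree prox.
have [M M0 [n0 hM]] := normalized_variance_bounded.
apply: small_approx => e e0.
pose W := 3 * (72 * M + 1); have W0 : 0 < W by rewrite /W; lra.
pose t : R := Num.min 1 (e / W); have eW : 0 < e / W by exact: divr_gt0.
have t01 : 0 < t <= 1 by rewrite lt_min ltr01 eW /= ge_min lexx.
have tW : t * W <= e by rewrite -ler_pdivlMr// ge_min lexx orbT.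
have /andP[t0 _] := t01.
exists (fun n => 36 * Ex (la n) (fun z : n.-tuple E => `|rank_form rho z - n%:R^-1 * Var (la n) (@rank_sum R d rho n)|)
   + (C + 108 * M + 4 / t * C ^+ 2) / n%:R).
  apply: smallD (small_inv _); apply: smallZ => //.
  exact: (rank_variance_estimator hd prox atomless atomless_y iid hD).
exists (maxn 5 n0) => n; rewrite geq_max => /andP[n5 /hM].
have [brf brs] := bmf_rank_stats n.
have np : (0 : R) < n%:R by rewrite ltr0n; apply: leq_trans n5.
set V := Var (la n) (@rank_sum R d rho n); set v := _^-1 * V => vM.
have v0 : 0 <= v by rewrite mulr_ge0 ?Var_ge0// invr_ge0 ltW.
pose a : R := 6 * n%:R / (n%:R ^+ 2 - 1).
have n3 : (3 : R) <= n%:R by rewrite ler_nat; apply: leq_trans n5.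
have /andP[q1 q2] := scaling_bound n3; rewrite -/a in q1 q2.
pose g' (z : n.-tuple E) := kk n + a * rank_sum rho z.
have bg' : bmf g' by apply: bmfD; [exact: bmf_cst|exact: bmfZ].
have Vg' : Var (la n) g' = a ^+ 2 * V by exact: Var_affine.
have w1 := Var_close (la n) (@bg n) bg' t01; rewrite Vg' in w1.
have w2 : Var (la n) (fun z => @g n z - g' z) <= (C / n%:R) ^+ 2.
  apply: (le_trans (Var_le (la n) 0 (bmfB (@bg n) bg'))).
  rewrite -[leRHS](Ex_cst (la n)); apply: (Ex_le_full (fullD n)).
  - by apply: bmfX; apply: bmfB; [exact: (bmfB (@bg n) bg')|exact: bmf_cst].
  - exact: bmf_cst.
  move=> z Dz; rewrite subr0 -[X in X <= _]real_normK ?num_real// lerXn2r ?nnegrE//; last exact: hg.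
  by rewrite divr_ge0// ltW.
set VG := Var (la n) (@g n) in w1 *; set VD := Var (la n) _ in w1 w2.
have nV : n%:R * (a ^+ 2 * V) = a ^+ 2 * n%:R ^+ 2 * v by rewrite /v; field; rewrite gt_eqF.
have q3 : 108 / n%:R <= 36 :> R by rewrite ler_pdivrMr//; move: n3; move: (n%:R) => ?; lra.
have w3 : `|n%:R * VG - a ^+ 2 * n%:R ^+ 2 * v| <= e + 4 / t * C ^+ 2 / n%:R.
  rewrite -nV -mulrBr normrM ger0_norm ?(ltW np)//; apply: (le_trans (ler_wpM2l (ltW np) w1)).
  rewrite mulrDr; apply: lerD; last first.
    rewrite mulrCA -mulrA; apply: ler_wpM2l; first by rewrite divr_ge0// ltW.
    rewrite (_ : C ^+ 2 / n%:R = n%:R * (C / n%:R) ^+ 2); last by field; rewrite gt_eqF.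
    by apply: ler_wpM2l => //; exact: ltW.
  rewrite mulrCA nV; apply: le_trans tW; rewrite /W mulrA (mulrC t); apply: ler_wpM2l.
    by rewrite mulr_ge0// ltW.
  apply: (@le_trans _ _ (72 * v)); last by rewrite -[leLHS]addr0; apply: lerD => //; exact: ler_wpM2l.
  by apply: ler_wpM2r => //; move: q2 q3; move: (108 / _) => ? ? ?; lra.
have w4 : `|36 * v - a ^+ 2 * n%:R ^+ 2 * v| <= 108 * M / n%:R.
  rewrite -mulrBl normrM (ger0_norm v0) distrC ger0_norm ?subr_ge0//.
  have d0 : 0 <= a ^+ 2 * n%:R ^+ 2 - 36 by rewrite subr_ge0.
  have d1 : a ^+ 2 * n%:R ^+ 2 - 36 <= 108 / n%:R by rewrite lerBlDr addrC.
  by rewrite [leRHS]mulrAC; exact: (ler_pM d0 v0 d1 vM).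
have bd : bmf (fun z : n.-tuple E => `|rank_form rho z - v|) by apply: bmf_norm; apply: bmfB => //; exact: bmf_cst.
have bd' : bmf (fun z : n.-tuple E => 36 * `|rank_form rho z - v|) by exact: bmfZ.
apply: (@le_trans _ _ (Ex (la n) (fun z : n.-tuple E => 36 * `|rank_form rho z - v| +
   (C / n%:R + `|36 * v - a ^+ 2 * n%:R ^+ 2 * v| + `|n%:R * VG - a ^+ 2 * n%:R ^+ 2 * v|)))).
  apply: (Ex_le_full (fullD n)).
  - by apply: bmf_norm; apply: bmfB; [exact: bf|exact: bmf_cst].
  - by apply: bmfD; [exact: bd'|exact: bmf_cst].
  move=> z Dz; have h1 := hf n5 Dz.
  rewrite (_ : @f n z - n%:R * VG = 36 * (rank_form rho z - v) + (@f n z - 36 * rank_form rho z)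
    + (36 * v - a ^+ 2 * n%:R ^+ 2 * v) - (n%:R * VG - a ^+ 2 * n%:R ^+ 2 * v)); last by ring.
  apply: (le_trans (ler_normB _ _)); rewrite [leRHS]addrA; apply: (lerD _ (lexx _)).
  apply: (le_trans (ler_normD _ _)); rewrite [leRHS]addrA; apply: (lerD _ (lexx _)).
  apply: (le_trans (ler_normD _ _)); apply: (lerD _ h1).
  by rewrite normrM (ger0_norm (ler0n _ 36)).
rewrite (ExD _ bd' (bmf_cst _)) Ex_cst (ExZ _ _ bd).
rewrite [leRHS]addrCA lerD2l; apply: (le_trans (lerD (lerD (lexx _) w4) w3)).
by rewrite le_eqVlt; apply/orP; left; apply/eqP; ring.
Qed.

End consistency.

Section nearest_neighbour_statistics.
Context {R : realType} {d n : nat}.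
Local Notation E := (d.-tuple R * R)%type.
Implicit Types z : n.-tuple E.
Local Notation nbz z := (nbs (@rho_nn R d) (xs z)).

Lemma sigma2_hatE z : sigma2_hat (xs z) (ys z) =
  36 * sig (ranks z) (Nb (@rho_nn R d) 0 z) (Nb (@rho_nn R d) 1 z) (Nb (@rho_nn R d) 2 z)
    (mut (nbz z)) (shr (nbz z)).
Proof. by []. Qed.

Lemma xiE z : (1 < n)%N -> xi (xs z) (ys z) =
  - ((2 * n%:R + 1) / (n%:R - 1)) + 6 * n%:R / (n%:R ^+ 2 - 1) * rank_sum (@rho_nn R d) z.
Proof.
move=> n2; rewrite addrC /xi; congr (_ - _).
have n0 : (n%:R : R) != 0 by rewrite pnatr_eq0 -lt0n ltnW.
rewrite /rank_sum /mr -mulr_suml.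
pose S : R := \sum_i (minn (ranks z i) (ranks z (Nb (@rho_nn R d) 0 z i)))%:R.
change (6 / (n%:R ^+ 2 - 1) * S = 6 * n%:R / (n%:R ^+ 2 - 1) * (S / n%:R)).
move: S (n%:R ^+ 2 - 1)^-1 => S v.
by move: (n%:R : R) n0 => x x0; field.
Qed.

End nearest_neighbour_statistics.

Lemma ratio_le (R : realType) (n : nat) (C : R) : 0 <= C -> (1 < n)%N ->
  C / (n%:R - 1) <= 2 * C / n%:R.
Proof.
move=> C0 n2; have x2 : (2 : R) <= n%:R by rewrite ler_nat.
rewrite [leRHS]mulrAC mulrC; apply: ler_wpM2r => //.
move: (n%:R) x2 => x x2; rewrite -div1r ler_pdivrMr; last by lra.
by rewrite mulrAC ler_pdivlMr; lra.
Qed.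

Section right_neighbour_statistics.
Context {R : realType} {n : nat}.
Local Notation E := (1.-tuple R * R)%type.
Local Notation rho := (@rho_cyc R).
Implicit Types z : n.-tuple E.

Definition position z (i : 'I_n) : R := tnth (xs z i) ord0.
Local Notation Nr k z := (right_neighbor (position z) k).

Definition position_pattern z : {ffun 'I_n * 'I_n -> bool} :=
  [ffun t => position z t.1 <= position z t.2].

Definition right_of (pat : {ffun 'I_n * 'I_n -> bool}) k i : 'I_n :=
  nth i (sort (fun j l => pat (j, l)) [seq j <- enum 'I_n | ~~ pat (j, i)]) k.-1.

Lemma right_neighborE z k : Nr k z = right_of (position_pattern z) k.
Proof.
apply/funext => i; rewrite /right_neighbor /right_of; congr (nth _ _ _).
have -> : [seq j <- enum 'I_n | ~~ position_pattern z (j, i)] =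
    [seq j <- enum 'I_n | position z i < position z j].
  by apply: eq_filter => j; rewrite ffunE ltNge.
by congr sort; apply/funext => j; apply/funext => l; rewrite ffunE.
Qed.

Lemma bmf_right (Phi : ('I_n -> nat) -> (nat -> 'I_n -> 'I_n) -> R) :
  bmf (fun z => Phi (ranks z) (fun k => Nr k z)).
Proof.
have fp : finobs position_pattern.
  apply: finobs_ffun => t; apply: finobs_bool.
  have mp i : measurable_fun setT (fun z => position z i).
    by apply: (measurableT_comp (measurable_tnth ord0)); exact: measurable_xs.
  by apply: measurable_fun_ler; exact: mp.
apply: bmf_ext (bmf_obs (fun o : {ffun 'I_n * 'I_n -> bool} * {ffun 'I_n * 'I_n -> bool} =>
  Phi (fun i => (\sum_(j < n) o.1 (j, i))%N) (right_of o.2))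
  (finobs_pair (@finobs_comparisons R 1 n) fp)) => z /=.
congr (Phi _ _); last by apply/funext => k; exact: right_neighborE.
by apply/funext => i; rewrite /ranks /rank; apply: eq_bigr => j _; rewrite ffunE.
Qed.

Lemma sigma2_hat_barE z : sigma2_hat_bar (position z) (ys z) =
  36 * sig (ranks z) (Nr 1 z) (Nr 2 z) (Nr 3 z) (fun=> false) (fun=> 0%N).
Proof.
rewrite /sigma2_hat_bar /sig; congr (36 * (_ + _ - _ + _ - _ + _ - _)).
- by congr (_ * _); apply: eq_bigr => i _; rewrite addr0 mulr1.
- rewrite [in RHS](eq_bigr (fun i => 2 * ((minn (ranks z i) (ranks z (Nr 1 z i)))%:R *
      (minn (ranks z i) (ranks z (Nr 2 z i)))%:R))); last by move=> i _ /=; ring.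
  by rewrite -mulr_sumr mulrA; congr (_ * _); ring.
- rewrite [in RHS](eq_bigr (fun i => 2 * ((minn (ranks z i) (ranks z (Nr 1 z i)))%:R *
      (minn (ranks z (Nr 2 z i)) (ranks z (Nr 3 z i)))%:R))); last by move=> i _ /=; ring.
  by rewrite -mulr_sumr mulrA; congr (_ * _); ring.
Qed.

Hypothesis n5 : (4 < n)%N.
Variable z : n.-tuple E.
Hypothesis inj_u : injective (position z).
Hypothesis inj_y : injective (ys z).

(** The vertices lacking a third right neighbour. *)
Let exc : {set 'I_n} := [set i | (nright (xs z) i < 3)%N]%SET.

Let inj_x : injective (xs z).
Proof. by move=> i j e; apply: inj_u; rewrite /position e. Qed.

Let n2 : (1 < n)%N. Proof. exact: leq_trans n5. Qed.
Let n3 : (2 < n)%N. Proof. exact: leq_trans n5. Qed.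
Let np : (0 : R) < n%:R. Proof. by rewrite ltr0n; apply: leq_trans n5. Qed.

Let card_exc : (#|exc| <= 3)%N.
Proof. by rewrite cardsE; exact: (card_few_right inj_x). Qed.

Let right_same i : i \notin exc -> [/\ Nr 1 z i = Nb rho 0 z i, Nr 2 z i = Nb rho 1 z i
  & Nr 3 z i = Nb rho 2 z i].
Proof.
rewrite inE -leqNgt => h; split; apply: right_neighbor_cyc; rewrite //=.
- exact: leq_trans h.
- exact: leq_trans h.
Qed.

(** The cyclic right neighbour is a permutation without short cycles. *)
Lemma rank_form_cyc : rank_form rho z =
  GR (ranks z) (Nb rho 0 z) (Nb rho 1 z) (Nb rho 2 z) (fun=> false) (fun=> 0%N).
Proof.
apply: GR_eq_weights => i.
  apply/negbTE; rewrite /mut eq_sym.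
  exact: (N1_cyc_not_mutual inj_x n3).
rewrite /shr eq_card0// => j; rewrite !inE; apply/negP => /andP[ji /eqP e].
by move/negP: ji; apply; apply/eqP; exact: (N1_cyc_inj inj_x n3 e).
Qed.

Lemma sigma2_hat_bar_close :
  `|sigma2_hat_bar (position z) (ys z) - 36 * rank_form rho z| <= 9792 / n%:R.
Proof.
have rn : forall i, (ranks z i <= n)%N := @rank_le _ _ (ys z).
have rc : forall i, (\sum_(l < n) (ranks z l <= ranks z i)%N)%N = ranks z i := @rank_count _ _ (ys z).
rewrite sigma2_hat_barE rank_form_cyc -mulrBr normrM (ger0_norm (ler0n _ 36)).
(* 14 / n from the diagonal terms, 258 = 86 * 3 from the exceptional vertices *)
rewrite (_ : 9792 / n%:R = 36 * (14 / n%:R + 258 / n%:R)); last by ring.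
apply: ler_wpM2l => //; set s := sig _ _ _ _ _ _; set g' := GR _ _ _ _ _ _.
pose g := @GR R n (ranks z) (Nr 1 z) (Nr 2 z) (Nr 3 z) (fun=> false) (fun=> 0%N).
rewrite (_ : s - g' = (s - g) + (g - g')); last by ring.
apply: (le_trans (ler_normD _ _)); apply: lerD.
  apply: (le_trans (sig_GR (Nr 1 z) (Nr 2 z) (Nr 3 z) (fun=> false) (fun=> 0%N) n2 rn rc)).
  by apply: (le_trans (ratio_le _ n2)) => //; rewrite -natrM.
apply: (le_trans (GR_change n2 rn right_same)).
apply: ler_wpM2r; first by rewrite invr_ge0 ltW.
by rewrite -natrM ler_nat (leq_mul (leqnn 86) card_exc).
Qed.

(** |a - b| = a + b - 2 min(a, b), and the cyclic successor is a permutation. *)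
Lemma sum_abs_cyc : \sum_i `|(ranks z (Nb rho 0 z i))%:R - (ranks z i)%:R| =
  n%:R ^+ 2 + n%:R - 2 * n%:R * rank_sum rho z.
Proof.
have absE (a b : nat) : `|a%:R - b%:R| = a%:R + b%:R - 2 * (minn b a)%:R :> R.
  wlog ab : a b / (a <= b)%N.
    by move=> H; have /orP[/H//|/H h] := leq_total a b; rewrite distrC h minnC [b%:R + _]addrC.
  rewrite (minn_idPr ab) ler0_norm ?subr_le0 ?ler_nat//; ring.
have perm : \sum_i (ranks z (Nb rho 0 z i))%:R = \sum_i (ranks z i)%:R :> R.
  by rewrite [RHS](reindex_inj (N1_cyc_inj inj_x n3)).
rewrite (eq_bigr _ (fun i _ => absE _ _)) sumrB big_split/= perm -mulr_sumr.
have -> : \sum_i (ranks z i)%:R + \sum_i (ranks z i)%:R = n%:R ^+ 2 + n%:R :> R.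
  by rewrite -natr_sum -natrX -!natrD -(sum_rank inj_y) mul2n addnn.
congr (_ - _); rewrite -mulrA; congr (_ * _); rewrite /rank_sum mulr_sumr; apply: eq_bigr => i _.
by rewrite /mr mulrC divfK// gt_eqF.
Qed.

(** Each of the exceptional vertices contributes at most n to the difference
    with the cyclic statistic. *)
Lemma xi_bar_close :
  `|xi_bar (position z) (ys z) - (1 - 3 / (n%:R ^+ 2 - 1) * (n%:R ^+ 2 + n%:R)
     + 6 * n%:R / (n%:R ^+ 2 - 1) * rank_sum rho z)| <= 9792 / n%:R.
Proof.
have rn : forall i, (ranks z i <= n)%N := @rank_le _ _ (ys z).
have y0 : (0 : R) < n%:R ^+ 2 - 1 by rewrite subr_gt0 exprn_egt1 ?ltr1n.
set T := \sum_i `|(ranks z (Nr 1 z i))%:R - (ranks z i)%:R| : R.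
have -> : xi_bar (position z) (ys z) - (1 - 3 / (n%:R ^+ 2 - 1) * (n%:R ^+ 2 + n%:R)
     + 6 * n%:R / (n%:R ^+ 2 - 1) * rank_sum rho z) =
   3 / (n%:R ^+ 2 - 1) * (\sum_i `|(ranks z (Nb rho 0 z i))%:R - (ranks z i)%:R| - T).
  by rewrite sum_abs_cyc /xi_bar -/T; ring.
have dT : `|\sum_i `|(ranks z (Nb rho 0 z i))%:R - (ranks z i)%:R| - T| <= 3 * n%:R.
  apply: (@le_trans _ _ (\sum_i (i \in exc)%:R * n%:R)).
    rewrite -sumrB; apply: (le_trans (ler_norm_sum _ _ _)); apply: ler_sum => i _.
    have [ie|/right_same[-> _ _]] := boolP (i \in exc); last by rewrite subrr normr0 mul0r.
    have bound j : 0 <= (ranks z j)%:R :> R /\ (ranks z j)%:R <= n%:R :> R.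
      by split; [exact: ler0n|rewrite ler_nat].
    have rb j k : 0 <= `|(ranks z j)%:R - (ranks z k)%:R| :> R /\
        `|(ranks z j)%:R - (ranks z k)%:R| <= n%:R :> R.
      split; first exact: normr_ge0.
      have [j0 jn] := bound j; have [k0 kn] := bound k.
      by rewrite ler_norml; apply/andP; split; lra.
    have [? ?] := rb (Nb rho 0 z i) i; have [? ?] := rb (Nr 1 z i) i.
    by rewrite mul1r ler_norml; apply/andP; split; lra.
  rewrite -mulr_suml sum_bool_card; apply: ler_wpM2r; first exact: ltW.
  by rewrite ler_nat; exact: card_exc.
rewrite normrM ger0_norm ?divr_ge0 ?(ltW y0)//.
apply: (le_trans (ler_wpM2l _ dT)); first by rewrite divr_ge0// ltW.
have n2' : (2 : R) <= n%:R by rewrite ler_nat.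
rewrite mulrAC ler_pdivrMr// mulrAC ler_pdivlMr//.
have := np; move: (n%:R) n2' => x x2 x0; nra.
Qed.

End right_neighbour_statistics.

(** * Convergence in probability *)

Lemma fullI (R : realType) (disp : measure_display) (W : measurableType disp)
    (P : probability W R) (A B : set W) : full P A -> full P B -> full P (A `&` B).
Proof.
move=> fA fB; have [mA _] := fA; have [mB PB] := fB.
have mAB := measurableI _ _ mA mB; split => //.
rewrite -(Ex_indicE P mAB) -PB -(Ex_indicE P mB); congr EFin.
apply: (Ex_eq_full fA); [exact: bmf_indic|exact: bmf_indic|move=> w Aw].
by rewrite !indicE in_setI (mem_set Aw).
Qed.

Lemma fine_variance (R : realType) (disp : measure_display) (W : measurableType disp)
    (P : probability W R) (f : W -> R) : fine (variance P f) = Var P f.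
Proof.
by rewrite /variance !unlock.
Qed.

Lemma cvg_in_probability_small (R : realType) (disp : measure_display)
    (W : measurableType disp) (P : probability W R) (f : nat -> W -> R) :
  (forall n, bmf (f n)) -> small (fun n => Ex P (fun w => `|f n w|)) ->
  cvg_in_probability P f 0.
Proof.
move=> bf sf e e0.
have mA n : measurable [set w | e < `|f n w - 0|].
  have mf : measurable_fun setT (fun w => `|f n w - 0|).
    by have [] : bmf (fun w => `|f n w - 0|) by apply: bmf_norm; apply: bmfB; [exact: bf|exact: bmf_cst].
  have := finobs_bool (measurable_fun_ltr (@measurable_cst _ _ W R setT e) mf) true.
  by congr measurable; apply/seteqP; split => w.
apply/fine_cvgP; split; first by near=> n; exact: fin_num_measure.
apply/cvgrPdist_le => t t0; have [n0 hn] := sf _ (mulr_gt0 t0 e0).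
exists n0 => // n /= /hn h; rewrite sub0r normrN -(Ex_indic P (mA n)).
rewrite ger0_norm; last by apply: Ex_ge0 => w; rewrite indicE.
have bn : bmf (fun w => `|f n w|) by exact: bmf_norm.
apply: (@le_trans _ _ (Ex P (fun w => e^-1 * `|f n w|))); last first.
  by rewrite ExZ// mulrC ler_pdivrMr.
apply: Ex_le; [exact: bmf_indic|exact: bmfZ|move=> w].
rewrite indicE; case: (boolP (w \in _)) => [|_]; last by rewrite mulr_ge0// invr_ge0 ltW.
by rewrite inE /= subr0 ler_pdivlMl// mulr1 => /ltW.
Unshelve. all: by end_near.
Qed.

Section sample_law.
Context {R : realType} {d : nat} {disp0 disp : measure_display}.
Context {T0 : measurableType disp0} {T : measurableType disp}.
Variables (P0 : probability T0 R) (P : probability T R).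
Variables (X : {RV P0 >-> d.-tuple R}) (Y : {RV P0 >-> R}).
Variables (Xs : nat -> {RV P >-> d.-tuple R}) (Ys : nat -> {RV P >-> R}).
Local Notation E := (d.-tuple R * R)%type.
Lemma measurable_pair_XY : measurable_fun setT (fun w => (X w, Y w)).
Proof. by apply: measurable_fun_pair. Qed.

Definition law : probability E R := distribution P0 (mk_mfun measurable_pair_XY).

Definition sample n (w : T) : n.-tuple E := [tuple (Xs i w, Ys i w) | i < n].

Lemma measurable_sample n : measurable_fun setT (@sample n).
Proof.
apply/measurable_fun_tnthP => i.
have -> : (tnth (T:=E))^~ i \o @sample n = (fun w => (Xs i w, Ys i w)).
  by apply/funext => w; rewrite /= tnth_mktuple.
by apply: measurable_fun_pair.
Qed.

Definition sample_law n : probability (n.-tuple E) R :=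
  distribution P (mk_mfun (@measurable_sample n)).

Lemma xs_sample n w : xs (sample n w) = (fun i : 'I_n => Xs i w).
Proof. by apply/funext => i; rewrite /xs tnth_mktuple. Qed.

Lemma ys_sample n w : ys (sample n w) = (fun i : 'I_n => Ys i w).
Proof. by apply/funext => i; rewrite /ys tnth_mktuple. Qed.

Lemma iid_sample n :
  iid_copies P0 P (fun w => (X w, Y w)) (fun (i : nat) w => (Xs i w, Ys i w)) ->
  iid_law law (sample_law n).
Proof.
move=> [ind same] B mB.
pose B' (i : nat) : set E := if insub i is Some j then B j else setT.
have mB' i : measurable (B' i) by rewrite /B'; case: insubP => [j _ _|_] //; exact: measurableT.
have B'E (i : 'I_n) : B' i = B i by rewrite /B' valK.
have -> : sample_law n (rect B) = P (\bigcap_(i in [set` iota 0 n]) ((fun w => (Xs i w, Ys i w)) @^-1` B' i)).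
  congr (P _); apply/seteqP; split => w /=.
    move=> h i /=; rewrite mem_iota add0n => /andP[_ ilt].
    by have := h (Ordinal ilt); rewrite tnth_mktuple -B'E.
  move=> h i; have := h i; rewrite /= mem_iota add0n ltn_ord => /(_ isT).
  by rewrite B'E tnth_mktuple.
rewrite (ind _ _ (iota_uniq 0 n) mB') -{1}(subn0 n) -/(index_iota 0 n) big_mkord.
by apply: eq_bigr => i _; rewrite B'E (same i _ (mB i)).
Qed.

Lemma cvg_sample (f g : forall n, n.-tuple E -> R) :
  (forall n, bmf (@f n)) -> (forall n, bmf (@g n)) ->
  small (fun n => Ex (sample_law n) (fun z => `|@f n z - n%:R * Var (sample_law n) (@g n)|)) ->
  cvg_in_probability P (fun n w => @f n (sample n w) -
    n%:R * fine (variance P (fun w' => @g n (sample n w')))) 0.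
Proof.
move=> bf bg sm.
have vE n : Var (sample_law n) (@g n) = fine (variance P (fun w' => @g n (sample n w'))).
  have bs c : bmf (fun z => (@g n z - c) ^+ 2) by apply: bmfX; apply: bmfB; [exact: bg|exact: bmf_cst].
  by rewrite fine_variance /Var /sample_law (Ex_distribution _ _ (bs _)) (Ex_distribution _ _ (bg n)).
apply: cvg_in_probability_small => [n|].
  by apply: bmfB; [exact: (bmf_comp (@measurable_sample n) (bf n))|exact: bmf_cst].
apply: (small_le (m := 0%N)) sm => n _; rewrite vE /sample_law Ex_distribution//.
by apply: bmf_norm; apply: bmfB; [exact: bf|exact: bmf_cst].
Qed.

End sample_law.

Theorem theorem1p2 (R : realType) (d : nat) (hd : (0 < d)%N)
  (disp0 : measure_display) (T0 : measurableType disp0) (P0 : probability T0 R)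
  (X : {RV P0 >-> d.-tuple R}) (Y : {RV P0 >-> R})
  (disp : measure_display) (T : measurableType disp) (P : probability T R)
  (Xs : nat -> {RV P >-> d.-tuple R}) (Ys : nat -> {RV P >-> R})
  (hF : continuous (joint_cdf X Y))
  (hiid : iid_copies P0 P (fun w => (X w, Y w))
            (fun (i : nat) w => (Xs i w, Ys i w))) :
  cvg_in_probability P
    (fun (n : nat) w =>
       sigma2_hat (fun i : 'I_n => Xs i w) (fun i : 'I_n => Ys i w)
       - n%:R * fine (variance P (fun w' =>
           xi (fun i : 'I_n => Xs i w') (fun i : 'I_n => Ys i w')))) 0
  /\
  (d = 1%N ->
   cvg_in_probability P
    (fun (n : nat) w =>
       sigma2_hat_bar (fun i : 'I_n => tnth (Xs i w) (Ordinal hd))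
                      (fun i : 'I_n => Ys i w)
       - n%:R * fine (variance P (fun w' =>
           xi_bar (fun i : 'I_n => tnth (Xs i w') (Ordinal hd))
                  (fun i : 'I_n => Ys i w')))) 0).
Proof.
have ax k t : law X Y [set e | tnth e.1 k = t] = 0%E := atomless_position hF k t.
have ay t : law X Y [set e | e.2 = t] = 0%E := atomless_response hF t.
have iid n : iid_law (law X Y) (sample_law Xs Ys n) by exact: iid_sample.
have msnd : measurable_fun setT (snd : d.-tuple R * R -> R) by exact: measurable_snd.
have [c [mc _ _]] := quantile_labels msnd ay 0.
split.
  have prox := @proximity_nn R d hd.
  have bf n : bmf (fun z : n.-tuple (d.-tuple R * R) => sigma2_hat (xs z) (ys z)).
    exact: (bmf_ranks prox mc (fun r nl _ => 36 * sig r (fun i => nth i (nl i) 0%N)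
      (fun i => nth i (nl i) 1%N) (fun i => nth i (nl i) 2%N) (mut nl) (shr nl))).
  have bg n : bmf (fun z : n.-tuple (d.-tuple R * R) => xi (xs z) (ys z)).
    exact: (bmf_ranks prox mc (fun r nl _ => 6 / (n%:R ^+ 2 - 1) *
      \sum_(i < n) (minn (r i) (r (nth i (nl i) 0%N)))%:R - (2 * n%:R + 1) / (n%:R - 1))).
  have -> : (fun (n : nat) w =>
       sigma2_hat (fun i : 'I_n => Xs i w) (fun i : 'I_n => Ys i w)
       - n%:R * fine (variance P (fun w' =>
           xi (fun i : 'I_n => Xs i w') (fun i : 'I_n => Ys i w')))) =
    (fun n w => sigma2_hat (xs (sample Xs Ys n w)) (ys (sample Xs Ys n w)) - n%:R *
       fine (variance P (fun w' => xi (xs (sample Xs Ys n w')) (ys (sample Xs Ys n w'))))).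
    apply/funext => n; apply/funext => w; rewrite xs_sample ys_sample; congr (_ - _ * fine (variance P _)).
    by apply/funext => w'; rewrite xs_sample ys_sample.
  apply: (cvg_sample (f := fun n (z : n.-tuple (d.-tuple R * R)) => sigma2_hat (xs z) (ys z))
    (g := fun n (z : n.-tuple (d.-tuple R * R)) => xi (xs z) (ys z)) bf bg).
  have fT n : full (sample_law Xs Ys n) setT by split => //; exact: probability_setT.
  (* 504 / n suffices here; the constant of the right neighbours is reused *)
  have C0 : (0 : R) <= 9792 by exact: ler0n.
  apply: (variance_consistency hd prox ax ay iid bf bg fT
    (kk := fun n => - ((2 * n%:R + 1) / (n%:R - 1))) C0).
  - move=> n z n5 _; have n2 : (1 < n)%N by exact: leq_trans n5.
    rewrite sigma2_hatE /rank_form -mulrBr normrM (ger0_norm (ler0n _ 36)).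
    apply: (le_trans (ler_wpM2l (ler0n _ 36) (sig_GR _ _ _ _ _ n2 (@rank_le _ _ (ys z)) (@rank_count _ _ (ys z))))).
    rewrite mulrA; apply: (le_trans (ratio_le _ n2)); first by rewrite mulr_ge0.
    by apply: ler_wpM2r; rewrite ?invr_ge0// -!natrM ler_nat.
  - move=> n z n5 _; have n2 : (1 < n)%N by exact: leq_trans n5.
    by rewrite (xiE _ n2) subrr normr0 divr_ge0.
move=> d1; subst d.
have -> : Ordinal hd = ord0 :> 'I_1 by exact: val_inj.
have bf n : bmf (fun z : n.-tuple (1.-tuple R * R) => sigma2_hat_bar (position z) (ys z)).
  apply: bmf_ext (bmf_right (fun r N => 36 * sig r (N 1%N) (N 2%N) (N 3%N) (fun=> false) (fun=> 0%N))) => z.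
  exact: sigma2_hat_barE.
have bg n : bmf (fun z : n.-tuple (1.-tuple R * R) => xi_bar (position z) (ys z)).
  exact: (bmf_right (fun r N => 1 - 3 / (n%:R ^+ 2 - 1) * \sum_(i < n) `|(r (N 1%N i))%:R - (r i)%:R|)).
have pos n w : position (sample Xs Ys n w) = (fun i : 'I_n => tnth (Xs i w) ord0).
  by rewrite /position xs_sample.
have -> : (fun (n : nat) w =>
     sigma2_hat_bar (fun i : 'I_n => tnth (Xs i w) ord0) (fun i : 'I_n => Ys i w)
     - n%:R * fine (variance P (fun w' =>
         xi_bar (fun i : 'I_n => tnth (Xs i w') ord0) (fun i : 'I_n => Ys i w')))) =
  (fun n w => sigma2_hat_bar (position (sample Xs Ys n w)) (ys (sample Xs Ys n w)) - n%:R *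
     fine (variance P (fun w' => xi_bar (position (sample Xs Ys n w')) (ys (sample Xs Ys n w'))))).
  apply/funext => n; apply/funext => w; rewrite pos ys_sample; congr (_ - _ * fine (variance P _)).
  by apply/funext => w'; rewrite pos ys_sample.
apply: (cvg_sample (f := fun n (z : n.-tuple (1.-tuple R * R)) => sigma2_hat_bar (position z) (ys z))
  (g := fun n (z : n.-tuple (1.-tuple R * R)) => xi_bar (position z) (ys z)) bf bg).
have fy n := full_injective (iid n) msnd ay.
have fx n := full_distinct hd ax (iid n).
have fxy n := fullI (fx n) (fy n).
have C0 : (0 : R) <= 9792 by exact: ler0n.
apply: (variance_consistency hd (@proximity_cyc R) ax ay iid bf bg fxy
  (kk := fun n => 1 - 3 / (n%:R ^+ 2 - 1) * (n%:R ^+ 2 + n%:R)) C0).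
- move=> n z n5 [dx dy]; apply: sigma2_hat_bar_close => // i j e.
  apply: contrapT => /eqP /dx /eqP; apply.
  by rewrite (_ : Ordinal _ = ord0) //; exact: val_inj.
- move=> n z n5 [dx dy]; apply: xi_bar_close => // i j e; apply: contrapT => /eqP.
    by move=> /dx /eqP; apply; rewrite (_ : Ordinal _ = ord0) //; exact: val_inj.
  by move=> /dy /eqP.
Qed.
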